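(* Assume that there exist $K>0$ and a nondecreasing, continuously differentiable function $\zeta:[0,\infty)\to[1,\infty)$ with $\int_0^\infty\frac{dr}{r\zeta(r)+1}=\infty$ such that $$2\langle x,b(x)\rangle+\mathrm{tr}(a(x))+\int_{\mathbb R^d_0}|y|^2\,\nu(x,dy)\le K(|x|^2\zeta(|x|^2)+1)\quad\text{for all }x\in\mathbb R^d.$$ Assume that for any $(t,x)\in[0,\infty)\times\mathbb R^d$ the stochastic differential equation $$X(s)=x+\int_t^sb(X(r))\,dr+\int_t^s\sigma(X(r))\,dW(r)+\int_t^s\int_Uc(X(r-),u)\,\widetilde N(du,dr),\qquad s\ge t,$$ has a unique weak solution $X=X^{t,x}$. Let $T>0$, let $\rho:[0,T]\times\mathbb R^d\to[0,\infty)$, $g:[0,T]\times\mathbb R^d\to\mathbb R$ and $f:\mathbb R^d\to\mathbb R$ be continuous, with $f$ and $g$ bounded. Suppose that $u:[0,T]\times\mathbb R^d\to\mathbb R$ is of class $C^{1,2}([0,T)\times\mathbb R^d)\cap C_b([0,T]\times\mathbb R^d)$ and satisfies the Cauchy problem $$\begin{cases}\dfrac{\partial}{\partial t}u(t,x)+\mathcal Lu(t,x)-\rho(t,x)u(t,x)=g(t,x),&(t,x)\in[0,T)\times\mathbb R^d,\\ u(T,x)=f(x),&x\in\mathbb R^d.\end{cases}$$ Then for all $0\le t\le T$ and $x\in\mathbb R^d$, $$u(t,x)=\mathbb E_{t,x}\Big[e^{-\int_t^T\rho(r,X(r))\,dr}f(X(T))-\int_t^Te^{-\int_t^s\rho(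r,X(r))\,dr}g(s,X(s))\,ds\Big].$$
   Context: Let $d\ge2$ and $\mathbb R^d_0=\mathbb R^d\setminus\{0\}$. $\mathcal L$ is the Lévy type operator $$\mathcal Lf(x)=\frac12\sum_{j,k=1}^da_{jk}(x)\frac{\partial^2f}{\partial x_j\partial x_k}(x)+\sum_{j=1}^db_j(x)\frac{\partial f}{\partial x_j}(x)+\int_{\mathbb R^d_0}[f(x+y)-f(x)-y\cdot Df(x)]\,\nu(x,dy),$$ where $b:\mathbb R^d\to\mathbb R^d$ is measurable, $a:\mathbb R^d\to\mathbb R^{d\times d}$ is measurable, symmetric and nonnegative definite, and $\nu(x,dy)$ is, for each $x$, a Lévy measure with $\int_{\mathbb R^d_0}(|y|\wedge|y|^2)\,\nu(x,dy)<\infty$. $\mathcal Lu(t,x)$ means $\mathcal L$ applied to $x\mapsto u(t,x)$; in particular it is required that $\int_{\mathbb R^d_0}|u(t,x+y)-u(t,x)-y\cdot D_xu(t,x)|\,\nu(x,dy)<\infty$ for all $x$. $\sigma:\mathbb R^d\to\mathbb R^{d\times d}$ is a measurable function with $\sigma(x)\sigma(x)^T=a(x)$. $M$ is a $\sigma$-finite measure on a measurable space $(U,\mathfrak U)$ and $c:\mathbb R^d\times U\to\mathbb R^d$ is a measurable function with $\nu(x,\Gamma)=\int_UI_\Gamma(c(x,u))\,M(du)$ for all $x\in\mathbb R^d$ and Borel $\Gamma\subset\mathbb R^d_0$ (such a representation exists). A weak solution consists of a filtered probability space satisfying the usual conditions, an adapted standard $d$-dimensional Brownian motion $W$, an adapted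 Poisson random measure $N$ on $U\times[0,\infty)$ with mean measure $M(du)\,dt$ and compensated measure $\widetilde N(du,dt)=N(du,dt)-M(du)\,dt$, and a process $X$ satisfying the equation; uniqueness is in law. $\mathbb E_{t,x}$ is expectation for $X=X^{t,x}$, with $X(t)=x$. $C_b$ denotes bounded continuous functions. *)

(* Defs.v *)
From HB Require Import structures.
From mathcomp Require Export all_boot all_order all_algebra.
From mathcomp Require Export all_classical all_reals all_analysis.
From mathcomp Require Export measurable_realfun.

Set Implicit Arguments.
Unset Strict Implicit.
Unset Printing Implicit Defensive.

Import Order.TTheory GRing.Theory Num.Def Num.Theory.
Import numFieldNormedType.Exports.

Local Open Scope classical_set_scope.
Local Open Scope ring_scope.

(* R^d is the row space 'rV[R]_d: its topology is the product topology, but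
   its norm in the library is the max norm, so the Euclidean inner product and
   norm are spelled out below. *)
Section Euclidean.
Context {R : realType} {d : nat}.
Implicit Types x y : 'rV[R]_d.

Definition dotp x y : R := \sum_(j < d) x ord0 j * y ord0 j.
Definition sqnorm x : R := dotp x x.
Definition enorm x : R := Num.sqrt (sqnorm x).

End Euclidean.

(* R^d with its Borel sigma-algebra; convertible to 'rV[R]_d. *)
Definition borelRd (R : realType) (d : nat) :=
  g_sigma_algebraType (@open 'rV[R]_d).

Definition Rd0 (R : realType) (d : nat) : set 'rV[R]_d := [set y | y != 0].
Arguments Rd0 {R d}.

Section Calculus.
Context {R : realType}.

(* Derivative relative to a set: two-sided at interior points of [D], one-sided
   at an end point belonging to [D]. *)
Definition diff_quotient (f : R -> R) (t h : R) : R := h^-1 * (f (t + h) - f t).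

Definition derivable_within (D : set R) (f : R -> R) (t : R) : Prop :=
  cvg (diff_quotient f t h @[h --> within [set h | D (t + h)] 0^']).

Definition derive_within (D : set R) (f : R -> R) (t : R) : R :=
  lim (diff_quotient f t h @[h --> within [set h | D (t + h)] 0^']).

Definition C1_on (D : set R) (f : R -> R) : Prop :=
  (forall t, D t -> derivable_within D f t) /\
  {within D, continuous (derive_within D f)}.

Context {d : nat}.

Definition basis_vec (j : 'I_d) : 'rV[R]_d := delta_mx ord0 j.

Definition partial1 (f : 'rV[R]_d -> R) (j : 'I_d) (x : 'rV[R]_d) : R :=
  'D_(basis_vec j) f x.

Definition partial2 (f : 'rV[R]_d -> R) (j k : 'I_d) (x : 'rV[R]_d) : R :=
  'D_(basis_vec j) (partial1 f k) x.

Definition grad (f : 'rV[R]_d -> R) (x : 'rV[R]_d) : 'rV[R]_d :=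
  \row_(j < d) partial1 f j x.

Definition strip (J : set R) : set (R * 'rV[R]_d) := J `*` setT.

Definition time_derivative (J : set R) (u : R -> 'rV[R]_d -> R)
    (t : R) (x : 'rV[R]_d) : R :=
  derive_within J (fun s => u s x) t.

Definition C12_on (J : set R) (u : R -> 'rV[R]_d -> R) : Prop :=
  {within strip J, continuous (fun p => u p.1 p.2)} /\
  (forall t x, J t -> derivable_within J (fun s => u s x) t) /\
  (forall t x j, J t -> derivable (u t) x (basis_vec j)) /\
  (forall t x j k, J t ->
     derivable (partial1 (u t) k : 'rV[R]_d -> R) x (basis_vec j)) /\
  {within strip J, continuous (fun p => time_derivative J u p.1 p.2)} /\
  (forall j, {within strip J, continuous (fun p => partial1 (u p.1) j p.2)}) /\
  (forall j k,
     {within strip J, continuous (fun p => partial2 (u p.1) j k p.2)}).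

Definition continuous_on_strip (J : set R) (u : R -> 'rV[R]_d -> R) : Prop :=
  {within strip J, continuous (fun p => u p.1 p.2)}.

Definition bounded_on_strip (J : set R) (u : R -> 'rV[R]_d -> R) : Prop :=
  exists C : R, forall t x, J t -> `|u t x| <= C.

End Calculus.

Section LevyOperator.
Context {R : realType} {d : nat}.
Variables (a : 'rV[R]_d -> 'M[R]_d) (b : 'rV[R]_d -> 'rV[R]_d).
(* Only the restriction of [nu x] to Rd0 is ever used. *)
Variable nu : 'rV[R]_d -> {measure set (borelRd R d) -> \bar R}.

Definition jump_increment (f : 'rV[R]_d -> R) (x y : 'rV[R]_d) : R :=
  f (x + y) - f x - dotp y (grad f x).

Definition levy_integrable (f : 'rV[R]_d -> R) (x : 'rV[R]_d) : Prop :=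
  (nu x).-integrable Rd0 (fun y : borelRd R d => (jump_increment f x y)%:E).

Definition levy_operator (f : 'rV[R]_d -> R) (x : 'rV[R]_d) : R :=
  2^-1 * (\sum_(j < d) \sum_(k < d) a x j k * partial2 f j k x)
  + \sum_(j < d) b x ord0 j * partial1 f j x
  + \int[nu x]_(y in Rd0) jump_increment f x y.

End LevyOperator.

Section Stochastic.
Context {R : realType} {dO : measure_display} {Omega : measurableType dO}.
Variable P : probability Omega R.

Local Notation leb := (@lebesgue_measure R).

Definition meas_wrt (G : set (set Omega)) {d'} {T : measurableType d'}
    (Y : Omega -> T) : Prop :=
  forall B : set T, measurable B -> G (Y @^-1` B).

(* Filtrations are indexed by [0, oo); values at negative times are junk. *)
Definition usual_filtration (F : R -> set (set Omega)) : Prop :=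
  (forall t, 0 <= t -> sigma_algebra setT (F t) /\ F t `<=` measurable) /\
  (forall s t, 0 <= s -> s <= t -> F s `<=` F t) /\
  (forall t, 0 <= t -> F t = \bigcap_(s in [set s | t < s]) F s) /\
  (forall A, P.-negligible A -> F 0 A).

Variable F : R -> set (set Omega).

Definition brownian_motion {d : nat} (W : R -> Omega -> 'rV[R]_d) : Prop :=
  (forall s, 0 <= s -> meas_wrt (F s) (W s : Omega -> borelRd R d)) /\
  {ae P, forall w, W 0 w = 0} /\
  (forall w, {within `[0, +oo[, continuous (fun s => W s w)}) /\
  (* W t - W s is independent of F s, with law N(0, (t - s) I_d);
     [normal_prob] takes the standard deviation *)
  (forall (s t : R) (A : set Omega) (B : 'I_d -> set (measurableTypeR R)),
     0 <= s -> s < t -> F s A -> (forall j, measurable (B j)) ->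
     P (A `&` [set w | forall j, B j (W t w ord0 j - W s w ord0 j)]) =
     (P A * \prod_(j < d) normal_prob 0 (Num.sqrt (t - s)) (B j))%E).

Section PoissonRandomMeasure.
Context {dU : measure_display} {U : measurableType dU}.
Variable M : {sigma_finite_measure set U -> \bar R}.
Variable N : Omega -> {measure set (U * measurableTypeR R) -> \bar R}.

Definition in_time (J : set R) (G : set (U * measurableTypeR R)) : Prop :=
  measurable G /\ G `<=` [set p | J p.2].

Definition mean_measure (G : set (U * measurableTypeR R)) : \bar R :=
  ((M \x leb) G)%E.

Definition poisson_random_measure : Prop :=
  (forall w G, in_time `[0, +oo[ G ->
     N w G = +oo%E \/ exists k : nat, N w G = k%:R%:E) /\
  (forall G (k : nat), in_time `[0, +oo[ G -> (mean_measure G < +oo)%E ->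
     P [set w | N w G = k%:R%:E] =
     poisson_prob (fine (mean_measure G)) k [set k]) /\
  (forall G, in_time `[0, +oo[ G -> mean_measure G = +oo%E ->
     {ae P, forall w, N w G = +oo%E}) /\
  (forall n (G : 'I_n -> set (U * measurableTypeR R)) (B : 'I_n -> set (\bar R)),
     (forall i, in_time `[0, +oo[ (G i)) -> trivIset setT G ->
     (forall i, measurable (B i)) ->
     P [set w | forall i, B i (N w (G i))] =
     (\prod_(i < n) P [set w | B i (N w (G i))])%E).

(* Adapted: N restricted to U x [0, t] is F t-measurable, and N restricted to
   U x (t, oo) is independent of F t. *)
Definition adapted_random_measure : Prop :=
  (forall t G, 0 <= t -> in_time `[0, t] G ->
     meas_wrt (F t) (fun w => N w G)) /\
  (forall t A E, 0 <= t -> F t A ->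
     <<s [set E' | exists G (B : set (\bar R)),
           [/\ in_time `]t, +oo[ G, measurable B &
               E' = [set w | B (N w G)]] ]>> E ->
     P (A `&` E) = (P A * P E)%E).

End PoissonRandomMeasure.

Definition cvg_to0_in_prob (Y : nat -> Omega -> \bar R) : Prop :=
  forall e : R, 0 < e ->
    P [set w | (e%:E < Y n w)%E] @[n --> \oo] --> 0%E.

Definition adapted_from {d'} {T : measurableType d'} (t0 : R)
    (Y : R -> Omega -> T) : Prop :=
  forall s, t0 <= s -> meas_wrt (F s) (Y s).

Definition cadlag_from {V : ptopologicalType} (t0 : R) (Y : R -> Omega -> V) :=
  forall w,
    (forall s, t0 <= s -> Y r w @[r --> s^'+] --> Y s w) /\
    (forall s, t0 < s -> cvg (Y r w @[r --> s^'-])).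

(* Y(r-) *)
Definition left_limit {V : ptopologicalType} (Y : R -> Omega -> V)
    (r : R) (w : Omega) : V := lim (Y q w @[q --> r^'-]).

(* Stochastic integrals are limits in probability of integrals of elementary
   integrands; an elementary integrand is a finite sum of terms
   xi(w) 1_(start, stop](r), resp. xi(w) 1_(start, stop](r) 1_mark(u), with xi
   bounded and F start-measurable. *)

Definition bounded_at (s : R) (xi : Omega -> R) : Prop :=
  (exists C : R, forall w, `|xi w| <= C) /\
  meas_wrt (F s) (xi : Omega -> measurableTypeR R).

Record elementary := Elementary {
  start : R; stop : R; coef : Omega -> R }.

Definition elementary_ok (t0 : R) (e : elementary) : Prop :=
  [/\ t0 <= start e, start e <= stop e & bounded_at (start e) (coef e)].

Definition elementary_val (S : seq elementary) (r : R) (w : Omega) : R :=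
  \sum_(e <- S) coef e w * \1_(`]start e, stop e]) r.

Definition elementary_int (B : R -> Omega -> R) (S : seq elementary)
    (s : R) (w : Omega) : R :=
  \sum_(e <- S) coef e w * (B (minr (stop e) s) w - B (minr (start e) s) w).

(* I(s) = int_t0^s H(r) dB(r), s >= t0 *)
Definition is_ito_integral (B : R -> Omega -> R) (t0 : R)
    (H : R -> Omega -> R) (I : R -> Omega -> R) : Prop :=
  adapted_from t0 (I : R -> Omega -> measurableTypeR R) /\
  (forall w, {within `[t0, +oo[, continuous (fun s => I s w)}) /\
  exists S : nat -> seq elementary,
    (forall n i, (i < size (S n))%N ->
       elementary_ok t0 (nth (Elementary 0 0 (cst 0)) (S n) i)) /\
    (forall s, t0 <= s -> cvg_to0_in_prob (fun n w =>
       \int[leb]_(r in `[t0, s]) ((H r w - elementary_val (S n) r w) ^+ 2)%:E)%E)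
    /\
    (forall s, t0 <= s -> cvg_to0_in_prob (fun n w =>
       (`|I s w - elementary_int B (S n) s w|)%:E)).

Section CompensatedIntegral.
Context {dU : measure_display} {U : measurableType dU}.
Variable M : {sigma_finite_measure set U -> \bar R}.
Variable N : Omega -> {measure set (U * measurableTypeR R) -> \bar R}.

Record marked := Marked { base : elementary; mark : set U }.

Definition marked_ok (t0 : R) (e : marked) : Prop :=
  [/\ elementary_ok t0 (base e), measurable (mark e) & (M (mark e) < +oo)%E].

Definition marked_val (S : seq marked) (r : R) (w : Omega) (u : U) : R :=
  \sum_(e <- S) coef (base e) w
     * \1_(`]start (base e), stop (base e)]) r * \1_(mark e) u.

(* N(mark x (p, q]) - M(mark) (q - p) *)
Definition compensated (A : set U) (p q : R) (w : Omega) : R :=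
  fine (N w (A `*` `]p, q])) - fine (M A) * (q - p).

Definition marked_int (S : seq marked) (s : R) (w : Omega) : R :=
  \sum_(e <- S) coef (base e) w *
    compensated (mark e) (minr (start (base e)) s) (minr (stop (base e)) s) w.

(* J(s) = int_t0^s int_U H(r, u) (N(du, dr) - M(du) dr), s >= t0 *)
Definition is_compensated_integral (t0 : R) (H : R -> Omega -> U -> R)
    (J : R -> Omega -> R) : Prop :=
  adapted_from t0 (J : R -> Omega -> measurableTypeR R) /\
  cadlag_from t0 J /\
  exists S : nat -> seq marked,
    (forall n i, (i < size (S n))%N ->
       marked_ok t0 (nth (Marked (Elementary 0 0 (cst 0)) set0) (S n) i)) /\
    (forall s, t0 <= s -> cvg_to0_in_prob (fun n w =>
       \int[leb]_(r in `[t0, s]) \int[M]_u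
          ((H r w u - marked_val (S n) r w u) ^+ 2)%:E)%E) /\
    (forall s, t0 <= s -> cvg_to0_in_prob (fun n w =>
       (`|J s w - marked_int (S n) s w|)%:E)).

End CompensatedIntegral.

End Stochastic.

Section WeakSolutions.
Context {R : realType} {d : nat} {dU : measure_display} {U : measurableType dU}.
Variables (b : 'rV[R]_d -> 'rV[R]_d) (sigma : 'rV[R]_d -> 'M[R]_d).
Variables (M : {sigma_finite_measure set U -> \bar R})
          (c : 'rV[R]_d -> U -> 'rV[R]_d).

(* X solves the equation from (t, x) when driven by (W, N); [IW i j] is the
   integral of sigma_ij(X) against the j-th coordinate of W and [IN i] that of
   c_i(X(r-), u) against the compensated measure. *)
Definition solves_sde {dO} {Omega : measurableType dO}
    (P : probability Omega R) (F : R -> set (set Omega))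
    (W : R -> Omega -> 'rV[R]_d)
    (N : Omega -> {measure set (U * measurableTypeR R) -> \bar R})
    (t : R) (x : 'rV[R]_d) (X : R -> Omega -> 'rV[R]_d) : Prop :=
  adapted_from F t (X : R -> Omega -> borelRd R d) /\
  cadlag_from t X /\
  {ae P, forall w, forall s i, t <= s ->
     lebesgue_measure.-integrable `[t, s] (fun r => (b (X r w) ord0 i)%:E)} /\
  exists (IW : 'I_d -> 'I_d -> R -> Omega -> R) (IN : 'I_d -> R -> Omega -> R),
    (forall i j, is_ito_integral P F (fun r w => W r w ord0 j) t
       (fun r w => sigma (X r w) i j) (IW i j)) /\
    (forall i, is_compensated_integral P F M N t
       (fun r w u => c (left_limit X r w) u ord0 i) (IN i)) /\
    {ae P, forall w, forall s i, t <= s ->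
       X s w ord0 i = x ord0 i
         + \int[lebesgue_measure]_(r in `[t, s]) b (X r w) ord0 i
         + \sum_(j < d) IW i j s w + IN i s w}.

Definition weak_solution (t : R) (x : 'rV[R]_d) {dO}
    {Omega : measurableType dO} (P : probability Omega R)
    (X : R -> Omega -> 'rV[R]_d) : Prop :=
  exists (F : R -> set (set Omega)) (W : R -> Omega -> 'rV[R]_d)
    (N : Omega -> {measure set (U * measurableTypeR R) -> \bar R}),
    [/\ usual_filtration P F, brownian_motion P F W,
        poisson_random_measure P M N, adapted_random_measure P F N &
        solves_sde P F W N t x X].

(* On the space of cadlag paths the Borel sigma-algebra of the Skorokhod
   topology is the trace of the sigma-algebra generated by the coordinates. *)
Definition path_sigma_algebra (t : R) : set (set (R -> 'rV[R]_d)) :=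
  <<s [set A | exists s (B : set (borelRd R d)),
        [/\ t <= s, measurable B & A = [set p | B (p s)]] ]>>.

Definition same_law (t : R) {d1 d2} {O1 : measurableType d1}
    {O2 : measurableType d2} (P1 : probability O1 R) (P2 : probability O2 R)
    (X1 : R -> O1 -> 'rV[R]_d) (X2 : R -> O2 -> 'rV[R]_d) : Prop :=
  forall A, path_sigma_algebra t A ->
    P1 [set w | A (fun s => X1 s w)] = P2 [set w | A (fun s => X2 s w)].

Definition unique_weak_solution (t : R) (x : 'rV[R]_d) : Prop :=
  (exists (dO : measure_display) (Omega : measurableType dO)
     (P : probability Omega R) (X : R -> Omega -> 'rV[R]_d),
     weak_solution t x P X) /\
  (forall (d1 d2 : measure_display) (O1 : measurableType d1)
     (O2 : measurableType d2) (P1 : probability O1 R) (P2 : probability O2 R)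
     (X1 : R -> O1 -> 'rV[R]_d) (X2 : R -> O2 -> 'rV[R]_d),
     weak_solution t x P1 X1 -> weak_solution t x P2 X2 ->
     same_law t P1 P2 X1 X2).

End WeakSolutions.

Definition discount {R : realType} {d : nat} (rho : R -> 'rV[R]_d -> R)
    (p : R -> 'rV[R]_d) (t s : R) : R :=
  expR (- \int[lebesgue_measure]_(r in `[t, s]) rho r (p r)).

Definition feynman_kac_functional {R : realType} {d : nat}
    (rho g : R -> 'rV[R]_d -> R) (f : 'rV[R]_d -> R)
    (t T : R) (p : R -> 'rV[R]_d) : R :=
  discount rho p t T * f (p T)
  - \int[lebesgue_measure]_(s in `[t, T]) (discount rho p t s * g s (p s)).

(* Main.v *)
(** No stopping times are needed: Ito's formula is applied to [K_s * phi s (X s)], where the discount [K]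
also contains [exp (- lam * int q (X r) dr)] with [q] dominating the coefficients, which makes every term
integrable. It is proved by approximating the coefficients by elementary predictable ones. With [phi] a
cut-off of [u], remove the cut-off, then let [lam -> 0], then let the terminal time increase to [T]; test
functions frozen in time show that [X] does not jump at [T]. *)
Require Import Defs.
From HB Require Import structures.
From mathcomp Require Import ring lra.

Set Implicit Arguments.
Unset Strict Implicit.
Unset Printing Implicit Defensive.

Import Order.TTheory GRing.Theory Num.Def Num.Theory.
Import numFieldNormedType.Exports.

Local Open Scope classical_set_scope.
Local Open Scope ring_scope.

Notation meas := (measurable_fun setT).
Notation measi p q f := (measurable_fun `[p, q] f).
Notation meas_comp := measurableT_comp.
Notation measM := measurable_funM.
Notation measD := measurable_funD.
Notation measB := measurable_funB.
Notation meas_sum := measurable_sum.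
Notation measEFin := measurable_EFinP.
Notation mR := measurableTypeR.
Notation sfun R d := (R -> 'rV[R]_d -> R).
Notation Leb := (@lebesgue_measure _).
Notation itg mu D f := (mu.-integrable D (EFin \o f)).
Notation itgT mu f := (itg mu setT f).
Notation itgi p q f := (itg Leb `[p, q] f).

(** The stochastic integrals are known only as limits in probability, so no moment of X is at hand
    and every passage to the limit has to be dominated by a constant. It comes from one identity:
    for K = exp (- int k) the integral of K * k is 1 - K(q) <= 1, however large k is. A drift term
    bounded by a multiple of K * k is then bounded after integration, uniformly over paths and
    approximations. To have this at every stage, the rate k of an approximation contains lam times
    the square norm of its own coefficients. Drift and rate are merely integrable in time, so they
    are never expanded in mean: on a time grid they are moved path by path with the noise frozen,
    and only the noise increment is expanded in mean, through Gaussian moments and factorial moments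
    of Poisson counts. As its coefficients are constant on a cell, the error per step h is eps * h +
    A * h^2. The derivative bounds of the cut-offs grow with their radius; the weight q is built
    from these bounds, so that one rate dominates the generators of all cut-offs at once. *)

Definition n1 {R : realType} {d} (v : 'rV[R]_d) : R := \sum_(j < d) `|v ord0 j|.

(** * Taylor expansion from partial derivatives *)

Section Taylor.
Context {R : realType} {d : nat}.
Implicit Types (f : 'rV[R]_d -> R) (x v : 'rV[R]_d).

Lemma n1_ge0 v : 0 <= n1 v.
exact: sumr_ge0. Qed.

Lemma le_coord_n1 v j : `|v ord0 j| <= n1 v.
by rewrite /n1 (bigD1 j)//= lerDl sumr_ge0. Qed.

Lemma le_coord_norm v j : `|v ord0 j| <= `|v|.
rewrite {2}/Num.norm/= mx_normE. exact: (le_bigmax _ (fun i=> `|v i.1 i.2|%:nng) (ord0, j)). Qed.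

Lemma norm_le_coord v (r : R) : 0 <= r -> (forall j, `|v ord0 j| <= r) -> `|v| <= r.
move=>r0 H; rewrite /Num.norm/= mx_normE. have -> : r = (NngNum r0)%:num by [].
rewrite num_le; apply/bigmax_leP; split=> [|[i j] _ /=]; first by rewrite -num_le. by rewrite -num_le/= ord1. Qed.

Lemma norm_le_n1 v : `|v| <= n1 v.
by apply: norm_le_coord=> [|j]; [exact: n1_ge0|exact: le_coord_n1]. Qed.

Lemma n1_le_norm v : n1 v <= d%:R * `|v|.
rewrite /n1 (le_trans (ler_sum _ (fun j _=> le_coord_norm v j)))//. by rewrite sumr_const card_ord mulr_natl.
Qed.

Lemma n1Z (a : R) v : n1 (a *: v) = `|a| * n1 v.
by rewrite /n1 mulr_sumr; apply: eq_bigr=> j _; rewrite mxE normrM. Qed.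

Lemma n1D v w : n1 (v + w) <= n1 v + n1 w.
by rewrite /n1 -big_split ler_sum//= => j _; rewrite mxE ler_normD. Qed.

Lemma n1N v : n1 (- v) = n1 v.
by rewrite /n1; apply: eq_bigr=> j _; rewrite mxE normrN. Qed.

(** The difference quotients of the two functions are literally the same. *)
Lemma is_derive_line f w e (D th : R) : is_derive (w + th *: e) e f D -> is_derive th 1 (fun r=> f (w + r *: e)) D.
move=> [df fD]. have E : (fun h : R=> h^-1 *: ((fun r=> f (w + r *: e)) (h *: (1 : R) + th) - f (w + th *: e)))
= (fun h : R=> h^-1 *: ((f \o shift (w + th *: e)) (h *: e) - f (w + th *: e))).
apply/funext=> h /=; congr (_ *: (f _ - _)). by rewrite -[h *: (1:R)]/(h * 1) mulr1 scalerDl addrCA.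
split; first by rewrite /derivable /= E. by rewrite -fD /derive /= E. Qed.

(** The mean value theorem for an increment of either sign, since it will be applied to coordinates
    of arbitrary vectors. *)
Lemma mvt_from0 (g dg : R -> R) (a : R) : (forall r : R, is_derive r 1 g (dg r)) ->
  exists2 th, `|th| <= `|a| & g a - g 0 = dg th * a.
move=>H. have C : continuous g.
by move=>r; apply: differentiable_continuous; apply/derivable1_diffP; case: (H r). have [a0|a0] := leP 0 a.
have [th] := @MVT_segment R g dg 0 a a0 (fun r _=> H r) (continuous_subspaceT C).
rewrite in_itv/= subr0=> /andP[t0 ta] ->; exists th=> //. by rewrite !ger0_norm.
have [th] := @MVT_segment R g dg a 0 (ltW a0) (fun r _=> H r) (continuous_subspaceT C).
rewrite in_itv/= => /andP[t0 ta] E; exists th. by rewrite ler0_norm// ler0_norm ?lerN2// ltW.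
by rewrite -opprB E sub0r mulrN opprK. Qed.

(* Moves one coordinate at a time, staying in the max-norm ball of radius |v|. *)
Lemma taylor1 f (D : 'I_d -> 'rV[R]_d -> R) x v (eta : R) (c : 'I_d -> R) :
  (forall j y, is_derive y (basis_vec j) f (D j y)) -> (forall j y, `|y - x| <= `|v| -> `|D j y - c j| <= eta) ->
  `|f (x + v) - f x - \sum_j c j * v ord0 j| <= eta * n1 v.
move=>fD Dc. pose w (k : nat) : 'rV[R]_d := x + \row_j (if (j < k)%N then v ord0 j else 0).
have w0 : w 0%N = x by apply/rowP=> j; rewrite !mxE addr0.
have wd : w d = x + v by apply/rowP=> j; rewrite !mxE ltn_ord.
have -> : f (x + v) - f x = \sum_(k < d) (f (w k.+1) - f (w k)).
rewrite -(big_mkord xpredT (fun k=> f (w k.+1) - f (w k))). by rewrite telescope_sumr// w0 wd.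
rewrite -sumrB (le_trans (ler_norm_sum _ _ _))// mulr_sumr ler_sum// => k _.
have wS : w k.+1 = w k + v ord0 k *: basis_vec k. apply/rowP=> j; rewrite !mxE ltnS leq_eqVlt -addrA; congr (_ + _).
have [->|nE] := eqVneq j k; first by rewrite eqxx ltnn/= mulr1 add0r.
by rewrite (_ : (j == k :> nat) = false) ?mulr0 ?addr0//; apply/negbTE.
have [th thv E] := @mvt_from0 (fun r=> f (w k + r *: basis_vec k))
(fun r=> D k (w k + r *: basis_vec k)) (v ord0 k) (fun r=> is_derive_line (fD _ _)).
move: E; rewrite -wS scale0r addr0=> ->; rewrite -mulrBl normrM ler_wpM2r//.
apply: Dc; apply: norm_le_coord=> // j; rewrite !mxE.
have -> : forall a b c : R, a + b + c - a = b + c by move=>a b c'; ring. have [->|nE] := eqVneq j k.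
by rewrite ltnn/= mulr1 add0r (le_trans thv)// le_coord_norm.
by rewrite mulr0 addr0; case: ifP=> _; rewrite ?normr0// le_coord_norm. Qed.

(** Continuity makes the partial derivatives nearly constant around x, so [taylor1] with the slopes
    [D j x] keeps the difference quotient in an arbitrary direction within e of the linear value. *)
Lemma is_derive_dir f (D : 'I_d -> 'rV[R]_d -> R) x v :
  (forall j y, is_derive y (basis_vec j) f (D j y)) -> (forall j, continuous (D j)) ->
  is_derive x v f (\sum_j D j x * v ord0 j).
move=>fD Dc. suff H : h^-1 *: ((f \o shift x) (h *: v) - f x) @[h --> 0^'] --> (\sum_j D j x * v ord0 j : R).
split; first by apply/cvg_ex; exists (\sum_j D j x * v ord0 j). exact/cvg_lim. apply/cvgrPdist_le=> e e0.
(* The error per unit of h is [et * n1 v]; the added 1 covers v = 0. *)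
pose et := e / (n1 v + 1). have n0 := n1_ge0 v. have et0 : 0 < et by rewrite divr_gt0// ltr_wpDl.
have : \forall r \near 0^'+, forall j y, `|y - x| <= r -> `|D j y - D j x| <= et.
have Hj j : \forall r \near 0^'+, forall y, `|y - x| <= r -> `|D j y - D j x| <= et.
have /cvgrPdist_le /(_ et et0) /nbhs_normP [r r0 Hr] := Dc j x. near=> s=> y ys; rewrite distrC; apply: Hr=> /=.
rewrite /ball_/= distrC (le_lt_trans ys)//; near: s; exact: nbhs_right_lt. by apply: filter_forall.
move=> [/= r r0 Hr]. near=> h. have h0 : h != 0 by near: h; exact: nbhs_dnbhs_neq. have hr : `|h *: v| <= r / 2.
rewrite normrZ (le_trans (ler_wpM2l _ (norm_le_n1 v)))//.
rewrite (@le_trans _ _ (r / 2 / (n1 v + 1) * (n1 v + 1)))//; last first. by rewrite divfK// gt_eqF// ltr_wpDl.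
apply: ler_pM=> //; last by rewrite lerDl. near: h; apply: dnbhs0_le. by rewrite !divr_gt0// ltr_wpDl.
have Hr' : forall j y, `|y - x| <= `|h *: v| -> `|D j y - D j x| <= et.
move=>j y yh; apply: (Hr (r / 2))=> /=; last exact: le_trans yh hr.
by rewrite sub0r normrN gtr0_norm ?divr_gt0// ltr_pdivrMr// ltr_pMr// ltr1n. by rewrite divr_gt0.
have T := @taylor1 f D x (h *: v) et (D ^~ x) fD Hr'. rewrite distrC /= [h *: v + x]addrC.
have -> : \sum_j D j x * v ord0 j = h^-1 *: (\sum_j D j x * (h *: v) ord0 j).
rewrite -[RHS]/(h^-1 * _) mulr_sumr; apply: eq_bigr=> j _; rewrite mxE; field. exact: h0.
rewrite -scalerBr normrZ normfV mulrC ler_pdivrMr ?normr_gt0//. rewrite (le_trans T)// n1Z mulrCA mulrC ler_wpM2r//.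
rewrite /et mulrAC ler_pdivrMr ?ltr_wpDl// ler_pM2l// lerDl. by [].
Unshelve. all: by end_near. Qed.

End Taylor.

Section Taylor2.
Context {R : realType} {d : nat}.
Implicit Types (f : 'rV[R]_d -> R) (x v : 'rV[R]_d).

(** The mean value theorem is used once, for f along the segment minus its quadratic Taylor
    polynomial. The derivative that appears is a combination of first-order remainders of the [D k],
    which [taylor1] bounds. *)
Lemma taylor2 f (D : 'I_d -> 'rV[R]_d -> R) (H : 'I_d -> 'I_d -> 'rV[R]_d -> R) x v (eta : R) :
  (forall j y, is_derive y (basis_vec j) f (D j y)) -> (forall j, continuous (D j)) ->
  (forall j k y, is_derive y (basis_vec j) (D k) (H j k y)) ->
  (forall j k y, `|y - x| <= `|v| -> `|H j k y - H j k x| <= eta) -> `|f (x + v) - f x - \sum_j D j x * v ord0 j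
  - 2^-1 * \sum_j \sum_k H j k x * (v ord0 j * v ord0 k)| <= eta * n1 v ^+ 2.
move=>fD Dc DH He. set A := \sum_j D j x * v ord0 j; set B := \sum_j \sum_k _.
pose g (r : R) := f (x + r *: v) - (r * A + r ^+ 2 * (2^-1 * B)).
pose dg (r : R) := \sum_j D j (x + r *: v) * v ord0 j - (A + r * B). have gD (r : R) : is_derive r 1 g (dg r).
apply: is_deriveB; first exact/is_derive_line/is_derive_dir. by apply: is_derive_eq; rewrite /GRing.scale/=; field.
have [th] := mvt_from0 1 gD. rewrite normr1 mulr1 /g scale1r scale0r addr0=> th1 E.
have -> : f (x + v) - f x - A - 2^-1 * B = dg th by rewrite -E; ring.
have -> : dg th = \sum_k (D k (x + th *: v) - D k x - \sum_j H j k x * (th *: v) ord0 j) * v ord0 k.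
rewrite /dg opprD addrA /A -sumrB /B exchange_big/= mulr_sumr -sumrB.
apply: eq_bigr=> k _; rewrite !mulrBl; congr (_ - _).
by rewrite mulr_suml mulr_sumr; apply: eq_bigr=> j _; rewrite mxE; ring.
rewrite expr2 mulrA (le_trans (ler_norm_sum _ _ _))// mulr_sumr ler_sum// => k _. rewrite normrM ler_wpM2r//.
have e0 : 0 <= eta. by apply: le_trans (He k k x _); rewrite ?subrr ?normr0.
rewrite (le_trans (@taylor1 _ _ (D k) (H ^~ k) x (th *: v) eta (fun j=> H j k x) _ _))//.
move=>j y yv; apply: He; rewrite (le_trans yv)// normrZ ler_piMl//.
by rewrite n1Z mulrCA ler_piMl// mulr_ge0// n1_ge0. Qed.

End Taylor2.

(** * Test functions on a time strip *)

Section TestFunctions.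
Context {R : realType} {d : nat}.

Definition unif_cont (p q : R) (h : sfun R d) := forall e, 0 < e -> exists2 del, 0 < del & forall s s' x x',
  p <= s <= q -> p <= s' <= q -> `|s - s'| < del -> `|x - x'| < del -> `|h s x - h s' x'| < e.

(** The derivatives are carried as explicit functions, so that estimates can refer to their common
    bound C and to their uniform continuity. The time derivative is required only inside the
    interval: at an end point u may have just a one-sided one. *)
Record test (p q : R) (phi phit : sfun R d) (phi1 : 'I_d -> sfun R d)
    (phi2 : 'I_d -> 'I_d -> sfun R d) (C : R) : Prop := Test {
  t_b0 : forall s x, p <= s <= q -> `|phi s x| <= C;
  t_bt : forall s x, p <= s <= q -> `|phit s x| <= C;
  t_b1 : forall j s x, p <= s <= q -> `|phi1 j s x| <= C;
  t_b2 : forall j k s x, p <= s <= q -> `|phi2 j k s x| <= C;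
  t_u0 : unif_cont p q phi;
  t_ut : unif_cont p q phit;
  t_u1 : forall j, unif_cont p q (phi1 j);
  t_u2 : forall j k, unif_cont p q (phi2 j k);
  t_dt : forall (s : R) x, p < s < q -> is_derive s 1 (phi ^~ x) (phit s x);
  t_d1 : forall j s x, p <= s <= q -> is_derive x (basis_vec j) (phi s) (phi1 j s x);
  t_d2 : forall j k s x, p <= s <= q -> is_derive x (basis_vec j) (phi1 k s) (phi2 j k s x)
}.

Context (p q : R) (phi phit : sfun R d) (phi1 : 'I_d -> sfun R d) (phi2 : 'I_d -> 'I_d -> sfun R d) (C : R) (T : test
  p q phi phit phi1 phi2 C).

Lemma unif_cont_x h s : p <= s <= q -> unif_cont p q h -> continuous (h s).
move=>spq hU x; apply/(@cvgrPdist_lt _ _ _ (nbhs x))=> e e0. have [del del0 H] := hU e e0.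
near=> y; apply: H=> //; first by rewrite subrr normr0.
Unshelve. all: by end_near. Qed.

Lemma unif_cont_s h x : unif_cont p q h -> {within `[p, q], continuous (h ^~ x)}.
move=>hU; apply/subspace_continuousP=> s spq. apply/cvgrPdist_lt=> e e0. have [del del0 H] := hU e e0.
rewrite near_withinE; near=> r=> rpq; apply: H.
- by move: spq; rewrite /= in_itv.
- by move: rpq; rewrite /= in_itv.
- by near: r; exact: cvgr_dist_lt.
- by rewrite subrr normr0.
Unshelve. all: by end_near. Qed.

Lemma test_C_ge0 : p <= q -> 0 <= C.
move=>pq; apply: le_trans (t_b0 T 0 (_ : p <= p <= q))=> //. by rewrite lexx. Qed.

(** Merges finitely many moduli of continuity into one: each condition survives shrinking the
    radius, so the minimum serves for all. *)
Lemma finite_pos_min (I : finType) (F : I -> R -> Prop) : (forall i a b, 0 < a -> a <= b -> F i b -> F i a) ->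
  (forall i, exists2 a, 0 < a & F i a) -> exists2 a, 0 < a & forall i, F i a.
move=>mono H. have [a Ha] : exists a : I -> R, forall i, 0 < a i /\ F i (a i).
suff /boolp.choice[a Ha] : forall i, exists a : R, 0 < a /\ F i a by exists a.
by move=>i; have [a ? ?] := H i; exists a. have m0 : 0 < \big[minr/1]_i a i.
by elim/big_ind : _=> // [x y x0 y0|i _]; [rewrite lt_min x0|case: (Ha i)]. exists (\big[minr/1]_i a i)=> // i.
apply: mono (m0) _ (Ha i).2; rewrite (bigD1 i)//= ge_min lexx//. Qed.

Lemma test_lip s x v : p <= s <= q -> `|phi s (x + v) - phi s x| <= C * n1 v.
move=>spq. have := @taylor1 _ _ (phi s) (fun j=> phi1 j s) x v C (fun=> 0) (fun j y=> t_d1 T j y spq).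
under eq_bigr do rewrite mul0r. by rewrite big1// !subr0; apply=> j y _; rewrite subr0; apply: (t_b1 T). Qed.

Lemma test_lip1 j s x v : p <= s <= q -> `|phi1 j s (x + v) - phi1 j s x| <= C * n1 v.
move=>spq. have := @taylor1 _ _ (phi1 j s) (fun k=> phi2 k j s) x v C (fun=> 0) (fun k y=> t_d2 T k j y spq).
under eq_bigr do rewrite mul0r. by rewrite big1// !subr0; apply=> k y _; rewrite subr0; apply: (t_b2 T). Qed.

Lemma test_taylor e : 0 < e -> exists2 A, 0 <= A & forall s x v, p <= s <= q ->
  `|phi s (x + v) - phi s x - \sum_j phi1 j s x * v ord0 j
  - 2^-1 * \sum_j \sum_k phi2 j k s x * (v ord0 j * v ord0 k)| <= e * n1 v ^+ 2 + A * n1 v ^+ 4.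
move=>e0. have [del del0 Hdel] : exists2 del, 0 < del & forall jk : 'I_d * 'I_d, forall s x x',
p <= s <= q -> `|x - x'| < del -> `|phi2 jk.1 jk.2 s x - phi2 jk.1 jk.2 s x'| < e.
apply: finite_pos_min=> [jk a b a0 ab H s x x' spq xx'|[j k]]. by apply: H=> //; exact: lt_le_trans ab.
have [del del0 H] := t_u2 T j k e0; exists del=> // s x x' spq xx'. by apply: H=> //; rewrite subrr normr0.
have [pq|qp] := leP p q; last first. exists 0=> // s x v /andP[ps sq]; have := le_lt_trans (le_trans ps sq) qp.
by rewrite ltxx. have C0 := test_C_ge0 pq. exists ((C + C) / del ^+ 4 + C / del ^+ 3 + C / del ^+ 2).
by rewrite !addr_ge0// divr_ge0// ?addr_ge0// exprn_ge0// ltW. move=>s x v spq; have n0 := n1_ge0 v.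
have [nd|nd] := ltP (n1 v) del. rewrite (@le_trans _ _ (e * n1 v ^+ 2))//.
apply: (@taylor2 _ _ (phi s) (fun j=> phi1 j s) (fun j k=> phi2 j k s)).
- by move=>j y; apply: (t_d1 T).
- by move=>j; apply: unif_cont_x=> //; apply: (t_u1 T).
- by move=>j k y; apply: (t_d2 T).
- move=>j k y yv; apply/ltW/(Hdel (j, k))=> //. by rewrite (le_lt_trans yv)// (le_lt_trans (norm_le_n1 v)).
rewrite lerDl mulr_ge0// ?exprn_ge0//. by rewrite !addr_ge0// divr_ge0// ?addr_ge0// exprn_ge0// ltW.
rewrite (@le_trans _ _ (C + C + C * n1 v + C * n1 v ^+ 2))//. rewrite (le_trans (ler_normB _ _))// lerD//.
rewrite (le_trans (ler_normB _ _))// lerD//. by rewrite (le_trans (ler_normB _ _))// lerD//; apply: (t_b0 T).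
rewrite (le_trans (ler_norm_sum _ _ _))// mulr_sumr ler_sum// => j _. by rewrite normrM ler_wpM2r//; apply: (t_b1 T).
rewrite normrM ger0_norm ?invr_ge0// -[leRHS]mul1r ler_pM ?invr_ge0//. by rewrite invf_le1// ler1n.
rewrite (le_trans (ler_norm_sum _ _ _))// expr2 mulrA -mulrA mulr_suml mulr_sumr ler_sum// => j _.
rewrite (le_trans (ler_norm_sum _ _ _))// mulr_sumr mulr_sumr ler_sum// => k _.
by rewrite !normrM ler_wpM2r// ?mulr_ge0//; apply: (t_b2 T).
rewrite (@le_trans _ _ (((C + C) / del ^+ 4 + C / del ^+ 3 + C / del ^+ 2) * n1 v ^+ 4))//; last first.
by rewrite lerDr mulr_ge0// ?exprn_ge0// ltW. have r1 : 1 <= n1 v / del by rewrite ler_pdivlMr// mul1r.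
have -> : ((C + C) / del ^+ 4 + C / del ^+ 3 + C / del ^+ 2) * n1 v ^+ 4 =
(C + C) * (n1 v / del) ^+ 4 + C * n1 v * (n1 v / del) ^+ 3 + C * n1 v ^+ 2 * (n1 v / del) ^+ 2.
by field; rewrite gt_eqF. by rewrite !lerD// ler_peMr ?exprn_ege1// ?mulr_ge0 ?addr_ge0 ?exprn_ge0. Qed.

Lemma time_mvt s s' x : p <= s -> s <= s' -> s' <= q ->
  exists2 r, s <= r <= s' & phi s' x - phi s x = phit r x * (s' - s).
move=>ps ss' s'q. have D (r : R) : r \in `]s, s'[ -> is_derive r 1 (phi ^~ x) (phit r x).
by rewrite in_itv/= => /andP[sr rs']; apply: (t_dt T); lra. have Cn : {within `[s, s'], continuous (phi ^~ x)}.
apply: continuous_subspaceW (unif_cont_s (t_u0 T)). by move=>r /=; rewrite !in_itv/=; lra.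
have [r] := MVT_segment ss' D Cn. by rewrite in_itv/= => rss' E; exists r. Qed.

Lemma test_fv_lip s s' x v : p <= s -> s <= s' -> s' <= q -> `|phi s' (x + v) - phi s x| <= C * (s' - s + n1 v).
move=>ps ss' s'q; have [r sr E] := time_mvt x ps ss' s'q.
have -> : phi s' (x + v) - phi s x = (phi s' x - phi s x) + (phi s' (x + v) - phi s' x) by ring.
rewrite (le_trans (ler_normD _ _))// mulrDr lerD//.
rewrite E normrM [`|s' - s|]ger0_norm ?subr_ge0// ler_wpM2r ?subr_ge0//. by apply: (t_bt T); lra.
by apply: test_lip; lra. Qed.

(** The expansion is made at the end point [(s', x + v)] and not at [(s, x)]: in the grid sums below
    the end point is a right grid point, where right-continuous paths converge. *)
Lemma test_fv e : 0 < e -> exists2 eta, 0 < eta & forall s s' x v, p <= s -> s <= s' -> s' <= q ->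
  s' - s < eta -> n1 v < eta ->
  `|phi s' (x + v) - phi s x - (s' - s) * phit s' (x + v) - \sum_j phi1 j s' (x + v) * v ord0 j|
  <= e * (s' - s + n1 v).
move=>e0. have [d1 d10 Hd1] : exists2 del, 0 < del & forall j, forall s x x',
p <= s <= q -> `|x - x'| < del -> `|phi1 j s x - phi1 j s x'| < e.
apply: finite_pos_min=> [jk a b a0 ab H s x x' spq xx'|j]. by apply: H=> //; exact: lt_le_trans ab.
have [del del0 H] := t_u1 T j e0; exists del=> // s x x' spq xx'. by apply: H=> //; rewrite subrr normr0.
have [d2 d20 Hd2] := t_ut T e0. exists (minr (d1 / 2) d2); first by rewrite lt_min divr_gt0.
move=>s s' x v ps ss' s'q; rewrite !lt_min=> /andP[s1 s2] /andP[v1 v2].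
have nv := norm_le_n1 v; have n0 := normr_ge0 v. have s'pq : p <= s' <= q by lra.
have [r sr E] := time_mvt x ps ss' s'q.
have -> : phi s' (x + v) - phi s x - (s' - s) * phit s' (x + v) - \sum_j phi1 j s' (x + v) * v ord0 j
= (phit r x - phit s' (x + v)) * (s' - s) + (phi s' (x + v) - phi s' x - \sum_j phi1 j s' (x + v) * v ord0 j).
rewrite [RHS](_ : _ = phit r x * (s' - s) - phit s' (x + v) * (s' - s) +
(phi s' (x + v) - phi s' x - \sum_j phi1 j s' (x + v) * v ord0 j)); last by ring. by rewrite -E; ring.
rewrite (le_trans (ler_normD _ _))// [e * _]mulrDr lerD//.
rewrite normrM [`|s' - s|]ger0_norm ?subr_ge0// ler_wpM2r ?subr_ge0//. apply/ltW/Hd2; [lra|by []| |].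
by rewrite ler0_norm; lra. by rewrite opprD addrA subrr sub0r normrN; exact: le_lt_trans v2.
apply: (@taylor1 _ _ (phi s') (fun j=> phi1 j s') x v e (fun j=> phi1 j s' (x + v))). by move=>j y; apply: (t_d1 T).
move=>j y yv; apply/ltW/Hd1=> //; rewrite opprD addrA distrC. rewrite (le_lt_trans (ler_normB _ _))//; lra. Qed.

End TestFunctions.

(** * Measurability in R^d and of right-continuous processes *)

Section BorelRd.
Context {R : realType} {d : nat}.

Lemma borelRd_open (A : set 'rV[R]_d) : open A -> measurable (A : set (borelRd R d)).
by move=>oA; exact: sub_sigma_algebra. Qed.

Lemma borelRd_continuous (f : 'rV[R]_d -> R) : continuous f -> meas (f : borelRd R d -> mR R).
move=>cf; apply: (measurability _ (RGenOInfty.measurableE R))=> _ [_ [a ->] <-].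
by rewrite setTI; apply: borelRd_open; apply: open_comp. Qed.

Lemma continuous_coord (j : 'I_d) : continuous (fun x : 'rV[R]_d=> x ord0 j).
move=>x; apply/(@cvgrPdist_lt _ _ _ (nbhs x))=> e e0. near=> y.
have : `|x - y| < e by near: y; exact: cvgr_dist_lt.
by apply: le_lt_trans; have := le_coord_norm (x - y) j; rewrite !mxE.
Unshelve. all: by end_near. Qed.

Lemma borelRd_coord (j : 'I_d) : meas ((fun x=> x ord0 j) : borelRd R d -> mR R).
apply: borelRd_continuous; exact: continuous_coord. Qed.

(** An open set is the union of the countably many rational boxes that it contains, and a box is a
    finite intersection of coordinate conditions. *)
Lemma borelRd_measurable {dT} {T : measurableType dT} (f : T -> 'rV[R]_d) : (forall j, meas (fun w=> f w ord0 j)) ->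
  meas (f : T -> borelRd R d).
move=>mf; apply: (@measurability _ _ _ _ _ (f : T -> borelRd R d) (@open 'rV[R]_d))=> //.
move=> _ [A oA <-]; rewrite setTI. pose box (a : {ffun 'I_d -> rat * rat}) : set 'rV[R]_d :=
[set x | forall j, ratr (a j).1 < x ord0 j < ratr (a j).2].
pose F (a : {ffun 'I_d -> rat * rat}) : set T := [set w | box a `<=` A /\ box a (f w)].
have -> : f @^-1` A = \bigcup_a F a. apply/seteqP; split=> [w Afw|w [a _ [aA afw]]]; last exact: aA.
have /nbhs_normP[e /= e0 eA] := open_nbhs_nbhs (conj oA Afw).
have H j : exists ab : rat * rat, [/\ f w ord0 j - e / 2 < ratr ab.1, ratr ab.1 < f w ord0 j,
f w ord0 j < ratr ab.2 & ratr ab.2 < f w ord0 j + e / 2].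
have [|q1] := @rat_in_itvoo R (f w ord0 j - e / 2) (f w ord0 j); first by lra.
have [|q2] := @rat_in_itvoo R (f w ord0 j) (f w ord0 j + e / 2); first by lra.
rewrite !in_itv/= => /andP[? ?] /andP[? ?]. by exists (q1, q2). have [a Ha] := boolp.choice H.
exists [ffun j=> a j]=> //; split; last first. by move=>j; rewrite ffunE; have [_ -> -> _] := Ha j.
move=>y ya; apply: eA=> /=. apply: (@le_lt_trans _ _ (e / 2)); last by lra. apply: norm_le_coord=> [|j]; first by lra.
have := ya j; rewrite !mxE ffunE ler_norml; have [] := Ha j; lra.
apply: countable_bigcupT_measurable; first exact: countableP.
move=>a; rewrite /F; have [aA|naA] := pselect (box a `<=` A); last first.
by rewrite (_ : [set _ | _] = set0)//; apply/seteqP; split=> // w [].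
rewrite (_ : [set _ | _] = \bigcap_j ((fun w=> f w ord0 j) @^-1` `]ratr (a j).1, ratr (a j).2[)).
apply: fin_bigcap_measurable=> [|j _]; first exact: finite_finset. by rewrite -[X in measurable X]setTI; exact: mf.
apply/seteqP; split=> [w [_ wa] j _|w wa]. by rewrite /= in_itv/=; exact: wa.
by split=> // j; have := wa j I; rewrite /= in_itv. Qed.

End BorelRd.

(** Projection of time onto [a, b]. Processes are controlled on such an interval only; composing
    with the projection gives functions on the whole line, for which joint measurability can be
    stated. *)
Definition clamp {R : realType} (a b r : R) : R := maxr a (minr b r).

Section Progressive.
Context {R : realType}.

Lemma clamp_id (a b r : R) : a <= r <= b -> clamp a b r = r.
by move=> /andP[ar rb]; rewrite /clamp (min_idPr rb) (max_idPr ar). Qed.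

Lemma clamp_itv (a b r : R) : a <= b -> a <= clamp a b r <= b.
by move=>ab; rewrite /clamp le_max lexx/= ge_max ab/= ge_min lexx. Qed.

Lemma clamp_measurable (a b : R) : meas (clamp a b).
by apply: measurable_maxr=> //; apply: measurable_minr. Qed.

(** The process is the limit of step processes that take, on each grid cell, the value at the next
    grid point, capped at b; each of these is measurable on countably many rectangles. Only times in
    [a, b] enter, so adaptedness follows when b is the current time. *)
Lemma progressive_measurable {dT} {T : measurableType dT} (Z : R -> T -> R) (a b : R) : a <= b ->
  (forall r, a <= r <= b -> meas (Z r)) -> (forall w r, a <= r < b -> Z s w @[s --> r^'+] --> Z r w) ->
  meas (fun p : mR R * T=> Z (clamp a b p.1) p.2).
move=>ab mZ cZ. pose h (n : nat) : R := n.+1%:R^-1. have h0 n : 0 < h n by rewrite invr_gt0.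
pose k n r := Num.truncn ((clamp a b r - a) / h n).
have kP n r : (k n r)%:R * h n <= clamp a b r - a < (k n r).+1%:R * h n.
rewrite -ler_pdivlMr// -ltr_pdivrMr//; apply: truncn_itv.
by apply: divr_ge0; [rewrite subr_ge0; case/andP: (clamp_itv r ab)|exact: ltW].
pose s n r := minr b (a + (k n r).+1%:R * h n). apply: (@measurable_fun_cvg _ _ _ _ (fun n p=> Z (s n p.1) p.2)).
move=>n. pose D i : set (mR R * T) := [set r : mR R | (i%:R * h n <= clamp a b r - a < i.+1%:R * h n)] `*` setT.
have DT : \bigcup_i D i = setT. by apply/seteqP; split=> // -[r w] _; exists (k n r)=> //; split=> //=; exact: kP.
rewrite -DT; apply/measurable_fun_bigcup=> i. apply: measurableX=> //.
rewrite (_ : [set _ | _] = (fun r=> clamp a b r - a) @^-1` `[i%:R * h n, i.+1%:R * h n[).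
rewrite -[X in measurable X]setTI. by apply: measB=> //; exact: clamp_measurable.
by apply/seteqP; split=> r /=; rewrite in_itv.
apply: (@eq_measurable_fun _ _ _ _ _ (fun p=> Z (minr b (a + i.+1%:R * h n)) p.2)).
move=> [r w]; rewrite inE=> -[/= Hi _]; congr Z; rewrite /s. suff -> : k n r = i by [].
have := kP n r; move: Hi=> /andP[A B] /andP[C E].
have : (i%:R : R) < (k n r).+1%:R by rewrite -(ltr_pM2r (h0 n)); exact: le_lt_trans E.
have : ((k n r)%:R : R) < i.+1%:R by rewrite -(ltr_pM2r (h0 n)); exact: le_lt_trans B.
by rewrite !ltr_nat !ltnS=> A' B'; apply/eqP; rewrite eqn_leq A' B'.
apply: measurable_funTS; apply: (meas_comp (mZ _ _))=> //. rewrite ge_min lexx/= le_min ab lerDl/= mulr_ge0// ltW//.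
move=> [r w] _ /=; have /andP[ca cb] := clamp_itv r ab. have sc n : clamp a b r <= s n r.
by rewrite le_min cb/= -lerBlDl ltW//; case/andP: (kP n r). move: cb; rewrite le_eqVlt=> /orP[/eqP cb|cb].
rewrite (_ : (fun n=> _) = cst (Z (clamp a b r) w)); first exact: cvg_cst.
apply/funext=> n /=; congr Z; apply/eqP; rewrite eq_le sc andbT cb /s ge_min lexx//.
have := cZ w (clamp a b r); rewrite ca cb=> /(_ isT) /cvg_at_rightP; apply; split.
by move=>n; rewrite lt_min cb/= -ltrBlDl; case/andP: (kP n r).
apply: (@squeeze_cvgr _ _ _ _ (cst (clamp a b r)) (fun n=> clamp a b r + h n)).
- apply: nearW=> n; rewrite sc/= ge_min; apply/orP; right.
have /andP[A B] := kP n r; rewrite -natr1 mulrDl mul1r; lra.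
- exact: cvg_cst.
- rewrite -[X in _ --> X]addr0; apply: cvgD; first exact: cvg_cst. exact: cvg_harmonic. Qed.

(** The positive and the negative part are treated separately by Tonelli, so that parameters with a
    non-integrable section are covered too; [fine] gives them a default value. *)
Lemma measurable_integral_param {dT} {T : measurableType dT} (v : R -> T -> R) (a b : R) :
  meas (fun p : mR R * T=> v (clamp a b p.1) p.2) -> meas (fun w=> \int[Leb]_(r in `[a, b]) v r w).
move=>mv. pose V (r : mR R) (w : T) : R := \1_(`[a, b]%classic) r * v (clamp a b r) w.
have mV : meas (fun p : mR R * T=> V p.1 p.2). apply: measM=> //.
have mi : meas (\1_(`[a, b]%classic) : mR R -> R) by []. exact: (meas_comp mi measurable_fst).
have -> : (fun w=> \int[Leb]_(r in `[a, b]) v r w) =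
(fun w=> fine (\int[Leb]_r (maxr (V r w) 0)%:E - \int[Leb]_r (maxr (- V r w) 0)%:E)%E).
apply/funext=> w; rewrite /Rintegral; congr fine. rewrite integral_mkcond integralE; congr (_ - _)%E.
apply: eq_integral=> r _; rewrite funeposE /patch /V indicE. case: ifPn=> rab; last by rewrite mul0r maxxx maxxx.
by rewrite mul1r clamp_id ?EFin_max//; move: rab; rewrite inE/= in_itv.
apply: eq_integral=> r _; rewrite funenegE /patch /V indicE.
case: ifPn=> rab; last by rewrite mul0r oppr0 oppe0 maxxx maxxx.
by rewrite mul1r clamp_id ?EFin_max//; move: rab; rewrite inE/= in_itv.
apply: meas_comp=> //; apply: emeasurable_funB.
apply: (@measurable_fun_fubini_tonelli_G _ _ _ _ _ Leb (fun p=> (maxr (V p.1 p.2) 0)%:E)).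
by apply/measEFin; apply: measurable_maxr. by move=>p; rewrite lee_fin le_max lexx orbT.
apply: (@measurable_fun_fubini_tonelli_G _ _ _ _ _ Leb (fun p=> (maxr (- V p.1 p.2) 0)%:E)).
by apply/measEFin; apply: measurable_maxr=> //; apply: meas_comp. by move=>p; rewrite lee_fin le_max lexx orbT. Qed.

End Progressive.

(** * Integrals on intervals and equidistant grids *)

Section IntegralTools.
Context {dT : measure_display} {T : measurableType dT} {R : realType} (mu : {measure set T -> \bar R}).

Lemma le_itg (D : set T) (f g : T -> R) : measurable D -> measurable_fun D f ->
  (forall x, D x -> `|f x| <= g x) -> itg mu D g -> itg mu D f.
move=>mD mf fg; apply: le_integrable=> //; first exact/measEFin.
by move=>x Dx; rewrite /= lee_fin (le_trans (fg _ Dx))// ler_norm. Qed.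

Lemma bounded_itg (D : set T) (f : T -> R) (C : R) : measurable D -> (mu D < +oo)%E ->
  measurable_fun D f -> (forall x, D x -> `|f x| <= C) -> itg mu D f.
move=>mD muD mf fC; apply: measurable_bounded_integrable=> //. exists C; split; first exact: num_real.
by move=>M CM x Dx; rewrite /= (le_trans (fC _ Dx))// ltW. Qed.

Lemma Rdct (D : set T) (f_ : nat -> T -> R) (f g : T -> R) : measurable D ->
  (forall n, measurable_fun D (f_ n)) -> measurable_fun D f ->
  {ae mu, forall x, D x -> f_ n x @[n --> \oo] --> f x} -> itg mu D g -> (forall n x, D x -> `|f_ n x| <= g x) ->
  itg mu D f /\ \int[mu]_(x in D) f_ n x @[n --> \oo] --> \int[mu]_(x in D) f x.
move=>mD mf_ mf cf ig fg. have mf_' n : measurable_fun D (EFin \o f_ n) by apply/measEFin.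
have mf' : measurable_fun D (EFin \o f) by apply/measEFin.
have cf' : {ae mu, forall x, D x -> (EFin \o f_ n) x @[n --> \oo] --> (EFin \o f) x}.
by apply: filterS cf=> x H Dx; apply: cvg_EFin; [exact: nearW|exact: H].
have fg' : {ae mu, forall x n, D x -> (`|(EFin \o f_ n) x| <= (EFin \o g) x)%E}.
by apply: aeW=> x n Dx; rewrite /= lee_fin fg. have [i0 _ c0] := dominated_convergence mD mf_' mf' cf' ig fg'.
split=> //; apply: fine_cvg; rewrite fineK//. exact: integrable_fin_num. Qed.

Lemma le_norm_Rint (D : set T) (f g : T -> R) : measurable D -> measurable_fun D f ->
  (forall x, D x -> `|f x| <= g x) -> itg mu D g -> `|\int[mu]_(x in D) f x| <= \int[mu]_(x in D) g x.
move=>mD mf fg ig; have if_ := le_itg mD mf fg ig.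
rewrite (le_trans (le_normr_Rintegral _ _))//; apply: le_Rintegral=> //. exact: integrable_norm if_. Qed.

Lemma itg_sum (D : set T) (I : Type) (s : seq I) (P : pred I) (f : I -> T -> R) : measurable D ->
  (forall i, P i -> itg mu D (f i)) -> itg mu D (fun x=> \sum_(i <- s | P i) f i x).
move=>mD Hf; rewrite (_ : EFin \o _ = (fun x=> \sum_(i <- s | P i) (f i x)%:E)%E); last first.
by apply/funext=> x /=; rewrite sumEFin. exact: integrable_sum. Qed.

Lemma Rint_sum (D : set T) (I : Type) (s : seq I) (P : pred I) (f : I -> T -> R) : measurable D ->
  (forall i, P i -> itg mu D (f i)) ->
  \int[mu]_(x in D) (\sum_(i <- s | P i) f i x) = \sum_(i <- s | P i) \int[mu]_(x in D) f i x.
move=>mD Hf; elim: s=> [|i s IH].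
by rewrite big_nil; under eq_Rintegral do rewrite big_nil; rewrite Rintegral_cst// mul0r.
rewrite big_cons; under eq_Rintegral do rewrite big_cons. case: ifPn=> [Pi|_]; last exact: IH.
by rewrite RintegralD ?IH//; [exact: Hf|exact: itg_sum]. Qed.

End IntegralTools.

Section RealInterval.
Context {R : realType}.
Implicit Types (p q s r : R) (f k : R -> R).

Definition int p q f := \int[Leb]_(r in `[p, q]) f r.

Lemma mitv p q : measurable (`[p, q]%classic : set (mR R)).
exact: measurable_itv. Qed.

Lemma leb_itv_lt p q : (Leb `[p, q]%classic < +oo)%E.
by rewrite lebesgue_measure_itv/=; case: ifPn=> _; rewrite ?ltry// -EFinB ltry. Qed.

Lemma itg_sub p q s s' f : p <= s -> s' <= q -> itgi p q f -> itgi s s' f.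
move=>ps sq; apply: integrableS=> //.
by move=>r /=; rewrite !in_itv/= => /andP[sr rs]; rewrite (le_trans ps)// (le_trans rs). Qed.

Lemma int_split p q s f : p <= s -> s <= q -> itgi p q f -> int p q f = int p s f + int s q f.
move=>ps sq fi; rewrite /int.
have := @Rintegral_itvB R f (BLeft p) (BRight q) s fi; rewrite !bnd_simp ps sq=> /(_ isT isT) H.
rewrite -(@Rintegral_itv_obnd_cbnd _ s) -?H; first by rewrite addrC subrK. apply: integrableS fi=> //.
by move=>r /=; rewrite !in_itv/= => /andP[sr ->]; rewrite andbT (le_trans ps)// ltW. Qed.

Lemma int_pp p f : int p p f = 0.
by rewrite /int set_itv1 Rintegral_set1. Qed.

Lemma int_cst p q (a : R) : p <= q -> int p q (fun=> a) = a * (q - p).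
move=>pq; rewrite /int Rintegral_cst; last exact: mitv.
have := @lebesgue_measure_itv R `[p, q]; rewrite /= => ->; rewrite lte_fin.
by case: ltP=> //= qp; rewrite (_ : q = p) ?subrr//; apply/eqP; rewrite eq_le pq qp. Qed.

Lemma itg_cst p q (a : R) : itgi p q (fun=> a).
by apply: (@bounded_itg _ _ _ Leb _ _ `|a|)=> //; exact: leb_itv_lt. Qed.

Lemma int_abs_cont p q f : itgi p q f -> forall e, 0 < e -> exists2 del, 0 < del &
  forall s s', p <= s -> s <= s' -> s' <= q -> s' - s < del -> int s s' (fun r=> `|f r|) < e.
move=>fi e e0. have fi' : itgT Leb (f \_ `[p, q]).
move: fi; rewrite (integrable_mkcond _ (mitv p q)); congr integrable.
by apply/funext=> r /=; rewrite /patch; case: ifPn. have [del [del0 H]] := integral_normr_continuous fi' e0.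
exists del=> // s s' ps ss' s'q sd; rewrite /int. rewrite (@eq_Rintegral _ _ _ Leb _ (fun r=> `|(f \_ `[p, q]) r|)).
apply: H=> //; have := @lebesgue_measure_itv R `[s, s']; rewrite /= => ->.
by case: ifPn=> _; rewrite ?lte_fin// -EFinB lte_fin. move=>r; rewrite inE/= in_itv/= => /andP[sr rs'].
by rewrite /patch ifT// inE/= in_itv/= (le_trans ps)// (le_trans rs'). Qed.

Lemma int_le p q f k : itgi p q f -> itgi p q k -> (forall r, p <= r <= q -> f r <= k r) -> int p q f <= int p q k.
move=>fi ki fk; apply: le_Rintegral=> //. Qed.

Lemma int_ge0 p q f : (forall r, p <= r <= q -> 0 <= f r) -> 0 <= int p q f.
by move=>f0; apply: Rintegral_ge0=> r /=; rewrite in_itv/=; exact: f0. Qed.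

Lemma int_eq p q f k : (forall r, p <= r <= q -> f r = k r) -> int p q f = int p q k.
by move=>fk; apply: eq_Rintegral=> r; rewrite inE/= in_itv/=; exact: fk. Qed.

Lemma int_norm p q f : itgi p q f -> `|int p q f| <= int p q (fun r=> `|f r|).
by move=>fi; exact: le_normr_Rintegral. Qed.

Lemma itg_norm p q f : itgi p q f -> itgi p q (fun r=> `|f r|).
by move=>fi; apply: integrable_norm fi. Qed.

Lemma int_continuous p q f : itgi p q f -> forall e, 0 < e -> exists2 del, 0 < del &
  forall s s', p <= s <= q -> p <= s' <= q -> `|s - s'| < del -> `|int p s f - int p s' f| < e.
move=>fi e e0; have [del del0 H] := int_abs_cont fi e0. exists del=> //.
have W s s' : p <= s <= q -> p <= s' <= q -> s <= s' -> `|s - s'| < del -> `|int p s f - int p s' f| < e.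
move=>spq s'pq ss'; rewrite distrC=> sd. have {}sd : s' - s < del by rewrite -(@ger0_norm _ (s' - s)) ?subr_ge0.
have fi' : itgi p s' f by apply: itg_sub fi; lra. rewrite distrC (@int_split p s' s f) //; last by lra.
rewrite addrAC subrr add0r (le_lt_trans (int_norm _))//; first by apply: itg_sub fi; lra. by apply: H=> //; lra.
move=>s s' spq s'pq; case: (leP s s')=> ss' sd; first exact: W.
by rewrite distrC; apply: W; rewrite // 1?ltW// distrC. Qed.

Section Partition.
Context (p q : R) (pq : p < q).

Definition gp (N i : nat) : R := p + (q - p) * (i%:R / N%:R).

(** Index of the cell [[gp i, gp i.+1[] that contains r. The maximum with 0 only guards times before
    p. *)
Definition gidx (N : nat) (r : R) : nat := Num.truncn (maxr 0 ((r - p) / (q - p) * N%:R)).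

Definition lft N r := gp N (gidx N r).

(** At r = q the index is N, one past the last cell, so the right neighbour has to be capped at
    q. *)
Definition rgt N r := minr q (gp N (gidx N r).+1).

Lemma gp0 N : gp N 0 = p.
by rewrite /gp mul0r mulr0 addr0. Qed.

Lemma gpN N : (0 < N)%N -> gp N N = q.
by move=>N0; rewrite /gp divff ?pnatr_eq0 ?gt_eqF// mulr1; ring. Qed.

Lemma gpS N i : (0 < N)%N -> gp N i.+1 - gp N i = (q - p) / N%:R.
by move=>N0; rewrite /gp -natr1; field; rewrite pnatr_eq0 gt_eqF. Qed.

Lemma gp_le N i j : (i <= j)%N -> gp N i <= gp N j.
move=>ij; rewrite /gp lerD2l; apply: ler_wpM2l; first by rewrite subr_ge0 ltW.
by apply: ler_wpM2r; rewrite ?invr_ge0 ?ler_nat. Qed.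

Lemma gp_itv N i : (i <= N)%N -> (0 < N)%N -> p <= gp N i <= q.
by move=>iN N0; rewrite -{1}(gp0 N) gp_le//= -(gpN N0) gp_le. Qed.

Lemma gidxP N r : (0 < N)%N -> p <= r -> gp N (gidx N r) <= r < gp N (gidx N r).+1.
move=>N0 pr; have qp : 0 < q - p by rewrite subr_gt0. have N0' : 0 < N%:R :> R by rewrite ltr0n.
have x0 : 0 <= (r - p) / (q - p) * N%:R. by rewrite mulr_ge0// divr_ge0 ?subr_ge0// ltW.
have E : Num.truncn ((r - p) / (q - p) * N%:R) = gidx N r by rewrite /gidx max_r.
have /andP[] := truncn_itv x0; rewrite E=> A B. rewrite /gp -lerBrDl -ltrBlDl; apply/andP; split.
by rewrite mulrC -ler_pdivlMr// ler_pdivrMr. by rewrite [ltRHS]mulrC -ltr_pdivrMr// ltr_pdivlMr. Qed.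

Lemma gidx_eq N i r : (0 < N)%N -> gp N i <= r < gp N i.+1 -> gidx N r = i.
move=>N0 /andP[A B]; have qp : 0 < q - p by rewrite subr_gt0. have N0' : 0 < N%:R :> R by rewrite ltr0n.
rewrite /gidx max_r; last first. apply: mulr_ge0=> //; apply: divr_ge0; last exact: ltW.
by rewrite subr_ge0 (le_trans _ A)// -{1}(gp0 N) gp_le. apply: truncn_def; apply/andP; split.
by rewrite -ler_pdivrMr// ler_pdivlMr// mulrC lerBrDl. by rewrite -ltr_pdivlMr// ltr_pdivrMr// [ltRHS]mulrC ltrBlDl.
Qed.

(** The index is a measurable map into nat, hence so is its composition with any sequence F. This
    settles all step functions on the grid. *)
Lemma gidx_measurable N (F : nat -> R) : meas (fun r : mR R=> F (gidx N r)).
have mg : meas (gidx N : mR R -> nat). move=> _ B _; rewrite setTI.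
have -> : gidx N @^-1` B = \bigcup_(i in B) (gidx N @^-1` [set i]).
apply/seteqP; split=> [r Br|r [i Bi /= ->]]//; by exists (gidx N r). apply: bigcup_measurable=> i _.
have -> : gidx N @^-1` [set i] = (fun r : mR R=> maxr 0 ((r - p) / (q - p) * N%:R)) @^-1` `[i%:R, i.+1%:R[.
by apply/seteqP; split=> r /=; rewrite in_itv/= -truncn_eq ?le_max ?lexx// => /eqP. rewrite -[X in measurable X]setTI.
apply: measurable_maxr=> //; apply: measM=> //; apply: measM=> //. exact: measB. exact: (meas_comp (f := F)). Qed.

Lemma lft_cvg N r : (0 < N)%N -> p <= r -> r - (q - p) / N%:R <= lft N r <= r.
move=>N0 pr; have /andP[A B] := gidxP N0 pr; rewrite /lft A andbT. by have := gpS (gidx N r) N0; lra. Qed.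

Lemma rgt_cvg N r : (0 < N)%N -> p <= r <= q ->
  [/\ r <= rgt N r, rgt N r <= r + (q - p) / N%:R & r < q -> r < rgt N r].
move=>N0 /andP[pr rq]; have /andP[A B] := gidxP N0 pr. have G := gpS (gidx N r) N0.
split; first by rewrite le_min rq ltW. by rewrite ge_min; apply/orP; right; lra. by move=>rq'; rewrite lt_min rq' B.
Qed.

Lemma sum_gp N (F : nat -> R -> R) : (0 < N)%N -> (forall i, (i < N)%N -> itg Leb `[gp N i, gp N i.+1] (F i)) ->
  itgi p q (fun r=> F (gidx N r) r) -> \sum_(i < N) int (gp N i) (gp N i.+1) (F i) = int p q (fun r=> F (gidx N r) r).
move=>N0 Fi FI.
suff H n : (n <= N)%N -> \sum_(i < n) int (gp N i) (gp N i.+1) (F i) = int p (gp N n) (fun r=> F (gidx N r) r).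
by rewrite H// gpN. elim: n=> [_|n IH nN]; first by rewrite big_ord0 gp0 int_pp. rewrite big_ord_recr/= IH 1?ltnW//.
have /andP[pn nq] := gp_itv (ltnW nN) N0; have /andP[pn' nq'] := gp_itv nN N0. have nn := @gp_le N n n.+1 (leqnSn n).
have I1 : itg Leb `[p, gp N n.+1] (fun r=> F (gidx N r) r) by apply: itg_sub FI.
rewrite (int_split pn nn I1); congr (_ + _).
(* The right end point of the closed cell already has the next index. It is a null set, so the
   integrals are compared on the half-open cell. *)
have itgo (h : R -> R) : itg Leb `[gp N n, gp N n.+1] h -> itg Leb `[gp N n, gp N n.+1[ h.
by apply: integrableS=> // r /=; rewrite !in_itv/= => /andP[-> /ltW].
have I2 : itg Leb `[gp N n, gp N n.+1] (fun r=> F (gidx N r) r) by apply: itg_sub FI.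
rewrite /int -!Rintegral_itv_bndo_bndc; [|exact: itgo|apply: itgo; exact: Fi].
by apply: eq_Rintegral=> r; rewrite inE/= in_itv/= => /(gidx_eq N0) ->. Qed.

End Partition.
End RealInterval.

Section IntegrableOps.
Context {dT : measure_display} {T : measurableType dT} {R : realType} (mu : {measure set T -> \bar R}) (D : set T) (mD : measurable D).

Lemma itgZ (a : R) (f : T -> R) : itg mu D f -> itg mu D (fun x=> a * f x).
by move=>fi; apply: (integrableZl mD a fi). Qed.

Lemma itgD (f g : T -> R) : itg mu D f -> itg mu D g -> itg mu D (fun x=> f x + g x).
by move=>fi gi; exact: (integrableD mD fi gi). Qed.

Lemma itgB (f g : T -> R) : itg mu D f -> itg mu D g -> itg mu D (fun x=> f x - g x).
by move=>fi gi; exact: (integrableB mD fi gi). Qed.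

Lemma itgN (f : T -> R) : itg mu D f -> itg mu D (fun x=> - f x).
by move=>fi; exact: (integrableN fi). Qed.

Lemma itgM_bounded (C : R) (f g : T -> R) : measurable_fun D f -> (forall x, D x -> `|f x| <= C) ->
  itg mu D g -> itg mu D (fun x=> f x * g x).
move=>mf fC gi; apply: (le_itg (g := fun x=> C * `|g x|))=> //.
- by apply: measM=> //; have /integrableP[/measEFin] := gi.
- by move=>x Dx; rewrite normrM ler_wpM2r// fC.
- by apply: itgZ; exact: integrable_norm gi. Qed.

End IntegrableOps.

(** * Exponential discounts of integrable rates *)

Section ExpIntegral.
Context {R : realType}.

Lemma expRN_le (x : R) : 0 <= x -> expR (- x) <= (1 + x)^-1.
move=>x0; rewrite expRN lef_pV2 ?expR_ge1Dx// posrE ?expR_gt0//. by rewrite ltr_wpDr. Qed.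

Lemma expRN_ge0_le1 (x : R) : 0 <= x -> expR (- x) <= 1.
by move=>x0; rewrite -expR0 ler_expR oppr_le0. Qed.

Lemma one_sub_expRN (x : R) : 0 <= x -> 0 <= x - (1 - expR (- x)) <= x ^+ 2.
move=>x0; have A := expR_ge1Dx (- x); have B := expRN_le x0. apply/andP; split; first by lra.
have : (1 + x)^-1 <= 1 - x + x ^+ 2. rewrite -[leLHS]mul1r ler_pdivrMr ?ltr_wpDr//.
have : 0 <= x ^+ 3 by rewrite exprn_ge0. lra. by lra. Qed.

(** With x the integral of the rate over a cell, the right-hand side is, up to constants, the
    relative drop of the discount over that cell. A bound by [minr 1 x] thereby becomes one that
    telescopes. *)
Lemma min1_expRN (x : R) : 0 <= x -> minr 1 x <= 2 * (1 - expR (- x)).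
move=>x0; have B := expRN_le x0. have [x1|x1] := leP 1 x.
have : (1 + x)^-1 <= 2^-1 by rewrite lef_pV2 ?posrE; lra. lra. have : (1 + x)^-1 <= 1 - x / 2.
rewrite -[leLHS]mul1r ler_pdivrMr; last by lra. nra. lra. Qed.

Lemma expRN_lip (x y : R) : 0 <= x -> 0 <= y -> `|expR (- x) - expR (- y)| <= `|x - y|.
wlog xy : x y / x <= y. move=>W x0 y0; have [xy|yx] := leP x y; first exact: W.
by rewrite distrC [leRHS]distrC; apply: W=> //; exact: ltW.
move=>x0 y0; rewrite ger0_norm ?subr_ge0 ?ler_expR ?lerN2// distrC ger0_norm ?subr_ge0//.
have -> : expR (- y) = expR (- x) * expR (- (y - x)) by rewrite -expRD; congr expR; ring.
have yx0 : 0 <= y - x by rewrite subr_ge0. have [A _] := andP (one_sub_expRN yx0).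
have := expRN_ge0_le1 x0; have := expR_ge0 (- x); have := expRN_ge0_le1 yx0; nra. Qed.

Lemma itg_meas (p q : R) (f : R -> R) : itgi p q f -> measi p q f.
by move=> /integrableP[/measEFin]. Qed.

Lemma le_itgi (p q : R) (f g : R -> R) : measi p q f ->
  (forall r, p <= r <= q -> `|f r| <= g r) -> itgi p q g -> itgi p q f.
move=>mf fg gi; apply: (@le_itg _ _ _ Leb `[p, q] f g)=> //. Qed.

Lemma int_dct_ae (p q : R) (f_ : nat -> R -> R) (f g : R -> R) : (forall n, measi p q (f_ n)) -> measi p q f ->
  {ae Leb, forall r, p <= r <= q -> f_ n r @[n --> \oo] --> f r} ->
  itgi p q g -> (forall n r, p <= r <= q -> `|f_ n r| <= g r) -> int p q (f_ n) @[n --> \oo] --> int p q f.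
move=>mf_ mf cf gi fg. by have [] := @Rdct _ _ _ Leb `[p, q]%classic f_ f g. Qed.

Lemma int_dct (p q : R) (f_ : nat -> R -> R) (f g : R -> R) : (forall n, measi p q (f_ n)) ->
  (forall r, p <= r <= q -> f_ n r @[n --> \oo] --> f r) ->
  itgi p q g -> (forall n r, p <= r <= q -> `|f_ n r| <= g r) -> int p q (f_ n) @[n --> \oo] --> int p q f.
move=>mf_ cf gi fg; apply: int_dct_ae gi fg=> //; last exact: aeW.
apply: measurable_fun_cvg mf_ _=> r /=; rewrite in_itv/=; exact: cf. Qed.

Lemma nat_large (x e : R) : 0 <= x -> 0 < e -> exists n0 : nat, forall n, (n0 <= n)%N -> x / n.+1%:R < e.
move=>x0 e0; exists (Num.truncn (x / e))=> n Hn. rewrite ltr_pdivrMr// mulrC -ltr_pdivrMr//.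
have y0 : 0 <= x / e by rewrite divr_ge0// ltW. have /andP[_ H] := truncn_itv y0.
by apply: lt_le_trans H _; rewrite ler_nat. Qed.

Context (p q : R) (k : R -> R) (pq : p <= q) (ki : itgi p q k) (k0 : forall r, p <= r <= q -> 0 <= k r).

Definition expint (r : R) := expR (- int p r k).

Lemma int_itv_ge0 s s' : p <= s -> s' <= q -> 0 <= int s s' k.
by move=>ps sq; apply: int_ge0=> r rs; apply: k0; lra. Qed.

Lemma expint_itv r : p <= r <= q -> 0 <= expint r <= 1.
by move=> /andP[pr rq]; rewrite expR_ge0/= expRN_ge0_le1// int_itv_ge0. Qed.

Lemma expint_split s s' : p <= s -> s <= s' -> s' <= q -> expint s' = expint s * expR (- int s s' k).
move=>ps ss' s'q; rewrite /expint -expRD -opprD -int_split//. exact: itg_sub ki. Qed.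

Lemma expint_le s s' : p <= s -> s <= s' -> s' <= q -> expint s' <= expint s.
move=>ps ss' s'q; rewrite (expint_split ps ss' s'q) ler_piMr ?expR_ge0//.
by rewrite expRN_ge0_le1// int_itv_ge0. Qed.

Lemma measurable_int (f : R -> R) : itgi p q f -> measi p q (fun r=> int p r f).
move=>fi; apply: subspace_continuous_measurable_fun=> //. exact: parameterized_integral_continuous. Qed.

Lemma expint_measurable : measi p q expint.
apply: (meas_comp (f := expR))=> //; apply: meas_comp=> //. exact: measurable_int. Qed.

Lemma expint_cont : forall e, 0 < e -> exists2 del, 0 < del &
  forall s s', p <= s <= q -> p <= s' <= q -> `|s - s'| < del -> `|expint s - expint s'| < e.
move=>e e0; have [del del0 H] := int_continuous ki e0.
exists del=> // s s' sq s'q sd; apply: le_lt_trans (H _ _ sq s'q sd).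
by apply: expRN_lip; apply: int_itv_ge0=> //; lra. Qed.

Lemma itg_expint : itgi p q (fun r=> expint r * k r).
apply: (le_itgi (g := k))=> //. apply: measM; first exact: expint_measurable. exact: itg_meas ki.
move=>r rpq; have /andP[A B] := expint_itv rpq. by rewrite normrM !ger0_norm ?k0// ler_piMl// k0. Qed.

(** The rate is merely integrable, so [expint] is not differentiated. Riemann sums with [expint]
    frozen at the left of each cell are computed in two ways: they converge to the integral by
    domination, and to [1 - expint q] because [one_sub_expRN] leaves on each cell an error quadratic
    in the integral of k. *)
Lemma int_expint_full : int p q (fun r=> expint r * k r) = 1 - expint q.
move: pq; rewrite le_eqVlt=> /orP[/eqP E|plq]. by rewrite -E int_pp /expint int_pp oppr0 expR0 subrr.
pose N n := n.+1. have qp0 : 0 <= q - p by rewrite subr_ge0.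
pose a n := int p q (fun r=> expint (lft p q (N n) r) * k r).
have lm n : measi p q (fun r=> expint (lft p q (N n) r)). apply: measurable_funTS.
exact: (@gidx_measurable _ p q (N n) (fun i=> expint (gp p q (N n) i))).
have li n r : p <= r <= q -> p <= lft p q (N n) r <= q.
move=> /andP[pr rq]; have /andP[A B] := @gidxP _ p q plq (N n) r isT pr. rewrite (le_trans A rq) andbT.
by rewrite -{1}(gp0 p q (N n)) gp_le. have ac : a n @[n --> \oo] --> int p q (fun r=> expint r * k r).
apply: (int_dct (g := k))=> //.
- move=>n; apply: measM; first exact: lm. exact: itg_meas ki.
- move=>r rpq; apply: cvgMl. apply/cvgrPdist_lt=> e e0; have [del del0 H] := expint_cont e0.
have [n0 Hn0] := nat_large qp0 del0. near=> n; apply: H=> //; first exact: li. have /andP[pr _] := rpq.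
have /andP[A B] := @lft_cvg _ p q plq (N n) r isT pr. rewrite ger0_norm ?subr_ge0//.
have : (q - p) / (N n)%:R < del by apply: Hn0; near: n; exact: nbhs_infty_ge. lra.
- move=>n r rpq; have /andP[A B] := expint_itv (li n r rpq). by rewrite normrM !ger0_norm ?k0// ler_piMl// k0.
(* On a short cell the integral I of k is below [e'], so the quadratic error [I ^+ 2] is at most
   [e' * I], and these sum to [e' * int p q k <= e]. *)
have ac' : a n @[n --> \oo] --> (1 - expint q : R). apply/cvgrPdist_le=> e e0. pose e' := e / (int p q k + 1).
have I0 : 0 <= int p q k by exact: int_itv_ge0. have e'0 : 0 < e' by rewrite divr_gt0// ltr_wpDl.
have [del del0 H] := int_abs_cont ki e'0. have [n0 Hn0] := nat_large qp0 del0. near=> n.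
have Nd : (q - p) / (N n)%:R < del by apply: Hn0; near: n; exact: nbhs_infty_ge. pose g := gp p q (N n).
have gi i : (i < N n)%N -> [/\ p <= g i, g i <= g i.+1 & g i.+1 <= q]. move=>iN; split; [|exact: gp_le|].
by have /andP[] := gp_itv plq (ltnW iN) (ltn0Sn n). by have /andP[] := gp_itv plq iN (ltn0Sn n).
have -> : a n = \sum_(i < N n) int (g i) (g i.+1) (fun r=> expint (g i) * k r).
rewrite (@sum_gp _ p q plq (N n) (fun i r=> expint (g i) * k r))//. move=>i iN; have [A B C] := gi i iN.
by apply: itgZ=> //; apply: itg_sub ki. apply: (le_itgi (g := k))=> //. apply: measM; first exact: lm.
exact: itg_meas ki. move=>r rpq; have /andP[A B] := expint_itv (li n r rpq).
by rewrite normrM !ger0_norm ?k0// ler_piMl// k0.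
have -> : 1 - expint q = \sum_(i < N n) (expint (g i) - expint (g i.+1)).
rewrite -(big_mkord xpredT (fun i=> expint (g i) - expint (g i.+1))). under eq_bigr do rewrite -opprB.
by rewrite sumrN telescope_sumr// opprB /g gp0 gpN// /expint int_pp oppr0 expR0.
rewrite -sumrB (le_trans (ler_norm_sum _ _ _))//. apply: (@le_trans _ _ (\sum_(i < N n) e' * int (g i) (g i.+1) k)).
apply: ler_sum=> i _; have [A B C] := gi i (ltn_ord i). have I0' : 0 <= int (g i) (g i.+1) k by exact: int_itv_ge0.
have Ie : int (g i) (g i.+1) k < e'.
rewrite (@int_eq _ _ _ k (fun r=> `|k r|)); last by move=>r ?; rewrite ger0_norm// k0; lra.
by apply: H=> //; rewrite /g gpS.
have -> : int (g i) (g i.+1) (fun r=> expint (g i) * k r) = expint (g i) * int (g i) (g i.+1) k.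
by apply: RintegralZl=> //; exact: itg_sub ki. rewrite (expint_split A B C). have /andP[D E] := one_sub_expRN I0'.
have gpq : p <= g i <= q by lra. have /andP[F G] := expint_itv gpq. rewrite ler_norml; apply/andP; split; nra.
rewrite -mulr_sumr. have -> : \sum_(i < N n) int (g i) (g i.+1) k = int p q k.
by rewrite (@sum_gp _ p q plq (N n) (fun=> k))// => i iN; have [A B C] := gi i iN; apply: itg_sub ki.
by rewrite /e' mulrAC ler_pdivrMr ?ltr_wpDl// ler_pM2l// lerDl. exact: (cvg_unique _ ac ac').
Unshelve. all: by end_near. Qed.

End ExpIntegral.

Lemma int_expint {R : realType} (p q : R) (k : R -> R) s s' : itgi p q k -> (forall r, p <= r <= q -> 0 <= k r) ->
  p <= s -> s <= s' -> s' <= q -> int s s' (fun r=> expint p k r * k r) = expint p k s - expint p k s'.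
move=>ki k0 ps ss' s'q. have ki' : itgi p s' k by apply: itg_sub ki.
have k0' : forall r, p <= r <= s' -> 0 <= k r by move=>r ?; apply: k0; lra.
have I := itg_expint (le_trans ps ss') ki' k0'. have := int_split ps ss' I.
rewrite int_expint_full//; last exact: le_trans ss'.
have ki'' : itgi p s k by apply: itg_sub ki=> //; exact: le_trans s'q. have k0'' r : p <= r <= s -> 0 <= k r.
by move=> /andP[A B]; apply: k0'; rewrite A (le_trans B).
have aux (x y z w : R) : 1 - w = 1 - z + x -> x = z - w by lra. by rewrite (int_expint_full ps ki'' k0''); exact: aux.
Qed.

Lemma cvg_of_diff {R : realType} {T : Type} (F : set_system T) {FF : Filter F}
  (f g : T -> R) (l : R) : f x - g x @[x --> F] --> (0 : R) -> g x @[x --> F] --> l -> f x @[x --> F] --> l.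
move=>H1 H2; rewrite (_ : f = (fun x=> f x - g x + g x)). by rewrite -(add0r l); exact: cvgD.
by apply/funext=> x; rewrite subrK. Qed.

Lemma cvg_bigsum {R : realType} {T I : Type} (s : seq I) (F : set_system T) {FF : Filter F}
  (f : I -> T -> R) (l : I -> R) : (forall i, f i x @[x --> F] --> l i) ->
  \sum_(i <- s) f i x @[x --> F] --> \sum_(i <- s) l i.
move=>H; elim: s=> [|i s IH]. by rewrite big_nil; under eq_fun do rewrite big_nil; exact: cvg_cst.
by rewrite big_cons; under eq_fun do rewrite big_cons; apply: cvgD. Qed.

Section RightCont.
Context {R : realType}.

Definition rcont {V : normedModType R} (p q : R) (h : R -> V) := forall r, p <= r < q -> h s @[s --> r^'+] --> h r.

Lemma rcontP {V : normedModType R} (p q : R) (h : R -> V) : rcont p q h <->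
  forall r, p <= r < q -> forall e, 0 < e -> exists2 del, 0 < del &
  forall s, r < s -> s < r + del -> `|h r - h s| < e.
split=> H r rpq. move=>e e0; have /cvgrPdist_lt/(_ e e0) [del /= del0 Hd] := H r rpq.
exists del=> // s rs sd; apply: Hd=> //=; rewrite ltr0_norm ?subr_lt0//; lra.
apply/cvgrPdist_lt=> e e0; have [del del0 Hd] := H r rpq e e0.
exists del=> //= s; rewrite /ball_/= => sd rs; apply: Hd=> //. by move: sd; rewrite ltr0_norm ?subr_lt0//; lra. Qed.

(** For r < q the right neighbour lies strictly to the right of r, and at r = q it is q itself, so
    right-continuity on [p, q[ is exactly what is called for. *)
Lemma rgt_lim {V : normedModType R} (p q : R) (h : R -> V) r : p < q -> rcont p q h -> p <= r <= q ->
  h (rgt p q n.+1 r) @[n --> \oo] --> h r.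
move=>pq /rcontP hc /andP[pr]; rewrite le_eqVlt=> /orP[/eqP ->|rq].
rewrite (_ : (fun n=> _) = cst (h q)); first exact: cvg_cst. apply/funext=> n /=; congr h; apply/eqP.
have [|A _ _] := @rgt_cvg _ p q pq n.+1 q isT; first by rewrite lexx ltW. by rewrite eq_le A andbT /rgt ge_min lexx.
apply/cvgrPdist_lt=> e e0; have [|del del0 H] := hc r _ e e0; first by rewrite pr.
have qp0 : 0 <= q - p by rewrite subr_ge0 ltW. have [n0 Hn0] := nat_large qp0 del0.
near=> n; have [|A B D] := @rgt_cvg _ p q pq n.+1 r isT; first by rewrite pr ltW. apply: H; first exact: D.
rewrite (le_lt_trans B)// ltrD2l; apply: Hn0; near: n; exact: nbhs_infty_ge.
Unshelve. all: by end_near. Qed.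

Lemma unif_cont_rcont {d} (p q : R) (h : sfun R d) (z : R -> 'rV[R]_d) :
  unif_cont p q h -> rcont p q z -> rcont p q (fun s=> h s (z s) : R^o).
move=>hU /rcontP zc; apply/rcontP=> r rpq e e0.
have [del del0 H] := hU e e0; have [del2 del20 H2] := zc r rpq del del0. exists (minr (q - r) (minr del del2)).
by rewrite !lt_min del0 del20 subr_gt0 !andbT; case/andP: rpq.
move=>s rs; rewrite -ltrBlDl !lt_min=> /andP[A /andP[B D]]. apply: H; [lra|lra| |].
by rewrite ltr0_norm ?subr_lt0//; lra. by apply: H2=> //; lra. Qed.

End RightCont.

(** Evaluates the integral over one cell of an integrand in which only b and w depend on r, all
    other factors being frozen at grid points. *)
Lemma int_lin {R : realType} {I : finType} (s s' K1 a m l : R) (f : I -> R) (b : I -> R -> R)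
  (w : R -> R) : s <= s' -> (forall j, itgi s s' (b j)) -> itgi s s' w ->
  int s s' (fun r=> K1 * (a + \sum_j b j r * f j) - w r * m + l) =
  K1 * ((s' - s) * a + \sum_j f j * int s s' (b j)) - int s s' w * m + (s' - s) * l.
move=>ss' bi wi. have bfi j : itgi s s' (fun r=> b j r * f j). under [X in itg _ _ X]eq_fun do rewrite mulrC.
exact: itgZ. have si : itgi s s' (fun r=> \sum_j b j r * f j) by apply: itg_sum.
have ai : itgi s s' (fun r=> a + \sum_j b j r * f j) by apply: itgD=> //; exact: itg_cst.
have wmi : itgi s s' (fun r=> w r * m). under [X in itg _ _ X]eq_fun do rewrite mulrC. exact: itgZ.
have kai : itgi s s' (fun r=> K1 * (a + \sum_j b j r * f j)) by exact: itgZ.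
rewrite {1}/int RintegralD//; [|exact: itgB|exact: itg_cst].
rewrite -[\int[_]_(_ in _) l]/(int s s' (fun=> l)) int_cst// [l * _]mulrC; congr (_ + _).
rewrite RintegralB//; congr (_ - _). rewrite RintegralZl// RintegralD//; last exact: itg_cst.
rewrite -[\int[_]_(_ in _) a]/(int s s' (fun=> a)) int_cst// [a * _]mulrC Rint_sum//; congr (_ * (_ + _)).
by apply: eq_bigr=> j _; rewrite RintegralZr// mulrC. by rewrite RintegralZr. Qed.

(** * Pathwise chain rule along a grid, with the noise part frozen *)

Section Discretisation.
Context {R : realType} {d : nat} (p q : R) (phi phit : sfun R d) (phi1 : 'I_d -> sfun R d) (phi2 : 'I_d -> 'I_d -> sfun R d)
  (C : R) (pq : p < q) (T : test p q phi phit phi1 phi2 C) (k : R -> R) (b : 'I_d -> R -> R) (c K0 B : R) (y : R ->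
  'rV[R]_d) (ell : R -> R) (ki : itgi p q k) (bi : forall j, itgi p q (b j)) (c0 : 0 <= c) (K0_itv : 0 <= K0 <= 1) (k0
  : forall r, p <= r <= q -> 0 <= k r) (kb : forall r, p <= r <= q -> 1 + \sum_j `|b j r| <= c * k r) (yc : rcont p q
  y) (ellc : rcont p q (ell : R -> R^o)) (ellB : forall r, p <= r <= q -> `|ell r| <= B).

Context (K : R -> R) (beta z : R -> 'rV[R]_d) (K_def : forall r, K r = K0 * expint p k r) (beta_def : forall r, beta r
  = \row_j int p r (b j)) (z_def : forall r, z r = beta r + y r).

(** Over each cell time, discount and drift move while y is already held at its right end value; the
    move of y itself is left out and will be treated in mean. In its place stands the step length
    times [ell], which will be K times the generator of the noise, taken at the left grid point
    because there it is adapted. *)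
Definition disc_sum (N : nat) := \sum_(i < N)
  (K (gp p q N i.+1) * phi (gp p q N i.+1) (beta (gp p q N i.+1) + y (gp p q N i.+1))
  - K (gp p q N i) * phi (gp p q N i) (beta (gp p q N i) + y (gp p q N i.+1)) + (q - p) / N%:R * ell (gp p q N i)).

Let nb r := 1 + \sum_j `|b j r|.

Let nbi : itgi p q nb.
apply: itgD=> //; first exact: itg_cst. by apply: itg_sum=> // j _; exact: itg_norm. Qed.
Let C0 : 0 <= C.
exact: test_C_ge0 T (ltW pq). Qed.
Let KP r : p <= r <= q -> 0 <= K r <= 1.
move=>rpq; have /andP[A D] := expint_itv k0 rpq; have /andP[E F] := K0_itv.
by rewrite K_def mulr_ge0//= mulr_ile1. Qed.
Let delta_sum s s' : p <= s -> s <= s' -> s' <= q -> s' - s + n1 (beta s' - beta s) <= int s s' nb.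
move=>ps ss' s'q; rewrite /int RintegralD//; last 2 first.
- exact: itg_cst.
- by apply: itg_sum=> // j _; apply: itg_norm; exact: itg_sub (bi j). rewrite -/(int s s' _) int_cst// mul1r lerD2l.
rewrite Rint_sum//; last by move=>j _; apply: itg_norm; exact: itg_sub (bi j).
apply: ler_sum=> j _; rewrite !beta_def !mxE. rewrite (@int_split _ p s' s)//; last exact: itg_sub (bi j).
by rewrite addrAC subrr add0r; apply: int_norm; exact: itg_sub (bi j). Qed.
Let betaE s s' j : p <= s -> s <= s' -> s' <= q -> (beta s' - beta s) ord0 j = int s s' (b j).
move=>ps ss' s'q; rewrite !beta_def !mxE (@int_split _ p s' s)//; last exact: itg_sub (bi j).
by rewrite addrAC subrr add0r. Qed.

(** The bound is a multiple of the decrement of K and so telescopes. The increment of phi is at most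
    2C and at most [C * (c * int s s' k)]; both are covered by C times
    [(2 + c) * minr 1 (int s s' k)], and [min1_expRN] doubles the constant. The decrement of K
    against phi adds 1, which gives [5 + 2 * c]. *)
Lemma disc_term_bound s s' x : p <= s -> s <= s' -> s' <= q ->
  `|K s' * phi s' x - K s * phi s (x - (beta s' - beta s))| <= C * (5 + 2 * c) * (K s - K s').
move=>ps ss' s'q; have spq : p <= s <= q by lra. have s'pq : p <= s' <= q by lra. set del := beta s' - beta s.
have I0 : 0 <= int s s' k by apply: int_itv_ge0 k0 _ _ _ _. have KE : K s - K s' = K s * (1 - expR (- int s s' k)).
by rewrite !K_def (expint_split ki ps ss' s'q); ring. have KK : 0 <= K s - K s'.
by rewrite KE mulr_ge0//; [case/andP: (KP spq)|rewrite subr_ge0 expRN_ge0_le1]. have /andP[Ks0 Ks1] := KP spq.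
have -> : K s' * phi s' x - K s * phi s (x - del) =
K s * (phi s' x - phi s (x - del)) - (K s - K s') * phi s' x by ring. rewrite (le_trans (ler_normB _ _))//.
have A1 : `|(K s - K s') * phi s' x| <= C * (K s - K s').
by rewrite normrM ger0_norm// mulrC ler_wpM2r//; exact: (t_b0 T).
have A2 : `|phi s' x - phi s (x - del)| <= C * ((2 + c) * minr 1 (int s s' k)).
have F1 : `|phi s' x - phi s (x - del)| <= C * (c * int s s' k).
rewrite -{1}(subrK del x) (le_trans (test_fv_lip T _ _ ps ss' s'q))//.
rewrite ler_wpM2l// (le_trans (delta_sum ps ss' s'q))//. rewrite /int -RintegralZl//; last exact: itg_sub ki.
apply: int_le; first exact: itg_sub nbi. by apply: itgZ=> //; exact: itg_sub ki. by move=>r rs; apply: kb; lra.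
have F2 : `|phi s' x - phi s (x - del)| <= C * 2.
rewrite (le_trans (ler_normB _ _))// mulr_natr mulr2n lerD//; exact: (t_b0 T).
have [I1|I1] := leP 1 (int s s' k); apply: le_trans.
- exact: F2.
- by apply: ler_wpM2l=> //; rewrite mulr1 lerDl.
- exact: F1.
- by apply: ler_wpM2l=> //; apply: ler_wpM2r=> //; rewrite lerDr.
have A3 : `|K s * (phi s' x - phi s (x - del))| <= C * (2 * (2 + c)) * (K s - K s'). rewrite normrM ger0_norm// KE.
have M1 := min1_expRN I0. apply: le_trans (ler_wpM2l Ks0 A2) _. have c2 : 0 <= 2 + c by apply: addr_ge0.
set m := minr _ _ in M1 *; set X := 1 - _ in M1 *.
have -> : K s * (C * ((2 + c) * m)) = K s * (C * (2 + c)) * m by ring.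
have -> : C * (2 * (2 + c)) * (K s * X) = K s * (C * (2 + c)) * (2 * X) by ring.
by apply: ler_wpM2l=> //; apply: mulr_ge0=> //; apply: mulr_ge0.
have : C * (5 + 2 * c) * (K s - K s') = C * (2 * (2 + c)) * (K s - K s') + C * (K s - K s') by ring. by lra. Qed.
Let gi N i : (i < N)%N -> [/\ p <= gp p q N i, gp p q N i <= gp p q N i.+1 & gp p q N i.+1 <= q].
move=>iN; have N0 : (0 < N)%N by exact: leq_ltn_trans iN. split; [|exact: gp_le|].
by have /andP[] := gp_itv pq (ltnW iN) N0. by have /andP[] := gp_itv pq iN N0. Qed.

(** The sum of the decrements of K is at most 1. The result is uniform in N and, for a given B, in
    the path, as bounded convergence will require. *)
Lemma disc_sum_bound N : (0 < N)%N -> `|disc_sum N| <= C * (5 + 2 * c) + B * (q - p).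
move=>N0; rewrite /disc_sum (le_trans (ler_norm_sum _ _ _))//.
apply: (@le_trans _ _ (\sum_(i < N) (C * (5 + 2 * c) * (K (gp p q N i) - K (gp p q N i.+1)) + (q - p) / N%:R * B))).
apply: ler_sum=> i _; have [A D E] := gi (ltn_ord i). rewrite (le_trans (ler_normD _ _))// lerD//.
have := @disc_term_bound _ _ (beta (gp p q N i.+1) + y (gp p q N i.+1)) A D E.
rewrite (_ : _ - (_ - _) = beta (gp p q N i) + y (gp p q N i.+1))//. by apply/rowP=> j; rewrite !mxE; ring.
rewrite normrM ger0_norm; last by rewrite divr_ge0// subr_ge0 ltW.
by rewrite ler_wpM2l ?divr_ge0 ?subr_ge0 ?(ltW pq)//; apply: ellB; rewrite A (le_trans D). rewrite big_split/= lerD//.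
rewrite -mulr_sumr. under eq_bigr do rewrite -opprB.
rewrite sumrN -(big_mkord xpredT (fun i=> K (gp p q N i.+1) - K (gp p q N i))).
rewrite telescope_sumr// gp0 gpN// opprB -[leRHS]mulr1 ler_wpM2l//.
by apply: mulr_ge0=> //; apply: addr_ge0=> //; apply: mulr_ge0.
have /andP[_ U] : 0 <= K p <= 1 by apply: KP; rewrite lexx ltW.
have /andP[V _] : 0 <= K q <= 1 by apply: KP; rewrite lexx ltW. lra. rewrite sumr_const card_ord -[leLHS]mulr_natl.
by rewrite (_ : _ * _ = B * (q - p))//; field; rewrite pnatr_eq0 gt_eqF. Qed.
Let rc_beta : rcont p q beta.
apply/rcontP=> r /andP[pr rq] e e0. have [del del0 H] := int_abs_cont nbi e0.
exists (minr (q - r) del); first by rewrite lt_min del0 subr_gt0 rq. move=>s rs; rewrite -ltrBlDl lt_min=> /andP[A D].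
have sq : s <= q by lra. rewrite distrC (le_lt_trans (norm_le_n1 _))//. have := delta_sum pr (ltW rs) sq.
have := H r s pr (ltW rs) sq D. rewrite (@int_eq _ _ _ (fun r=> `|nb r|) nb); last first.
by move=>r' _; rewrite ger0_norm// addr_ge0// sumr_ge0. lra. Qed.
Let rc_z : rcont p q z.
move=>r rpq; rewrite (_ : z = fun r=> beta r + y r); last exact/funext.
by apply: cvgD; [exact: rc_beta|exact: yc]. Qed.
(** Its integral over cell i is the first-order expansion of the i-th term of [disc_sum], with [ell]
    moved to the right grid point. K is frozen on the left and the test functions on the right,
    while b and [expint * k] keep their dependence on r, as they are only integrable. The cap at q
    serves the index N that occurs at r = q. *)
Let F N i r := K (gp p q N i) * (phit (minr q (gp p q N i.+1)) (z (minr q (gp p q N i.+1)))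
  + \sum_j b j r * phi1 j (minr q (gp p q N i.+1)) (z (minr q (gp p q N i.+1))))
  - expint p k r * k r * (K0 * phi (minr q (gp p q N i.+1)) (z (minr q (gp p q N i.+1))))
  + ell (minr q (gp p q N i.+1)).

Let G r := C * (c * k r) + C * k r + B.

Let Gi : itgi p q G.
apply: itgD=> //; last exact: itg_cst. by apply: itgD=> //; apply: itgZ=> //; apply: itgZ. Qed.
Let F_bound K1 m r : 0 <= K1 <= 1 -> p <= m <= q -> p <= r <= q ->
  `|K1 * (phit m (z m) + \sum_j b j r * phi1 j m (z m)) - expint p k r * k r * (K0 * phi m (z m)) + ell m| <= G r.
move=> /andP[K10 K11] mpq rpq. have /andP[E0 E1] := expint_itv k0 rpq.
have kr := k0 rpq; have /andP[K00 K01] := K0_itv. rewrite (le_trans (ler_normD _ _))// lerD//; last exact: ellB.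
rewrite (le_trans (ler_normB _ _))// lerD//.
rewrite normrM ger0_norm// (@le_trans _ _ (1 * (C * nb r)))//; last first. by rewrite mul1r ler_wpM2l//; exact: kb.
apply: ler_pM=> //; rewrite (le_trans (ler_normD _ _))// mulrDr mulr1 lerD//. exact: (t_bt T).
rewrite (le_trans (ler_norm_sum _ _ _))// mulr_sumr ler_sum// => j _.
by rewrite normrM mulrC ler_wpM2r//; exact: (t_b1 T). have P1 := t_b0 T (z m) mpq.
rewrite !normrM (ger0_norm E0) (ger0_norm kr) (ger0_norm K00). rewrite mulrC; apply: ler_pM; rewrite ?mulr_ge0//.
by rewrite -[leRHS]mul1r; apply: ler_pM. by rewrite ler_piMl. Qed.
Let F_meas N : measi p q (fun r=> F N (gidx p q N r) r).
have gm (h : nat -> R) : measi p q (fun r=> h (gidx p q N r)).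
by apply: measurable_funTS; exact: gidx_measurable. have mb j : measi p q (b j) by exact: itg_meas.
have mE : measi p q (fun r=> expint p k r * k r). by apply: itg_meas; apply: itg_expint=> //; exact: ltW.
apply: measD; last exact: (gm (fun i=> ell (minr q (gp p q N i.+1)))). apply: measB.
apply: measM; first exact: (gm (fun i=> K (gp p q N i))). apply: measD.
exact: (gm (fun i=> phit (minr q (gp p q N i.+1)) (z (minr q (gp p q N i.+1))))).
apply: meas_sum=> j; apply: measM=> //.
exact: (gm (fun i=> phi1 j (minr q (gp p q N i.+1)) (z (minr q (gp p q N i.+1))))). apply: measM=> //.
exact: (gm (fun i=> K0 * phi (minr q (gp p q N i.+1)) (z (minr q (gp p q N i.+1))))). Qed.

(** The integrals of F converge by domination, since right grid points tend to r from the right and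
    the paths are right-continuous. The difference to [disc_sum] has two parts: the remainders of
    [test_fv], at most [e'] times the integral of nb, and the shift of [ell] from left to right grid
    points, which telescopes to one step length times [ell q - ell p]. *)
Lemma disc_sum_cvg : disc_sum n.+1 @[n --> \oo] -->
  int p q (fun r=> K r * (phit r (z r) + \sum_j b j r * phi1 j r (z r) - k r * phi r (z r)) + ell r).
have qp0 : 0 <= q - p by rewrite subr_ge0 ltW. have li n r : p <= r <= q -> p <= lft p q n.+1 r <= q.
move=> /andP[pr rq]; have /andP[A D] := @gidxP _ p q pq n.+1 r isT pr.
by rewrite (le_trans A rq) andbT -{1}(gp0 p q n.+1) gp_le. have ri n r : p <= r <= q -> p <= rgt p q n.+1 r <= q.
move=>rpq; have [A D E] := @rgt_cvg _ p q pq n.+1 r isT rpq.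
by rewrite (le_trans _ A) ?ge_min ?lexx//; case/andP: rpq.
have Kc r : p <= r <= q -> K (lft p q n.+1 r) @[n --> \oo] --> K r.
move=>rpq; rewrite K_def (_ : (fun n=> _) = (fun n=> K0 * expint p k (lft p q n.+1 r))); last first.
by apply/funext=> n; rewrite K_def. apply: cvgMr.
apply/cvgrPdist_lt=> e e0; have [del del0 H] := expint_cont ki k0 e0. have [n0 Hn0] := nat_large qp0 del0.
near=> n; apply: H=> //; first exact: li. have /andP[pr _] := rpq. have /andP[A D] := @lft_cvg _ p q pq n.+1 r isT pr.
rewrite ger0_norm ?subr_ge0//. have : (q - p) / n.+1%:R < del by apply: Hn0; near: n; exact: nbhs_infty_ge.
by move=>X; apply: le_lt_trans X; rewrite lerBlDr addrC -lerBlDr.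
have Fc : int p q (fun r=> F n.+1 (gidx p q n.+1 r) r) @[n --> \oo] -->
int p q (fun r=> K r * (phit r (z r) + \sum_j b j r * phi1 j r (z r) - k r * phi r (z r)) + ell r).
apply: (int_dct (g := G))=> //.
- move=>r rpq. have -> : K r * (phit r (z r) + \sum_j b j r * phi1 j r (z r) - k r * phi r (z r)) + ell r =
K r * (phit r (z r) + \sum_j b j r * phi1 j r (z r)) - expint p k r * k r * (K0 * phi r (z r)) + ell r.
by rewrite K_def; ring. apply: cvgD; last exact: rgt_lim pq ellc rpq. apply: cvgB. apply: cvgM. exact: Kc.
apply: cvgD. exact: (rgt_lim pq (unif_cont_rcont (t_ut T) rc_z) rpq). apply: cvg_bigsum=> j; apply: cvgMr.
exact: (rgt_lim pq (unif_cont_rcont (t_u1 T j) rc_z) rpq). apply: cvgMr; apply: cvgMr.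
exact: (rgt_lim pq (unif_cont_rcont (t_u0 T) rc_z) rpq).
- move=>n r rpq; apply: F_bound=> //; last exact: ri. by apply: KP; exact: li.
suff D0 : disc_sum n.+1 - int p q (fun r=> F n.+1 (gidx p q n.+1 r) r) @[n --> \oo] --> (0 : R).
exact: cvg_of_diff D0 Fc. apply/cvgrPdist_le=> e e0. pose I := int p q nb.
have I0 : 0 <= I by apply: int_ge0=> r _; rewrite addr_ge0// sumr_ge0. pose e' := e / 2 / (I + 1).
have e'0 : 0 < e' by rewrite !divr_gt0// ltr_wpDl. have [eta eta0 Heta] := test_fv T e'0.
have [del del0 Hdel] := int_abs_cont nbi eta0. have e20 : 0 < e / 2 by rewrite divr_gt0.
have mm : 0 < minr eta del by rewrite lt_min eta0. have [n0 Hn0] := nat_large qp0 mm.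
have B0 : 0 <= (q - p) * (2 * B). by rewrite mulr_ge0// mulr_ge0// (le_trans _ (ellB (_ : p <= p <= q)))// lexx ltW.
have [nB HnB] := nat_large B0 e20. near=> n; rewrite sub0r normrN; set N := n.+1.
have Nd : (q - p) / N%:R < minr eta del by apply: Hn0; near: n; exact: nbhs_infty_ge.
have Nb : (q - p) * (2 * B) / N%:R < e / 2 by apply: HnB; near: n; exact: nbhs_infty_ge.
move: Nd; rewrite lt_min=> /andP[Nd1 Nd2]. pose h := (q - p) / N%:R. pose g := gp p q N.
have mg i : (i < N)%N -> minr q (g i.+1) = g i.+1. by move=>iN; have [_ _ ?] := gi iN; exact: min_idPr.
have Fi i : (i < N)%N -> itg Leb `[g i, g i.+1] (F N i). move=>iN; have [A D E] := gi iN.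
apply: (le_itgi (g := G)); last exact: itg_sub Gi.
have mb j : measurable_fun `[g i, g i.+1] (b j) by apply: itg_meas; exact: itg_sub (bi j).
have mE : measurable_fun `[g i, g i.+1] (fun r=> expint p k r * k r).
by apply: itg_meas; apply: (itg_sub A E); apply: itg_expint=> //; exact: ltW.
apply: measD=> //; apply: measB; last exact: measM. apply: measM=> //; apply: measD=> //.
by apply: meas_sum=> j; exact: measM. move=>r rg; apply: F_bound.
- by apply: KP; rewrite A (le_trans D).
- by rewrite mg// E (le_trans A).
- by move: rg=> /andP[r1 r2]; rewrite (le_trans A r1) (le_trans r2 E).
have FE i : (i < N)%N -> int (g i) (g i.+1) (F N i) =
K (g i) * (h * phit (g i.+1) (z (g i.+1)) + \sum_j phi1 j (g i.+1) (z (g i.+1)) * (beta (g i.+1) - beta (g i)) ord0 j)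
- (K (g i) - K (g i.+1)) * phi (g i.+1) (z (g i.+1)) + h * ell (g i.+1). move=>iN; have [A D E] := gi iN.
rewrite /F mg// int_lin//; last 2 first.
- by move=>j; exact: itg_sub (bi j).
- by apply: (itg_sub A E); apply: itg_expint=> //; exact: ltW. rewrite (int_expint ki k0 A D E) !K_def gpS// -/h.
rewrite (eq_bigr (fun j=> phi1 j (g i.+1) (z (g i.+1)) * (beta (g i.+1) - beta (g i)) ord0 j)). by ring.
by move=>j _; rewrite betaE. rewrite -(@sum_gp _ p q pq N (F N))//; last first. apply: (le_itgi (g := G))=> //.
by move=>r rpq; apply: F_bound; [apply: KP; exact: li|exact: ri|]. rewrite /disc_sum -sumrB -/N -/g -/h.
pose Rm i := K (g i) * (phi (g i.+1) (z (g i.+1)) - phi (g i) (beta (g i) + y (g i.+1))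
- h * phit (g i.+1) (z (g i.+1)) - \sum_j phi1 j (g i.+1) (z (g i.+1)) * (beta (g i.+1) - beta (g i)) ord0 j).
rewrite (eq_bigr (fun i : 'I_N=> Rm i - h * (ell (g i.+1) - ell (g i)))); last first.
by move=>i _; rewrite (FE i)// /Rm -z_def; ring.
rewrite sumrB -mulr_sumr -(big_mkord xpredT (fun i=> ell (g i.+1) - ell (g i))).
rewrite telescope_sumr// /g gp0 gpN//. apply: (@le_trans _ _ (e' * I + h * (2 * B))).
rewrite (le_trans (ler_normB _ _))// lerD//; last first.
rewrite normrM ger0_norm ?divr_ge0// ler_wpM2l ?divr_ge0// (le_trans (ler_normB _ _))//.
rewrite mulr_natl mulr2n lerD//; apply: ellB; rewrite lexx ?andbT ltW//. rewrite (le_trans (ler_norm_sum _ _ _))//.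
have -> : I = \sum_(i < N) int (g i) (g i.+1) nb.
by rewrite (@sum_gp _ p q pq N (fun=> nb))// => i iN; have [A D E] := gi iN; apply: itg_sub nbi.
rewrite mulr_sumr; apply: ler_sum=> i _; have [A D E] := gi (ltn_ord i).
have /andP[Ki0 Ki1] : 0 <= K (g i) <= 1 by apply: KP; rewrite A (le_trans D).
have hE : g i.+1 - g i = h by exact: gpS. have nl : int (g i) (g i.+1) nb < eta.
rewrite (@int_eq _ _ _ nb (fun r=> `|nb r|)); last first. by move=>r' _; rewrite ger0_norm// addr_ge0// sumr_ge0.
by apply: Hdel=> //; rewrite hE. have ds := delta_sum A D E. have n1l : n1 (beta (g i.+1) - beta (g i)) < eta.
apply: le_lt_trans nl; apply: le_trans ds; rewrite lerDr subr_ge0//.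
have := Heta (g i) (g i.+1) (beta (g i) + y (g i.+1)) (beta (g i.+1) - beta (g i)) A D E _ n1l. rewrite hE=> /(_ Nd1).
rewrite (_ : beta (g i) + y (g i.+1) + _ = z (g i.+1)); last first.
by rewrite z_def; apply/rowP=> j; rewrite !mxE; ring. move=>HH.
rewrite /Rm normrM ger0_norm// -[leRHS]mul1r; apply: ler_pM=> //.
apply: le_trans HH _; apply: ler_wpM2l; first exact: ltW. by rewrite -hE. have : e' * I <= e / 2.
by rewrite /e' mulrAC ler_pdivrMr ?ltr_wpDl// ler_wpM2l ?lerDl// ltW.
have : h * (2 * B) <= e / 2 by rewrite /h mulrAC ltW. lra.
Unshelve. all: by end_near. Qed.

End Discretisation.

(** * Conditional means and independence *)

Section ConditionalMean.
Context {R : realType} {dO : measure_display} {Om : measurableType dO} (P : probability Om R) (G : set (set Om)) (sG : sigma_algebra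
  setT G) (Gm : G `<=` measurable).

(** The sample space carrying the smaller sigma-algebra, so that G-measurability becomes
    measurability on a type and the general lemmas apply. *)
Definition subalg := g_sigma_algebraType G.

Lemma subalg_measurable (A : set Om) : measurable (A : set subalg) <-> G A.
split=> [|GA]; last exact: sub_sigma_algebra. by rewrite /measurable/= sigma_algebra_id. Qed.

Lemma measurable_of_subalg {d'} {T : measurableType d'} (xi : Om -> T) : meas (xi : subalg -> T) -> meas xi.
move=>mxi _ B mB; apply: Gm; apply/subalg_measurable. exact: mxi. Qed.

Lemma meas_wrt_subalg {d'} {T : measurableType d'} (xi : Om -> T) : meas_wrt G xi <-> meas (xi : subalg -> T).
split=> [H _ B mB|H B mB]. by rewrite setTI; apply/subalg_measurable; exact: H.
by apply/subalg_measurable; rewrite -[X in measurable X]setTI; exact: H. Qed.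

(* The pair (Y, m) behaves as E[Y | G] = m. *)
Definition cmean (Y : Om -> R) (m : R) := itgT P Y /\ forall (xi : Om -> R) C,
  meas (xi : subalg -> R) -> (forall w, `|xi w| <= C) -> \int[P]_w (xi w * Y w) = m * \int[P]_w xi w.

Lemma itg_bounded (xi Y : Om -> R) (C : R) : meas xi -> (forall w, `|xi w| <= C) ->
  itgT P Y -> itgT P (fun w=> xi w * Y w).
by move=>mxi xiC; apply: itgM_bounded=> // w _; exact: xiC. Qed.

Lemma P_itg_bounded (xi : Om -> R) (C : R) : meas xi -> (forall w, `|xi w| <= C) -> itgT P xi.
move=>mxi xiC; apply: (@bounded_itg _ _ _ P setT xi C)=> //.
rewrite [X in (X < _)%E](_ : _ = 1%E); last exact: probability_setT. exact: ltry. Qed.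

Lemma Rint_indic (A : set Om) : measurable A -> \int[P]_w \1_A w = fine (P A).
by move=>mA; rewrite /Rintegral integral_indic// setIT. Qed.

Lemma id_subalg_measurable : meas (id : Om -> subalg).
by move=> _ B mB; rewrite setTI; apply/Gm/subalg_measurable. Qed.

(** The product formula on rectangles identifies the law of [w |-> (w, Z w)], with the first
    component seen through G, as the product of P on G with mu. Tonelli for this product integrates
    Z out with w frozen. *)
Lemma freezing {d'} {T : measurableType d'} (Z : Om -> T) (mu : {sigma_finite_measure set T -> \bar R})
  (F : subalg * T -> \bar R) : meas Z -> (forall A B, G A -> measurable B -> P (A `&` Z @^-1` B) = (P A * mu B)%E) ->
  meas F -> (forall x, 0 <= F x)%E -> (\int[P]_w F (w, Z w) = \int[P]_w \int[mu]_z F (w, z))%E.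
move=>mZ H mF F0. pose Phi (w : Om) : subalg * T := (w, Z w). have mPhi : meas Phi.
by apply: measurable_fun_pair=> //; exact: id_subalg_measurable. have mid := id_subalg_measurable.
pose PhiM : {mfun Om >-> (subalg * T)%type} := HB.pack Phi (isMeasurableFun.Build _ _ _ _ Phi mPhi).
pose idM : {mfun Om >-> subalg} :=
HB.pack (id : Om -> subalg) (isMeasurableFun.Build _ _ _ _ (id : Om -> subalg) mid). pose m' := distribution P PhiM.
pose m1 := distribution P idM. have U X : measurable X -> (m1 \x mu)%E X = m' X.
apply: product_measure_unique=> A B mA mB.
by rewrite /m1 /m' /distribution /pushforward -H//; apply/subalg_measurable. transitivity (\int[m']_x F x)%E.
by rewrite /m' /distribution ge0_integral_pushforward. transitivity (\int[(m1 \x mu)%E]_x F x)%E.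
by apply: eq_measure_integral=> X mX _; exact: esym (U X mX). rewrite fubini_tonelli1//.
rewrite /m1 /distribution ge0_integral_pushforward//. exact: (@measurable_fun_fubini_tonelli_F _ _ _ _ _ mu F).
by move=>w _; apply: integral_ge0. Qed.

Lemma cmean_law {d'} {T : measurableType d'} (Z : Om -> T) (mu : {sigma_finite_measure set T -> \bar R})
  (f : T -> R) : meas Z -> meas f -> itgT mu f ->
  (forall A B, G A -> measurable B -> P (A `&` Z @^-1` B) = (P A * mu B)%E) ->
  cmean (fun w=> f (Z w)) (\int[mu]_x f x).
move=>mZ mf fi H.
have pos (xi : Om -> R) (g : T -> \bar R) : meas (xi : subalg -> R) -> (forall w, 0 <= xi w) ->
meas g -> (forall x, 0 <= g x)%E -> (\int[P]_w ((xi w)%:E * g (Z w)) = (\int[P]_w (xi w)%:E) * \int[mu]_x g x)%E.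
move=>mxi xi0 mg g0. rewrite (@freezing _ _ Z mu (fun x=> ((xi x.1)%:E * g x.2)%E))//; last 2 first.
- apply: emeasurable_funM; last exact: (meas_comp mg). by apply/measEFin; exact: (meas_comp mxi).
- by move=>x; rewrite mule_ge0// lee_fin. under eq_integral=> w _ do rewrite /= ge0_integralZl ?lee_fin//.
rewrite ge0_integralZr//; [by apply/measEFin; exact: measurable_of_subalg|by move=>w _; rewrite lee_fin|exact: integral_ge0].
have mf' : meas (EFin \o f) by exact/measEFin. have i1 : itgT P (fun w=> f (Z w)).
apply/integrableP; split; first by apply/measEFin; exact: meas_comp. have /integrableP[_] := fi.
have := pos (fun=> 1) (fun x=> `|(f x)%:E|%E) (measurable_cst _) (fun=> ler01) _ (fun x=> abse_ge0 _).
have -> : (\int[P]__ (1%R)%:E = 1)%E by rewrite integral_cst// mul1e; exact: probability_setT. rewrite mul1e=> <-.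
by under [X in (X < _)%E]eq_integral do rewrite mul1e. exact: meas_comp.
(* It is enough to treat xi >= 0: that case for [xi + C] and for the constant C gives the general
   one by subtraction. *)
split=> // xi C mxi xiC; have mxi' := measurable_of_subalg mxi. wlog xi0 : xi C mxi xiC mxi' / forall w, 0 <= xi w.
move=>W; have ixi := P_itg_bounded mxi' xiC; have ic := @P_itg_bounded (fun=> C) `|C| (measurable_cst _) (fun=> lexx _).
have C0 w : 0 <= xi w + C by rewrite -lerBlDr sub0r; have := xiC w; rewrite ler_norml=> /andP[].
have Cp : 0 <= C by exact: le_trans (normr_ge0 _) (xiC point).
have := W (fun w=> xi w + C) (C + C) (measD mxi (measurable_cst _)) _ (measD mxi' (measurable_cst _)) C0.
have -> : \int[P]_w ((xi w + C) * f (Z w)) = \int[P]_w (xi w * f (Z w)) + \int[P]_w (C * f (Z w)).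
rewrite -RintegralD//; [|exact: itg_bounded xiC i1|exact: itgZ]. by apply: eq_Rintegral=> w _; rewrite mulrDl.
rewrite RintegralD// (W (fun=> C) C (measurable_cst _) _ (measurable_cst _) (fun=> Cp)) ?mulrDr; last first.
by move=>w; rewrite ger0_norm.
move=> /(_ _)/addIr; apply=> w; apply: le_trans (ler_normD _ _) _; apply: lerD; [exact: xiC|by rewrite ger0_norm].
have [fp fn] := (integrable_pos_fin_num measurableT fi, integrable_neg_fin_num measurableT fi).
have fx : (\int[P]_w (xi w)%:E)%E \is a fin_num by exact: integrable_fin_num (P_itg_bounded mxi' xiC).
rewrite /Rintegral integralE [in X in _ = fine X * _]integralE.
have -> : (\int[P]_w ((EFin \o (fun w=> (xi w * f (Z w))%R))^\+ w) = (\int[P]_w (xi w)%:E) * \int[mu]_x (EFin \o f)^\+ x)%E.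
rewrite -pos//; last exact: measurable_funepos.
by apply: eq_integral=> w _; rewrite !funeposE /= -!EFin_max -EFinM maxr_pMr// mulr0.
have -> : (\int[P]_w ((EFin \o (fun w=> (xi w * f (Z w))%R))^\- w) = (\int[P]_w (xi w)%:E) * \int[mu]_x (EFin \o f)^\- x)%E.
rewrite -pos//; last exact: measurable_funeneg.
by apply: eq_integral=> w _; rewrite !funenegE /= -!EFin_max -EFinM maxr_pMr// mulr0 mulrN.
rewrite -muleBr ?fineM//; first exact: mulrC. by rewrite fin_numB fp. by rewrite fin_num_adde_defl// fin_numN. Qed.

End ConditionalMean.

(** * Moments of Poisson and Gaussian variables *)

Section BeppoLevi.
Context {dT : measure_display} {T : measurableType dT} {R : realType} (mu : {measure set T -> \bar R}).

Lemma beppo_levi (f_ : nat -> T -> R) (f : T -> R) (L : R) : (forall n, meas (f_ n)) -> (forall n x, 0 <= f_ n x) ->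
  (forall n m x, (n <= m)%N -> f_ n x <= f_ m x) -> (forall x, f_ n x @[n --> \oo] --> f x) ->
  (forall n, itgT mu (f_ n)) -> \int[mu]_x f_ n x @[n --> \oo] --> L -> itgT mu f /\ \int[mu]_x f x = L.
move=>mf f0 fm fc fi fL. have := @cvg_monotone_convergence _ _ _ mu setT measurableT (fun n x=> (f_ n x)%:E).
have mf' n : meas (EFin \o f_ n) by exact/measEFin.
move=> /(_ mf' (fun n x _=> f0 n x : (0 <= (f_ n x)%:E)%E) (fun x _ n m nm=> fm n m x nm : (_%:E <= _%:E)%E)).
have E x : limn (fun n=> (f_ n x)%:E) = (f x)%:E. by apply/cvg_lim=> //; apply: cvg_EFin; [exact: nearW|exact: fc].
under eq_integral do rewrite E. move=>H. have H2 : (\int[mu]_x (f_ n x)%:E)%E @[n --> \oo] --> L%:E.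
have E2 n : (\int[mu]_x (f_ n x)%:E)%E = (\int[mu]_x f_ n x)%:E.
by rewrite /Rintegral fineK//; exact: integrable_fin_num (fi n).
by under eq_fun do rewrite E2; apply: cvg_EFin; [exact: nearW|exact: fL].
have E3 : (\int[mu]_x (f x)%:E)%E = L%:E by exact: (cvg_unique _ H H2).
have f00 x : 0 <= f x by apply: (cvgr_to_ge (fc x)); exact: nearW.
have mff : meas f by apply: measurable_fun_cvg mf _=> x _; exact: fc. split; last by rewrite /Rintegral E3.
apply/integrableP; split; first exact/measEFin. under eq_integral do rewrite /= ger0_norm//. by rewrite E3 ltry. Qed.

End BeppoLevi.

(** p and the Radon-Nikodym derivative have the same integrals over all measurable sets, hence agree
    almost everywhere, and the change of variables holds for the latter. *)
Lemma integral_density {R : realType} (nu : probability (mR R) R) (p : R -> R) (f : R -> \bar R) :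
  nu `<< @lebesgue_measure R -> meas p ->
  (forall A : set (mR R), measurable A -> nu A = \int[@lebesgue_measure R]_(x in A) (p x)%:E)%E ->
  meas f -> (forall x, 0 <= f x)%E -> (\int[nu]_x f x = \int[@lebesgue_measure R]_x (f x * (p x)%:E))%E.
move=>dom mp nuE mf f0; have mp' : meas (EFin \o p) by exact/measEFin.
have fi := Radon_Nikodym_SigmaFinite.f_integrable dom.
have mr : meas (Radon_Nikodym_SigmaFinite.f nu (@lebesgue_measure R)) by move/integrableP : fi=> [].
rewrite -(Radon_Nikodym_SigmaFinite.change_of_variables dom f0 measurableT mf); apply: ae_eq_integral=> //.
- exact: (emeasurable_funM mf mr).
- exact: (emeasurable_funM mf mp'). apply: ae_eqe_mul2l; apply: integral_ae_eq=> // E _ mE.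
by rewrite -(Radon_Nikodym_SigmaFinite.f_integral dom mE); exact: nuE. Qed.

Section PoissonMoments.
Context {R : realType} {dO : measure_display} {Om : measurableType dO} (P : probability Om R) (N : Om -> nat) (lam : R) (mN : forall k,
  measurable (N @^-1` [set k])) (lam0 : 0 <= lam) (NP : forall k, P (N @^-1` [set k]) = poisson_prob lam k [set k]).

Let Pk k := fine (P (N @^-1` [set k])).

Let Pk_fin k : P (N @^-1` [set k]) \is a fin_num.
exact: fin_num_measure. Qed.

Lemma poisson_step k : k.+1%:R * Pk k.+1 = lam * Pk k.
rewrite /Pk !NP /poisson_prob; case: ifPn=> [l0|].
rewrite !esum_set1 /=; try by rewrite lee_fin poisson_pmf_ge0. rewrite /poisson_pmf l0 factS natrM exprS; field.
by rewrite pnatr_eq0 -lt0n fact_gt0 /= addrC natr1 pnatr_eq0.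
(* At rate 0 the law is the point mass at 0. *)
rewrite -leNgt=> l0; have -> : lam = 0 by apply/eqP; rewrite eq_le l0. by rewrite !diracE mul0r memNset ?mulr0. Qed.
Let mNR (h : nat -> R) : meas (fun w=> h (N w)).
have mN' : meas N. move=> _ B _; rewrite setTI. have -> : N @^-1` B = \bigcup_(i in B) (N @^-1` [set i]).
apply/seteqP; split=> [r Br|r [i Bi /= ->]]//; by exists (N r). by apply: bigcup_measurable=> i _.
exact: (meas_comp (f := h)). Qed.
Let sum_indic (h : nat -> R) K w : h (N w) * ((N w < K)%N)%:R = \sum_(k < K) h k * \1_(N @^-1` [set (k : nat)]) w.
case: (ltnP (N w) K)=> NK; rewrite ?mulr1 ?mulr0.
rewrite (bigD1 (Ordinal NK))//= indicE mem_set// mulr1 big1 ?addr0// => k kN.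
by rewrite indicE memNset ?mulr0//= => E; move/eqP: kN; apply; apply/val_inj.
rewrite big1// => k _; rewrite indicE memNset ?mulr0//= => E. by have := ltn_ord k; rewrite -E ltnNge NK. Qed.
Let int_trunc (h : nat -> R) K : \int[P]_w (h (N w) * ((N w < K)%N)%:R) = \sum_(k < K) h k * Pk k.
have ii k : itgT P (\1_(N @^-1` [set k]) : Om -> R). apply: (@P_itg_bounded _ _ _ _ _ 1)=> // w.
by rewrite ger0_norm// indicE lern1 leq_b1. under eq_Rintegral do rewrite sum_indic.
rewrite Rint_sum//; last by move=>k _; exact: itgZ. apply: eq_bigr=> k _; rewrite RintegralZl//; congr (_ * _).
by rewrite Rint_indic. Qed.
Let trunc_cvg w (x : R) : x * ((N w < K)%N)%:R @[K --> \oo] --> x.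
apply: cvg_near_cst; near=> K. rewrite (_ : (N w < K)%N) ?mulr1//; near: K; exact: nbhs_infty_gt.
Unshelve. all: by end_near. Qed.
Let sumPk : \sum_(k < K) Pk k @[K --> \oo] --> (1 : R).
have := @Rdct _ _ _ P setT (fun K w=> 1 * ((N w < K)%N)%:R) (fun=> 1) (fun=> 1) measurableT. case=> //.
- by move=>K; exact: (mNR (fun k=> 1 * ((k < K)%N)%:R)).
- by apply: aeW=> w _; exact: trunc_cvg.
- by apply: (@P_itg_bounded _ _ _ _ _ 1)=> // w; rewrite normr1.
- by move=>K w _; rewrite mul1r; case: (_ < _)%N; rewrite ?normr1 ?normr0. move=> _; rewrite Rintegral_cst// mul1r.
rewrite [X in fine X](_ : _ = 1%E); last exact: probability_setT. under eq_fun do rewrite (int_trunc (fun=> 1)).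
by under eq_fun do under eq_bigr do rewrite mul1r. Qed.
(** Truncation at counts below K turns the mean into a finite sum over the weights; monotone
    convergence yields integrability and value together. *)
Let moment (h : nat -> R) (L : R) : (forall k, 0 <= h k) -> \sum_(k < K) h k * Pk k @[K --> \oo] --> L ->
  itgT P (fun w=> h (N w)) /\ \int[P]_w h (N w) = L.
move=>h0 hL; apply: (@beppo_levi _ _ _ P (fun K w=> h (N w) * ((N w < K)%N)%:R)).
- by move=>K; exact: (mNR (fun k=> h k * ((k < K)%N)%:R)).
- by move=>K w; exact: mulr_ge0.
- move=>K K' w KK'; apply: ler_wpM2l=> //; rewrite ler_nat. by case: (ltnP (N w) K)=> // NK; rewrite (leq_trans NK).
- by move=>w; exact: trunc_cvg.
- move=>K; apply: (@P_itg_bounded _ _ _ _ _ (\sum_(k < K) h k)). exact: (mNR (fun k=> h k * ((k < K)%N)%:R)).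
move=>w; rewrite ger0_norm ?mulr_ge0// sum_indic ler_sum// => k _. by rewrite ler_piMr// indicE lern1 leq_b1.
- by under eq_fun do rewrite int_trunc. Qed.

Lemma poisson_mean : itgT P (fun w=> (N w)%:R : R) /\ \int[P]_w (N w)%:R = lam.
apply: (@moment (fun k=> k%:R))=> //. rewrite -(cvg_shiftS (fun K=> \sum_(k < K) k%:R * Pk k)) /=.
have E K : \sum_(k < K.+1) k%:R * Pk k = lam * \sum_(k < K) Pk k.
rewrite big_ord_recl mul0r add0r mulr_sumr; apply: eq_bigr=> k _. exact: poisson_step. under eq_fun do rewrite E.
suff: lam * \sum_(k < K) Pk k @[K --> \oo] --> lam * 1 by rewrite mulr1. by apply: cvgMr; exact: sumPk. Qed.

(** [n * n.-1] vanishes unless there are at least two jumps, and then it dominates n. With lam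
    proportional to the step, its mean [lam ^+ 2] makes multiple jumps negligible. *)
Lemma poisson_fact2 : itgT P (fun w=> (N w * (N w).-1)%:R : R) /\ \int[P]_w (N w * (N w).-1)%:R = lam ^+ 2.
apply: (@moment (fun k=> (k * k.-1)%:R))=> //.
rewrite -(cvg_shiftS (fun K=> \sum_(k < K) (k * k.-1)%:R * Pk k)) /=.
rewrite -(cvg_shiftS (fun K=> \sum_(k < K.+1) (k * k.-1)%:R * Pk k)) /=.
have E K : \sum_(k < K.+2) (k * k.-1)%:R * Pk k = lam ^+ 2 * \sum_(k < K) Pk k.
rewrite big_ord_recl /= mul0r add0r big_ord_recl /= /bump /= muln0 mul0r add0r mulr_sumr.
apply: eq_bigr=> k _; rewrite /bump /= !add1n natrM.
rewrite add0n; have A := poisson_step k.+1; have B := poisson_step k.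
transitivity (k.+1%:R * (k.+2%:R * Pk k.+2)); first by ring.
rewrite A; transitivity (lam * (k.+1%:R * Pk k.+1)); first by ring. by rewrite B; ring. under eq_fun do rewrite E.
suff: lam ^+ 2 * \sum_(k < K) Pk k @[K --> \oo] --> lam ^+ 2 * 1 by rewrite mulr1. by apply: cvgMr; exact: sumPk. Qed.

End PoissonMoments.

Lemma cvg_to_eq {R : realType} (f : nat -> R) (l l' : R) :
  f n @[n --> \oo] --> l -> l = l' -> f n @[n --> \oo] --> l'.
by move=>H <-. Qed.

Section GaussianMoments.
Context {R : realType} (h : R) (h0 : 0 < h).

Definition gpdf : R -> R := normal_pdf 0 (Num.sqrt h).

Let sh : Num.sqrt h != 0.
by rewrite sqrtr_eq0 -ltNge. Qed.
Let gpdfE x : gpdf x = normal_peak (Num.sqrt h) * expR (- x ^+ 2 / (2 * h)).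
rewrite /gpdf normal_pdfE// /normal_pdf. by rewrite /normal_fun subr0 sqr_sqrtr ?ltW// mulr_natl. Qed.

Lemma gpdf_ge0 x : 0 <= gpdf x.
exact: normal_pdf_ge0. Qed.
Let is_derive_gpdf (x : R) : is_derive x 1 gpdf (- (x / h) * gpdf x).
rewrite (_ : gpdf = fun x=> normal_peak (Num.sqrt h) * expR (- x ^+ 2 / (2 * h))); last exact/funext.
apply: is_derive_eq; rewrite /GRing.scale /=; field. by rewrite gt_eqF. Qed.
Let cont_derive (f g : R -> R) : (forall x : R, is_derive x 1 f (g x)) -> continuous f.
by move=>H x; apply: differentiable_continuous; apply/derivable1_diffP; case: (H x). Qed.
Let gpdf_cont : continuous gpdf.
exact: cont_derive is_derive_gpdf. Qed.
Let ftc (F f : R -> R) (n : R) : 0 < n -> (forall x : R, is_derive x 1 F (f x)) -> continuous f ->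
  int (- n) n f = F n - F (- n).
move=>n0 dF cf; rewrite /int /Rintegral (@continuous_FTC2 _ f F)//.
- by lra.
- exact: continuous_subspaceT.
- have cF := cont_derive dF; split=> [x _||].
+ by case: (dF x).
+ exact/cvg_at_right_filter/cF.
+ exact/cvg_at_left_filter/cF.
- by move=>x _; rewrite derive1E; case: (dF x). Qed.
Let itg_cont (f : R -> R) p q : continuous f -> itgi p q f.
move=>cf; apply: continuous_compact_integrable; first exact: segment_compact. exact: continuous_subspaceT. Qed.
Let a n := int (- n) n gpdf.
Let b n := int (- n) n (fun x=> x ^+ 2 * gpdf x).
Let c n := int (- n) n (fun x=> x ^+ 4 * gpdf x).

Let contX (k : nat) : continuous (fun x : R=> x ^+ k * gpdf x).
by move=>x; apply: cvgM; [exact: exprn_continuous|exact: gpdf_cont]. Qed.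
(** Integration by parts on a bounded interval, with antiderivative [- (h * (x * gpdf x))]; the last
    term is the boundary contribution. *)
Let bE (n : R) : 0 < n -> b n = h * a n - 2 * h * n * gpdf n.
move=>n0. have gN : gpdf (- n) = gpdf n by rewrite !gpdfE sqrrN.
have D (x : R) : is_derive x 1 (fun x=> - (h * (x * gpdf x))) (x ^+ 2 * gpdf x - h * gpdf x).
have dg := is_derive_gpdf x. apply: is_derive_eq; rewrite /GRing.scale /=; field; exact: lt0r_neq0.
have Cn : continuous (fun x : R=> x ^+ 2 * gpdf x - h * gpdf x).
by move=>x; apply: cvgB; [exact: contX|apply: cvgMr; exact: gpdf_cont]. have := ftc n0 D Cn; rewrite gN.
have -> : int (- n) n (fun x=> x ^+ 2 * gpdf x - h * gpdf x) = b n - h * a n.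
rewrite /int RintegralB//; [|exact: itg_cont|]; last first. by apply: itg_cont=> x; apply: cvgMr; exact: gpdf_cont.
by rewrite RintegralZl//; exact: itg_cont. by move=>H; apply: (addIr (- (h * a n))); rewrite H; ring. Qed.
Let cE (n : R) : 0 < n -> c n = 3 * h * b n - 2 * h * n ^+ 3 * gpdf n.
move=>n0. have gN : gpdf (- n) = gpdf n by rewrite !gpdfE sqrrN.
have D (x : R) : is_derive x 1 (fun x=> - (h * (x ^+ 3 * gpdf x))) (x ^+ 4 * gpdf x - 3 * h * (x ^+ 2 * gpdf x)).
have dg := is_derive_gpdf x. apply: is_derive_eq; rewrite /GRing.scale /=; field; exact: lt0r_neq0.
have Cn : continuous (fun x : R=> x ^+ 4 * gpdf x - 3 * h * (x ^+ 2 * gpdf x)).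
by move=>x; apply: cvgB; [exact: contX|apply: cvgMr; exact: contX]. have := ftc n0 D Cn; rewrite gN.
have -> : int (- n) n (fun x=> x ^+ 4 * gpdf x - 3 * h * (x ^+ 2 * gpdf x)) = c n - 3 * h * b n.
rewrite /int RintegralB//; [|exact: itg_cont|]; last first. by apply: itg_cont=> x; apply: cvgMr; exact: contX.
by rewrite RintegralZl//; exact: itg_cont. by move=>H; apply: (addIr (- (3 * h * b n))); rewrite H; ring. Qed.
Let mean0 (n : R) : 0 < n -> int (- n) n (fun x=> x * gpdf x) = 0.
move=>n0. have gN : gpdf (- n) = gpdf n by rewrite !gpdfE sqrrN.
have D (x : R) : is_derive x 1 (fun x=> - (h * gpdf x)) (x * gpdf x). have dg := is_derive_gpdf x.
apply: is_derive_eq; rewrite /GRing.scale /=; field; exact: lt0r_neq0. rewrite (ftc n0 D) ?gN ?subrr//.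
by move=>x; apply: cvgM; [exact: cvg_id|exact: gpdf_cont]. Qed.
Let chi (n : nat) (x : R) : R := \1_(`[- n.+1%:R, n.+1%:R]%classic) x.

Let chiE n (f : R -> R) : \int[Leb]_x (chi n x * f x) = int (- n.+1%:R) n.+1%:R f.
rewrite /int [RHS]Rintegral_mkcond; apply: eq_Rintegral=> x _.
by rewrite /chi indicE /patch; case: ifPn=> _; rewrite ?mul1r ?mul0r. Qed.
Let chi_cvg x (y : R) : chi n x * y @[n --> \oo] --> y.
apply: cvg_near_cst; near=> n; rewrite /chi indicE mem_set ?mul1r//= in_itv/= -ler_norml.
rewrite (@le_trans _ _ (Num.truncn `|x|).+1%:R)//. by have /andP[_ /ltW] := truncn_itv (normr_ge0 x).
rewrite ler_nat ltnS; near: n; exact: nbhs_infty_ge.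
Unshelve. all: by end_near. Qed.
Let mf (f : R -> R) : continuous f -> meas f.
exact: continuous_measurable_fun. Qed.
Let itg_chi n (f : R -> R) : continuous f -> itgT Leb (fun x=> chi n x * f x).
move=>cf; have := itg_cont (- n.+1%:R) n.+1%:R cf.
rewrite (integrable_mkcond _ (mitv _ _)); congr integrable; apply/funext=> x /=.
by rewrite /chi indicE /patch; case: ifPn=> _; rewrite ?mul1r ?mul0r. Qed.
Let chi01 n x : 0 <= chi n x <= 1.
by rewrite /chi indicE ler0n lern1 leq_b1. Qed.
Let chi_mono n m x : (n <= m)%N -> chi n x <= chi m x.
move=>nm; rewrite /chi !indicE ler_nat. have [|//] := boolP (x \in `[- n.+1%:R, n.+1%:R]%classic).
rewrite !inE/= in_itv/= => /andP[A B]; rewrite mem_set//= in_itv/=.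
have : (n.+1%:R : R) <= m.+1%:R by rewrite ler_nat. by move=>nm'; apply/andP; split; lra. Qed.
Let trunc_bl (f : R -> R) (L : R) : continuous f -> (forall x, 0 <= f x) ->
  int (- n.+1%:R) n.+1%:R f @[n --> \oo] --> L -> itgT Leb f /\ \int[Leb]_x f x = L.
move=>cf f0 fL; apply: (@beppo_levi _ _ _ Leb (fun n x=> chi n x * f x)).
- by move=>n; apply: measM; [exact: measurable_indic|exact: mf].
- by move=>n x; rewrite mulr_ge0//; have /andP[] := chi01 n x.
- by move=>n m x nm; rewrite ler_wpM2r// chi_mono.
- by move=>x; exact: chi_cvg.
- by move=>n; exact: itg_chi.
- by under eq_fun do rewrite chiE. Qed.
Let gpdf_itg : itgT Leb gpdf /\ \int[Leb]_x gpdf x = 1.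
split; first exact: integrable_normal_pdf. by rewrite /Rintegral integral_normal_pdf. Qed.
Let trunc_cvg (f : R -> R) : continuous f -> itgT Leb f -> int (- n.+1%:R) n.+1%:R f @[n --> \oo] --> \int[Leb]_x f x.
move=>cf fi; under eq_fun do rewrite -chiE.
have [] := @Rdct _ _ _ Leb setT (fun n x=> chi n x * f x) f (fun x=> `|f x|)=> //.
- by move=>n; apply: measM; [exact: measurable_indic|exact: mf].
- exact: mf.
- by apply: aeW=> x _; exact: chi_cvg.
- exact: integrable_norm fi.
- by move=>n x _; rewrite normrM ler_piMl//; have /andP[A B] := chi01 n x; rewrite ger0_norm. Qed.
Let n3gpdf : n.+1%:R ^+ 3 * gpdf n.+1%:R @[n --> \oo] --> (0 : R).
(* With [y = m ^+ 2 / (4 * h)] the exponential is [expR (- y) ^+ 2 <= y^-1 ^+ 2 = 16 * h ^+ 2 / m ^+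
   4], so [m ^+ 3] times the density is at most A / m. *)
pose A := normal_peak (Num.sqrt h) * (16 * h ^+ 2).
apply: (@squeeze_cvgr _ _ _ _ (cst 0) (fun n=> A * n.+1%:R^-1)).
- apply: nearW=> n; set m : R := n.+1%:R. have m0 : 0 < m by rewrite ltr0n.
have pk0 : 0 <= normal_peak (Num.sqrt h) by exact: normal_peak_ge0.
rewrite mulr_ge0 ?gpdf_ge0 ?exprn_ge0 ?(ltW m0)//= gpdfE /A. rewrite mulrCA -[leRHS]mulrA; apply: ler_wpM2l=> //.
pose y := m ^+ 2 / (4 * h). have y0 : 0 < y by rewrite divr_gt0 ?exprn_gt0// mulr_gt0.
have -> : expR (- m ^+ 2 / (2 * h)) = expR (- y) ^+ 2.
rewrite [expR (- y) ^+ 2]expr2 -expRD; congr expR; rewrite /y; field; exact: lt0r_neq0. have E1 : expR (- y) <= y^-1.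
by rewrite (le_trans (expRN_le (ltW y0)))// lef_pV2 ?posrE ?ltr_wpDl// lerDr.
apply: (@le_trans _ _ (m ^+ 3 * y^-1 ^+ 2)). apply: ler_wpM2l; first by rewrite exprn_ge0// ltW.
by apply: lerXn2r=> //; rewrite nnegrE ?expR_ge0// invr_ge0 ltW.
rewrite le_eqVlt; apply/orP; left; apply/eqP; rewrite /y; field. by rewrite !lt0r_neq0.
- exact: cvg_cst.
- by rewrite -(mulr0 A); apply: cvgMr; exact: cvg_harmonic. Qed.
Let ngpdf : n.+1%:R * gpdf n.+1%:R @[n --> \oo] --> (0 : R).
apply: (@squeeze_cvgr _ _ _ _ (cst 0) (fun n=> n.+1%:R ^+ 3 * gpdf n.+1%:R)).
- apply: nearW=> n; rewrite mulr_ge0 ?gpdf_ge0//=; apply: ler_wpM2r; first exact: gpdf_ge0.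
by rewrite -natrX ler_nat -{1}(expn1 n.+1) leq_pexp2l.
- exact: cvg_cst.
- exact: n3gpdf. Qed.

Lemma gaussian_density (f : R -> R) : continuous f -> itgT Leb (fun x=> f x * gpdf x) ->
  itg (normal_prob 0 (Num.sqrt h)) setT f /\ \int[normal_prob 0 (Num.sqrt h)]_x f x = \int[Leb]_x (f x * gpdf x).
move=>cf fgi; have mff := mf cf; have mg := mf gpdf_cont. have mff' : meas (EFin \o f) by exact/measEFin.
have D (k : R -> \bar R) : meas k -> (forall x, 0 <= k x)%E ->
(\int[normal_prob 0 (Num.sqrt h)]_x k x = \int[Leb]_x (k x * (gpdf x)%:E))%E.
by move=>mk k0; apply: integral_density=> //; exact: normal_prob_dominates. split.
apply/integrableP; split=> //; have /integrableP[_] := fgi. rewrite D//; last exact: meas_comp.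
by under eq_integral do rewrite /= normrM (ger0_norm (gpdf_ge0 _)) EFinM.
rewrite /Rintegral integralE [in RHS]integralE !D; try exact: measurable_funepos; try exact: measurable_funeneg; try by [].
congr (fine (_ - _)%E); apply: eq_integral=> x _.
by rewrite !funeposE /= -!EFin_max -EFinM maxr_pMl ?gpdf_ge0// mul0r.
by rewrite !funenegE /= -!EFin_max -EFinM maxr_pMl ?gpdf_ge0// mul0r mulNr. Qed.

(** The truncated moments satisfy the recursions obtained by parts, the boundary terms vanish in the
    limit, and monotone convergence gives integrability and value. The first moment is zero on every
    symmetric interval and is dominated through [|x| <= 1 + x ^+ 2]. *)
Lemma gaussian_moments : let N := normal_prob 0 (Num.sqrt h) in [/\ itgT N id /\ \int[N]_x x = 0,
  itgT N (fun x=> x ^+ 2) /\ \int[N]_x (x ^+ 2) = h & itgT N (fun x=> x ^+ 4) /\ \int[N]_x (x ^+ 4) = 3 * h ^+ 2].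
have [gi g1] := gpdf_itg.
have ac : a n.+1%:R @[n --> \oo] --> (1 : R) by have := trunc_cvg gpdf_cont gi; rewrite g1.
have n0 n : 0 < (n.+1%:R : R) by rewrite ltr0n. have bc : b n.+1%:R @[n --> \oo] --> (h : R).
under eq_fun do rewrite bE//. apply: (@cvg_to_eq _ _ (h * 1 - 2 * h * 0)); last by ring.
apply: cvgB; first by apply: cvgMr; exact: ac. by under eq_fun do rewrite -mulrA; apply: cvgMr; exact: ngpdf.
have cc : c n.+1%:R @[n --> \oo] --> (3 * h ^+ 2 : R). under eq_fun do rewrite cE//.
apply: (@cvg_to_eq _ _ (3 * h * h - 2 * h * 0)); last by ring. apply: cvgB; first by apply: cvgMr; exact: bc.
by under eq_fun do rewrite -mulrA; apply: cvgMr; exact: n3gpdf.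
have [bi bI] := trunc_bl (@contX 2%N) (fun x=> mulr_ge0 (sqr_ge0 x) (gpdf_ge0 x)) bc.
have [ci cI] := trunc_bl (@contX 4%N) (fun x=> mulr_ge0 (exprn_even_ge0 x (isT : ~~ odd 4)) (gpdf_ge0 x)) cc.
have xc : continuous (fun x : R=> x * gpdf x). by move=>x; apply: cvgM; [exact: cvg_id|exact: gpdf_cont].
have xi : itgT Leb (fun x=> x * gpdf x). apply: (@le_itg _ _ _ Leb setT _ (fun x=> gpdf x + x ^+ 2 * gpdf x))=> //.
- exact: mf.
- move=>x _; rewrite normrM (ger0_norm (gpdf_ge0 x)) -{2}[gpdf x]mul1r -mulrDl.
apply: ler_wpM2r; first exact: gpdf_ge0. have : 0 <= (`|x| - 1) ^+ 2 by exact: sqr_ge0.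
by rewrite -(real_normK (num_real x)); have := normr_ge0 x; nra.
- exact: itgD. have xI : \int[Leb]_x (x * gpdf x) = 0. have := trunc_cvg xc xi; under eq_fun do rewrite mean0//.
have H0 : (fun _ : nat=> (0 : R)) @ \oo --> (0 : R) by exact: cvg_cst. by move=>H; exact: (cvg_unique _ H H0). split.
- by have [A ->] := gaussian_density (fun x : R=> @cvg_id _ (nbhs x) : id @ x --> id x) xi.
- by have [A ->] := gaussian_density (@exprn_continuous R 2) bi.
- by have [A ->] := gaussian_density (@exprn_continuous R 4) ci. Qed.

End GaussianMoments.

(** * Expansion of a test function over one noise increment *)

Section Inequalities.
Context {R : realType}.

(** Trades a first power for a small constant and a fourth power. The small constant will be
    absorbed by the number of jumps. *)
Lemma young1 (x e : R) : 0 <= x -> 0 < e -> x <= e + x ^+ 4 / e ^+ 3.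
move=>x0 e0; have [xe|ex] := leP x e. by rewrite (le_trans xe)// lerDl divr_ge0 ?exprn_ge0// ltW.
apply: (@le_trans _ _ (x ^+ 4 / e ^+ 3)); last by rewrite lerDr ltW.
rewrite ler_pdivlMr ?exprn_gt0// (exprS x 3) ler_wpM2l//. by apply: lerXn2r; rewrite ?nnegrE // ltW. Qed.

Lemma sqrD_le (x y : R) : (x + y) ^+ 2 <= 2 * x ^+ 2 + 2 * y ^+ 2.
have := sqr_ge0 (x - y); nra. Qed.

Lemma exprD4_le (x y : R) : (x + y) ^+ 4 <= 8 * x ^+ 4 + 8 * y ^+ 4.
have E z : z ^+ 4 = (z ^+ 2) ^+ 2 by move=> *; rewrite -exprM.
rewrite !E; have A := sqrD_le x y; have B := sqrD_le (x ^+ 2) (y ^+ 2).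
have : ((x + y) ^+ 2) ^+ 2 <= (2 * x ^+ 2 + 2 * y ^+ 2) ^+ 2.
by apply: lerXn2r=> //; rewrite nnegrE ?sqr_ge0// addr_ge0// mulr_ge0// sqr_ge0. lra. Qed.

(** Cauchy-Schwarz, from the nonnegativity of the sum of all [(x i - x j) ^+ 2]. *)
Lemma sum_sqr_le {J : finType} (x : J -> R) : (\sum_j x j) ^+ 2 <= #|J|%:R * \sum_j x j ^+ 2.
have H : 0 <= \sum_i \sum_j (x i - x j) ^+ 2 by apply: sumr_ge0=> i _; apply: sumr_ge0=> j _; exact: sqr_ge0.
have : \sum_i \sum_j (x i - x j) ^+ 2 = 2 * (#|J|%:R * \sum_j x j ^+ 2) - 2 * (\sum_j x j) ^+ 2.
have -> : \sum_i \sum_j (x i - x j) ^+ 2 =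
\sum_(i : J) \sum_(j : J) (x i ^+ 2 + x j ^+ 2) - \sum_(i : J) \sum_(j : J) 2 * (x i * x j).
rewrite -sumrB; apply: eq_bigr=> i _; rewrite -sumrB; apply: eq_bigr=> j _; ring.
have -> : \sum_(i : J) \sum_(j : J) 2 * (x i * x j) = 2 * (\sum_j x j) ^+ 2.
rewrite expr2 big_distrlr /= mulr_sumr; apply: eq_bigr=> i _; by rewrite mulr_sumr.
congr (_ - _); have cE : #|xpredT : pred J| = #|J| by apply: eq_card.
transitivity (\sum_(i : J) (#|J|%:R * x i ^+ 2 + \sum_(j : J) x j ^+ 2)).
by apply: eq_bigr=> i _; rewrite big_split/= sumr_const cE mulr_natl.
rewrite big_split/= sumr_const cE -mulr_sumr -[X in _ + X]mulr_natl. by rewrite [RHS]mulr_natl mulr2n. lra. Qed.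

Lemma sum_pow4_le {J : finType} (x : J -> R) : (\sum_j x j) ^+ 4 <= #|J|%:R ^+ 3 * \sum_j x j ^+ 4.
rewrite (_ : 4 = 2 * 2)%N// exprM. apply: (@le_trans _ _ ((#|J|%:R * \sum_j x j ^+ 2) ^+ 2)).
apply: lerXn2r; rewrite ?nnegrE ?sqr_ge0//; last exact: sum_sqr_le.
by apply: mulr_ge0=> //; apply: sumr_ge0=> j _; exact: sqr_ge0.
rewrite exprMn [_ ^+ 3]exprSr -mulrA; apply: ler_wpM2l; first exact: sqr_ge0. have := sum_sqr_le (fun j=> x j ^+ 2).
by under [X in _ <= _ * X -> _]eq_bigr do rewrite -exprM. Qed.

Lemma sum_le_const (d : nat) (F : 'I_d -> R) (c : R) : (forall i, F i <= c) -> \sum_i F i <= d%:R * c.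
move=>Fc; apply: (@le_trans _ _ (\sum_(i < d) c)); first exact: ler_sum.
by rewrite sumr_const card_ord mulr_natl. Qed.

End Inequalities.

Section OneStepPath.
Context {R : realType} {d : nat} {I : finType} (p q : R) (phi phit : sfun R d) (phi1 : 'I_d -> sfun R d) (phi2 : 'I_d ->
  'I_d -> sfun R d) (C : R) (T : test p q phi phit phi1 phi2 C).

Context (M : R).

Section Path.
Context (s h : R) (z : 'rV[R]_d) (w : 'I_d -> R) (sg : 'I_d -> 'I_d -> R) (g : I -> 'rV[R]_d) (mu : I -> R) (n : I ->
  nat) (spq : p <= s <= q) (h01 : 0 <= h <= 1) (sgM : forall i j, `|sg i j| <= M) (gM : forall a i, `|g a ord0 i| <=
  M) (mu0 : forall a, 0 <= mu a) (muM : \sum_a mu a <= M).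

Definition wcoef (i : 'I_d) := \sum_j sg i j * w j.

Definition kcoef (i : 'I_d) := \sum_a mu a * g a ord0 i.

(** [mu a] is the intensity of jumps of type a, so [h * mu a] compensates the count [n a] over a
    step of length h. *)
Definition dY : 'rV[R]_d := \row_i (wcoef i + \sum_a g a ord0 i * ((n a)%:R - h * mu a)).

(** What is left of the increment of phi once the terms with a known conditional mean are
    subtracted: the linear and the quadratic Gaussian term, the drift of the compensator, and the
    jumps as if each occurred alone from z. *)
Definition remainder := phi s (z + dY) - phi s z - \sum_i phi1 i s z * wcoef i
  - 2^-1 * (\sum_i \sum_k phi2 i k s z * (wcoef i * wcoef k)) + h * (\sum_i phi1 i s z * kcoef i)
  - \sum_a (n a)%:R * (phi s (z + g a) - phi s z).

Let W2 := \sum_j w j ^+ 2.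
Let W4 := \sum_j w j ^+ 4.
Let nt := (\sum_a n a)%N.
Let a : 'rV[R]_d := \row_i wcoef i.
Let kap : 'rV[R]_d := \row_i kcoef i.
(** v collects the Gaussian part and the compensator, J the raw jumps. *)
Let v := a - h *: kap.
Let J : 'rV[R]_d := \sum_a (n a)%:R *: g a.

Let M0 (i : 'I_d) : 0 <= M. Proof. exact: le_trans (sgM i i). Qed.
Let dYE : dY = v + J.
apply/rowP=> i; rewrite !mxE summxE /kcoef -addrA; congr (_ + _).
rewrite mulr_sumr -sumrN -big_split/=; apply: eq_bigr=> a' _. by rewrite mxE; ring. Qed.
Let n1a : n1 a <= d%:R * M * \sum_j `|w j|.
rewrite -mulrA; apply: sum_le_const=> i; rewrite mxE (le_trans (ler_norm_sum _ _ _))// mulr_sumr ler_sum// => j _.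
by rewrite normrM ler_wpM2r. Qed.
Let n1a2 : n1 a ^+ 2 <= (d%:R * M) ^+ 2 * d%:R * W2.
apply: (@le_trans _ _ ((d%:R * M * \sum_j `|w j|) ^+ 2)).
by apply: lerXn2r=> //; rewrite ?nnegrE ?n1_ge0// (le_trans (n1_ge0 _) n1a).
rewrite exprMn -[leRHS]mulrA; apply: ler_wpM2l; first exact: sqr_ge0.
have := sum_sqr_le (fun j=> `|w j|); rewrite card_ord /W2.
by under [X in _ <= _ * X -> _]eq_bigr do rewrite real_normK ?num_real//. Qed.
Let n1a4 : n1 a ^+ 4 <= (d%:R * M) ^+ 4 * d%:R ^+ 3 * W4.
apply: (@le_trans _ _ ((d%:R * M * \sum_j `|w j|) ^+ 4)).
by apply: lerXn2r=> //; rewrite ?nnegrE ?n1_ge0// (le_trans (n1_ge0 _) n1a).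
rewrite exprMn -[leRHS]mulrA; apply: ler_wpM2l; first exact: exprn_even_ge0.
have := sum_pow4_le (fun j=> `|w j|); rewrite card_ord /W4. by under [X in _ <= _ * X -> _]eq_bigr do
rewrite (_ : 4 = 2 * 2)%N// exprM real_normK ?num_real// -exprM. Qed.
Let n1k : n1 kap <= d%:R * M ^+ 2.
apply: sum_le_const=> i; rewrite mxE (le_trans (ler_norm_sum _ _ _))//. have M0' := M0 i.
apply: (@le_trans _ _ (\sum_a' mu a' * M)). apply: ler_sum=> a' _; rewrite normrM ger0_norm//; exact: ler_wpM2l.
by rewrite -mulr_suml expr2; apply: ler_wpM2r. Qed.
Let n1v : n1 v <= n1 a + h * n1 kap.
rewrite /v (le_trans (n1D _ _))// lerD2l n1N n1Z ger0_norm//. by case/andP: h01. Qed.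
Let nn1 : (0 < nt)%N -> (1 : R) <= nt%:R.
by rewrite ler1n. Qed.
Let C0 : 0 <= C.
by apply: (test_C_ge0 T); case/andP: spq=> A B; exact: le_trans B. Qed.
(** Interaction of the continuous move v with the jumps J. It is zero without jumps; otherwise it is
    at most [2 * C * n1 v], and [young1] together with [1 <= nt] splits this into a small multiple
    of the number of jumps and a fourth power. *)
Let R1 e : 0 < e -> `|phi s (z + v + J) - phi s (z + J) - (phi s (z + v) - phi s z)| <=
  2 * C * (e * nt%:R + n1 v ^+ 4 / e ^+ 3).
move=>e0; have Y0 : 0 <= n1 v ^+ 4 / e ^+ 3. by rewrite divr_ge0 ?exprn_ge0 ?n1_ge0// ltW.
have [n0|] := posnP nt. have -> : J = 0.
rewrite /J big1// => a' _; move/eqP: n0; rewrite sum_nat_eq0=> /forallP/(_ a')/eqP ->. by rewrite scale0r.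
rewrite !addr0 subrr normr0 n0 mulr0 add0r. by apply: mulr_ge0=> //; apply: mulr_ge0.
move=>npos; apply: (le_trans (ler_normB _ _)). have B : C * n1 v <= C * (e * nt%:R + n1 v ^+ 4 / e ^+ 3).
apply: ler_wpM2l=> //; rewrite (le_trans (young1 (n1_ge0 v) e0))// lerD2r. by rewrite ler_peMr ?nn1// ltW.
set Z := _ + _ / _ in B *; have -> : 2 * C * Z = C * Z + C * Z by ring. apply: lerD; apply: le_trans B.
by rewrite [z + v + J]addrAC; apply: (test_lip T). exact: (test_lip T). Qed.
(** Jumping by the sum of the jumps against adding up separate jumps: no difference for at most one
    jump, and for two or more the number of jumps is dominated by [nt * nt.-1]. *)
Let R2 : `|phi s (z + J) - phi s z - \sum_a (n a)%:R * (phi s (z + g a) - phi s z)| <= 4 * C * (nt * nt.-1)%:R.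
have bd x : `|phi s x| <= C by exact: (t_b0 T). have [n1|n1] := leqP nt 1.
suff -> : phi s (z + J) - phi s z - \sum_a (n a)%:R * (phi s (z + g a) - phi s z) = 0. by rewrite normr0 !mulr_ge0.
have [a' na'|all0] := pickP (fun a'=> n a' != 0%N); last first.
rewrite /J !big1 ?addr0 ?subrr// => a' _; have := all0 a'=> /negbFE/eqP ->. by rewrite mul0r. by rewrite scale0r.
have E : n a' = 1%N /\ forall b, b != a' -> n b = 0%N. move: n1; rewrite /nt (bigD1 a')//= => n1.
have n1' : (0 < n a')%N by rewrite lt0n. have S0 : (\sum_(i | i != a') n i = 0)%N.
by apply/eqP; rewrite -leqn0 -(leq_add2l 1) (leq_trans _ n1)// leq_add2r.
split; first by apply/eqP; rewrite eqn_leq n1' andbT (leq_trans (leq_addr _ _) n1).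
move=>b ba; move/eqP: S0; rewrite sum_nat_eq0=> /forallP/(_ b). by rewrite ba=> /eqP. have [na1 nb0] := E.
rewrite /J (bigD1 a')//= [X in z + (_ + X)]big1; last by move=>b /nb0 ->; rewrite scale0r.
rewrite na1 scale1r addr0 (bigD1 a')//= big1; last by move=>b /nb0 ->; rewrite mul0r.
by rewrite na1 mul1r addr0 subrr. have n2 : (nt%:R : R) <= (nt * nt.-1)%:R.
by rewrite ler_nat leq_pmulr// -ltnS prednK// (leq_trans _ n1).
have n2' : (1 : R) <= nt%:R by rewrite ler1n (leq_trans _ n1).
apply: (@le_trans _ _ (4 * C * nt%:R)); last by apply: ler_wpM2l=> //; rewrite mulr_ge0.
rewrite (le_trans (ler_normB _ _))//. apply: (@le_trans _ _ (2 * C + 2 * C * nt%:R)); last first.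
by have := ler_wpM2l C0 n2'; lra. apply: lerD. by rewrite (le_trans (ler_normB _ _))// mulr_natl mulr2n lerD.
rewrite (le_trans (ler_norm_sum _ _ _))// /nt natr_sum mulr_sumr ler_sum// => a' _.
rewrite normrM ger0_norm// mulrC ler_wpM2r//. by rewrite (le_trans (ler_normB _ _))// mulr_natl mulr2n lerD. Qed.
(** Replaces v by its Gaussian part a in the quadratic form. The compensator part carries a factor h
    and ends up in a term of order [h ^+ 2]; the mixed terms are split with weight e. *)
Let R4 e : 0 < e -> `|2^-1 * (\sum_i \sum_k phi2 i k s z * (v ord0 i * v ord0 k)) -
  2^-1 * (\sum_i \sum_k phi2 i k s z * (wcoef i * wcoef k))| <= C * (e * n1 a ^+ 2 + (e^-1 + 1) * (h * n1 kap) ^+ 2).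
move=>e0. have b2 i k : `|phi2 i k s z| <= C by exact: (t_b2 T). have h0 : 0 <= h by case/andP: h01.
set x := n1 a; set y := h * n1 kap. have x0 : 0 <= x by exact: n1_ge0. have y0 : 0 <= y by rewrite mulr_ge0// n1_ge0.
rewrite -mulrBr -sumrB normrM ger0_norm ?invr_ge0//. apply: (@le_trans _ _ (2^-1 * (C * (2 * x * y + y ^+ 2)))).
apply: ler_wpM2l; first by rewrite invr_ge0. rewrite (le_trans (ler_norm_sum _ _ _))//.
apply: (@le_trans _ _ (\sum_i \sum_k C * (`|wcoef i| * (h * `|kcoef k|) + (h * `|kcoef i|) * `|wcoef k|
+ (h * `|kcoef i|) * (h * `|kcoef k|)))).
apply: ler_sum=> i _; rewrite -sumrB (le_trans (ler_norm_sum _ _ _))// ler_sum// => k _.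
rewrite -mulrBr normrM; apply: ler_pM=> //; rewrite !mxE.
have -> : (wcoef i - h * kcoef i) * (wcoef k - h * kcoef k) - wcoef i * wcoef k =
- (wcoef i * (h * kcoef k)) - (h * kcoef i) * wcoef k + (h * kcoef i) * (h * kcoef k) by ring.
rewrite (le_trans (ler_normD _ _))// !normrM (ger0_norm h0) lerD2r.
by rewrite (le_trans (ler_normB _ _))// normrN !normrM (ger0_norm h0). rewrite le_eqVlt; apply/orP; left; apply/eqP.
have xE : x = \sum_i `|wcoef i| by apply: eq_bigr=> i _; rewrite mxE. have yE : y = \sum_i h * `|kcoef i|.
by rewrite -mulr_sumr; congr (_ * _); apply: eq_bigr=> i _; rewrite mxE.
have -> : 2 * x * y + y ^+ 2 = x * y + y * x + y * y by ring.
rewrite xE yE !big_distrlr /= -!big_split mulr_sumr; apply: eq_bigr=> i _. by rewrite -!big_split mulr_sumr.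
have -> : C * (e * x ^+ 2 + (e^-1 + 1) * y ^+ 2) = 2^-1 * (C * (2 * (e * x ^+ 2 + (e^-1 + 1) * y ^+ 2))) by field; rewrite gt_eqF.
apply: ler_wpM2l; first by rewrite invr_ge0. apply: ler_wpM2l=> //. have H : 2 * x * y <= e * x ^+ 2 + e^-1 * y ^+ 2.
have := sqr_ge0 (e * x - y); have e1 : 0 < e^-1 by rewrite invr_gt0.
have E : e^-1 * (e * x - y) ^+ 2 = e * x ^+ 2 - 2 * x * y + e^-1 * y ^+ 2 by field; rewrite gt_eqF.
move=>S; have := mulr_ge0 (ltW e1) S; rewrite E; lra. have Hx := sqr_ge0 x; have Hy := sqr_ge0 y.
have : 0 <= e * x ^+ 2 by rewrite mulr_ge0// ltW. have : 0 <= e^-1 * y ^+ 2 by rewrite mulr_ge0// invr_ge0 ltW. lra.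
Qed.
Let R4' := R4.

(** The four parts are the interaction of v and J, the effect of several jumps, the second-order
    Taylor remainder of v alone, and the exchange of v for a in the quadratic form. *)
Lemma remainder_split : remainder = (phi s (z + v + J) - phi s (z + J) - (phi s (z + v) - phi s z))
  + (phi s (z + J) - phi s z - \sum_a (n a)%:R * (phi s (z + g a) - phi s z))
  + (phi s (z + v) - phi s z - \sum_j phi1 j s z * v ord0 j
  - 2^-1 * \sum_j \sum_k phi2 j k s z * (v ord0 j * v ord0 k))
  + (2^-1 * (\sum_i \sum_k phi2 i k s z * (v ord0 i * v ord0 k)) -
  2^-1 * (\sum_i \sum_k phi2 i k s z * (wcoef i * wcoef k))).
rewrite /remainder dYE addrA. have -> : \sum_j phi1 j s z * v ord0 j =
\sum_i phi1 i s z * wcoef i - h * (\sum_i phi1 i s z * kcoef i).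
by rewrite mulr_sumr -sumrB; apply: eq_bigr=> i _; rewrite !mxE; ring. ring. Qed.

(** Two groups of terms: e stands in front of quantities whose mean is of order h, the possibly
    large constant in front of quantities whose mean is of order [h ^+ 2]. *)
Lemma remainder_le (e A : R) : 0 < e -> 0 <= A -> (`|phi s (z + v) - phi s z - \sum_j phi1 j s z * v ord0 j
  - 2^-1 * \sum_j \sum_k phi2 j k s z * (v ord0 j * v ord0 k)| <= e * n1 v ^+ 2 + A * n1 v ^+ 4) ->
  `|remainder| <= e * (2 * C + 2 * (d%:R * M) ^+ 2 * d%:R + C * (d%:R * M) ^+ 2 * d%:R) * (W2 + nt%:R)
  + ((2 * C / e ^+ 3 + A) * 8 * ((d%:R * M) ^+ 4 * d%:R ^+ 3 + (d%:R * M ^+ 2) ^+ 4)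
  + 4 * C + (2 * e + C * (e^-1 + 1)) * (d%:R * M ^+ 2) ^+ 2) * (W4 + (nt * nt.-1)%:R + h ^+ 2).
move=>e0 A0 tay; set D := d%:R * M; have h0 : 0 <= h by case/andP: h01. have h1 : h <= 1 by case/andP: h01.
rewrite remainder_split; have r1 := R1 e0; have r2 := R2; have r4 := R4' e0.
set r1' := (X in `|X + _ + _ + _|); set r2' := (X in `|_ + X + _ + _|).
set r3' := (X in `|_ + X + _|); set r4' := (X in `|_ + _ + _ + X|).
apply: (@le_trans _ _ (`|r1'| + `|r2'| + `|r3'| + `|r4'|)).
rewrite (le_trans (ler_normD _ _))// lerD2r (le_trans (ler_normD _ _))// lerD2r. exact: ler_normD.
set x := n1 a in r4; set y := h * n1 kap in r4; set t := n1 v in r1 tay. have x0 : 0 <= x by exact: n1_ge0.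
have y0 : 0 <= y by rewrite mulr_ge0// n1_ge0. have t0 : 0 <= t by exact: n1_ge0. have txy : t <= x + y by exact: n1v.
have t2 : t ^+ 2 <= 2 * x ^+ 2 + 2 * y ^+ 2.
by apply: le_trans (sqrD_le _ _); apply: lerXn2r; rewrite ?nnegrE ?addr_ge0.
have t4 : t ^+ 4 <= 8 * x ^+ 4 + 8 * y ^+ 4.
by apply: le_trans (exprD4_le _ _); apply: lerXn2r; rewrite ?nnegrE ?addr_ge0.
have x2 : x ^+ 2 <= D ^+ 2 * d%:R * W2 by exact: n1a2. have x4 : x ^+ 4 <= D ^+ 4 * d%:R ^+ 3 * W4 by exact: n1a4.
set G := d%:R * M ^+ 2. have yG : y <= h * G by apply: ler_wpM2l=> //; exact: n1k.
have G0 : 0 <= G by apply: mulr_ge0=> //; exact: sqr_ge0. have y2 : y ^+ 2 <= G ^+ 2 * h ^+ 2.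
have hG0 : 0 <= h * G by exact: mulr_ge0. apply: (@le_trans _ _ ((h * G) ^+ 2)); first by apply: lerXn2r.
by rewrite exprMn mulrC. have y4 : y ^+ 4 <= G ^+ 4 * h ^+ 2. have hG0 : 0 <= h * G by exact: mulr_ge0.
apply: (@le_trans _ _ ((h * G) ^+ 4)); first by apply: lerXn2r.
rewrite exprMn mulrC ler_wpM2l ?exprn_ge0// (exprD h 2 2) ler_piMr ?sqr_ge0//. by rewrite expr_le1.
have W20 : 0 <= W2 by apply: sumr_ge0=> j _; exact: sqr_ge0.
have W40 : 0 <= W4 by apply: sumr_ge0=> j _; rewrite exprn_even_ge0.
have D20 : 0 <= D ^+ 2 * d%:R by apply: mulr_ge0=> //; exact: sqr_ge0.
have D40 : 0 <= D ^+ 4 * d%:R ^+ 3 by apply: mulr_ge0; [exact: exprn_even_ge0|exact: exprn_ge0].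
have G40 : 0 <= G ^+ 4 by exact: exprn_ge0. have G20 : 0 <= G ^+ 2 by exact: exprn_ge0.
have h20 : 0 <= h ^+ 2 by exact: sqr_ge0. have nt0 : 0 <= nt%:R :> R by []. have f0 : 0 <= (nt * nt.-1)%:R :> R by [].
have e3 : 0 <= (e ^+ 3)^-1 by rewrite invr_ge0 exprn_ge0 ?ltW. have ei : 0 <= e^-1 by rewrite invr_ge0 ltW.
have e0' := ltW e0; have CC := C0. rewrite -!(mulrA _ (D ^+ 2) d%:R).
(* From here on only the signs and the collected bounds of these quantities matter, so they are
   abstracted. *)
move: (D ^+ 2 * d%:R) (D ^+ 4 * d%:R ^+ 3) (G ^+ 4) (G ^+ 2) (h ^+ 2) (nt%:R : R) ((nt * nt.-1)%:R : R)
(e ^+ 3)^-1 e^-1 (`|r1'|) (`|r2'|) (`|r3'|) (`|r4'|) (t ^+ 2) (t ^+ 4) (x ^+ 2) (x ^+ 4) (y ^+ 2) (y ^+ 4)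
W2 W4 D20 D40 G40 G20 h20 nt0 f0 e3 ei r1 r2 tay r4 t2 t4 x2 x4 y2 y4 W20 W40. clear -CC e0' A0.
move=>D2 D4 G4 G2 h2 m f e3 ei q1 q2 q3 q4 t2 t4 x2 x4 y2 y4 w2 w4.
move=>D20 D40 G40 G20 h20 m0 f0 e30 ei0 B1 B2 B3 B4 Ht2 Ht4 Hx2 Hx4 Hy2 Hy4 w20 w40. have X2 : x2 <= D2 * (w2 + m).
by apply: (le_trans Hx2); rewrite ler_wpM2l// lerDl. have Y2 : y2 <= G2 * (w4 + f + h2).
by apply: (le_trans Hy2); rewrite ler_wpM2l// lerDr addr_ge0. have T4 : t4 <= 8 * (D4 + G4) * (w4 + f + h2).
have E1 : x4 <= D4 * (w4 + f + h2). by apply: (le_trans Hx4); rewrite ler_wpM2l// -addrA lerDl addr_ge0.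
have E2 : y4 <= G4 * (w4 + f + h2). by apply: (le_trans Hy4); rewrite ler_wpM2l// lerDr addr_ge0.
apply: (le_trans Ht4); rewrite -mulrDr -mulrA; apply: ler_wpM2l=> //. by rewrite mulrDl; apply: lerD.
have M1 : m <= w2 + m by rewrite lerDr. have F1 : f <= w4 + f + h2 by rewrite -addrA [leRHS]addrCA lerDl addr_ge0.
move: (w2 + m) (w4 + f + h2) X2 Y2 T4 M1 F1=> u v X2 Y2 T4 M1 F1.
have E1 : q1 <= 2 * C * (e * u) + 2 * C * e3 * (8 * (D4 + G4) * v). apply: (le_trans B1); rewrite mulrDr; apply: lerD.
by apply: ler_wpM2l; [exact: mulr_ge0|exact: ler_wpM2l]. have -> : 2 * C * (t4 * e3) = 2 * C * e3 * t4 by ring.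
by apply: ler_wpM2l=> //; apply: mulr_ge0=> //; apply: mulr_ge0.
have E2 : q2 <= 4 * C * v by apply: (le_trans B2); apply: ler_wpM2l=> //; exact: mulr_ge0.
have E3 : q3 <= e * (2 * (D2 * u) + 2 * (G2 * v)) + A * (8 * (D4 + G4) * v).
apply: (le_trans B3); apply: lerD; apply: ler_wpM2l=> //. by apply: (le_trans Ht2); apply: lerD; apply: ler_wpM2l.
have E4 : q4 <= C * (e * (D2 * u) + (ei + 1) * (G2 * v)).
apply: (le_trans B4); apply: ler_wpM2l=> //; apply: lerD; apply: ler_wpM2l=> //. by rewrite addr_ge0.
apply: (le_trans (lerD (lerD (lerD E1 E2) E3) E4)). by rewrite le_eqVlt; apply/orP; left; apply/eqP; ring. Qed.

End Path.

(** eps and A are fixed before the step, the point, the coefficients and the increments, all of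
    which will be random or vary with the grid. *)
Definition remainder_small (eps A : R) := forall (s h : R) z (w : 'I_d -> R) sg (g : I -> 'rV[R]_d) (mu : I -> R) n, p <= s <= q -> 0 <= h <= 1 ->
  (forall i j, `|sg i j| <= M) -> (forall a i, `|g a ord0 i| <= M) -> (forall a, 0 <= mu a) -> \sum_a mu a <= M ->
  `|remainder s h z w sg g mu n| <= eps * (\sum_j w j ^+ 2 + (\sum_a n a)%N%:R)
  + A * (\sum_j w j ^+ 4 + ((\sum_a n a) * (\sum_a n a).-1)%N%:R + h ^+ 2).

Lemma remainder_bound (pq : p <= q) (M0 : 0 <= M) (eps : R) : 0 < eps -> exists2 A, 0 <= A & remainder_small eps A.
(* L contains the coefficient of e in [remainder_le]; the added 1 makes it positive. *)
move=>eps0; pose L : R := 1 + (2 * C + 2 * (d%:R * M) ^+ 2 * d%:R + C * (d%:R * M) ^+ 2 * d%:R).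
have C0 : 0 <= C by exact: (test_C_ge0 T). have L1 : 1 <= L. by rewrite lerDl !addr_ge0 ?mulr_ge0 ?sqr_ge0.
have L0 : 0 < L by apply: lt_le_trans L1. have e0 : 0 < eps / L by rewrite divr_gt0.
have [A A0 HA] := test_taylor T e0; set e := eps / L in e0 HA. eexists; last first.
move=>s h z w sg g mu n spq h01 sgM gM mu0 muM. have RB := remainder_le n spq h01 sgM gM mu0 muM e0 A0 (HA _ _ _ spq).
apply: (le_trans (RB z w)). apply: lerD=> //; apply: ler_wpM2r.
by apply: addr_ge0=> //; apply: sumr_ge0=> j _; exact: sqr_ge0.
rewrite -[leRHS](@divfK _ L) ?gt_eqF// -/e; apply: ler_wpM2l; first exact: ltW. by rewrite /L lerDr.
have e0' := ltW e0. have e3 : 0 <= 2 * C / e ^+ 3. by apply: divr_ge0; [exact: mulr_ge0|exact: exprn_ge0].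
have ei : 0 <= e^-1 by rewrite invr_ge0. have p4 (x : R) : 0 <= x ^+ 4 by rewrite exprn_even_ge0.
have g0 : 0 <= (d%:R * M) ^+ 4 * d%:R ^+ 3 + (d%:R * M ^+ 2) ^+ 4.
by apply: addr_ge0=> //; apply: mulr_ge0=> //; exact: exprn_ge0. apply: addr_ge0; first apply: addr_ge0.
- by apply: mulr_ge0=> //; apply: mulr_ge0=> //; exact: addr_ge0.
- exact: mulr_ge0. apply: mulr_ge0; last exact: sqr_ge0. by apply: addr_ge0; apply: mulr_ge0=> //; exact: addr_ge0.
Qed.
End OneStepPath.

(** * The mean of one noise increment *)

Section OneStepMean.
Context {R : realType} {dO : measure_display} {Om : measurableType dO} (P : probability Om R) {d : nat} {I : finType}.

(** All that is used of the noise over a step of length h. The factorial moment concerns the total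
    count, so that it also covers two jumps with different marks. *)
Record increments (G : set (set Om)) (h : R) (w : 'I_d -> Om -> R) (n : I -> Om -> nat)
    (mu : I -> R) : Prop := Increments {
  inc_w : forall j, cmean P G (w j) 0;
  inc_ww : forall j l, cmean P G (fun x=> w j x * w l x) (h * (j == l)%:R);
  inc_w4 : forall j, itgT P (fun x=> w j x ^+ 4) /\ \int[P]_x (w j x ^+ 4) <= 3 * h ^+ 2;
  inc_n : forall a, cmean P G (fun x=> (n a x)%:R) (h * mu a);
  inc_n2 : itgT P (fun x=> ((\sum_a n a x) * (\sum_a n a x).-1)%N%:R : R) /\
    \int[P]_x ((\sum_a n a x) * (\sum_a n a x).-1)%N%:R <= (h * \sum_a mu a) ^+ 2 }.

Lemma measurable_itg (f : Om -> R) : itgT P f -> meas f.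
by move=> /integrableP[/measEFin]. Qed.

Lemma cmean0 (G : set (set Om)) (sG : sigma_algebra setT G) (Gm : G `<=` measurable)
  (Y xi : Om -> R) (m C : R) : cmean P G Y m -> meas (xi : subalg G -> R) -> (forall w, `|xi w| <= C) ->
  itgT P (fun w=> xi w * (Y w - m)) /\ \int[P]_w (xi w * (Y w - m)) = 0.
move=>cm mxi xiC; have mx := measurable_of_subalg sG Gm mxi.
have iY : itgT P (fun w=> xi w * Y w) by apply: (itg_bounded mx xiC); exact: cm.1.
have ix : itgT P (fun w=> xi w * m). apply: (itg_bounded mx xiC); apply: (@P_itg_bounded _ _ _ _ _ `|m|)=> //.
have E : (fun w=> xi w * (Y w - m)) = (fun w=> xi w * Y w - xi w * m). by apply/funext=> w; rewrite mulrBr.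
rewrite E; split; first exact: itgB. rewrite RintegralB// (cm.2 _ _ mxi xiC) RintegralZr ?[m * _]mulrC ?subrr//.
exact: (P_itg_bounded _ mx xiC). Qed.

Lemma cmean_mean (G : set (set Om)) (Y : Om -> R) (m : R) : cmean P G Y m -> \int[P]_x Y x = m.
move=> [_ /(_ (fun=> 1) 1 (measurable_cst _))]. under eq_Rintegral do rewrite mul1r.
move=> ->; last by move=> ?; rewrite normr1.
by rewrite Rintegral_cst// [X in fine X](_ : _ = 1%E) ?mulr1//; exact: probability_setT. Qed.

Context (p q : R) (phi phit : sfun R d) (phi1 : 'I_d -> sfun R d) (phi2 : 'I_d -> 'I_d -> sfun R d) (C : R) (T : test
  p q phi phit phi1 phi2 C).

(** The generator with frozen coefficients, for a jump measure consisting of the masses [mu a] at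
    the points [g a]. *)
Definition gen (s : R) (z : 'rV[R]_d) (sg : 'I_d -> 'I_d -> R) (g : I -> 'rV[R]_d) (mu : I -> R) :=
  2^-1 * (\sum_i \sum_k phi2 i k s z * (\sum_j sg i j * sg k j))
  + \sum_a mu a * (phi s (z + g a) - phi s z - \sum_i phi1 i s z * g a ord0 i).

(** The last bracket consists of coefficients known at the start of the step times centred
    variables; [w j - 0] is written to match [cmean0]. *)
Lemma martingale_part s h z (w : 'I_d -> R) sg (g : I -> 'rV[R]_d) mu (n : I -> nat) :
  phi s (z + dY h w sg g mu n) - phi s z = remainder phi phi1 phi2 s h z w sg g mu n + h * gen s z sg g mu
  + (\sum_i \sum_j phi1 i s z * sg i j * (w j - 0)
  + \sum_i \sum_k \sum_j \sum_l 2^-1 * phi2 i k s z * (sg i j * sg k l) * (w j * w l - h * (j == l)%:R)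
  + \sum_a (phi s (z + g a) - phi s z) * ((n a)%:R - h * mu a)).
rewrite /remainder /gen.
have E1 : \sum_i phi1 i s z * wcoef w sg i = \sum_i \sum_j phi1 i s z * sg i j * (w j - 0).
apply: eq_bigr=> i _; rewrite mulr_sumr; apply: eq_bigr=> j _; ring.
have E2 : 2^-1 * (\sum_i \sum_k phi2 i k s z * (wcoef w sg i * wcoef w sg k)) -
h * (2^-1 * (\sum_i \sum_k phi2 i k s z * (\sum_j sg i j * sg k j))) =
\sum_i \sum_k \sum_j \sum_l 2^-1 * phi2 i k s z * (sg i j * sg k l) * (w j * w l - h * (j == l)%:R).
have D (x : 'I_d -> R) (j : 'I_d) : \sum_l x l * (h * (j == l)%:R) = h * x j.
rewrite (bigD1 j)//= eqxx big1 ?addr0 ?mulr1 1?mulrC// => l /negbTE lj. by rewrite eq_sym lj !mulr0.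
rewrite !mulr_sumr -sumrB; apply: eq_bigr=> i _; rewrite !mulr_sumr -sumrB; apply: eq_bigr=> k _.
rewrite /wcoef big_distrlr /= !mulr_sumr -sumrB; apply: eq_bigr=> j _. under [RHS]eq_bigr do rewrite mulrBr.
rewrite sumrB D !mulr_sumr; congr (_ - _); last by ring. by apply: eq_bigr=> l _; ring.
have E3 : \sum_a (n a)%:R * (phi s (z + g a) - phi s z) + h * (\sum_a mu a * (- \sum_i phi1 i s z * g a ord0 i)) =
h * (\sum_a mu a * (phi s (z + g a) - phi s z - \sum_i phi1 i s z * g a ord0 i))
+ \sum_a (phi s (z + g a) - phi s z) * ((n a)%:R - h * mu a).
by rewrite !mulr_sumr -!big_split/=; apply: eq_bigr=> a _; ring.
have E4 : h * (\sum_i phi1 i s z * kcoef g mu i) = - (h * (\sum_a mu a * (- \sum_i phi1 i s z * g a ord0 i))).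
rewrite -mulrN; congr (_ * _); rewrite -sumrN. under [RHS]eq_bigr do rewrite mulrN opprK mulr_sumr.
rewrite exchange_big /=; apply: eq_bigr=> i _; rewrite mulr_sumr; apply: eq_bigr=> a _; ring.
rewrite mulrDr -E1 -E2; move: E3 E4.
set x1 := \sum_i _ * wcoef _ _ _; set x2 := \sum_i \sum_k _; set x3 := \sum_a _; set x4 := h * _.
set x5 := h * _; set x6 := \sum_a _; set x7 := h * _; set x8 := h * _=> E3 E4.
rewrite E4; move: E3; clear; move=>E3; lra. Qed.

Section Mean.
Context (G : set (set Om)) (s h M B : R) (K : Om -> R) (z : Om -> 'rV[R]_d) (sg : 'I_d -> 'I_d -> Om -> R) (g : I ->
  Om -> 'rV[R]_d) (mu : I -> R) (w : 'I_d -> Om -> R) (n : I -> Om -> nat) (spq : p <= s <= q) (h01 : 0 <= h <= 1) (sG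
  : sigma_algebra setT G) (Gm : G `<=` measurable) (inc : increments G h w n mu) (mK : meas (K : subalg G -> R)) (K01
  : forall x, 0 <= K x <= 1) (mz : meas (z : subalg G -> borelRd R d)) (msg : forall i j, meas (sg i j : subalg G ->
  R)) (mg : forall a i, meas ((fun x=> g a x ord0 i) : subalg G -> R)) (sgM : forall i j x, `|sg i j x| <= M) (gM :
  forall a i x, `|g a x ord0 i| <= M) (mu0 : forall a, 0 <= mu a) (muM : \sum_a mu a <= M).

Definition incr x := dY h (w ^~ x) (fun i j=> sg i j x) (g ^~ x) mu (n ^~ x).

Definition cgen x := gen s (z x) (fun i j=> sg i j x) (g ^~ x) mu.

Let mcomp (f : 'rV[R]_d -> R) (y : Om -> 'rV[R]_d) : continuous f -> meas (y : subalg G -> borelRd R d) ->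
  meas ((fun x=> f (y x)) : subalg G -> R).
by move=>cf my; apply: (meas_comp (borelRd_continuous cf) my). Qed.
Let phic : continuous (phi s). Proof. exact: unif_cont_x spq (t_u0 T). Qed.
Let phi1c i : continuous (phi1 i s). Proof. exact: unif_cont_x spq (t_u1 T i). Qed.
Let phi2c i k : continuous (phi2 i k s). Proof. exact: unif_cont_x spq (t_u2 T i k). Qed.
Let mzc j : meas ((fun x=> z x ord0 j) : subalg G -> R).
exact: meas_comp (borelRd_coord j) mz. Qed.
Let mzg a : meas ((fun x=> z x + g a x) : subalg G -> borelRd R d).
apply: borelRd_measurable=> j. under eq_fun do rewrite mxE. by apply: measD; [exact: mzc|exact: mg]. Qed.
Let K1 x : `|K x| <= 1. Proof. by have /andP[k0 k1] := K01 x; rewrite ger0_norm. Qed.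
Let C0 : 0 <= C. Proof. by apply: (test_C_ge0 T); case/andP: spq=> A E; exact: le_trans E. Qed.
Let M0 (i : 'I_d) : Om -> 0 <= M. Proof. move=>x; exact: le_trans (sgM i i x). Qed.

Definition mart x := \sum_i \sum_j (K x * (phi1 i s (z x) * sg i j x)) * (w j x - 0)
  + \sum_i \sum_k \sum_j \sum_l (K x * (2^-1 * phi2 i k s (z x) * (sg i j x * sg k l x)))
  * (w j x * w l x - h * (j == l)%:R) + \sum_a (K x * (phi s (z x + g a x) - phi s (z x))) * ((n a x)%:R - h * mu a).

Lemma mart_mean0 : itgT P mart /\ \int[P]_x mart x = 0.
have b1 i j x : `|K x * (phi1 i s (z x) * sg i j x)| <= 1 * (C * M).
by rewrite !normrM; apply: ler_pM=> //; apply: ler_pM=> //; exact: (t_b1 T).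
have b2 i k j l x : `|K x * (2^-1 * phi2 i k s (z x) * (sg i j x * sg k l x))| <= 1 * (2^-1 * C * (M * M)).
rewrite normrM; apply: ler_pM=> //; rewrite normrM; apply: ler_pM=> //.
by rewrite normrM ger0_norm ?invr_ge0//; apply: ler_wpM2l; [rewrite invr_ge0|exact: (t_b2 T)].
by rewrite normrM; apply: ler_pM. have b3 a x : `|K x * (phi s (z x + g a x) - phi s (z x))| <= 1 * (C + C).
rewrite normrM; apply: ler_pM=> //; apply: (le_trans (ler_normB _ _)). by apply: lerD; exact: (t_b0 T).
have m1 i j : meas ((fun x=> K x * (phi1 i s (z x) * sg i j x)) : subalg G -> R).
by apply: measM=> //; apply: measM=> //; exact: mcomp. have m2 i k j l : meas
((fun x=> K x * (2^-1 * phi2 i k s (z x) * (sg i j x * sg k l x))) : subalg G -> R).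
apply: measM=> //; apply: measM; last exact: measM. by apply: measM=> //; exact: mcomp.
have m3 a : meas ((fun x=> K x * (phi s (z x + g a x) - phi s (z x))) : subalg G -> R).
by apply: measM=> //; apply: measB; exact: mcomp. have c1 i j := cmean0 sG Gm (inc_w inc j) (m1 i j) (b1 i j).
have c2 i k j l := cmean0 sG Gm (inc_ww inc j l) (m2 i k j l) (b2 i k j l).
have c3 a := cmean0 sG Gm (inc_n inc a) (m3 a) (b3 a).
have i1 : itgT P (fun x=> \sum_i \sum_j (K x * (phi1 i s (z x) * sg i j x)) * (w j x - 0)).
by do 2 (apply: itg_sum=> // ? _); exact: (c1 _ _).1.
have i2 : itgT P (fun x=> \sum_i \sum_k \sum_j \sum_l (K x * (2^-1 * phi2 i k s (z x) * (sg i j x * sg k l x)))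
* (w j x * w l x - h * (j == l)%:R)). by do 4 (apply: itg_sum=> // ? _); exact: (c2 _ _ _ _).1.
have i3 : itgT P (fun x=> \sum_a (K x * (phi s (z x + g a x) - phi s (z x))) * ((n a x)%:R - h * mu a)).
by apply: itg_sum=> // ? _; exact: (c3 _).1. split; first by apply: itgD=> //; apply: itgD.
rewrite /mart RintegralD//; last exact: itgD. rewrite RintegralD// !Rint_sum//; last 3 first.
- by move=> ? _; exact: (c3 _).1.
- by move=> ? _; do 3 (apply: itg_sum=> // ? _); exact: (c2 _ _ _ _).1.
- by move=> ? _; apply: itg_sum=> // ? _; exact: (c1 _ _).1. rewrite big1; last first.
move=>i _; rewrite Rint_sum//; last by move=> ? _; exact: (c1 _ _).1. by rewrite big1// => j _; exact: (c1 _ _).2.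
rewrite big1; last first.
move=>i _; rewrite Rint_sum//; last by move=> ? _; do 2 (apply: itg_sum=> // ? _); exact: (c2 _ _ _ _).1.
rewrite big1// => k _. rewrite Rint_sum//; last by move=> ? _; do 1 (apply: itg_sum=> // ? _); exact: (c2 _ _ _ _).1.
rewrite big1// => j _. rewrite Rint_sum//; last by move=> ? _; exact: (c2 _ _ _ _).1.
by rewrite big1// => l _; exact: (c2 _ _ _ _).2. by rewrite big1 ?addr0// => a _; exact: (c3 _).2. Qed.

Lemma cgen_measurable : meas (cgen : subalg G -> R).
apply: measD. apply: measM=> //; apply: meas_sum=> i; apply: meas_sum=> k. apply: measM; first exact: mcomp.
by apply: meas_sum=> j; apply: measM. apply: meas_sum=> a; apply: measM=> //; apply: measB.
by apply: measB; exact: mcomp. by apply: meas_sum=> i; apply: measM=> //; exact: mcomp. Qed.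

Lemma cgen_bound x : 0 <= M -> `|cgen x| <= 2^-1 * (d%:R * (d%:R * (C * (d%:R * (M * M))))) + M * (C + C + d%:R * (C * M)).
move=>M0'; have bd (F : 'I_d -> R) c : (forall i, `|F i| <= c) -> `|\sum_i F i| <= d%:R * c.
by move=>Fc; apply: (le_trans (ler_norm_sum _ _ _)); exact: sum_le_const.
apply: (le_trans (ler_normD _ _)); apply: lerD.
rewrite normrM ger0_norm ?invr_ge0//; apply: ler_wpM2l; first by rewrite invr_ge0.
apply: (bd)=> i; apply: (bd)=> k; rewrite normrM; apply: ler_pM=> //; first exact: (t_b2 T).
by apply: (bd)=> j; rewrite normrM; apply: ler_pM.
apply: (@le_trans _ _ (\sum_a mu a * (C + C + d%:R * (C * M)))); last first.
rewrite -mulr_suml; apply: ler_wpM2r=> //; by apply: addr_ge0; [exact: addr_ge0|apply: mulr_ge0=> //; exact: mulr_ge0].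
apply: (le_trans (ler_norm_sum _ _ _)); apply: ler_sum=> a _.
rewrite normrM ger0_norm//; apply: ler_wpM2l=> //; apply: (le_trans (ler_normB _ _)); apply: lerD.
by apply: (le_trans (ler_normB _ _)); apply: lerD; exact: (t_b0 T).
by apply: (bd)=> i; rewrite normrM; apply: ler_pM=> //; exact: (t_b1 T). Qed.
Let mincr : meas ((fun x=> z x + incr x) : Om -> borelRd R d).
apply: borelRd_measurable=> i; under eq_fun do rewrite !mxE.
have mm (f : Om -> R) : meas (f : subalg G -> R) -> meas f. exact: measurable_of_subalg.
apply: measD; first exact: mm (mzc i). apply: measD. apply: meas_sum=> j; apply: measM; first exact: mm (msg i j).
exact: measurable_itg (inc_w inc j).1. apply: meas_sum=> a; apply: measM; first exact: mm (mg a i).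
apply: measB=> //; exact: measurable_itg (inc_n inc a).1. Qed.

(** By [mart_mean0] only the remainder is left, and the constants are means of its two groups:
    [d * h] and at most [M * h] for squares and counts; [3 * d], [M ^+ 2] and 1 times [h ^+ 2] for
    the fourth powers, the factorial moment and [h ^+ 2] itself. *)
Lemma one_step (eps A : R) : 0 <= eps -> 0 <= A -> 0 <= M -> remainder_small (I := I) p q phi phi1 phi2 M eps A ->
  `|\int[P]_x (K x * (phi s (z x + incr x) - phi s (z x))) - h * \int[P]_x (K x * cgen x)|
  <= eps * ((d%:R + M) * h) + A * ((3 * d%:R + M ^+ 2 + 1) * h ^+ 2).
move=>eps0 A0 M0' RB. have mm (f : Om -> R) : meas (f : subalg G -> R) -> meas f. exact: measurable_of_subalg.
have h0 : 0 <= h by case/andP: h01.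
pose rem x := remainder phi phi1 phi2 s h (z x) (w ^~ x) (fun i j=> sg i j x) (g ^~ x) mu (n ^~ x).
pose bnd x := eps * (\sum_j w j x ^+ 2 + (\sum_a n a x)%N%:R)
+ A * (\sum_j w j x ^+ 4 + ((\sum_a n a x) * (\sum_a n a x).-1)%N%:R + h ^+ 2).
have mD : meas (fun x=> K x * (phi s (z x + incr x) - phi s (z x))). apply: measM; first exact: mm.
apply: measB; last exact: mm (mcomp phic mz). exact: (meas_comp (borelRd_continuous phic) mincr).
have iD : itgT P (fun x=> K x * (phi s (z x + incr x) - phi s (z x))).
apply: (@P_itg_bounded _ _ _ _ _ (1 * (C + C)))=> // x; rewrite normrM; apply: ler_pM=> //.
by apply: (le_trans (ler_normB _ _)); apply: lerD; exact: (t_b0 T). have iL : itgT P (fun x=> K x * cgen x).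
apply: (itg_bounded (C := 1))=> //; first exact: mm.
by apply: (P_itg_bounded _ (mm _ cgen_measurable) (cgen_bound ^~ M0')). have [iM eM] := mart_mean0.
have E x : K x * rem x = K x * (phi s (z x + incr x) - phi s (z x)) - h * (K x * cgen x) - mart x.
pose s1 := \sum_i \sum_j phi1 i s (z x) * sg i j x * (w j x - 0).
pose s2 := \sum_i \sum_k \sum_j \sum_l 2^-1 * phi2 i k s (z x) * (sg i j x * sg k l x)
* (w j x * w l x - h * (j == l)%:R). pose s3 := \sum_a (phi s (z x + g a x) - phi s (z x)) * ((n a x)%:R - h * mu a).
have -> : mart x = K x * (s1 + s2 + s3). rewrite /s1 /s2 /s3 !mulrDr; congr (_ + _ + _).
- by rewrite [RHS]mulr_sumr; apply: eq_bigr=> i _; rewrite [RHS]mulr_sumr; apply: eq_bigr=> j _; rewrite -mulrA.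
- by do 4 (rewrite [RHS]mulr_sumr; apply: eq_bigr=> ? _); rewrite -mulrA.
- by rewrite [RHS]mulr_sumr; apply: eq_bigr=> a _; rewrite -mulrA.
rewrite /incr martingale_part -/(rem x) -/(cgen x) -/s1 -/s2 -/s3.
move: (rem x) (cgen x) (K x) s1 s2 s3=> r1 r2 r3 r4 r5 r6; ring. have iR : itgT P (fun x=> K x * rem x).
have -> : (fun x=> K x * rem x) = (fun x=> K x * (phi s (z x + incr x) - phi s (z x)) - h * (K x * cgen x) - mart x).
exact/funext. by apply: itgB=> //; apply: itgB=> //; exact: itgZ.
have <- : \int[P]_x (K x * rem x) = \int[P]_x (K x * (phi s (z x + incr x) - phi s (z x))) - h * \int[P]_x (K x * cgen x).
under eq_Rintegral do rewrite E. rewrite RintegralB//; last by apply: itgB=> //; exact: itgZ.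
rewrite RintegralB//; last exact: itgZ. by rewrite eM subr0 RintegralZl.
have iw2 : itgT P (fun x=> \sum_j w j x ^+ 2).
by apply: itg_sum=> // j _; have [] := inc_ww inc j j; under eq_fun do rewrite -expr2.
have in1 : itgT P (fun x=> (\sum_a n a x)%N%:R : R). under eq_fun do rewrite natr_sum.
by apply: itg_sum=> // a _; exact: (inc_n inc a).1. have iw4 : itgT P (fun x=> \sum_j w j x ^+ 4).
by apply: itg_sum=> // j _; exact: (inc_w4 inc j).1. have in2 := (inc_n2 inc).1.
have ih : itgT P (fun=> h ^+ 2) by apply: (@P_itg_bounded _ _ _ _ _ `|h ^+ 2|). have iB : itgT P bnd.
by apply: itgD=> //; apply: itgZ=> //; [apply: itgD|apply: itgD=> //; apply: itgD].
apply: (le_trans (le_norm_Rint _ (measurable_itg iR) (g := bnd) _ iB))=> //.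
move=>x _; rewrite normrM -[leRHS]mul1r; apply: ler_pM=> //. exact: RB. rewrite /bnd RintegralD//; last 2 first.
- by apply: itgZ=> //; apply: itgD.
- by apply: itgZ=> //; apply: itgD=> //; apply: itgD. rewrite RintegralZl//; last exact: itgD.
rewrite RintegralZl//; last by apply: itgD=> //; apply: itgD. apply: lerD; apply: ler_wpM2l=> //.
rewrite RintegralD// mulrDl; apply: lerD.
rewrite Rint_sum//; last by move=>j _; have [] := inc_ww inc j j; under eq_fun do rewrite -expr2.
apply: sum_le_const=> j; under eq_Rintegral do rewrite expr2. by rewrite (cmean_mean (inc_ww inc j j)) eqxx mulr1.
under eq_Rintegral do rewrite natr_sum. rewrite Rint_sum//; last by move=>a _; exact: (inc_n inc a).1.
under eq_bigr do rewrite (cmean_mean (inc_n inc _)). by rewrite -mulr_sumr mulrC; apply: ler_wpM2r.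
rewrite RintegralD//; last exact: itgD.
rewrite RintegralD// (mulrDl _ 1) (mulrDl _ (M ^+ 2)); apply: lerD; first apply: lerD.
- rewrite Rint_sum//; last by move=>j _; exact: (inc_w4 inc j).1.
rewrite -mulrA mulrCA; apply: sum_le_const=> j; exact: (inc_w4 inc j).2.
- apply: (le_trans (inc_n2 inc).2); rewrite exprMn mulrC; apply: ler_wpM2r; first exact: sqr_ge0.
by apply: lerXn2r=> //; rewrite nnegrE sumr_ge0.
- by rewrite Rintegral_cst// [X in _ * fine X](_ : _ = 1%E) ?mulr1 ?mul1r//; exact: probability_setT. Qed.

End Mean.
End OneStepMean.

(** * Increments of the Brownian motion and of the Poisson random measure *)

Section ProductLaw.
Context {R : realType} {dO : measure_display} {Om : measurableType dO} (P : probability Om R) (G : set (set Om)) (Gm : G `<=`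
  measurable).

(** For fixed A both sides are finite measures in B that agree on rectangles, the right one being
    the product of mu2 with mu1 scaled by [P A]. *)
Lemma pair_law {d1 d2} {T1 : measurableType d1} {T2 : measurableType d2}
  (mu1 : probability T1 R) (mu2 : probability T2 R) (Z1 : Om -> T1) (Z2 : Om -> T2) : meas Z1 -> meas Z2 ->
  (forall A B1 B2, G A -> measurable B1 -> measurable B2 ->
  P (A `&` (Z1 @^-1` B1 `&` Z2 @^-1` B2)) = (P A * (mu1 B1 * mu2 B2))%E) -> forall A B, G A -> measurable B ->
  P (A `&` (fun w=> (Z1 w, Z2 w)) @^-1` B) = (P A * (mu1 \x mu2) B)%E.
move=>m1 m2 H A B GA mB; have mA := Gm GA. pose Z w := (Z1 w, Z2 w).
have mZ : meas Z by exact/measurable_fun_pair. pose Zm : {mfun Om >-> (T1 * T2)%type} := mfun_Sub (mem_set mZ).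
have PA0 : (0 <= fine (P A))%R by exact/fine_ge0/measure_ge0.
have PAE : P A = (fine (P A))%:E by rewrite fineK// fin_num_measure.
have := @product_measure_unique _ _ _ _ R (mscale (NngNum PA0) mu1) mu2 (pushforward (mrestr P mA) Zm) _ B mB.
have mZm : meas Zm by []. move=> /(_ mZm) H'; have : (mscale (NngNum PA0) mu1 \x mu2)%E B = P (A `&` Z @^-1` B).
rewrite setIC; apply: H'=> B1 B2 mB1 mB2.
rewrite [X in (X * _)%E](_ : _ = (P A * mu1 B1)%E); last by congr (_ * _)%E; exact: (esym PAE).
by rewrite -muleA -H// setIC.
rewrite /Z=> <-; rewrite /product_measure1 ge0_integral_mscale//; first by congr (_ * _)%E; exact: (esym PAE).
exact: measurable_fun_xsection. Qed.

End ProductLaw.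

Section BrownianIncrements.
Context {R : realType} {dO : measure_display} {Om : measurableType dO} (P : probability Om R) (F : R -> set (set Om)) (d : nat) (W : R
  -> Om -> 'rV[R]_d) (uF : usual_filtration P F) (BW : brownian_motion P F W) (s t : R) (s0 : 0 <= s) (st : s < t).

Definition bm_incr j w := W t w ord0 j - W s w ord0 j.

Let sF (r : R) : 0 <= r -> sigma_algebra setT (F r). Proof. by move=> /(uF.1 r)[]. Qed.
Let Fm (r : R) : 0 <= r -> F r `<=` measurable. Proof. by move=> /(uF.1 r)[]. Qed.
Let t0 : 0 <= t. Proof. exact: le_trans s0 (ltW st). Qed.

Lemma filtration_measurable {d'} {T : measurableType d'} r (Y : Om -> T) : 0 <= r -> meas_wrt (F r) Y -> meas Y.
move=>r0 /meas_wrt_subalg; move/(_ (sF r0)). by move=>mY; exact: (measurable_of_subalg (sF r0) (Fm r0) mY).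
Qed.

Lemma bm_incr_measurable j : meas (bm_incr j).
have m r : 0 <= r -> meas (fun w=> W r w ord0 j). move=>r0; apply: (meas_comp (borelRd_coord j)).
exact: filtration_measurable r0 (BW.1 r r0). by apply: measB; exact: m. Qed.
Let N : probability _ R := normal_prob 0 (Num.sqrt (t - s)).
Let ts : 0 < t - s. Proof. by rewrite subr_gt0. Qed.
Let law1 j A B : F s A -> measurable B -> P (A `&` bm_incr j @^-1` B) = (P A * N B)%E.
move=>FA mB; have [_ [_ [_ /(_ s t A (fun i=> if i == j then B else setT))]]] := BW.
rewrite (bigD1 j)//= eqxx big1 ?mule1; last first. by move=>i /negbTE ->; exact: probability_setT.
move=> <- //; last by move=>i; case: ifP. congr (P (_ `&` _)); apply/seteqP; split=> w /=.
by move=>Bw i; case: eqVneq=> // ->. by move/(_ j); rewrite eqxx. Qed.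
Let law2 j l A B1 B2 : j != l -> F s A -> measurable B1 -> measurable B2 ->
  P (A `&` (bm_incr j @^-1` B1 `&` bm_incr l @^-1` B2)) = (P A * (N B1 * N B2))%E.
move=>jl FA mB1 mB2.
have [_ [_ [_ /(_ s t A (fun i=> if i == j then B1 else if i == l then B2 else setT))]]] := BW.
rewrite (bigD1 j)//= eqxx (bigD1 l)//=; last by rewrite eq_sym.
rewrite eq_sym (negbTE jl) eqxx big1 ?mule1; last first.
by move=>i /andP[/negbTE -> /negbTE ->]; exact: probability_setT.
move=> <- //; last by move=>i; case: ifP=> // _; case: ifP. congr (P (_ `&` _)); apply/seteqP; split=> w /=.
by move=> [Bj Bl] i; case: eqVneq=> [->//|_]; case: eqVneq=> // ->.
by move=>H; split; [have := H j; rewrite eqxx|have := H l; rewrite eq_sym (negbTE jl) eqxx]. Qed.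
Let G0 := gaussian_moments ts.

Let law_mean j (f : R -> R) : meas f -> itgT N f -> cmean P (F s) (fun w=> f (bm_incr j w)) (\int[N]_x f x).
move=>mf fi; apply: (@cmean_law _ _ _ P _ (sF s0) (Fm s0) _ (mR R)
(bm_incr j) N f (bm_incr_measurable j) mf fi)=> A B. exact: law1. Qed.

Lemma bm_incr_mean j : cmean P (F s) (bm_incr j) 0.
by have [[i0 e0] _ _] := G0; rewrite -[X in cmean _ _ _ X]e0; apply: law_mean. Qed.

Lemma bm_incr_sqr j : cmean P (F s) (fun w=> bm_incr j w ^+ 2) (t - s).
have [_ [i0 e0] _] := G0; rewrite -[X in cmean _ _ _ X]e0. exact: (law_mean j (f := fun x=> x ^+ 2)). Qed.

Lemma bm_incr_pow4 j : cmean P (F s) (fun w=> bm_incr j w ^+ 4) (3 * (t - s) ^+ 2).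
have [_ _ [i0 e0]] := G0; rewrite -[X in cmean _ _ _ X]e0. exact: (law_mean j (f := fun x=> x ^+ 4)). Qed.

(** The pair of coordinates has the product of two centred laws, and by Fubini the mean of the
    product is zero. *)
Lemma bm_incr_cross j l : j != l -> cmean P (F s) (fun w=> bm_incr j w * bm_incr l w) 0.
move=>jl; have [[i1 e1] [i2 e2] _] := G0. have mxy : meas (fun z : mR R * mR R=> z.1 * z.2). exact: measM.
have i1a : (\int[N]_x `|x%:E| < +oo)%E by have /integrableP[_] := i1.
have ixy : itg (N \x N)%E setT (fun z : mR R * mR R=> z.1 * z.2). apply/integrable12ltyP; first exact/measEFin.
have E x : (\int[N]_y `|(EFin \o (fun z : mR R * mR R=> (z.1 * z.2)%R)) (x, y)| = `|x%:E| * \int[N]_y `|y%:E|)%E.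
under eq_integral do rewrite /= normrM EFinM. rewrite ge0_integralZl//; exact/measEFin.
under eq_integral do rewrite E. rewrite ge0_integralZr//; last exact: integral_ge0.
by apply: lte_mul_pinfty=> //; [exact: integral_ge0|rewrite ge0_fin_numE//; exact: integral_ge0]. exact/measEFin.
have <- : \int[(N \x N)%E]_z (z.1 * z.2) = 0. rewrite /Rintegral -(integral12_prod_meas1 ixy).
suff E : fubini_F N (EFin \o (fun z : mR R * mR R=> z.1 * z.2)) = cst 0%E. by rewrite E integral0.
apply/funext=> x; rewrite /fubini_F. under eq_integral do rewrite /= EFinM. rewrite integralZl//.
have -> : (\int[N]_y y%:E = (\int[N]_y y)%:E)%E. by rewrite /Rintegral fineK//; exact: integrable_fin_num.
by rewrite e1 mule0. refine (@cmean_law _ _ _ P _ (sF s0) (Fm s0) _ (mR R * mR R)%type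
(fun w=> (bm_incr j w, bm_incr l w)) (product_subprobability (N : subprobability _ R, N : subprobability _ R)) (fun z=> z.1 * z.2) _ mxy ixy _).
by apply/measurable_fun_pair; exact: bm_incr_measurable.
apply: (pair_law (Fm s0))=> [||A B1 B2 FA mB1 mB2]; try exact: bm_incr_measurable. exact: law2. Qed.

End BrownianIncrements.

Lemma measure_finType {dT} {T : measurableType dT} {R : realType} {I : finType}
  (m : {measure set T -> \bar R}) (B : I -> set T) : (forall a, measurable (B a)) ->
  trivIset setT B -> m (\bigcup_a B a) = (\sum_a m (B a))%E.
move=>mB tB; have E : [set: I] = [set` index_enum I] by apply/seteqP; split=> i //= _; exact: mem_index_enum.
rewrite measure_fin_bigcup//; last exact: finite_finset. rewrite E -fsbig_seq//; exact: index_enum_uniq. Qed.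

Lemma ae_eq_itg {dT} {T : measurableType dT} {R : realType} (mu : {measure set T -> \bar R})
  (D : set T) (f g : T -> R) : measurable D -> measurable_fun D f ->
  {ae mu, forall x, D x -> g x = f x} -> itg mu D g -> itg mu D f /\ \int[mu]_(x in D) f x = \int[mu]_(x in D) g x.
move=>mD mf gf gi; have mg := (integrableP _ _ _ gi).1.
have mf' : measurable_fun D (EFin \o f) by exact/measEFin. split.
apply/integrableP; split=> //; have /integrableP[_] := gi; congr (_ < _)%E.
apply: ae_eq_integral=> //; [exact: meas_comp|exact: meas_comp|]. by apply: filterS gf=> x E Dx /=; rewrite E.
rewrite /Rintegral; congr fine; apply: ae_eq_integral=> //. by apply: filterS gf=> x E Dx /=; rewrite E. Qed.

Section PoissonCounts.
Context {R : realType} {dO : measure_display} {Om : measurableType dO} (P : probability Om R) (F : R -> set (set Om)) (uF :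
  usual_filtration P F) {dU} {U : measurableType dU} (M : {sigma_finite_measure set U -> \bar R}) (N : Om -> {measure
  set (U * mR R) -> \bar R}) (prm : poisson_random_measure P M N) (adN : adapted_random_measure P F N).

(** [fine] sends the value [+oo], which has probability zero on sets of finite mean, to 0. *)
Definition count (G : set (U * mR R)) w : nat := Num.truncn (fine (N w G)).

Lemma countE G w : in_time `[0, +oo[ G -> fine (N w G) = (count G w)%:R.
move=> /(prm.1 w)[|[k]]; rewrite /count=> -> /=; first by rewrite truncn0. by rewrite natrK. Qed.
Let sF (r : R) : 0 <= r -> sigma_algebra setT (F r). Proof. by move=> /(uF.1 r)[]. Qed.
Let Fm (r : R) : 0 <= r -> F r `<=` measurable. Proof. by move=> /(uF.1 r)[]. Qed.

Lemma poisson_setT (lam : R) : 0 <= lam -> (\sum_(k <oo) poisson_prob lam k [set k] = 1)%E.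
move=>lam0; transitivity (poisson_prob lam 0%N setT); last exact: probability_setT.
have -> : [set: nat] = \bigcup_k [set k] by apply/seteqP; split=> // k _; exists k.
rewrite measure_bigcup//; last by apply/trivIsetP=> i j _ _ ij; apply/seteqP; split=> // k [/= -> kj]; move: ij; rewrite kj eqxx.
by apply: eq_eseriesl=> k; rewrite in_setT. Qed.

Section Bounded.
Context (G : set (U * mR R)) (t : R) (t0 : 0 <= t) (Gt : in_time `[0, t] G) (Gfin : (mean_measure M G < +oo)%E).

Let Goo : in_time `[0, +oo[ G.
by split; [exact: Gt.1|move=>x /(Gt.2)/=; rewrite !in_itv/= andbT=> /andP[]]. Qed.
Let lam := fine (mean_measure M G).
Let lam0 : 0 <= lam. Proof. exact/fine_ge0/measure_ge0. Qed.

Lemma N_measurable : meas (fun w=> N w G).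
have /(meas_wrt_subalg (sF t0)) H := adN.1 t G t0 Gt. exact: (measurable_of_subalg (sF t0) (Fm t0) H). Qed.

(** The Poisson weights sum to one, so no mass is left for the value [+oo]. *)
Lemma N_fin_ae : {ae P, forall w, N w G < +oo}%E.
have mk k : measurable [set w | N w G = k%:R%:E].
have := N_measurable measurableT (emeasurable_set1 (k%:R%:E)); rewrite setTI; exact.
have PS : P (\bigcup_k [set w | N w G = k%:R%:E]) = 1%E. rewrite measure_bigcup//; last first.
apply/trivIsetP=> i j _ _ /eqP ij; apply/seteqP; split=> // w [/= -> [/eqP]]. by rewrite eqr_nat=> /eqP /ij.
rewrite -(poisson_setT lam0); apply: (@etrans _ _ (\sum_(k <oo) P [set w | N w G = k%:R%:E])%E).
by apply: eq_eseriesl=> k; rewrite in_setT. by apply: eq_eseriesr=> k _; rewrite (prm.2.1 G k Goo Gfin).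
have mS : measurable (\bigcup_k [set w | N w G = k%:R%:E]) by exact: bigcup_measurable.
exists (~` \bigcup_k [set w | N w G = k%:R%:E]); split.
- exact: measurableC.
- by rewrite probability_setC// PS subee.
- move=>w /= nN [k _ /= Nk]; apply: nN; by rewrite Nk ltry. Qed.

Lemma count_measurable k : measurable (count G @^-1` [set k]).
have mc : meas (fun w=> (count G w)%:R : R). under eq_fun do rewrite -countE//.
by apply: meas_comp=> //; exact: N_measurable.
rewrite (_ : _ @^-1` _ = (fun w=> (count G w)%:R : R) @^-1` [set k%:R]); last first.
by apply/seteqP; split=> w /= => [->//|/eqP]; rewrite eqr_nat=> /eqP. by rewrite -[X in measurable X]setTI; exact: mc.
Qed.

(** The events [count G = k] and [N G = k] can differ only where [N G] is infinite. *)
Lemma count_law k : P (count G @^-1` [set k]) = poisson_prob lam k [set k].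
rewrite -(prm.2.1 G k Goo Gfin). have mN := N_measurable. have mk : measurable [set w | N w G = k%:R%:E].
have := mN measurableT _ (emeasurable_set1 (k%:R%:E)); rewrite setTI; exact.
have moo : measurable [set w | N w G = +oo%E].
have := mN measurableT _ (emeasurable_set1 (+oo%E)); rewrite setTI; exact. have Poo : P [set w | N w G = +oo%E] = 0%E.
apply/negligibleP=> //; apply: negligibleS N_fin_ae=> w /= ->. by rewrite ltxx.
apply/eqP; rewrite eq_le; apply/andP; split.
apply: (@le_trans _ _ (P ([set w | N w G = k%:R%:E] `|` [set w | N w G = +oo%E]))).
apply: le_measure; rewrite ?inE; [exact: count_measurable|exact: measurableU|].
move=>w /= cw; have [|[j Nj]] := prm.1 w G Goo; first by right. by left; rewrite Nj -cw /count Nj /= natrK.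
by apply: (le_trans (measureU2 _ mk moo)); rewrite [X in (_ + X)%E]Poo adde0.
apply: le_measure; rewrite ?inE; [exact: mk|exact: count_measurable|]. by move=>w /= Nk; rewrite /count Nk /= natrK.
Qed.

(** Independence is given for the extended-valued variable [N w G], so [cmean_law] is applied to it,
    with [fine] as the function of that variable. *)
Lemma count_mean (s : R) : 0 <= s -> in_time `]s, +oo[ G -> cmean P (F s) (fun w=> (count G w)%:R) lam.
move=>s0 Gs; have [ci ce] := poisson_mean count_measurable lam0 count_law.
pose X : {mfun Om >-> \bar R} := mfun_Sub (mem_set N_measurable).
have mfine : meas (fine : \bar R -> R) by exact: fine_measurable.
have E : EFin \o fine \o X = EFin \o (fun w=> (count G w)%:R). by apply/funext=> w /=; rewrite countE.
have iX : itg (distribution P X) setT fine. apply/integrableP; split; first exact/measEFin.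
rewrite (@ge0_integral_distribution _ _ _ _ _ P X (fun y=> `|(EFin \o fine) y|%E))//; last first.
by apply: meas_comp=> //; exact/measEFin. have /integrableP[_] := ci; congr (_ < _)%E; apply: eq_integral=> w _ /=.
by rewrite countE. have -> : lam = \int[distribution P X]_y fine y.
rewrite -ce /Rintegral (@integral_distribution _ _ _ _ _ P X (EFin \o fine)).
- by congr fine; apply: eq_integral=> w _ /=; rewrite countE.
- exact/measEFin.
- by rewrite E. have -> : (fun w=> (count G w)%:R) = (fun w=> fine (N w G)) :> (Om -> R).
by apply/funext=> w; rewrite countE.
apply: (@cmean_law _ _ _ P _ (sF s0) (Fm s0) _ (\bar R) (fun w=> N w G) (distribution P X) fine)=> //.
exact: N_measurable. move=>A B FA mB; rewrite (adN.2 s A)//. apply: sub_gen_smallest; exists G, B; split=> //. Qed.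

End Bounded.

Lemma mean_measureX (A : set U) (s t : R) : measurable A -> s <= t ->
  mean_measure M (A `*` `]s, t]) = (M A * (t - s)%:E)%E.
move=>mA st; rewrite /mean_measure product_measure1E//.
suff E : lebesgue_measure (`]s, t]%classic : set R) = (t - s)%:E by exact: (congr1 (fun x=> M A * x)%E E).
rewrite lebesgue_measure_itv/= lte_fin; case: ltP=> // ts. by rewrite (@le_anti _ _ s t) ?st// subrr. Qed.

Lemma in_timeX (A : set U) (s t : R) (J : set R) : measurable A -> `]s, t] `<=` J -> in_time J (A `*` `]s, t]).
move=>mA sJ; split; first exact: measurableX. by move=> [u r] [/= _ /sJ]. Qed.

Section Atoms.
Context {I : finType} (A : I -> set U) (mA : forall a, measurable (A a)) (Afin : forall a, (M (A a) < +oo)%E) (dA :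
  trivIset setT A).

Let fin_mean a s t : s <= t -> (mean_measure M (A a `*` `]s, t]) < +oo)%E.
by move=>st; rewrite mean_measureX//; apply: lte_mul_pinfty; rewrite ?ge0_fin_numE ?ltry. Qed.
Let sub0 (s t : R) : 0 <= s -> `]s, t] `<=` `[0, t].
by move=>s0 r /=; rewrite !in_itv/= => /andP[/ltW/(le_trans s0) -> ->]. Qed.
Let sub1 (s t : R) : `]s, t] `<=` `]s, +oo[.
by move=>r /=; rewrite !in_itv/= => /andP[-> _]. Qed.

Lemma count_increment s t a : 0 <= s -> s <= t ->
  cmean P (F s) (fun w=> (count (A a `*` `]s, t]) w)%:R) ((t - s) * fine (M (A a))).
move=>s0 st; have t0 := le_trans s0 st.
have -> : (t - s) * fine (M (A a)) = fine (mean_measure M (A a `*` `]s, t])).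
have Mf : M (A a) \is a fin_num by rewrite ge0_fin_numE. by rewrite mean_measureX// fineM//= mulrC.
apply: (count_mean t0)=> //.
- by apply: in_timeX=> //; exact: sub0.
- exact: fin_mean.
- by apply: in_timeX=> //; exact: sub1. Qed.

(** The marks being disjoint, the total count is almost surely the count of their union, itself a
    Poisson variable whose factorial moment is known. *)
Lemma count_fact2 s t : 0 <= s -> s <= t ->
  itgT P (fun w=> ((\sum_a count (A a `*` `]s, t]) w) * (\sum_a count (A a `*` `]s, t]) w).-1)%N%:R : R) /\
  \int[P]_w ((\sum_a count (A a `*` `]s, t]) w) * (\sum_a count (A a `*` `]s, t]) w).-1)%N%:R
  = ((t - s) * \sum_a fine (M (A a))) ^+ 2.
move=>s0 st; have t0 := le_trans s0 st. pose UA := \bigcup_a A a.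
have mUA : measurable UA by apply: fin_bigcup_measurable=> //; exact: finite_finset.
have MUA : M UA = (\sum_a M (A a))%E by exact: measure_finType.
have MUfin : (M UA < +oo)%E by rewrite MUA; apply: lte_sum_pinfty.
have mG a : measurable (A a `*` `]s, t] : set (U * mR R)) by exact: measurableX.
have NUA w : N w (UA `*` `]s, t]) = (\sum_a N w (A a `*` `]s, t]))%E.
rewrite /UA setX_bigcupl; apply: measure_finType=> //.
apply/trivIsetP=> i j _ _ ij; rewrite -setXI; move/trivIsetP : dA=> /(_ i j Logic.I Logic.I ij) ->. by rewrite set0X.
have finU : (mean_measure M (UA `*` `]s, t]) < +oo)%E.
by rewrite mean_measureX//; apply: lte_mul_pinfty; rewrite ?ge0_fin_numE ?ltry.
have GU : in_time `[0, t] (UA `*` `]s, t]) by apply: in_timeX=> //; exact: sub0.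
have Goo (B : set U) : measurable B -> in_time `[0, +oo[ (B `*` `]s, t]).
move=>mB; apply: in_timeX=> // r /=; rewrite !in_itv/= andbT=> /andP[/ltW sr _]. exact: le_trans sr.
have U0 : 0 <= fine (mean_measure M (UA `*` `]s, t])) by apply/fine_ge0; exact: measure_ge0.
have [i2 e2] := poisson_fact2 (count_measurable t0 GU) U0 (count_law t0 GU finU).
have EQ : {ae P, forall w, count (UA `*` `]s, t]) w = (\sum_a count (A a `*` `]s, t]) w)%N}.
apply: filterS (N_fin_ae t0 GU finU)=> w Nw. apply/eqP; rewrite -(eqr_nat R) natr_sum -countE; last exact: Goo.
rewrite NUA -sum_fine. by apply/eqP; apply: eq_bigr=> a _; rewrite countE//; exact: Goo.
move=>a _; rewrite ge0_fin_numE//; apply: le_lt_trans Nw; rewrite NUA. by rewrite (bigD1 a)//= leeDl// sume_ge0.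
have lamE : fine (mean_measure M (UA `*` `]s, t])) = (t - s) * \sum_a fine (M (A a)).
have Mf : M UA \is a fin_num by rewrite ge0_fin_numE. rewrite mean_measureX// fineM//= mulrC MUA -sum_fine// => a _.
by rewrite ge0_fin_numE. rewrite lamE in e2.
pose f := fun w=> ((\sum_a count (A a `*` `]s, t]) w) * (\sum_a count (A a `*` `]s, t]) w).-1)%N%:R : R.
pose g := fun w=> (count (UA `*` `]s, t]) w * (count (UA `*` `]s, t]) w).-1)%N%:R : R. have mf : meas f.
have -> : f = fun w=> (\sum_a (count (A a `*` `]s, t]) w)%:R) * (\sum_a (count (A a `*` `]s, t]) w)%:R - 1) :> R.
apply/funext=> w; rewrite /f -natr_sum natrM; case: (\sum_a _)%N=> [|k]; first by rewrite !mul0r.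
by congr (_ * _); rewrite -natr1 addrK. have mc a : meas (fun w=> (count (A a `*` `]s, t]) w)%:R : R).
exact: measurable_itg (count_increment a s0 st).1.
by apply: measM; [|apply: measB=> //]; apply: meas_sum=> a; exact: mc.
have [fi fe] : itgT P f /\ \int[P]_w f w = \int[P]_w g w.
by apply: ae_eq_itg=> //; apply: filterS EQ=> w E _; rewrite /g /f E. by split=> //; rewrite fe. Qed.

End Atoms.
End PoissonCounts.

Section Increments.
Context {R : realType} {dO : measure_display} {Om : measurableType dO} (P : probability Om R) (F : R -> set (set Om)) (uF :
  usual_filtration P F) {d} (W : R -> Om -> 'rV[R]_d) (BW : brownian_motion P F W) {dU} {U : measurableType dU} (M :
  {sigma_finite_measure set U -> \bar R}) (N : Om -> {measure set (U * mR R) -> \bar R}) (prm : poisson_random_measure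
  P M N) (adN : adapted_random_measure P F N).

Lemma levy_increments {I : finType} (A : I -> set U) (s t : R) :
  (forall a, measurable (A a)) -> (forall a, (M (A a) < +oo)%E) -> trivIset setT A -> 0 <= s -> s < t ->
  increments P (F s) (t - s) (bm_incr W s t) (fun a=> count N (A a `*` `]s, t])) (fun a=> fine (M (A a))).
move=>mA Afin dA s0 st; have ts : 0 <= t - s by rewrite subr_ge0 ltW. split.
- by move=>j; exact: bm_incr_mean.
- move=>j l; have [<-|jl] := eqVneq j l; last by rewrite mulr0; exact: bm_incr_cross.
by rewrite mulr1; under eq_fun do rewrite -expr2; exact: bm_incr_sqr.
- by move=>j; have H := bm_incr_pow4 uF BW s0 st j; split; [exact: H.1|rewrite (cmean_mean H)].
- by move=>a; apply: (count_increment uF prm adN)=> //; exact: ltW.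
- have [i2 e2] := count_fact2 uF prm adN mA Afin dA s0 (ltW st). by split=> //; rewrite e2. Qed.

End Increments.

Lemma test_sub {R : realType} {d} (p q p' q' : R) phi phit phi1 phi2 (C : R) :
  p <= p' -> q' <= q -> @test R d p q phi phit phi1 phi2 C -> test p' q' phi phit phi1 phi2 C.
move=>pp qq [b0 bt b1 b2 u0 ut u1 u2 dt d1 d2]. have S s : p' <= s <= q' -> p <= s <= q.
by move=> /andP[A B]; rewrite (le_trans pp A) (le_trans B qq). have U h : unif_cont p q h -> unif_cont p' q' h.
move=>uh e e0; have [del del0 H] := uh e e0; exists del=> // s s' x x' /S ps /S ps'. exact: H.
split; try by [move=>s x /S; eauto | move=>j s x /S; eauto | move=>j k s x /S; eauto].
- exact: U.
- exact: U.
- by move=>j; exact: U.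
- by move=>j k; exact: U.
- move=>s x /andP[A B]; apply: dt; apply/andP; split; [exact: le_lt_trans A|exact: lt_le_trans qq]. Qed.

Lemma rcont_measurable {R : realType} (p q : R) (h : R -> R) : p < q -> rcont p q (h : R -> R^o) -> measi p q h.
move=>pq rh; apply: (measurable_fun_cvg (h := fun n r=> h (rgt p q n.+1 r)))=> [n|r].
apply: measurable_funTS; exact: (gidx_measurable p q n.+1 (fun i=> h (minr q (gp p q n.+1 i.+1)))).
by rewrite /= in_itv/= => pr; exact: (rgt_lim pq rh pr). Qed.

(** * Refinement of overlapping marks into disjoint atoms *)

Section Atoms.
Context {dU : measure_display} {U : measurableType dU} {R : realType} {J : finType} (mark : J -> set U) (mm : forall j, measurable (mark
  j)).

Definition signature (u : U) : {set J} := [set j | `[< mark j u >]]%SET.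

(** The points in no mark have the empty signature. They carry no jump and their set may have
    infinite measure, so this atom is replaced by the empty set. *)
Definition atom (al : {set J}) : set U := if al == finset.set0 then set0 else signature @^-1` [set al].

Lemma atom_measurable al : measurable (atom al).
rewrite /atom; case: ifP=> // _.
have -> : signature @^-1` [set al] = \bigcap_(j : J) (if j \in al then mark j else ~` mark j).
apply/seteqP; split=> u /=. move=> <- j _; rewrite inE; case: ifPn=> [/asboolP//|/asboolPn]; exact.
move=>H; apply/setP=> j; rewrite inE; have := H j Logic.I. by case: ifP=> jal /= mj; apply/asboolP.
apply: fin_bigcap_measurable; first exact: finite_finset. by move=>j _; case: ifP=> // _; exact: measurableC. Qed.

Lemma atom_trivIset : trivIset setT atom.
apply/trivIsetP=> a b _ _ ab; rewrite /atom; case: ifP=> _; first by rewrite set0I.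
case: ifP=> _; first by rewrite setI0. by apply/seteqP; split=> // u [/= -> E]; move: ab; rewrite E eqxx. Qed.

Lemma atom_fin (M : {measure set U -> \bar R}) al : (forall j, (M (mark j) < +oo)%E) -> (M (atom al) < +oo)%E.
move=>Mf; rewrite /atom; case: ifP=> [_|/negbT /set0Pn[j jal]]; first by rewrite measure0 ltry.
apply: le_lt_trans (Mf j); apply: le_measure; rewrite ?inE=> //.
by have := atom_measurable al; rewrite /atom ifN//; apply/set0Pn; exists j.
by move=>u /= E; move: jal; rewrite -E inE=> /asboolP. Qed.

Lemma mark_atoms j : mark j = \bigcup_(al in [set: {set J}]) (if j \in al then atom al else set0).
apply/seteqP; split=> u /=.
move=>mj; exists (signature u)=> //; have js : j \in signature u by rewrite inE; apply/asboolP.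
rewrite js /atom ifN//; apply/set0Pn; by exists j.
move=> [al _]; case: ifP=> // jal; rewrite /atom; case: ifP=> // _ /= E. by move: jal; rewrite -E inE=> /asboolP. Qed.

Lemma mark_atoms_measure {d'} {T' : measurableType d'} (N : {measure set (U * T') -> \bar R})
  (D : set T') j : measurable D -> N (mark j `*` D) = (\sum_(al : {set J} | j \in al) N (atom al `*` D))%E.
move=>mD; rewrite {1}mark_atoms setX_bigcupl measure_finType.
- rewrite [RHS]big_mkcond/=; apply: eq_bigr=> al _; case: ifP=> // _. by rewrite set0X measure0.
- by move=>al; case: ifP=> _; [apply: measurableX=> //; exact: atom_measurable|rewrite set0X].
- apply/trivIsetP=> a b _ _ ab; rewrite -setXI. move/trivIsetP : atom_trivIset=> /(_ a b Logic.I Logic.I ab) E.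
case: ifP=> _; last by rewrite set0I set0X. by case: ifP=> _; [rewrite E set0X|rewrite setI0 set0X]. Qed.

(** [f] of the signature is a simple function on the atoms; [f finset.set0 = 0] accounts for the
    discarded one. *)
Lemma Rint_atoms (M : {measure set U -> \bar R}) (f : {set J} -> R) :
  (forall j, (M (mark j) < +oo)%E) -> f finset.set0 = 0 -> itgT M (fun u=> f (signature u)) /\
  \int[M]_u f (signature u) = \sum_al fine (M (atom al)) * f al.
move=>Mf f0. have E u : f (signature u) = \sum_al f al * \1_(atom al) u.
rewrite (bigD1 (signature u))//= big1 ?addr0; last first.
move=>al /negP alu; rewrite indicE /atom; case: ifP=> _; first by rewrite in_set0 mulr0.
by rewrite memNset ?mulr0//= => /esym /eqP. rewrite indicE /atom; case: ifP=> [/eqP ->|_]; first by rewrite f0 mul0r.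
by rewrite mem_set ?mulr1. have i1 al : itgT M (\1_(atom al) : U -> R). apply/integrableP; split.
by apply/measEFin; apply: measurable_indic; exact: atom_measurable.
rewrite (eq_integral (fun u=> (\1_(atom al) u)%:E)); last first. by move=>u _ /=; rewrite ger0_norm// indicE.
by rewrite integral_indic ?setIT//; [exact: atom_fin|exact: atom_measurable].
have e1 al : \int[M]_u (\1_(atom al) u : R) = fine (M (atom al)).
by rewrite /Rintegral integral_indic ?setIT//; exact: atom_measurable.
have -> : (fun u=> f (signature u)) = (fun u=> \sum_al f al * \1_(atom al) u) by exact/funext.
split; first by apply: itg_sum=> // al _; exact: itgZ. rewrite Rint_sum//; last by move=>al _; exact: itgZ.
by apply: eq_bigr=> al _; rewrite RintegralZl// e1 mulrC. Qed.

End Atoms.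

(** * The formula on a cell where the noise coefficients are constant *)

Section CompleteProbability.
Context {R : realType} {dO : measure_display} {Om : measurableType dO} (P : probability Om R) (cP : forall A, P.-negligible A ->
  measurable A).

Lemma ae_measurable (f g : Om -> R) : meas g -> {ae P, forall w, f w = g w} -> meas f.
move=>mg fg _ B mB; rewrite setTI. pose E := [set w | f w = g w]. have nE : P.-negligible (~` E) by exact: fg.
have mE : measurable E by rewrite -[E]setCK; apply: measurableC; exact: cP.
have -> : f @^-1` B = (g @^-1` B `&` E) `|` (f @^-1` B `&` ~` E). apply/seteqP; split=> w /=.
move=>Bf; have [Ew|nEw] := pselect (E w); last by right. by left; split=> //; rewrite -Ew. by move=> [[Bg ->]|[]].
apply: measurableU. by apply: measurableI=> //; have := mg measurableT B mB; rewrite setTI.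
by apply: cP; apply: negligibleS nE=> w []. Qed.

(** Bounded convergence when bound and convergence hold only almost surely. The measurability of f
    is part of the conclusion: the functions are cut to 0 off a set D of full measure, and
    completeness carries the result back. *)
Lemma bdct (f_ : nat -> Om -> R) (f : Om -> R) (C : R) : (forall n, meas (f_ n)) ->
  {ae P, forall w, (forall n, `|f_ n w| <= C) /\ f_ n w @[n --> \oo] --> f w} ->
  [/\ itgT P f, meas f, {ae P, forall w, `|f w| <= C} & \int[P]_w f_ n w @[n --> \oo] --> \int[P]_w f w].
move=>mf [N [mN PN sN]]. pose D := ~` N; have mD : measurable D by exact: measurableC.
have HD w : D w -> (forall n, `|f_ n w| <= C) /\ f_ n w @[n --> \oo] --> f w.
by move=>Dw; apply: contrapT=> H; apply: Dw; exact: sN. have C0 : 0 <= C. have [w Dw] : D !=set0.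
apply/set0P/eqP=> D0; have : P D = 1%E by rewrite probability_setC// PN sube0.
by rewrite D0 measure0=> /esym /eqP; rewrite onee_eq0. exact: le_trans (normr_ge0 _) ((HD w Dw).1 0%N).
have aeD : {ae P, forall w, D w} by exists N; split=> // w /contrapT.
pose g_ n w := \1_D w * f_ n w; pose g w := \1_D w * f w. have mg_ n : meas (g_ n) by exact: measM.
have gl w : g_ n w @[n --> \oo] --> g w. have [Dw|nDw] := pselect (D w).
rewrite /g /g_; under eq_fun do rewrite indicE mem_set// mul1r. by rewrite indicE mem_set// mul1r; exact: (HD w Dw).2.
rewrite /g /g_; under eq_fun do rewrite indicE memNset// mul0r. by rewrite indicE memNset// mul0r; exact: cvg_cst.
have mg : meas g by apply: (measurable_fun_cvg mg_)=> w _; exact: gl. have gC n w : `|g_ n w| <= C.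
rewrite /g_ indicE; have [Dw|nDw] := pselect (D w); last by rewrite memNset// mul0r normr0.
by rewrite mem_set// mul1r; exact: (HD w Dw).1. have iC : itgT P (fun=> C) by apply: (@P_itg_bounded _ _ _ P _ `|C|).
have [gi gcv] := Rdct measurableT mg_ mg (aeW P (fun w _=> gl w)) iC (fun n w _=> gC n w).
have fg (h : Om -> R) : {ae P, forall w, h w = \1_D w * h w}.
by apply: filterS aeD=> w Dw; rewrite indicE mem_set// mul1r. have mf' : meas f by exact: ae_measurable mg (fg f).
have [fi fe] : itgT P f /\ \int[P]_w f w = \int[P]_w g w.
apply: ae_eq_itg=> //; apply: filterS (fg f)=> w E _; exact: (esym E). split=> //.
apply: filterS aeD=> w Dw; have [bn cn] := HD w Dw. have cn' : `|f_ n w| @[n --> \oo] --> `|f w| by apply: cvg_norm.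
rewrite -(cvg_lim _ cn')//; apply: limr_le; first exact: cvgP cn'. by apply: nearW.
rewrite fe; have -> : (fun n=> \int[P]_w f_ n w) = (fun n=> \int[P]_w g_ n w); last exact: gcv.
apply/funext=> n; have gni : itgT P (g_ n) by exact: (@P_itg_bounded _ _ _ P _ C).
have [] := @ae_eq_itg _ _ _ P setT (f_ n) (g_ n) measurableT (mf n) _ gni=> //.
by apply: filterS (fg (f_ n))=> w E _; exact: (esym E). Qed.

End CompleteProbability.
Section Cell.
Context {R : realType} {dO : measure_display} {Om : measurableType dO} (P : probability Om R) (cP : forall A, P.-negligible A ->
  measurable A) {d} {I : finType} (p q : R) (phi phit : sfun R d) (phi1 : 'I_d -> sfun R d) (phi2 : 'I_d -> 'I_d ->
  sfun R d) (C c M : R) (pq : p < q) (T : test p q phi phit phi1 phi2 C) (F : R -> set (set Om)) (sF : forall s, p <=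
  s <= q -> sigma_algebra setT (F s)) (Fm : forall s, p <= s <= q -> F s `<=` measurable) (Fmono : forall s, p <= s <=
  q -> F p `<=` F s) (dw : R -> R -> 'I_d -> Om -> R) (n : R -> R -> I -> Om -> nat) (mu : I -> R) (inc : forall s t,
  p <= s -> s < t -> t <= q -> increments P (F s) (t - s) (dw s t) (n s t) mu) (sg : 'I_d -> 'I_d -> Om -> R) (g : I
  -> Om -> 'rV[R]_d) (msg : forall i j, meas_wrt (F p) (sg i j)) (mg : forall a i, meas_wrt (F p) (fun x=> g a x ord0
  i)) (sgM : forall i j x, `|sg i j x| <= M) (gM : forall a i x, `|g a x ord0 i| <= M) (mu0 : forall a, 0 <= mu a)
  (muM : \sum_a mu a <= M) (M0 : 0 <= M) (c0 : 0 <= c) (K : R -> Om -> R) (beta Y z : R -> Om -> 'rV[R]_d) (kk : R ->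
  Om -> R) (bb : 'I_d -> R -> Om -> R) (zE : forall s x, z s x = beta s x + Y s x) (mK : forall s, p <= s <= q ->
  meas_wrt (F s) (K s)) (mbeta : forall s, p <= s <= q -> meas_wrt (F s) (beta s : Om -> borelRd R d)) (mY : forall s,
  p <= s <= q -> meas_wrt (F s) (Y s : Om -> borelRd R d)) (K01 : forall s x, 0 <= K s x <= 1).

(** The pathwise facts that hold off a null set. [gp_kb] is the domination of time and drift by the
    killing rate; [gp_incr] ties Y to the noise, with coefficients frozen over the whole cell. *)
Record good_path (x : Om) : Prop := GoodPath {
  gp_k : itgi p q (kk ^~ x);
  gp_b : forall j, itgi p q (bb j ^~ x);
  gp_k0 : forall r, p <= r <= q -> 0 <= kk r x;
  gp_kb : forall r, p <= r <= q -> 1 + \sum_j `|bb j r x| <= c * kk r x;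
  gp_K : forall r, p <= r <= q -> K r x = K p x * expint p (kk ^~ x) r;
  gp_beta : forall r, p <= r <= q -> beta r x = beta p x + \row_j int p r (bb j ^~ x);
  gp_Y : rcont p q (Y ^~ x);
  gp_incr : forall s t, p <= s -> s < t -> t <= q ->
    Y t x - Y s x = incr (t - s) sg g mu (dw s t) (n s t) x }.

Context (good : {ae P, forall x, good_path x}).

Definition cellH s x := K s x * phi s (z s x).

Definition cellgen r x := cgen phi phi1 phi2 r (z r) sg g mu x.

(** The drift of [cellH] in Ito's formula. *)
Definition cellTheta r x := K r x * (phit r (z r x) + \sum_j bb j r x * phi1 j r (z r x)
  - kk r x * phi r (z r x)) + K r x * cellgen r x.

Let C0 : 0 <= C. Proof. by apply: (test_C_ge0 T); exact: ltW. Qed.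
Let pp : p <= p <= q. Proof. by rewrite lexx ltW. Qed.
Let qq : p <= q <= q. Proof. by rewrite lexx ltW. Qed.
Let Fms s {d'} {T' : measurableType d'} (f : Om -> T') : p <= s <= q -> meas_wrt (F s) f -> meas f.
by move=>ps /(meas_wrt_subalg (sF ps)) mf; exact: (measurable_of_subalg (sF ps) (Fm ps) mf). Qed.
Let Fsub s {d'} {T' : measurableType d'} (f : Om -> T') : p <= s <= q -> meas_wrt (F s) f ->
  meas (f : subalg (F s) -> T').
by move=>ps /(meas_wrt_subalg (sF ps)). Qed.
Let madd s (f h : Om -> 'rV[R]_d) : p <= s <= q -> meas (f : subalg (F s) -> borelRd R d) ->
  meas (h : subalg (F s) -> borelRd R d) -> meas ((fun x=> f x + h x) : subalg (F s) -> borelRd R d).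
move=>ps mf mh; apply: borelRd_measurable=> j; under eq_fun do rewrite mxE.
by apply: measD; apply: (meas_comp (borelRd_coord j)). Qed.
Let maddO (f h : Om -> 'rV[R]_d) : meas (f : Om -> borelRd R d) -> meas (h : Om -> borelRd R d) ->
  meas ((fun x=> f x + h x) : Om -> borelRd R d).
move=>mf mh; apply: borelRd_measurable=> j; under eq_fun do rewrite mxE.
by apply: measD; apply: (meas_comp (borelRd_coord j)). Qed.
Let mz s : p <= s <= q -> meas (z s : subalg (F s) -> borelRd R d).
move=>ps; have -> : z s = fun x=> beta s x + Y s x by exact/funext.
by apply: madd=> //; apply: Fsub=> //; [exact: mbeta|exact: mY]. Qed.
Let phic s : p <= s <= q -> continuous (phi s). Proof. by move=>ps; exact: unif_cont_x ps (t_u0 T). Qed.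
Let Bg := 2^-1 * (d%:R * (d%:R * (C * (d%:R * (M * M))))) + M * (C + C + d%:R * (C * M)).

Let gen_bound s x : p <= s <= q -> `|cellgen s x| <= Bg.
by move=>ps; have := @cgen_bound _ _ _ d I p q phi phit phi1 phi2 C T s M (z s) sg g mu ps sgM gM mu0 muM x M0. Qed.
Let K1 s x : `|K s x| <= 1. Proof. by have /andP[k0 k1] := K01 s x; rewrite ger0_norm. Qed.
Let Kgen_bound s x : p <= s <= q -> `|K s x * cellgen s x| <= Bg.
by move=>ps; rewrite normrM -[leRHS]mul1r; apply: ler_pM=> //; exact: gen_bound. Qed.
Let mgen s : p <= s <= q -> meas (fun x=> K s x * cellgen s x).
move=>ps; apply: measM; first by apply: Fms (mK ps).
apply: (measurable_of_subalg (sF ps) (Fm ps)); apply: (cgen_measurable T)=> //.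
- exact: mz.
- by move=>i j; apply: Fsub=> // B mB; apply: Fmono=> //; exact: msg.
- by move=>a i; apply: Fsub=> // B mB; apply: Fmono=> //; exact: mg. Qed.
Let mH s s' : p <= s <= q -> p <= s' <= q -> meas (fun x=> K s x * phi s (beta s x + Y s' x)).
move=>ps ps'; apply: measM; first by apply: Fms (mK ps). apply: (meas_comp (borelRd_continuous (phic ps))).
by apply: maddO; [apply: Fms (mbeta ps)|apply: Fms (mY ps')]. Qed.
Let bH s y x : p <= s <= q -> `|K s x * phi s y| <= C.
by move=>ps; rewrite normrM -[leRHS]mul1r; apply: ler_pM=> //; exact: (t_b0 T). Qed.
Let iH s s' : p <= s <= q -> p <= s' <= q -> itgT P (fun x=> K s x * phi s (beta s x + Y s' x)).
by move=>ps ps'; apply: (P_itg_bounded _ (mH ps ps'))=> x; exact: bH. Qed.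
Let iHs s : p <= s <= q -> itgT P (cellH s).
move=>ps; have -> : cellH s = fun x=> K s x * phi s (beta s x + Y s x); last exact: iH.
by apply/funext=> x; rewrite /cellH zE. Qed.

(* One grid step: the increment of Y alone, with time and drift frozen at s. *)
Let Xst s s' x := K s x * phi s (beta s x + Y s' x) - K s x * phi s (beta s x + Y s x).

(** [one_step], with the increment of Y expressed through the noise. That expression holds on good
    paths only, and completeness makes the two integrands interchangeable. *)
Let step eps A s s' : p <= s -> s < s' -> s' <= q -> s' - s <= 1 -> 0 <= eps -> 0 <= A ->
  remainder_small (I := I) p q phi phi1 phi2 M eps A ->
  `|\int[P]_x Xst s s' x - (s' - s) * \int[P]_x (K s x * cellgen s x)|
  <= eps * ((d%:R + M) * (s' - s)) + A * ((3 * d%:R + M ^+ 2 + 1) * (s' - s) ^+ 2).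
move=>ps ss' s'q h1 eps0 A0 RB. have psq : p <= s <= q by rewrite ps (le_trans (ltW ss') s'q).
have psq' : p <= s' <= q by rewrite s'q (le_trans ps (ltW ss')).
have := one_step T psq (h := s' - s) _ (sF psq) (Fm psq) (inc ps ss' s'q) (Fsub psq (mK psq)) (K01 s)
(mz psq) _ _ sgM gM mu0 muM eps0 A0 M0 RB. rewrite subr_ge0 (ltW ss') h1=> /(_ isT).
move=> /(_ (fun i j=> Fsub psq (fun B mB=> Fmono psq (msg i j mB)))).
move=> /(_ (fun a i=> Fsub psq (fun B mB=> Fmono psq (mg a i mB)))). congr (`|_ - _| <= _).
have mX : meas (Xst s s') by apply: measB; exact: mH. have iX : itgT P (Xst s s') by apply: itgB=> //; exact: iH.
have E : {ae P, forall x, Xst s s' x =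
K s x * (phi s (z s x + incr (s' - s) sg g mu (dw s s') (n s s') x) - phi s (z s x))}.
apply: filterS good=> x gx; rewrite -(gp_incr gx)// zE mulrBr /Xst.
by congr (K s x * phi s _ - _); rewrite -addrA; congr (_ + _); rewrite addrCA subrr addr0.
refine (ae_eq_itg measurableT _ _ iX).2; last by apply: filterS E=> x ->.
by apply: (ae_measurable cP mX); apply: filterS E=> x ->. Qed.
Let rc_K x : good_path x -> rcont p q (K ^~ x : R -> R^o).
move=>gx; apply/rcontP=> r /andP[pr rq] e e0. have [del del0 H] := expint_cont (gp_k gx) (gp_k0 gx) e0.
exists (minr del (q - r)); first by rewrite lt_min del0 subr_gt0. move=>s rs; rewrite -ltrBlDl lt_min=> /andP[sd sq].
have pr' : p <= r <= q by rewrite pr ltW.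
have ps' : p <= s <= q by rewrite (le_trans pr (ltW rs))/=; move: sq; rewrite ltrD2r=> /ltW.
rewrite (gp_K gx pr') (gp_K gx ps') -mulrBr normrM; apply: le_lt_trans (H r s pr' ps' _). by rewrite ler_piMl.
by rewrite distrC gtr0_norm ?subr_gt0. Qed.
Let rc_beta x : good_path x -> rcont p q (beta ^~ x).
move=>gx; apply/rcontP=> r /andP[pr rq] e e0. have e2 : 0 < e / 2 by rewrite divr_gt0.
have [del del0 H] : exists2 del, 0 < del & forall j s s', p <= s <= q -> p <= s' <= q ->
`|s - s'| < del -> `|int p s (bb j ^~ x) - int p s' (bb j ^~ x)| < e / 2.
have := @finite_pos_min R 'I_d (fun j del=> forall s s', p <= s <= q -> p <= s' <= q ->
`|s - s'| < del -> `|int p s (bb j ^~ x) - int p s' (bb j ^~ x)| < e / 2).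
case=> [j a b a0 ab H s s' ps ps' ss'|j|del del0 H].
- by apply: H=> //; exact: lt_le_trans ab.
- by have [del del0 H] := int_continuous (gp_b gx j) e2; exists del.
- by exists del. exists (minr del (q - r)); first by rewrite lt_min del0 subr_gt0.
move=>s rs; rewrite -ltrBlDl lt_min=> /andP[sd sq]. have pr' : p <= r <= q by rewrite pr ltW.
have ps' : p <= s <= q by rewrite (le_trans pr (ltW rs))/=; move: sq; rewrite ltrD2r=> /ltW.
have rsd : `|r - s| < del by rewrite distrC gtr0_norm ?subr_gt0.
rewrite (gp_beta gx pr') (gp_beta gx ps') opprD addrACA subrr add0r.
apply: (@le_lt_trans _ _ (e / 2)); last by rewrite ltr_pdivrMr// ltr_pMr// ltr1n.
apply: norm_le_coord; first exact: ltW. by move=>j; rewrite !mxE ltW// H. Qed.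
Let rc_z x : good_path x -> rcont p q (z ^~ x).
move=>gx r pr; rewrite /= zE; under eq_fun do rewrite zE.
by apply: cvgD; [exact: (rc_beta gx pr)|exact: (gp_Y gx pr)]. Qed.
Let rc_ell x : good_path x -> rcont p q ((fun r=> K r x * cellgen r x) : R -> R^o).
move=>gx r pr; apply: cvgM; first exact: (rc_K gx pr).
have U h : unif_cont p q h -> h s (z s x) @[s --> r^'+] --> (h r (z r x) : R^o).
by move=>uh; exact: (unif_cont_rcont uh (rc_z gx) pr).
have Ug a : phi s (z s x + g a x) @[s --> r^'+] --> (phi r (z r x + g a x) : R^o).
apply: (unif_cont_rcont (t_u0 T) (z := fun s=> z s x + g a x))=> // r' pr'.
by apply: cvgD; [exact: (rc_z gx pr')|exact: cvg_cst]. apply: cvgD. apply: cvgM; first exact: cvg_cst.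
apply: cvg_bigsum=> i; apply: cvg_bigsum=> k; apply: cvgM; last exact: cvg_cst. exact: U (t_u2 T i k).
apply: cvg_bigsum=> a; apply: cvgM; first exact: cvg_cst.
apply: cvgB; first by apply: cvgB; [exact: Ug|exact: U (t_u0 T)].
apply: cvg_bigsum=> i; apply: cvgM; last exact: cvg_cst. exact: U (t_u1 T i). Qed.

(* The telescoped sum: H_q - H_p with the Y-increments replaced by their conditional drift. *)
Let S N x := cellH q x - cellH p x - \sum_(i < N) Xst (gp p q N i) (gp p q N i.+1) x
  + \sum_(i < N) (q - p) / N%:R * (K (gp p q N i) x * cellgen (gp p q N i) x).

(** Each increment of H is split at the intermediate value with time s and noise [Y s']: the first
    half is [Xst] and cancels, the second is a term of [disc_sum]. *)
Let S_disc N x : (0 < N)%N -> good_path x -> S N x = disc_sum p q phi (fun r=> beta p x + Y r x)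
  (fun r=> K r x * cellgen r x) (fun r=> K p x * expint p (kk ^~ x) r) (fun r=> \row_j int p r (bb j ^~ x)) N.
move=>N0 gx; rewrite /S /disc_sum.
have -> : cellH q x - cellH p x = \sum_(i < N) (cellH (gp p q N i.+1) x - cellH (gp p q N i) x).
have := @telescope_sumr R 0 N (fun i=> cellH (gp p q N i) x) (leq0n N). by rewrite big_mkord gpN// gp0=> ->.
rewrite -sumrB -big_split/=; apply: eq_bigr=> i _; congr (_ + _).
have pi : p <= gp p q N i <= q by apply: gp_itv=> //; exact: ltnW.
have pi1 : p <= gp p q N i.+1 <= q by apply: gp_itv.
have Ez r : p <= r <= q -> \row_j int p r (bb j ^~ x) + (beta p x + Y (gp p q N i.+1) x) = beta r x + Y (gp p q N i.+1) x.
by move=>pr; rewrite addrA [_ + beta p x]addrC -(gp_beta gx).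
rewrite (Ez _ pi) (Ez _ pi1) -(gp_K gx pi) -(gp_K gx pi1) /cellH /Xst.
rewrite (zE (gp p q N i)) (zE (gp p q N i.+1)); set a1 := K _ x * _; set a2 := K _ x * _; set a3 := K _ x * _.
by rewrite opprB addrA subrK. Qed.
Let Theta_lim x : good_path x -> S N.+1 x @[N --> \oo] --> int p q (cellTheta ^~ x).
move=>gx; have E N : S N.+1 x = disc_sum p q phi (fun r=> beta p x + Y r x)
(fun r=> K r x * cellgen r x) (fun r=> K p x * expint p (kk ^~ x) r)
(fun r=> \row_j int p r (bb j ^~ x)) N.+1 by exact: S_disc. under eq_fun do rewrite E.
have rcy : rcont p q (fun r=> beta p x + Y r x). by move=>r pr; apply: cvgD; [exact: cvg_cst|exact: (gp_Y gx)].
have eB r : p <= r <= q -> `|K r x * cellgen r x| <= Bg by exact: Kgen_bound.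
apply: cvg_to_eq (disc_sum_cvg pq T (gp_k gx) (gp_b gx) (K01 p x) (gp_k0 gx) (gp_kb gx) rcy (rc_ell gx) eB
(fun=> erefl) (fun=> erefl) (fun=> erefl)) _. apply: int_eq=> r pr; rewrite /cellTheta -(gp_K gx)//.
by rewrite [_ + (beta p x + _)]addrA [\row_j _ + beta p x]addrC -(gp_beta gx)// -zE. Qed.
Let Theta_itg x : good_path x -> itgi p q (cellTheta ^~ x).
move=>gx; have mU h : unif_cont p q h -> measi p q (fun r=> h r (z r x)).
by move=>uh; apply: (rcont_measurable pq); exact: (unif_cont_rcont uh (rc_z gx)).
have mk := itg_meas (gp_k gx); have mb j := itg_meas (gp_b gx j).
apply: (@le_itgi R p q _ (fun r=> C * (c * kk r x) + C * kk r x + Bg)).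
- apply: measD; last by apply: (rcont_measurable pq); exact: rc_ell.
apply: measM; first by apply: (rcont_measurable pq); exact: rc_K.
apply: measB; last by apply: measM=> //; exact: mU (t_u0 T). apply: measD; first exact: mU (t_ut T).
by apply: meas_sum=> j; apply: measM=> //; exact: mU (t_u1 T j).
- move=>r pr; apply: (le_trans (ler_normD _ _)); apply: lerD; last exact: Kgen_bound.
rewrite normrM -[leRHS]mul1r; apply: ler_pM=> //. apply: (le_trans (ler_normB _ _)); apply: lerD.
apply: (@le_trans _ _ (C * (1 + \sum_j `|bb j r x|))); last by apply: ler_wpM2l=> //; exact: (gp_kb gx).
rewrite mulrDr mulr1; apply: (le_trans (ler_normD _ _)); apply: lerD; first exact: (t_bt T).
rewrite mulr_sumr; apply: (le_trans (ler_norm_sum _ _ _)); apply: ler_sum=> j _.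
by rewrite normrM mulrC ler_wpM2r//; exact: (t_b1 T).
by rewrite normrM mulrC (ger0_norm (gp_k0 gx pr)); apply: ler_wpM2r; [exact: (gp_k0 gx)|exact: (t_b0 T)].
- have ik := gp_k gx; apply: itgD=> //; last exact: itg_cst. by apply: itgD=> //; apply: itgZ=> //; apply: itgZ. Qed.
Let S_bound N x : good_path x -> `|S N.+1 x| <= C * (5 + 2 * c) + Bg * (q - p).
move=>gx; rewrite S_disc//; apply: (@disc_sum_bound _ _ _ _ _ _ _ _ _ pq T (kk ^~ x) (fun j=> bb j ^~ x) c (K p x))=> //.
- exact: gp_k.
- exact: gp_b.
- exact: gp_k0.
- exact: gp_kb.
- by move=>r pr; exact: Kgen_bound. Qed.
Let gpi N i : (i < N)%N -> [/\ p <= gp p q N i <= q, p <= gp p q N i.+1 <= q &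
  gp p q N i.+1 - gp p q N i = (q - p) / N%:R].
move=>iN; have N0 : (0 < N)%N by exact: leq_ltn_trans iN.
by split; [apply: gp_itv=> //; exact: ltnW|exact: gp_itv|exact: gpS]. Qed.
Let iX N (i : 'I_N) : itgT P (Xst (gp p q N i) (gp p q N i.+1)).
by have [a b _] := gpi (ltn_ord i); apply: itgB=> //; exact: iH. Qed.
Let iG N (i : 'I_N) : itgT P (fun x=> K (gp p q N i) x * cellgen (gp p q N i) x).
have [a b _] := gpi (ltn_ord i); apply: (P_itg_bounded _ (mgen a))=> x; exact: Kgen_bound. Qed.
Let iS N : itgT P (S N).
apply: itgD=> //; last by apply: itg_sum=> // i _; apply: itgZ=> //; exact: iG.
apply: itgB=> //; first by apply: itgB=> //; exact: iHs. by apply: itg_sum=> // i _; exact: iX. Qed.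
Let D := \int[P]_x cellH q x - \int[P]_x cellH p x.

Let S_mean N : \int[P]_x S N x = D - \sum_(i < N) (\int[P]_x Xst (gp p q N i) (gp p q N i.+1) x
  - (q - p) / N%:R * \int[P]_x (K (gp p q N i) x * cellgen (gp p q N i) x)).
have i1 : itgT P (fun x=> cellH q x - cellH p x) by apply: itgB=> //; exact: iHs.
have i2 : itgT P (fun x=> \sum_(i < N) Xst (gp p q N i) (gp p q N i.+1) x). by apply: itg_sum=> // i _; exact: iX.
have i3 : itgT P (fun x=> \sum_(i < N) (q - p) / N%:R * (K (gp p q N i) x * cellgen (gp p q N i) x)).
by apply: itg_sum=> // i _; apply: itgZ=> //; exact: iG. rewrite /S RintegralD//; last exact: itgB.
rewrite RintegralB// RintegralB//; [|exact: iHs|exact: iHs]. rewrite !Rint_sum//; last first.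
by move=>i _; apply: itgZ=> //; exact: iG. rewrite -/D sumrB opprB [RHS]addrA [RHS]addrAC; congr (_ + _).
by apply: eq_bigr=> i _; rewrite RintegralZl//; exact: iG. Qed.

(** Two limits of the mean of S are compared. Pathwise, S converges boundedly to the integral of
    [cellTheta]. In mean, S differs from D by N one-step errors of the form [eps * h + A * h ^+ 2],
    hence by as little as desired. *)
Lemma cell_mean : [/\ itgT P (fun x=> int p q (cellTheta ^~ x)), {ae P, forall x, itgi p q (cellTheta ^~ x)},
  {ae P, forall x, `|int p q (cellTheta ^~ x)| <= C * (5 + 2 * c) + Bg * (q - p)} &
  \int[P]_x cellH q x - \int[P]_x cellH p x = \int[P]_x int p q (cellTheta ^~ x)].
have HS : {ae P, forall x, (forall N, `|S N.+1 x| <= C * (5 + 2 * c) + Bg * (q - p)) /\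
S N.+1 x @[N --> \oo] --> int p q (cellTheta ^~ x)}.
by apply: filterS good=> x gx; split=> [N|]; [exact: S_bound|exact: Theta_lim].
have [iT mT bT lT] := bdct cP (fun N=> measurable_itg (iS N.+1)) HS. split=> //.
apply: filterS good=> x gx; exact: Theta_itg. rewrite -/D.
suff : \int[P]_x S N.+1 x @[N --> \oo] --> D by move/(cvg_lim (@Rhausdorff R))=> <-; exact: cvg_lim lT.
(* L and Q come from summing the two error terms of [step] over the grid: the choice [e / 2 / L]
   makes the first sum at most e / 2, and the second is Q / N. *)
apply/cvgrPdist_le=> e e0. pose L := (d%:R + M) * (q - p) + 1. have L0 : 0 < L.
by apply: ltr_wpDl=> //; apply: mulr_ge0; [exact: addr_ge0|rewrite subr_ge0 ltW].
have eL : 0 < e / 2 / L by rewrite !divr_gt0.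
have [A A0 RB] := @remainder_bound _ _ I _ _ _ _ _ _ _ T M (ltW pq) M0 _ eL.
pose Q := A * (3 * d%:R + M ^+ 2 + 1) * (q - p) ^+ 2. have Q0 : 0 <= Q.
by rewrite mulr_ge0 ?sqr_ge0// mulr_ge0// !addr_ge0// ?mulr_ge0// sqr_ge0.
have [n1 Hn1] := nat_large Q0 (divr_gt0 e0 (ltr0Sn R 1)). have qp0 : 0 <= q - p by rewrite subr_ge0 ltW.
have [n2 Hn2] := nat_large qp0 (@ltr01 R). near=> N0; rewrite S_mean opprB addrC subrK.
have n1N : (n1 <= N0)%N by near: N0; exact: nbhs_infty_ge. have n2N : (n2 <= N0)%N by near: N0; exact: nbhs_infty_ge.
pose N := N0.+1; have N0' : 0 < N%:R :> R by rewrite ltr0n. pose h := (q - p) / N%:R.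
have hh : h <= 1 by apply/ltW; exact: Hn2.
apply: (@le_trans _ _ (\sum_(i < N) (e / 2 / L * ((d%:R + M) * h) + A * ((3 * d%:R + M ^+ 2 + 1) * h ^+ 2)))).
apply: (le_trans (ler_norm_sum _ _ _)); apply: ler_sum=> i _. have [a b E] := gpi (ltn_ord i).
have hE : gp p q N i.+1 - gp p q N i = h by exact: E.
have lt : gp p q N i < gp p q N i.+1 by rewrite -subr_gt0 hE divr_gt0// subr_gt0.
have := @step (e / 2 / L) A (gp p q N i) (gp p q N i.+1) _ lt _ _ (ltW eL) A0 RB.
by rewrite hE; apply; [case/andP: a|case/andP: b|]. rewrite sumr_const card_ord -[X in X <= _]mulr_natl mulrDr.
have Nh : N%:R * h = q - p by rewrite /h mulrC divfK// gt_eqF.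
have -> : N%:R * (e / 2 / L * ((d%:R + M) * h)) = e / 2 / L * ((d%:R + M) * (q - p)) by rewrite -Nh; ring.
have -> : N%:R * (A * ((3 * d%:R + M ^+ 2 + 1) * h ^+ 2)) = Q / N%:R. by rewrite /Q -Nh; field; rewrite gt_eqF.
have : Q / N%:R < e / 2 by exact: Hn1. have : e / 2 / L * ((d%:R + M) * (q - p)) <= e / 2.
rewrite -mulrA; apply: ler_piMr; first by apply: divr_ge0=> //; exact: ltW.
by rewrite mulrC ler_pdivrMr// mul1r /L lerDl. lra.
Unshelve. all: by end_near. Qed.

End Cell.

Lemma ae_imp {dT} {T : measurableType dT} {R : realType} (mu : {measure set T -> \bar R})
  (A B : T -> Prop) : (forall x, A x -> B x) -> {ae mu, forall x, A x} -> {ae mu, forall x, B x}.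
by move=>AB; apply: negligibleS=> x /= nB a; apply: nB; exact: AB. Qed.

Lemma fin_bound {R : realType} {I : finType} {Om : Type} (f : I -> Om -> R) :
  (forall i, exists C, forall w, `|f i w| <= C) -> exists2 C, 0 <= C & forall i w, `|f i w| <= C.
move=> /boolp.choice[C HC]; exists (\sum_i `|C i|); first by apply: sumr_ge0.
move=>i w; apply: (le_trans (HC i w)); rewrite (bigD1 i)//=.
by apply: (le_trans (ler_norm _)); rewrite lerDl sumr_ge0. Qed.

Lemma sum_bound {R : realType} {I : finType} {Om : Type} (f : I -> Om -> R) :
  (forall i, exists C, forall w, `|f i w| <= C) -> exists C, forall w, `|\sum_i f i w| <= C.
move=> /fin_bound[C C0 HC]; exists (\sum_(i : I) C)=> w.
by apply: (le_trans (ler_norm_sum _ _ _)); exact: ler_sum. Qed.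

Lemma rcont_coord {R : realType} {d} (p q : R) (y : R -> 'rV[R]_d) :
  (forall i, rcont p q ((fun s=> y s ord0 i) : R -> R^o)) -> rcont p q y.
move=>H; apply/rcontP=> r pr e e0; have e2 : 0 < e / 2 by rewrite divr_gt0.
have [del del0 D] := @finite_pos_min R 'I_d (fun j del=> forall s, r < s -> s < r + del ->
`|y r ord0 j - y s ord0 j| < e / 2) (fun i a b a0 ab Hb s rs sa=> Hb s rs (lt_le_trans sa (lerD (lexx r) ab)))
(fun j=> (rcontP _ _ _).1 (H j) r pr _ e2).
exists del=> // s rs sd; apply: (@le_lt_trans _ _ (e / 2)); last by rewrite ltr_pdivrMr// ltr_pMr// ltr1n.
apply: norm_le_coord; first exact: ltW. by move=>j; rewrite !mxE ltW// D. Qed.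

(** Makes the later induction on interval end points decrease: r is counted by b and not by a. *)
Lemma count_lt {T : eqType} (a b : pred T) (s : seq T) r : (forall x, a x -> b x) -> r \in s ->
  ~~ a r -> b r -> (seq.count a s < seq.count b s)%N.
move=>ab rs nar br; elim: s rs=> //= y s IH; rewrite inE=> /orP[/eqP <-|/IH lt].
rewrite (negbTE nar) br add0n add1n ltnS; exact: sub_count.
rewrite -addnS leq_add//; by have := ab y; case: (a y)=> // ->. Qed.

(** Elementary integrands live on intervals open on the left, so on a suitable cell they are
    constant except possibly at its left end. *)
Lemma itg_eq_oc {R : realType} (p q : R) (f g : R -> R) : (forall r, p < r <= q -> f r = g r) ->
  itgi p q f -> itgi p q g /\ int p q f = int p q g.
move=>fg fi; have mf : measurable_fun `]p, q] f by apply/measurable_fun_itv_obnd_cbndP; exact: itg_meas.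
have mgo : measurable_fun `]p, q] g. apply: (eq_measurable_fun f) mf=> r; rewrite inE/= in_itv/=; exact: fg.
have E (h : R -> R -> \bar R) : (\int[Leb]_(r in `]p, q]) h r (f r) = \int[Leb]_(r in `]p, q]) h r (g r))%E.
by apply: eq_integral=> r; rewrite inE/= in_itv/= => pr; rewrite fg.
have mg : measi p q g by exact/measurable_fun_itv_obnd_cbndP. split. apply/integrableP; split; first exact/measEFin.
have /integrableP[_] := fi; congr (_ < _)%E. rewrite -!integral_itv_obnd_cbnd; [exact: (E (fun _ y=> `|y%:E|%E))| |].
by apply: meas_comp=> //; exact/measEFin. by apply: meas_comp=> //; exact/measEFin.
rewrite /int /Rintegral -!integral_itv_obnd_cbnd; [|exact/measEFin|exact/measEFin].
by congr fine; exact: (E (fun _ y=> y%:E)). Qed.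

Lemma itg_union {R : realType} (p r q : R) (f : R -> R) : p <= r -> r <= q -> itgi p r f -> itgi r q f -> itgi p q f.
move=>pr rq f1 f2. have sE : `[p, q]%classic = (`[p, r[%classic `|` `[r, q]%classic : set R).
by rewrite (@itv_bndbnd_setU _ _ _ (BLeft r)) ?bnd_simp.
have f1o : measurable_fun `[p, r[ f by apply/measurable_fun_itv_bndo_bndcP; exact: itg_meas. have mf : measi p q f.
by rewrite sE; apply/measurable_funU=> //; split=> //; exact: itg_meas.
have ma (D : set R) : measurable_fun D f -> measurable_fun D (fun x=> `|(f x)%:E|%E).
by move=>mD; apply: meas_comp=> //; exact/measEFin. apply/integrableP; split; first exact/measEFin.
have [/integrableP[_ l1] /integrableP[_ l2]] := (f1, f2). rewrite /= sE ge0_integral_setU//.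
- apply: lte_add_pinfty; last exact: l2. by rewrite integral_itv_bndo_bndc; [exact: l1|exact: ma].
- by rewrite -sE; exact: ma.
- apply/disj_setPS=> x [/=]; rewrite !in_itv/= => /andP[_ xr] /andP[rx _]. by have := lt_le_trans xr rx; rewrite ltxx.
Qed.

(** Continuity from above: the products of A with ]r, r + delta] decrease to the empty set and have
    finite measure. *)
Lemma measure_rcont {R : realType} {dU} {U : measurableType dU}
  (N : {measure set (U * mR R) -> \bar R}) (A : set U) (p q : R) : measurable A -> (N (A `*` `]p, q]) < +oo)%E ->
  rcont p q ((fun s=> fine (N (A `*` `]p, s]))) : R -> R^o).
move=>mA Nfin; apply/rcontP=> r /andP[pr rq] e e0.
have mX a b : measurable (A `*` `]a, b] : set (U * mR R)) by exact: measurableX.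
have sub (a b a' b' : R) : a' <= a -> b <= b' -> (A `*` `]a, b] : set (U * mR R)) `<=` A `*` `]a', b'].
move=>aa bb' [u v] [/= Au]; rewrite !in_itv/= => /andP[av vb]; split=> //.
by rewrite (le_lt_trans aa av) (le_trans vb bb').
have leN a b : p <= a -> b <= q -> (N (A `*` `]a, b]) <= N (A `*` `]p, q]))%E.
by move=>pa bq; apply: le_measure; rewrite ?inE//; exact: sub. pose b n := r + (q - r) / n.+1%:R.
have qr0 : 0 < q - r by rewrite subr_gt0. have bq n : b n <= q.
rewrite /b -lerBrDl ler_pdivrMr// ler_peMr ?ler1n// ltW//.
have cv : N (A `*` `]r, b n]) @[n --> \oo] --> (0 : \bar R)%E. have -> : 0%E = N (\bigcap_n (A `*` `]r, b n])).
rewrite (_ : \bigcap_n _ = set0) ?measure0//; apply/seteqP; split=> // -[u v] H.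
have [/= Au] := H 0%N Logic.I; rewrite in_itv/= => /andP[rv _].
have [n0 Hn0] := nat_large (ltW qr0) (e := v - r) ltac:(by rewrite subr_gt0).
have [/= _] := H n0 Logic.I; rewrite in_itv/= => /andP[_]; rewrite /b -lerBlDl leNgt. by rewrite Hn0.
apply: nonincreasing_cvg_mu=> //.
- by apply: le_lt_trans Nfin; exact: leN.
- exact: bigcap_measurable.
- move=>n m nm; apply/subsetPset; apply: sub=> //; rewrite /b lerD2l. apply: ler_wpM2l; first exact: ltW.
by rewrite lef_pV2 ?posrE// ler_nat. have fN n : N (A `*` `]r, b n]) \is a fin_num.
by rewrite ge0_fin_numE//; apply: le_lt_trans Nfin; exact: leN.
have [n0 Hn0] : exists n, fine (N (A `*` `]r, b n])) < e. have /fine_cvgP[_ /cvgrPdist_lt /(_ e e0)] := cv.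
move=> [n0 _ /(_ n0 (leqnn n0))] /=; rewrite sub0r normrN ger0_norm ?fine_ge0// => H. by exists n0.
exists ((q - r) / n0.+1%:R); first by rewrite divr_gt0.
move=>s rs sb; have sq : s <= q by apply: le_trans (ltW sb) (bq n0).
have -> : A `*` `]p, s] = (A `*` `]p, r]) `|` (A `*` `]r, s]) :> set (U * mR R).
apply/seteqP; split=> [[u v]|[u v]] /=; rewrite !in_itv/=.
move=> [Au /andP[pv vs]]; have [vr|rv] := leP v r; first by left; rewrite pv. by right; rewrite vs.
move=> [[Au /andP[pv vr]]|[Au /andP[rv vs]]]; split=> //. by rewrite pv (le_trans vr (ltW rs)).
by rewrite vs (le_lt_trans pr rv). have fin a b' : p <= a -> b' <= q -> N (A `*` `]a, b']) \is a fin_num.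
by move=>pa bq'; rewrite ge0_fin_numE//; apply: le_lt_trans Nfin; exact: leN. rewrite measureU//; last first.
apply/seteqP; split=> // -[u v] [/= [_]]; rewrite !in_itv/= => /andP[_ vr] [_ /andP[rv _]].
by have := lt_le_trans rv vr; rewrite ltxx. rewrite fineD; [|exact: fin (lexx p) (ltW rq)|exact: fin pr sq].
rewrite opprD addrA subrr sub0r normrN ger0_norm ?fine_ge0//.
apply: le_lt_trans Hn0; apply: fine_le=> //; first exact: fin pr sq.
by apply: le_measure; rewrite ?inE//; apply: sub=> //; exact: ltW. Qed.

(** * The formula for elementary integrands *)

Section ElementaryFormula.
Context {R : realType} {dO : measure_display} {Om : measurableType dO} (P : probability Om R) (F : R -> set (set Om)) (uF :
  usual_filtration P F) {d} (W : R -> Om -> 'rV[R]_d) (BW : brownian_motion P F W) {dU} {U : measurableType dU} (M :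
  {sigma_finite_measure set U -> \bar R}) (N : Om -> {measure set (U * mR R) -> \bar R}) (prm : poisson_random_measure
  P M N) (adN : adapted_random_measure P F N) (t0 T1 : R) (t00 : 0 <= t0) (tT : t0 <= T1).

Lemma usual_complete (A : set Om) : P.-negligible A -> measurable A.
by move=>nA; have [_ F0] := uF.1 0 (lexx 0); apply: F0; exact: uF.2.2.2. Qed.

Definition dflt_e : @elementary R dO Om := Elementary 0 0 (cst 0).

Definition dflt_m : @marked R dO Om dU U := Marked dflt_e set0.

Section OneElementary.
Context (p q : R) (tp : t0 <= p) (pq : p < q) (qT : q <= T1).

(** With both end points off the open interval, the indicator of ]start, stop] is constant on ]p,
    q]. *)
Definition nobreak (e : @elementary R dO Om) := (stop e <= p \/ q <= stop e) /\ (start e <= p \/ q <= start e).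

Definition active (e : @elementary R dO Om) : bool := (start e <= p) && (q <= stop e).

Lemma active_indic e r : nobreak e -> p < r <= q -> \1_(`]start e, stop e]) r = (active e)%:R :> R.
move=> [Hs Ht] /andP[pr rq]; rewrite indicE /active.
have [sp|ps] := leP (start e) p; have [qs|sq] := leP q (stop e)=> /=.
- by rewrite mem_set//= in_itv/= (le_lt_trans sp pr) (le_trans rq qs).
- rewrite memNset//= in_itv/= => /andP[_ rs]; case: Hs=> [sp'|qs]; last by move: sq; rewrite ltNge qs.
by have := lt_le_trans pr (le_trans rs sp'); rewrite ltxx.
- rewrite memNset//= in_itv/= => /andP[sr _]; case: Ht=> [sp'|qs']; first by move: ps; rewrite ltNge sp'.
by have := lt_le_trans sr (le_trans rq qs'); rewrite ltxx.
- rewrite memNset//= in_itv/= => /andP[sr _]; case: Ht=> [sp'|qs']; first by move: ps; rewrite ltNge sp'.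
by have := lt_le_trans sr (le_trans rq qs'); rewrite ltxx. Qed.

(* Clipping the endpoints at s: only active intervals move between s and s'. *)
Lemma active_clip (G : R -> R -> R) e s s' : nobreak e -> start e <= stop e ->
  p <= s -> s <= s' -> s' <= q -> G s s = 0 -> G s' s' = 0 ->
  (start e <= p -> q <= stop e -> G (start e) s' - G (start e) s = G s s') ->
  G (minr (start e) s') (minr (stop e) s') - G (minr (start e) s) (minr (stop e) s) = (active e)%:R * G s s'.
move=> [Hs Ht] st ps ss' s'q G0 G1 GE; rewrite /active. have [sp|ps1] := leP (start e) p; last first.
case: Ht=> [|qs]; first by rewrite leNgt ps1. have sq := le_trans ss' s'q. rewrite !min_r ?G0 ?G1 ?subrr ?mul0r//.
- exact: le_trans sq (le_trans qs st).
- exact: le_trans sq qs.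
- exact: le_trans s'q (le_trans qs st).
- exact: le_trans s'q qs. have ss1 : start e <= s by exact: le_trans ps.
rewrite (min_l ss1) (min_l (le_trans ss1 ss')). have [qs|sq] := leP q (stop e)=> /=.
by rewrite mul1r !min_r ?GE// ?(le_trans s'q)// (le_trans (le_trans ss' s'q)).
case: Hs=> [sp'|]; last by rewrite leNgt sq. by rewrite !min_l ?subrr ?mul0r// (le_trans sp')// (le_trans ps). Qed.

Lemma elementary_val_active (S : seq (@elementary R dO Om)) r w :
  (forall l, (l < size S)%N -> nobreak (nth dflt_e S l)) -> p < r <= q ->
  elementary_val S r w = \sum_(e <- S) coef e w * (active e)%:R.
move=>nb pr; rewrite /elementary_val !(big_nth dflt_e) !big_mkord; apply: eq_bigr=> l _.
by rewrite (active_indic (nb l (ltn_ord l)) pr). Qed.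

Lemma elementary_int_active B (S : seq (@elementary R dO Om)) s s' w :
  (forall l, (l < size S)%N -> nobreak (nth dflt_e S l)) ->
  (forall l, (l < size S)%N -> start (nth dflt_e S l) <= stop (nth dflt_e S l)) -> p <= s -> s <= s' -> s' <= q ->
  elementary_int B S s' w - elementary_int B S s w = (\sum_(e <- S) coef e w * (active e)%:R) * (B s' w - B s w).
move=>nb st ps ss' s'q; rewrite /elementary_int !(big_nth dflt_e) !big_mkord -sumrB mulr_suml.
apply: eq_bigr=> l _; rewrite -mulrBr -mulrA; congr (_ * _).
apply: (active_clip (G := fun a b=> B b w - B a w))=> //; rewrite ?subrr//.
- exact: nb.
- exact: st.
- by move=> *; rewrite opprB addrA subrK. Qed.

(** The counted interval is split at s, and [fine] is additive only on finite counts; this is the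
    purpose of the last premise. *)
Lemma compensated_active (A : set U) e s s' w : measurable A -> nobreak e ->
  t0 <= start e -> start e <= stop e -> p <= s -> s <= s' -> s' <= q -> (N w (A `*` `]t0, T1]) < +oo)%E ->
  compensated M N A (minr (start e) s') (minr (stop e) s') w
  - compensated M N A (minr (start e) s) (minr (stop e) s) w = (active e)%:R * compensated M N A s s' w.
move=>mA nb te st ps ss' s'q Nfin. have fin a b : t0 <= a -> b <= T1 -> N w (A `*` `]a, b]) \is a fin_num.
move=>ta bT; rewrite ge0_fin_numE//; apply: le_lt_trans Nfin; apply: le_measure; rewrite ?inE.
- exact: measurableX.
- exact: measurableX.
- move=> [u r] [/= Au]; rewrite !in_itv/= => /andP[ar rb]; split=> //.
by rewrite (le_lt_trans ta ar) (le_trans rb bT). have C0 a : compensated M N A a a w = 0.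
by rewrite /compensated subrr mulr0 subr0 set_itv_ge ?bnd_simp ?ltxx// setX0 measure0.
apply: (active_clip (G := fun a b=> compensated M N A a b w))=> // sp qs; rewrite /compensated.
have sT : s' <= T1 by exact: le_trans qT.
have -> : A `*` `]start e, s'] = (A `*` `]start e, s]) `|` (A `*` `]s, s']) :> set (U * mR R).
apply/seteqP; split=> [[u r]|[u r]] /=; rewrite !in_itv/=.
move=> [Au /andP[er rs']]; have [rs|sr] := leP r s; first by left; rewrite er. by right; rewrite rs'.
move=> [[Au /andP[er rs]]|[Au /andP[sr rs']]]; split=> //. by rewrite er (le_trans rs ss').
by rewrite rs' (le_lt_trans (le_trans sp ps) sr). rewrite measureU//.
- rewrite fineD; [|exact: (fin _ _ te (le_trans ss' sT))|exact: (fin _ _ (le_trans tp ps) sT)].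
by move: (fine _) (fine _) (fine _)=> a b m; ring.
- exact: measurableX.
- exact: measurableX.
- apply/seteqP; split=> // -[u r] [/= [_]]; rewrite !in_itv/= => /andP[_ rs] [_ /andP[sr _]].
by have := lt_le_trans sr rs; rewrite ltxx. Qed.

End OneElementary.

Context (phi phit : sfun R d) (phi1 : 'I_d -> sfun R d) (phi2 : 'I_d -> 'I_d -> sfun R d) (C c : R) (T : test t0 T1
  phi phit phi1 phi2 C) (c0 : 0 <= c) (x0 : 'rV[R]_d) (SW : 'I_d -> 'I_d -> seq (@elementary R dO Om)) (SN : 'I_d ->
  seq (@marked R dO Om dU U)) (okW : forall i j l, (l < size (SW i j))%N -> elementary_ok F t0 (nth dflt_e (SW i j)
  l)) (okN : forall i l, (l < size (SN i))%N -> marked_ok F M t0 (nth dflt_m (SN i) l)) (kk : R -> Om -> R) (bb : 'I_d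
  -> R -> Om -> R) (kk0 : forall r x, 0 <= kk r x).

Definition Kp s x := expR (- int t0 s (kk ^~ x)).

Definition betap s x : 'rV[R]_d := \row_j int t0 s (bb j ^~ x).
Context (mKp : forall s, t0 <= s <= T1 -> meas_wrt (F s) (Kp s)) (mbetap : forall s, t0 <= s <= T1 -> meas_wrt (F s)
  (betap s : Om -> borelRd R d)) (good : {ae P, forall x, [/\ itgi t0 T1 (kk ^~ x), forall j, itgi t0 T1 (bb j ^~ x) &
  forall r, t0 <= r <= T1 -> 1 + \sum_j `|bb j r x| <= c * kk r x]}).

(** Starting point and noise only. The drift [betap] is kept apart because it is moved pathwise. *)
Definition Yp s x : 'rV[R]_d := \row_i (x0 ord0 i
  + \sum_j elementary_int (fun r w=> W r w ord0 j) (SW i j) s x + marked_int M N (SN i) s x).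

Definition zp s x := betap s x + Yp s x.

Definition jump_term r (z y : 'rV[R]_d) := phi r (z + y) - phi r z - \sum_i phi1 i r z * y ord0 i.

Definition genp r x := 2^-1 * (\sum_i \sum_k phi2 i k r (zp r x) *
  (\sum_j elementary_val (SW i j) r x * elementary_val (SW k j) r x))
  + \int[M]_u jump_term r (zp r x) (\row_i marked_val (SN i) r x u).

Definition Thetap r x := Kp r x * (phit r (zp r x) + \sum_j bb j r x * phi1 j r (zp r x)
  - kk r x * phi r (zp r x)) + Kp r x * genp r x.

Definition Hp s x := Kp s x * phi s (zp s x).

(** All marked intervals of all coordinates, so that one family of atoms serves the d components of
    a jump at once. *)
Let J : finType := {i : 'I_d & 'I_(size (SN i))}.
Let eN (j : J) := nth dflt_m (SN (tag j)) (tagged j).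
Let mk (j : J) := mark (eN j).
Let okJ (j : J) : marked_ok F M t0 (eN j). Proof. exact: okN. Qed.
Let mmk j : measurable (mk j). Proof. by have [] := okJ j. Qed.
Let mkfin j : (M (mk j) < +oo)%E. Proof. by have [] := okJ j. Qed.
Let Fmono s s' : 0 <= s -> s <= s' -> F s `<=` F s'. Proof. exact: uF.2.1. Qed.
Let sF s : t0 <= s <= T1 -> sigma_algebra setT (F s).
by move=> /andP[ts _]; have [] := uF.1 s (le_trans t00 ts). Qed.
Let Fm s : t0 <= s <= T1 -> F s `<=` measurable.
by move=> /andP[ts _]; have [] := uF.1 s (le_trans t00 ts). Qed.
Let coef_meas e s : elementary_ok F t0 e -> start e <= s -> meas_wrt (F s) (coef e).
move=> [te _ [_ me]] es B mB; apply: Fmono es _ _=> //; last exact: me. exact: le_trans te. Qed.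
Let Nfin : {ae P, forall x, forall j, (N x (mk j `*` `]t0, T1]) < +oo)%E}.
have H (j : J) : {ae P, forall x, (N x (mk j `*` `]t0, T1]) < +oo)%E}.
have T10 : 0 <= T1 by exact: le_trans tT. apply: (N_fin_ae uF prm adN T10). split; first exact: measurableX.
move=> [u r] [/= _]; rewrite !in_itv/= => /andP[tr ->]; rewrite andbT. by rewrite ltW// (le_lt_trans t00 tr).
rewrite mean_measureX//; apply: lte_mul_pinfty; rewrite ?ltry// ge0_fin_numE//; exact: mkfin.
have : {ae P, forall x, forall j, j \in enum J -> (N x (mk j `*` `]t0, T1]) < +oo)%E}.
elim: (enum J)=> [|j l IH]; first by apply: aeW.
apply: filterS2 IH (H j)=> x IHx Hx i; rewrite inE=> /orP[/eqP ->//|]; exact: IHx.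
by apply: filterS=> x Hx j; apply: Hx; rewrite mem_enum. Qed.
Let mYp s : t0 <= s <= T1 -> meas_wrt (F s) (Yp s : Om -> borelRd R d).
move=>ts; apply/(meas_wrt_subalg (sF ts)); have s0 : 0 <= s by case/andP: ts=> /(le_trans t00).
have sFs := sF ts. have sub (f : Om -> R) r : t0 <= r -> r <= s -> meas_wrt (F r) f -> meas (f : subalg (F s) -> R).
move=>tr rs mf; apply/(meas_wrt_subalg sFs)=> B mB; apply: Fmono rs _ _; last exact: mf. exact: le_trans tr.
have mW r j : t0 <= r -> r <= s -> meas ((fun w=> W r w ord0 j) : subalg (F s) -> R).
move=>tr rs; apply: (sub _ r)=> // B mB. have mj := borelRd_coord j measurableT mB; rewrite setTI in mj.
exact: (BW.1 r (le_trans t00 tr) _ mj). apply: borelRd_measurable=> i; under eq_fun do rewrite mxE.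
apply: measD; first apply: measD=> //. apply: meas_sum=> j; rewrite /elementary_int.
under eq_fun do rewrite (big_nth dflt_e) big_mkord. apply: meas_sum=> l; set e := nth _ _ _.
(* For an interval starting after s both clipped end points equal s and the term is zero, so a
   coefficient that is not yet known at s does not enter. *)
have [te se me] := okW (ltn_ord l); rewrite -/e in te se me. have [es|se'] := leP (start e) s. apply: measM.
by apply: (sub _ (start e))=> //; apply: coef_meas=> //; exact: okW.
apply: measB; apply: mW; rewrite ?ge_min ?lexx ?orbT// le_min. by rewrite (le_trans te se); case/andP: ts.
rewrite (_ : (fun _=> _) = cst 0)//; apply/funext=> w. by rewrite min_r ?subrr ?mulr0// (le_trans (ltW se')).
rewrite /marked_int; under eq_fun do rewrite (big_nth dflt_m) big_mkord. apply: meas_sum=> l; set e := nth _ _ _.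
have [[te se me] mke fke] := okN (ltn_ord l); rewrite -/e in te se me mke fke.
have [es|se'] := leP (start (base e)) s. apply: measM. by apply: (sub _ (start (base e)))=> //; apply: coef_meas.
apply: measB=> //.
have mN : meas ((fun w=> N w (mark e `*` `]start (base e), minr (stop (base e)) s])) : subalg (F s) -> \bar R).
apply/(meas_wrt_subalg sFs); apply: adN.1=> //; split; first exact: measurableX.
move=> [u r] [/= _]; rewrite !in_itv/= le_min=> /andP[er /andP[_ rs]].
by rewrite rs andbT ltW// (le_lt_trans (le_trans t00 te) er).
exact: (meas_comp (@fine_measurable R _ measurableT) mN). rewrite (_ : (fun _=> _) = cst 0)//; apply/funext=> w.
by rewrite min_r ?(le_trans (ltW se'))// /compensated subrr mulr0 subr0 set_itv_ge ?bnd_simp ?ltxx// setX0 measure0 mulr0.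
Qed.
Let zp_E s x : zp s x = betap s x + Yp s x. Proof. by []. Qed.
Let Kp01 s x : 0 <= Kp s x <= 1.
rewrite expR_ge0/= /Kp; apply: expRN_ge0_le1; apply: int_ge0=> r _; exact: kk0. Qed.

Section CellFormula.
Context (p q : R) (tp : t0 <= p) (pq : p < q) (qT : q <= T1) (nbW : forall i j l, (l < size (SW i j))%N -> nobreak p q
  (nth dflt_e (SW i j) l)) (nbN : forall i l, (l < size (SN i))%N -> nobreak p q (base (nth dflt_m (SN i) l))).

Let sgc i j x := \sum_(e <- SW i j) coef e x * (active p q e)%:R.
Let gj (j : J) x := coef (base (eN j)) x * (active p q (base (eN j)))%:R.
(** The jump vector of an atom: coordinate i adds the coefficients of the active intervals whose
    mark contains the atom. *)
Let gc (al : {set J}) x : 'rV[R]_d := \row_i \sum_(l < size (SN i))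
  gj (Tagged (fun i=> 'I_(size (SN i))) l) x * (Tagged (fun i=> 'I_(size (SN i))) l \in al)%:R.
Let mu (al : {set J}) := fine (M (atom mk al)).

Let tpT r : p <= r <= q -> t0 <= r <= T1.
by move=> /andP[pr rq]; rewrite (le_trans tp pr) (le_trans rq qT). Qed.
Let pT : t0 <= p <= T1. Proof. by apply: tpT; rewrite lexx ltW. Qed.
Let coef_active_meas e : elementary_ok F t0 e -> meas_wrt (F p) (fun x=> coef e x * (active p q e)%:R).
move=>oe; apply/(meas_wrt_subalg (sF pT)); rewrite /active. have [ep|pe] := leP (start e) p=> /=.
by apply: measM=> //; apply/(meas_wrt_subalg (sF pT)); exact: coef_meas.
by rewrite (_ : (fun _=> _) = cst 0)//; apply/funext=> x; rewrite mulr0. Qed.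
Let coef_active_bd e : elementary_ok F t0 e -> exists C, forall x, `|coef e x * (active p q e)%:R| <= C.
move=> [_ _ [[C' HC] _]]; exists C'=> x; rewrite normrM; apply: le_trans (HC x).
by case: active; rewrite ?normr1 ?mulr1// normr0 mulr0. Qed.
Let msg i j : meas_wrt (F p) (sgc i j).
apply/(meas_wrt_subalg (sF pT)); rewrite /sgc; under eq_fun do rewrite (big_nth dflt_e) big_mkord.
apply: meas_sum=> l; apply/(meas_wrt_subalg (sF pT)); apply: coef_active_meas; exact: okW. Qed.
Let mgc a i : meas_wrt (F p) (fun x=> gc a x ord0 i).
apply/(meas_wrt_subalg (sF pT)); under eq_fun do rewrite mxE. apply: meas_sum=> l; apply: measM=> //.
apply/(meas_wrt_subalg (sF pT)); apply: coef_active_meas; by have [] := okJ (Tagged (fun i=> 'I_(size (SN i))) l).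
Qed.
Let bounds : exists2 B, 0 <= B & [/\ forall i j x, `|sgc i j x| <= B,
  forall a i x, `|gc a x ord0 i| <= B & \sum_a mu a <= B].
have [B1 B10 H1] := @fin_bound R ('I_d * 'I_d)%type Om (fun ij=> sgc ij.1 ij.2) (fun ij=> ltac:(
rewrite /sgc; under boolp.eq_exists=> C' do (under boolp.eq_forall=> w do rewrite (big_nth dflt_e) big_mkord);
apply: sum_bound=> l; apply: coef_active_bd; exact: okW)).
have [B2 B20 H2] := @fin_bound R ({set J} * 'I_d)%type Om (fun ai x=> gc ai.1 x ord0 ai.2) (fun ai=> ltac:(
under boolp.eq_exists=> C' do (under boolp.eq_forall=> w do rewrite mxE);
apply: sum_bound=> l; have [oe _ _] := okJ (Tagged (fun i=> 'I_(size (SN i))) l);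
have [C' HC] := coef_active_bd oe; exists C'=> x; rewrite normrM; apply: le_trans (HC x);
by case: (_ \in _); rewrite ?normr1 ?mulr1// normr0 mulr0)).
have m0 : 0 <= \sum_a mu a by apply: sumr_ge0=> a _; apply/fine_ge0.
exists (B1 + B2 + \sum_a mu a); first by rewrite !addr_ge0. split.
- by move=>i j x; apply: (le_trans (H1 (i, j) x)); rewrite -addrA lerDl addr_ge0.
- by move=>a i x; apply: (le_trans (H2 (a, i) x)); rewrite addrAC lerDr addr_ge0.
- by rewrite lerDr addr_ge0. Qed.
(** The compensated count of a mark is the sum over the atoms that it contains; exchanging the sums
    over marks and atoms produces the jump vectors [gc]. *)
Let Yp_incr x s t : (forall j, (N x (mk j `*` `]t0, T1]) < +oo)%E) -> p <= s -> s < t -> t <= q ->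
  Yp t x - Yp s x = incr (t - s) sgc gc mu (bm_incr W s t) (fun a=> count N (atom mk a `*` `]s, t])) x.
move=>Nx ps st tq; have ts := le_trans tp ps; have tT1 := le_trans tq qT.
apply/rowP=> i; rewrite /Yp /incr /dY !mxE.
have -> : x0 ord0 i + \sum_j elementary_int (fun r w=> W r w ord0 j) (SW i j) t x + marked_int M N (SN i) t x -
(x0 ord0 i + \sum_j elementary_int (fun r w=> W r w ord0 j) (SW i j) s x + marked_int M N (SN i) s x) =
\sum_j (elementary_int (fun r w=> W r w ord0 j) (SW i j) t x - elementary_int (fun r w=> W r w ord0 j) (SW i j) s x)
+ (marked_int M N (SN i) t x - marked_int M N (SN i) s x). by rewrite sumrB; ring. congr (_ + _).
apply: eq_bigr=> j _; rewrite (elementary_int_active (p := p) (q := q))//; last exact: ltW.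
- by move=>l; exact: nbW.
- by move=>l /(okW)[]. transitivity (\sum_(l < size (SN i)) gj (Tagged (fun i=> 'I_(size (SN i))) l) x *
\sum_(a : {set J} | Tagged (fun i=> 'I_(size (SN i))) l \in a) ((count N (atom mk a `*` `]s, t]) x)%:R - (t - s) * mu a)).
rewrite /marked_int !(big_nth dflt_m) !big_mkord -sumrB; apply: eq_bigr=> l _.
pose j : J := Tagged (fun i=> 'I_(size (SN i))) l. have [[te se _] mme _] := okJ j.
rewrite -mulrBr /gj -mulrA; congr (_ * _).
transitivity ((active p q (base (eN j)))%:R * compensated M N (mk j) s t x).
exact: (@compensated_active p q tp qT (mk j) (base (eN j)) s t x mme (nbN (ltn_ord l)) te se ps (ltW st) tq (Nx j)).
congr (_ * _); rewrite /compensated. have in0 a : in_time `[0, +oo[ (atom mk a `*` `]s, t]).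
apply: in_timeX; first exact: atom_measurable. move=>r /=; rewrite !in_itv/= andbT=> /andP[sr _].
by apply: ltW; apply: le_lt_trans sr; exact: le_trans t00 ts. have fN : N x (mk j `*` `]s, t]) \is a fin_num.
rewrite ge0_fin_numE//; apply: le_lt_trans (Nx j); apply: le_measure; rewrite ?inE.
- exact: measurableX.
- exact: measurableX.
- move=> [u r] [/= Au]; rewrite !in_itv/= => /andP[ar rb]; split=> //.
by rewrite (le_lt_trans ts ar) (le_trans rb tT1).
have -> : fine (N x (mk j `*` `]s, t])) = \sum_(a : {set J} | j \in a) (count N (atom mk a `*` `]s, t]) x)%:R.
rewrite (mark_atoms_measure mmk)// -sum_fine. by apply: eq_bigr=> a _; rewrite (countE prm).
move=>a ja; rewrite ge0_fin_numE//. have : (N x (mk j `*` `]s, t]) < +oo)%E by rewrite -ge0_fin_numE.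
apply: le_lt_trans; rewrite (mark_atoms_measure mmk)// (bigD1 a)//= leeDl// sume_ge0//.
have -> : fine (M (mk j)) = \sum_(a : {set J} | j \in a) mu a. rewrite {1}(mark_atoms mk j) measure_finType.
- rewrite [RHS]big_mkcond/= -sum_fine. by apply: eq_bigr=> a _; case: ifP=> // _; rewrite measure0.
move=>a _; case: ifP=> _; last by rewrite measure0. by rewrite ge0_fin_numE//; exact: atom_fin.
- by move=>a; case: ifP=> // _; exact: atom_measurable.
- apply/trivIsetP=> a a' _ _ aa'; have /trivIsetP/(_ a a' Logic.I Logic.I aa') E := @atom_trivIset _ U J mk.
case: ifP=> _; last by rewrite set0I. by case: ifP=> _; rewrite ?setI0. by rewrite sumrB mulrC -mulr_sumr.
under eq_bigr do rewrite mulr_sumr big_mkcond/=.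
rewrite exchange_big/=; apply: eq_bigr=> a _; rewrite mxE mulr_suml; apply: eq_bigr=> l _.
by case: ifP=> _; rewrite ?mulr1// mulr0 mul0r. Qed.

Lemma Yp_cell_rcont x : (forall j, (N x (mk j `*` `]t0, T1]) < +oo)%E) -> rcont p q (Yp ^~ x).
move=>Nx; apply: rcont_coord=> i. have rW j : rcont p q ((fun s=> W s x ord0 j) : R -> R^o).
apply/rcontP=> r /andP[pr rq] e e0; have r0 : 0 <= r by rewrite (le_trans t00)// (le_trans tp). have cW := BW.2.2.1 x.
have cr : W s x @[s --> within `[0, +oo[ (nbhs r)] --> W r x.
by move/subspace_continuousP : cW; apply; rewrite /= in_itv/= r0.
have : \forall s \near within `[0, +oo[ (nbhs r), `|W r x - W s x| < e. by move/cvgrPdist_lt : cr; apply.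
rewrite near_withinE=> /nbhs_ballP[del /= del0 H]; exists del=> // s rs sd.
have := H s; rewrite /ball/= distrC gtr0_norm ?subr_gt0// ltrBlDl=> /(_ sd).
rewrite in_itv/= andbT (le_trans r0 (ltW rs))=> /(_ isT).
by apply: le_lt_trans; have := le_coord_norm (W r x - W s x) j; rewrite !mxE.
have rM (l : 'I_(size (SN i))) : rcont p q ((fun s=> gj (Tagged (fun i=> 'I_(size (SN i))) l) x *
compensated M N (mk (Tagged (fun i=> 'I_(size (SN i))) l)) p s x) : R -> R^o).
move=>r pr; apply: cvgM; first exact: cvg_cst.
apply: cvgB; last by apply: cvgM; [exact: cvg_cst|apply: cvgB; [exact: cvg_at_right_filter cvg_id|exact: cvg_cst]].
apply: (measure_rcont (q := q))=> //.
apply: le_lt_trans (Nx (Tagged (fun i=> 'I_(size (SN i))) l)); apply: le_measure; rewrite ?inE.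
- exact: measurableX.
- exact: measurableX.
- move=> [u r'] [/= Au]; rewrite !in_itv/= => /andP[ar rb]; split=> //.
by rewrite (le_lt_trans tp ar) (le_trans rb qT).
(* On the cell Y is affine in the increments since p of W and of the compensated counts. *)
pose y s := Yp p x ord0 i + \sum_j sgc i j x * (W s x ord0 j - W p x ord0 j) +
\sum_(l < size (SN i)) gj (Tagged (fun i=> 'I_(size (SN i))) l) x *
compensated M N (mk (Tagged (fun i=> 'I_(size (SN i))) l)) p s x. have yE s : p <= s <= q -> Yp s x ord0 i = y s.
move=> /andP[ps sq]; rewrite /y /Yp !mxE. have -> : \sum_j sgc i j x * (W s x ord0 j - W p x ord0 j) =
\sum_j elementary_int (fun r w=> W r w ord0 j) (SW i j) s x - \sum_j elementary_int (fun r w=> W r w ord0 j) (SW i j) p x.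
rewrite -sumrB; apply: eq_bigr=> j _; rewrite (elementary_int_active (p := p) (q := q))//.
- by move=>l; exact: nbW.
- by move=>l /(okW)[]. suff -> : \sum_(l < size (SN i)) gj (Tagged (fun i=> 'I_(size (SN i))) l) x *
compensated M N (mk (Tagged (fun i=> 'I_(size (SN i))) l)) p s x =
marked_int M N (SN i) s x - marked_int M N (SN i) p x by ring.
rewrite /marked_int !(big_nth dflt_m) !big_mkord -sumrB; apply: eq_bigr=> l _.
pose j : J := Tagged (fun i=> 'I_(size (SN i))) l. have [[te se _] mme _] := okJ j.
rewrite -mulrBr /gj -mulrA; congr (_ * _).
exact/esym/(@compensated_active p q tp qT (mk j) (base (eN j)) p s x mme (nbN (ltn_ord l)) te se (lexx p) ps sq (Nx j)).
have ry : rcont p q (y : R -> R^o). move=>r pr; apply: cvgD; last by apply: cvg_bigsum=> l; exact: rM.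
apply: cvgD; first exact: cvg_cst. apply: cvg_bigsum=> j; apply: cvgM; first exact: cvg_cst.
by apply: cvgB; [exact: rW|exact: cvg_cst].
apply/rcontP=> r pr e e0; have [del del0 H] := (rcontP _ _ _).1 ry r pr e e0. have /andP[pr1 rq1] := pr.
exists (minr del (q - r)); first by rewrite lt_min del0 subr_gt0. move=>s rs; rewrite -ltrBlDl lt_min=> /andP[sd sq].
have ps' : p <= s <= q by rewrite (le_trans pr1 (ltW rs))/=; move: sq; rewrite ltrD2r=> /ltW.
rewrite !yE//; last by rewrite pr1 ltW. by apply: H=> //; rewrite -ltrBlDl. Qed.
Let marked_val_sig i r x u : p < r <= q -> marked_val (SN i) r x u = gc (signature mk u) x ord0 i.
move=>pr; rewrite mxE /marked_val !(big_nth dflt_m) big_mkord; apply: eq_bigr=> l _.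
pose j : J := Tagged (fun i=> 'I_(size (SN i))) l. rewrite (active_indic (nbN (ltn_ord l)) pr) /gj; congr (_ * _).
rewrite inE indicE; have [mu'|nmu] := pselect (mk j u). by rewrite mem_set//; case: asboolP.
by rewrite memNset//; case: asboolP. Qed.
Let genp_cell r x : p < r <= q -> genp r x = cgen phi phi1 phi2 r (zp r) sgc gc mu x.
move=>pr; rewrite /genp /cgen /gen; congr (_ + _).
congr (_ * _); apply: eq_bigr=> i _; apply: eq_bigr=> k _; congr (_ * _); apply: eq_bigr=> j _.
by rewrite !(elementary_val_active _ _ pr)// => l; exact: nbW.
have -> : (fun u=> jump_term r (zp r x) (\row_i marked_val (SN i) r x u)) =
(fun u=> (fun a=> jump_term r (zp r x) (gc a x)) (signature mk u)).
apply/funext=> u; congr (jump_term _ _ _); apply/rowP=> i; rewrite mxE. exact: marked_val_sig.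
have [||_ ->] := @Rint_atoms _ U R J mk mmk M (fun a=> jump_term r (zp r x) (gc a x))=> //.
rewrite /jump_term; have -> : gc finset.set0 x = 0. by apply/rowP=> i; rewrite !mxE big1// => l _; rewrite inE mulr0.
by rewrite addr0 subrr sub0r big1 ?oppr0// => i _; rewrite mxE mulr0. Qed.

(** [cell_mean] with the atoms as marks. Its drift agrees with [Thetap] on ]p, q] only, which
    [itg_eq_oc] allows for. *)
Lemma cell_formula : [/\ itgT P (fun x=> int p q (Thetap ^~ x)), {ae P, forall x, itgi p q (Thetap ^~ x)} &
  \int[P]_x Hp q x - \int[P]_x Hp p x = \int[P]_x int p q (Thetap ^~ x)].
have [B B0 [sgB gB muB]] := bounds. have sub_itg f : itgi t0 T1 f -> itgi p q f by exact: itg_sub.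
have [] := @cell_mean R dO Om P usual_complete d {set J} p q phi phit phi1 phi2 C c B pq
(test_sub tp qT T) F (fun s ps=> sF (tpT ps)) (fun s ps=> Fm (tpT ps)) _
(fun s t j=> bm_incr W s t j) (fun s t a=> count N (atom mk a `*` `]s, t])) mu _
sgc gc msg mgc sgB gB _ muB B0 c0 Kp betap Yp zp kk bb zp_E
(fun s ps=> mKp (tpT ps)) (fun s ps=> mbetap (tpT ps)) (fun s ps=> mYp (tpT ps)) Kp01 _.
- by move=>s /andP[ps _]; apply: Fmono=> //; exact: le_trans tp.
- move=>s t ps st tq; apply: (levy_increments uF BW prm adN)=> //.
+ by move=>a; exact: atom_measurable.
+ by move=>a; exact: atom_fin.
+ exact: atom_trivIset.
+ by rewrite (le_trans t00)// (le_trans tp).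
- by move=>a; apply/fine_ge0.
- apply: filterS2 good Nfin=> x [ki bi kb] Nx; split.
+ exact: sub_itg.
+ by move=>j; exact: sub_itg.
+ by [].
+ by move=>r /tpT; exact: kb.
+ move=>r /andP[pr rq]; rewrite /Kp /expint -expRD -opprD -int_split//. by apply: itg_sub ki=> //; exact: le_trans qT.
+ move=>r /andP[pr rq]; apply/rowP=> j; rewrite !mxE -int_split//. by apply: itg_sub (bi j)=> //; exact: le_trans qT.
+ exact: Yp_cell_rcont.
+ by move=>s t ps st tq; exact: Yp_incr. set Th := cellTheta _ _ _ _ _ _ _ _ _ _ _=> i1 i2 _ eH.
have E x r : p < r <= q -> Thetap r x = Th r x. by move=>pr; rewrite /Thetap genp_cell.
have E2 : {ae P, forall x, itgi p q (Thetap ^~ x) /\ int p q (Th ^~ x) = int p q (Thetap ^~ x)}.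
by apply: filterS i2=> x; apply: itg_eq_oc=> r pr; exact/esym/E. have mT : meas (fun x=> int p q (Thetap ^~ x)).
by apply: (ae_measurable usual_complete (measurable_itg i1)); apply: filterS E2=> x [_ ->].
have [i3 e3] : itgT P (fun x=> int p q (Thetap ^~ x)) /\
\int[P]_x int p q (Thetap ^~ x) = \int[P]_x int p q (Th ^~ x). by apply: ae_eq_itg=> //; apply: filterS E2=> x [_ ->].
split; [exact: i3|by apply: filterS E2=> x []|by rewrite e3]. Qed.

End CellFormula.
Let EW : finType := {ij : 'I_d * 'I_d & 'I_(size (SW ij.1 ij.2))}.
Let ends (i : (EW + J) * bool) : R := let e := match i.1 with | inl w=> nth dflt_e (SW (tag w).1 (tag w).2) (tagged w)
  | inr j=> base (eN j) end in if i.2 then start e else stop e.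
Let inside p q (r : R) := p < r < q.

Let count_split p r q : r \in codom ends -> p < r < q ->
  (seq.count (inside p r) (codom ends) < seq.count (inside p q) (codom ends))%N /\
  (seq.count (inside r q) (codom ends) < seq.count (inside p q) (codom ends))%N.
move=>rL /andP[pr rq]; split; apply: (count_lt _ rL); rewrite /inside ?ltxx ?andbF ?pr ?rq// => s /andP[A B].
by rewrite A (lt_trans B). by rewrite B (lt_trans pr). Qed.

Definition mean_formula p q := [/\ itgT P (fun x=> int p q (Thetap ^~ x)), {ae P, forall x, itgi p q (Thetap ^~ x)} &
  \int[P]_x Hp q x - \int[P]_x Hp p x = \int[P]_x int p q (Thetap ^~ x)].

Let mean_formula_pp p : mean_formula p p.
have E : (fun x=> int p p (Thetap ^~ x)) = cst 0 by apply/funext=> x; rewrite int_pp. split.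
- by rewrite E; apply: (@P_itg_bounded _ _ _ P _ 0)=> // x; rewrite normr0.
- apply: aeW=> x; rewrite set_itv1. apply/integrableP; split; first exact: measurable_fun_set1.
by rewrite integral_set1// ltry.
- by rewrite subrr; under eq_Rintegral do rewrite int_pp; rewrite Rintegral_cst// mul0r. Qed.
Let mean_formula_add p r q : p <= r -> r <= q -> mean_formula p r -> mean_formula r q -> mean_formula p q.
move=>pr rq [i1 a1 e1] [i2 a2 e2]. have A : {ae P, forall x, itgi p q (Thetap ^~ x) /\
int p r (Thetap ^~ x) + int r q (Thetap ^~ x) = int p q (Thetap ^~ x)}.
apply: filterS2 a1 a2=> x f1 f2; have f12 := itg_union pr rq f1 f2. by split=> //; rewrite -int_split.
have mT : meas (fun x=> int p q (Thetap ^~ x)).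
apply: (@ae_measurable _ _ _ P usual_complete _ (fun x=> int p r (Thetap ^~ x) + int r q (Thetap ^~ x))).
by apply: measD; [exact: measurable_itg i1|exact: measurable_itg i2]. by apply: filterS A=> x [_ ->].
have [i e] : itgT P (fun x=> int p q (Thetap ^~ x)) /\
\int[P]_x int p q (Thetap ^~ x) = \int[P]_x (int p r (Thetap ^~ x) + int r q (Thetap ^~ x)).
by apply: ae_eq_itg=> //; [apply: filterS A=> x [_ ->]|exact: itgD]. split; [exact: i|by apply: filterS A=> x []|].
rewrite e RintegralD// -e1 -e2; ring. Qed.

(** Induction on the number of interval end points strictly between p and q: the formula is
    additive, so it can be split at such a point, and when none is left all integrands are constant
    on the cell. *)
Lemma elementary_formula p q : t0 <= p -> p <= q -> q <= T1 -> mean_formula p q.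
have [n] := ubnP (seq.count (inside p q) (codom ends)). elim: n p q=> // n IH p q; rewrite ltnS=> cn tp pq qT.
have [<-|pq'] := eqVneq p q; first exact: mean_formula_pp. have {}pq : p < q by rewrite lt_neqAle pq'.
have [/hasP[r rL /andP[pr rq]]|/hasPn nb] := boolP (has (inside p q) (codom ends)).
have [c1 c2] := count_split rL (introT andP (conj pr rq)). apply: (@mean_formula_add p r q (ltW pr) (ltW rq)).
exact: (IH p r (leq_trans c1 cn) tp (ltW pr) (le_trans (ltW rq) qT)).
exact: (IH r q (leq_trans c2 cn) (le_trans tp (ltW pr)) (ltW rq) qT).
have nbE i : ~~ inside p q (ends i) by apply: nb; exact: codom_f. have dich s : ~~ inside p q s -> s <= p \/ q <= s.
rewrite /inside negb_and -!leNgt=> /orP[]; by [left|right]. apply: (cell_formula tp pq qT)=> [i j l ls|i l ls].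
- pose w : EW := Tagged (fun ij : 'I_d * 'I_d=> 'I_(size (SW ij.1 ij.2))) (Ordinal ls : 'I_(size (SW (i, j).1 (i, j).2))).
by split; apply: dich; [exact: (nbE (inl w, false))|exact: (nbE (inl w, true))].
- pose j : J := Tagged (fun i=> 'I_(size (SN i))) (Ordinal ls).
by split; apply: dich; [exact: (nbE (inr j, false))|exact: (nbE (inr j, true))]. Qed.

Lemma Yp_adapted s : t0 <= s <= T1 -> meas_wrt (F s) (Yp s : Om -> borelRd R d).
exact: mYp. Qed.

Definition marks_finite x := forall i l, (l < size (SN i))%N ->
  (N x (mark (nth dflt_m (SN i) l) `*` `]t0, T1]) < +oo)%E.

Lemma marks_finite_ae : {ae P, forall x, marks_finite x}.
apply: ae_imp Nfin=> x H i l ls; exact: (H (Tagged (fun i=> 'I_(size (SN i))) (Ordinal ls))). Qed.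

(** A short enough interval to the right of r contains no interval end point in its interior, so the
    cell result applies. *)
Lemma Yp_rcont x : marks_finite x -> rcont t0 T1 (Yp ^~ x).
move=>Nx r /andP[tr rT]; have Nx' (j : J) : (N x (mk j `*` `]t0, T1]) < +oo)%E by exact: Nx.
have [|i|a a0 Ha] := @finite_pos_min R _ (fun i a=> ends i <= r \/ r + a <= ends i).
- by move=>i a b _ ab []; [left|right; apply: le_trans (_ : r + b <= _); rewrite ?lerD2l].
- have [le_r|lt_r] := leP (ends i) r; first by exists 1=> //; left.
by exists (ends i - r); [rewrite subr_gt0|right; rewrite addrC subrK]. pose q := minr (r + a) T1.
have rq : r < q by rewrite lt_min rT andbT ltrDl. have qT : q <= T1 by rewrite ge_min lexx orbT.
have nbE i : ends i <= r \/ q <= ends i. by have [|H] := Ha i; [left|right; apply: le_trans H; rewrite ge_min lexx].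
have nbW i j l : (l < size (SW i j))%N -> nobreak r q (nth dflt_e (SW i j) l).
move=>ls; pose w : EW := Tagged (fun ij : 'I_d * 'I_d=> 'I_(size (SW ij.1 ij.2))) (Ordinal ls : 'I_(size (SW (i, j).1 (i, j).2))).
by split; [exact: (nbE (inl w, false))|exact: (nbE (inl w, true))].
have nbN i l : (l < size (SN i))%N -> nobreak r q (base (nth dflt_m (SN i) l)).
move=>ls; pose j : J := Tagged (fun i=> 'I_(size (SN i))) (Ordinal ls).
by split; [exact: (nbE (inr j, false))|exact: (nbE (inr j, true))].
by refine (Yp_cell_rcont tr qT nbW nbN Nx' _); rewrite lexx. Qed.

End ElementaryFormula.

(** * Convergence of the drift integrals along one path *)

Lemma unif_cont_measurable {R : realType} {d} (p q : R) (h : sfun R d) : p <= q ->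
  unif_cont p q h -> meas (fun x : mR R * borelRd R d=> h (clamp p q x.1) x.2).
move=>pq uh; apply: progressive_measurable=> // [r pr|y r pr].
by apply: borelRd_continuous; exact: unif_cont_x uh.
apply: (unif_cont_rcont uh (z := fun=> y))=> // r' pr'; exact: cvg_cst. Qed.

Lemma measurable_Rint_param {R : realType} {d1 d2} {T1 : measurableType d1} {T2 : measurableType d2}
  (m : {sigma_finite_measure set T2 -> \bar R}) (f : T1 * T2 -> R) : meas f -> meas (fun x=> \int[m]_y f (x, y)).
move=>mf; apply: (meas_comp (@fine_measurable R _ measurableT)). have mE : meas (EFin \o f) by exact/measEFin.
under eq_fun=> x do rewrite integralE. apply: emeasurable_funB.
- have mp := measurable_funepos mE. have := measurable_fun_fubini_tonelli_F (m2 := m) _ mp (fun x=> funepos_ge0 _ x).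
by congr measurable_fun; apply/funext=> x; apply: eq_integral=> y _; rewrite !funeposE.
- have mp := measurable_funeneg mE. have := measurable_fun_fubini_tonelli_F (m2 := m) _ mp (fun x=> funeneg_ge0 _ x).
by congr measurable_fun; apply/funext=> x; apply: eq_integral=> y _; rewrite !funenegE. Qed.

Lemma measurable_itg' {dT} {T : measurableType dT} {R : realType} (mu : {measure set T -> \bar R})
  (D : set T) (f : T -> R) : itg mu D f -> measurable_fun D f.
by move=> /integrableP[/measEFin]. Qed.

Lemma cvg_ext {R : realType} (f g : nat -> R) (l : R) : (forall n, f n = g n) ->
  g n @[n --> \oo] --> l -> f n @[n --> \oo] --> l.
by move=> /funext ->. Qed.

Section L1Limits.
Context {R : realType} (p q : R) (pq : p <= q).

(** [m_ n * a_ n] is [m_ n * (a_ n - a)], small in L1, plus [m_ n * a], which converges by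
    domination. *)
Lemma L1_mul (a_ m_ : nat -> R -> R) (a m : R -> R) (B : R) : (forall n, itgi p q (a_ n)) -> itgi p q a ->
  int p q (fun r=> `|a_ n r - a r|) @[n --> \oo] --> (0 : R) -> (forall n, measi p q (m_ n)) -> measi p q m ->
  (forall n r, p <= r <= q -> `|m_ n r| <= B) -> (forall r, p <= r <= q -> `|m r| <= B) ->
  {ae Leb, forall r, p <= r <= q -> m_ n r @[n --> \oo] --> m r} ->
  int p q (fun r=> m_ n r * a_ n r) @[n --> \oo] --> int p q (fun r=> m r * a r).
move=>ai_ ai ca mm_ mm bm_ bm cm.
have imul (mm' a' : R -> R) : measi p q mm' -> (forall r, p <= r <= q -> `|mm' r| <= B) ->
itgi p q a' -> itgi p q (fun r=> mm' r * a' r).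
move=>h1 h2 h3; apply: (itgM_bounded _ (C := B))=> // r /=; rewrite in_itv/=; exact: h2.
have id n : itgi p q (fun r=> a_ n r - a r) by exact: itgB.
have e1 : int p q (fun r=> m_ n r * (a_ n r - a r)) @[n --> \oo] --> (0 : R).
apply: (@squeeze_cvgr _ _ _ _ (fun n=> - (B * int p q (fun r=> `|a_ n r - a r|)))
(fun n=> B * int p q (fun r=> `|a_ n r - a r|))).
- apply: nearW=> n; rewrite -ler_norml; apply: (le_trans (int_norm (imul _ _ (mm_ n) (bm_ n) (id n)))).
rewrite -RintegralZl//; last exact: itg_norm.
apply: int_le; [exact: itg_norm (imul _ _ (mm_ n) (bm_ n) (id n))|by apply: itgZ=> //; exact: itg_norm|].
by move=>r pr; rewrite normrM; apply: ler_wpM2r=> //; exact: bm_.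
- by rewrite -[0]oppr0; apply: cvgN; rewrite -[0](mulr0 B); apply: cvgM=> //; exact: cvg_cst.
- by rewrite -[0](mulr0 B); apply: cvgM=> //; exact: cvg_cst.
have e2 : int p q (fun r=> m_ n r * a r) @[n --> \oo] --> int p q (fun r=> m r * a r).
apply: (@int_dct_ae R p q _ _ (fun r=> B * `|a r|)).
- by move=>n; apply: measM=> //; exact: itg_meas.
- by apply: measM=> //; exact: itg_meas.
- apply: ae_imp cm=> r H pr. by apply: cvgM; [exact: (H pr)|exact: cvg_cst].
- by apply: itgZ=> //; exact: itg_norm.
- by move=>n r pr; rewrite normrM; apply: ler_wpM2r=> //; exact: bm_.
apply: (@cvg_to_eq _ _ (0 + int p q (fun r=> m r * a r))); last by rewrite add0r. under eq_fun=> n.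
rewrite (_ : int p q (fun r=> m_ n r * a_ n r) = int p q (fun r=> m_ n r * (a_ n r - a r)) + int p q (fun r=> m_ n r * a r)).
over. rewrite /int -RintegralD//; [|exact: (imul _ _ (mm_ n) (bm_ n) (id n))|exact: (imul _ _ (mm_ n) (bm_ n) ai)].
by apply: eq_Rintegral=> r _; rewrite mulrBr subrK. exact: cvgD. Qed.

(* The shape of every estimate below: an arbitrarily small multiple of a fixed integrable function
   plus a multiple of a function tending to 0 in L1. *)
Lemma L1_small (a_ : nat -> R -> R) (S : R -> R) (D_ : nat -> R -> R) (B : R -> R) :
  itgi p q S -> (forall n, itgi p q (D_ n)) -> int p q (D_ n) @[n --> \oo] --> (0 : R) ->
  (forall n, itgi p q (a_ n)) -> (forall n r, 0 <= a_ n r) ->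
  (forall e, 0 < e -> forall n r, p <= r <= q -> a_ n r <= e * S r + B e * D_ n r) ->
  int p q (a_ n) @[n --> \oo] --> (0 : R).
move=>Si Di cD ai a0 H; apply/cvgrPdist_le=> e e0. pose e1 := e / 2 / (1 + `|int p q S|).
have den : 0 < 1 + `|int p q S| by rewrite ltr_pwDl. have e10 : 0 < e1 by rewrite !divr_gt0.
have cBD : B e1 * int p q (D_ n) @[n --> \oo] --> (0 : R).
by rewrite -[0](mulr0 (B e1)); apply: cvgM=> //; exact: cvg_cst. have e2 : 0 < e / 2 by rewrite divr_gt0.
near=> n; rewrite sub0r normrN ger0_norm; last by apply: int_ge0. have : B e1 * int p q (D_ n) <= e / 2.
apply: (le_trans (ler_norm _)); rewrite -normrN -sub0r; near: n. by move/cvgrPdist_le : cBD; apply.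
have : int p q (a_ n) <= e1 * int p q S + B e1 * int p q (D_ n).
rewrite /int -!RintegralZl// -RintegralD//; [|exact: itgZ|exact: itgZ].
by apply: int_le=> //; [apply: itgD=> //; exact: itgZ|move=>r pr; exact: H]. have : e1 * int p q S <= e / 2.
apply: (@le_trans _ _ (e1 * (1 + `|int p q S|))); last by rewrite /e1 divfK// gt_eqF.
by apply: ler_wpM2l; [exact: ltW|rewrite (le_trans (ler_norm _))// lerDr]. lra.
Unshelve. all: by end_near. Qed.

End L1Limits.

Section JumpTerm.
Context {R : realType} {d : nat} (p q : R) (phi phit : sfun R d) (phi1 : 'I_d -> sfun R d) (phi2 : 'I_d -> 'I_d -> sfun R d)
  (C : R) (T : test p q phi phit phi1 phi2 C).

(** [taylor1] at the base point z + y' with the slopes taken at z: on the ball used there the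
    gradient differs from them by at most C times the distance to z. For y' = 0 this is quadratic
    growth, integrable for square integrable jumps. *)
Lemma jump_term_lip r z y y' : p <= r <= q -> `|jump_term phi phi1 r z y - jump_term phi phi1 r z y'| <=
  C * (n1 y' + d%:R * n1 (y - y')) * n1 (y - y').
move=>pr; set v := y - y'. have -> : jump_term phi phi1 r z y - jump_term phi phi1 r z y' =
phi r (z + y' + v) - phi r (z + y') - \sum_j phi1 j r z * v ord0 j.
have -> : z + y' + v = z + y by rewrite /v -addrA [y' + _]addrC subrK. rewrite /jump_term.
rewrite (_ : \sum_j phi1 j r z * v ord0 j = \sum_j phi1 j r z * y ord0 j - \sum_j phi1 j r z * y' ord0 j); first by ring.
by rewrite -sumrB; apply: eq_bigr=> j _; rewrite !mxE mulrBr.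
apply: (@taylor1 R d (phi r) (fun j=> phi1 j r) (z + y') v _ (fun j=> phi1 j r z)). by move=>j w; exact: (t_d1 T).
move=>j w wv; have C0 : 0 <= C by apply: (test_C_ge0 T); case/andP: pr=> /le_trans; apply.
have -> : w = z + (y' + (w - (z + y'))) by rewrite addrA [RHS]addrC subrK.
apply: (le_trans (test_lip1 T _ _ _ pr)); apply: ler_wpM2l=> //.
apply: (le_trans (n1D _ _)); rewrite lerD2l; apply: (le_trans (n1_le_norm _)).
by apply: ler_wpM2l=> //; apply: (le_trans wv); exact: norm_le_n1. Qed.

Lemma jump_term0 r z : jump_term phi phi1 r z 0 = 0.
by rewrite /jump_term addr0 subrr sub0r big1 ?oppr0// => i _; rewrite mxE mulr0. Qed.

Lemma jump_term_le r z y : p <= r <= q -> `|jump_term phi phi1 r z y| <= C * d%:R * n1 y ^+ 2.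
move=>pr; have := jump_term_lip z y 0 pr; rewrite jump_term0 !subr0.
have -> : n1 (0 : 'rV[R]_d) = 0 by apply: big1=> j _; rewrite mxE normr0. by rewrite add0r expr2 !mulrA. Qed.

End JumpTerm.

Section PathLimit.
Context {R : realType} {d : nat} {dU : measure_display} {U : measurableType dU} (M : {sigma_finite_measure set U -> \bar R}) (p q : R) (phi
  phit : sfun R d) (phi1 : 'I_d -> sfun R d) (phi2 : 'I_d -> 'I_d -> sfun R d) (C lam : R) (pq : p <= q) (T : test p q
  phi phit phi1 phi2 C) (lam0 : 0 < lam).

(* Coefficients seen along one path: drift b, extra killing kap, and a pair (f, g) of a matrix-valued
   function of time and a vector-valued function of time and mark. *)
Context (b : 'I_d -> R -> R) (kap : R -> R) (bi : forall j, itgi p q (b j)) (kapi : itgi p q kap) (kap_b : forall r, p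
  <= r <= q -> lam * (1 + \sum_j `|b j r|) <= kap r).

Definition sqint (f : 'I_d -> 'I_d -> R -> R) (g : 'I_d -> R -> U -> R) (r : R) : R :=
  \sum_i \sum_j f i j r ^+ 2 + \sum_i \int[M]_u (g i r u ^+ 2).

Record admissible (f : 'I_d -> 'I_d -> R -> R) (g : 'I_d -> R -> U -> R) : Prop := Admissible {
  ad_f : forall i j, meas (f i j : mR R -> R);
  ad_g : forall i, meas (fun x : mR R * U=> g i x.1 x.2);
  ad_gi : forall i r, itgT M (fun u=> g i r u ^+ 2);
  ad_i : itgi p q (sqint f g) }.

(** The rate contains lam times the squares of the very coefficients in the generator, so each
    approximation is discounted strongly enough for itself. *)
Definition rate f g r := kap r + lam * sqint f g r.

Definition pathK f g r := expR (- int p r (rate f g)).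

Definition jump_int (g : 'I_d -> R -> U -> R) (z : R -> 'rV[R]_d) r :=
  \int[M]_u jump_term phi phi1 r (z r) (\row_i g i r u).

Definition pathgen (f : 'I_d -> 'I_d -> R -> R) g (z : R -> 'rV[R]_d) r := 2^-1 * (\sum_i \sum_k phi2 i k r (z r) *
  (\sum_j f i j r * f k j r)) + jump_int g z r.

Definition pathTheta f g (z : R -> 'rV[R]_d) r := pathK f g r * (phit r (z r) + \sum_j b j r * phi1 j r (z r)
  - rate f g r * phi r (z r)) + pathK f g r * pathgen f g z r.

Let C0 : 0 <= C. Proof. exact: test_C_ge0 T pq. Qed.

Lemma sqint_ge0 f g r : 0 <= sqint f g r.
apply: addr_ge0; apply: sumr_ge0=> i _; first by apply: sumr_ge0=> j _; exact: sqr_ge0.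
by apply: Rintegral_ge0=> u _; exact: sqr_ge0. Qed.
Let kap0 r : p <= r <= q -> 0 <= kap r.
move=>pr; apply: le_trans (kap_b pr); apply: mulr_ge0; first exact: ltW.
by apply: addr_ge0=> //; apply: sumr_ge0. Qed.
Let rate0 f g r : p <= r <= q -> 0 <= rate f g r.
by move=>pr; apply: addr_ge0; [exact: kap0|apply: mulr_ge0; [exact: ltW|exact: sqint_ge0]]. Qed.

Lemma n1_sqr (v : 'rV[R]_d) : n1 v ^+ 2 <= d%:R * \sum_i v ord0 i ^+ 2.
have := sum_sqr_le (fun j=> `|v ord0 j|); rewrite card_ord.
by under [X in _ <= _ * X -> _]eq_bigr do rewrite real_normK ?num_real//. Qed.

Section Fixed.
Context (f : 'I_d -> 'I_d -> R -> R) (g : 'I_d -> R -> U -> R) (z : R -> 'rV[R]_d) (ad : admissible f g) (mz : meas (z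
  : mR R -> borelRd R d)).

Lemma rate_itg : itgi p q (rate f g).
by apply: itgD=> //; apply: itgZ=> //; exact: ad_i ad. Qed.

Lemma pathK_itv r : p <= r <= q -> 0 <= pathK f g r <= 1.
by move=>pr; apply: (@expint_itv R p q (rate f g))=> // r'; exact: rate0. Qed.
Let pathK1 r : p <= r <= q -> `|pathK f g r| <= 1.
by move=> /pathK_itv/andP[a b']; rewrite ger0_norm. Qed.

Lemma pathK_measurable : measi p q (pathK f g).
exact: expint_measurable rate_itg. Qed.

Lemma test_measurable h (y : R -> 'rV[R]_d) : meas (y : mR R -> borelRd R d) ->
  unif_cont p q h -> measi p q (fun r=> h r (y r)).
move=>my uh; have mh := unif_cont_measurable pq uh. have : measi p q (fun r : mR R=> h (clamp p q r) (y r)).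
apply: measurable_funTS; apply: (meas_comp mh (g := fun r : mR R=> (r, y r : borelRd R d))).
exact/measurable_fun_pair. by apply: eq_measurable_fun=> r; rewrite inE/= in_itv/= => pr; rewrite clamp_id. Qed.

Lemma jump_term_measurable : meas
  (fun x : mR R * U=> jump_term (fun r=> phi (clamp p q r)) (fun j r=> phi1 j (clamp p q r)) x.1 (z x.1) (\row_i g i x.1 x.2)).
have m1 : meas (fun x : mR R * U=> (z x.1 : borelRd R d)) by exact: meas_comp mz _.
have m2 : meas (fun x : mR R * U=> (\row_i g i x.1 x.2 : borelRd R d)).
by apply: borelRd_measurable=> j; under eq_fun do rewrite mxE; exact: ad_g ad j.
have m12 : meas (fun x : mR R * U=> (z x.1 + \row_i g i x.1 x.2 : borelRd R d)).
apply: borelRd_measurable=> j; under eq_fun do rewrite mxE.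
by apply: measD; [exact: (meas_comp (borelRd_coord j) m1)|exact: (meas_comp (borelRd_coord j) m2)].
have mh h (y : mR R * U -> borelRd R d) : unif_cont p q h -> meas y ->
meas (fun x : mR R * U=> h (clamp p q x.1) (y x)).
move=>uh my; apply: (meas_comp (unif_cont_measurable pq uh) (g := fun x=> (x.1, y x))). exact/measurable_fun_pair.
apply: measB; first by apply: measB; [exact: mh (t_u0 T) m12|exact: mh (t_u0 T) m1].
apply: meas_sum=> i; apply: measM; first exact: mh (t_u1 T i) m1. by under eq_fun do rewrite mxE; exact: ad_g ad i.
Qed.
Let sum_g_itg r : itgT M (fun u=> \sum_i g i r u ^+ 2).
by apply: itg_sum=> // i _; exact: ad_gi ad i r. Qed.
Let Rint_sum_g r : \int[M]_u (\sum_i g i r u ^+ 2) = \sum_i \int[M]_u (g i r u ^+ 2).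
by rewrite Rint_sum// => i _; exact: ad_gi ad i r. Qed.

Lemma jump_sect_measurable r : p <= r <= q -> meas (fun u=> jump_term phi phi1 r (z r) (\row_i g i r u)).
move=>pr; have mm := meas_comp jump_term_measurable (g := fun u : U=> (r, u)).
have := mm setT (measurable_pair1 r); congr measurable_fun; apply/funext=> u /=.
by rewrite /jump_term !clamp_id//; under eq_bigr do rewrite clamp_id//. Qed.

Lemma jump_sect_le r u : p <= r <= q ->
  `|jump_term phi phi1 r (z r) (\row_i g i r u)| <= C * d%:R * d%:R * \sum_i g i r u ^+ 2.
move=>pr; apply: (le_trans (jump_term_le T _ _ pr)); rewrite -[leRHS]mulrA; apply: ler_wpM2l. exact: mulr_ge0.
by apply: (le_trans (n1_sqr _)); under eq_bigr do rewrite mxE. Qed.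

Lemma jump_sect_itg r : p <= r <= q -> itgT M (fun u=> jump_term phi phi1 r (z r) (\row_i g i r u)).
move=>pr; apply: (le_itg measurableT (jump_sect_measurable pr) (g := fun u=> C * d%:R * d%:R * \sum_i g i r u ^+ 2)).
by move=>u _; exact: jump_sect_le. exact: itgZ. Qed.

Lemma jump_int_le r : p <= r <= q -> `|jump_int g z r| <= C * d%:R * d%:R * \sum_i \int[M]_u (g i r u ^+ 2).
move=>pr; rewrite -Rint_sum_g -RintegralZl//. apply: le_norm_Rint=> //; first exact: jump_sect_measurable.
by move=>u _; exact: jump_sect_le. exact: itgZ. Qed.

Lemma jump_int_measurable : measi p q (jump_int g z).
have := measurable_Rint_param M jump_term_measurable.
move=> /(measurable_funTS (D := `[p, q]%classic)); apply: eq_measurable_fun=> r.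
rewrite inE/= in_itv/= => pr; apply: eq_Rintegral=> u _.
by rewrite /jump_term !clamp_id//; under eq_bigr do rewrite clamp_id//. Qed.

Lemma jump_int_itg : itgi p q (jump_int g z).
apply: (@le_itgi R p q _ (fun r=> C * d%:R * d%:R * sqint f g r)); first exact: jump_int_measurable.
move=>r pr; apply: (le_trans (jump_int_le pr)); apply: ler_wpM2l; first by rewrite !mulr_ge0.
by rewrite lerDr; apply: sumr_ge0=> i _; apply: sumr_ge0=> j _; exact: sqr_ge0. by apply: itgZ=> //; exact: ad_i ad.
Qed.

Lemma ff_itg i j k : itgi p q (fun r=> f i j r * f k j r).
apply: (@le_itgi R p q _ (sqint f g)); last exact: ad_i ad.
by apply: measurable_funTS; apply: measM; exact: ad_f ad _ _. move=>r pr; rewrite normrM.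
have le2 i' j' : f i' j' r ^+ 2 <= sqint f g r. rewrite /sqint (bigD1 i')//= (bigD1 j')//= -!addrA lerDl !addr_ge0//.
- by apply: sumr_ge0=> *; exact: sqr_ge0.
- by apply: sumr_ge0=> *; apply: sumr_ge0=> *; exact: sqr_ge0.
- by apply: sumr_ge0=> *; apply: Rintegral_ge0=> u _; exact: sqr_ge0.
have := le2 i j; have := le2 k j; have : 0 <= (`|f i j r| - `|f k j r|) ^+ 2 by exact: sqr_ge0.
rewrite sqrrB !real_normK ?num_real//; lra. Qed.

(** Bound of the drift relative to [pathK * rate]. The three summands stand for time and drift, for
    the killing, and for the generator; each [lam^-1] comes from bounding a coefficient by rate /
    lam. *)
Definition Bnd := C * (1 + lam^-1) + C + lam^-1 * (2^-1 * (d%:R * (d%:R * (C * d%:R))) + C * d%:R * d%:R).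

Let prod_le_sqint i j k r : `|f i j r * f k j r| <= sqint f g r.
rewrite normrM. have le2 i' j' : f i' j' r ^+ 2 <= sqint f g r.
rewrite /sqint (bigD1 i')//= (bigD1 j')//= -!addrA lerDl !addr_ge0//.
- by apply: sumr_ge0=> *; exact: sqr_ge0.
- by apply: sumr_ge0=> *; apply: sumr_ge0=> *; exact: sqr_ge0.
- by apply: sumr_ge0=> *; apply: Rintegral_ge0=> u _; exact: sqr_ge0.
have := le2 i j; have := le2 k j; have : 0 <= (`|f i j r| - `|f k j r|) ^+ 2 by exact: sqr_ge0.
rewrite sqrrB !real_normK ?num_real//; lra. Qed.
Let sq_ge0 r : 0 <= sqint f g r. Proof. exact: sqint_ge0. Qed.
Let gsum_le r : \sum_i \int[M]_u (g i r u ^+ 2) <= sqint f g r.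
by rewrite lerDr; apply: sumr_ge0=> i _; apply: sumr_ge0=> j _; exact: sqr_ge0. Qed.

Lemma pathgen_le r : p <= r <= q -> `|pathgen f g z r| <=
  (2^-1 * (d%:R * (d%:R * (C * d%:R))) + C * d%:R * d%:R) * sqint f g r.
move=>pr; apply: (le_trans (ler_normD _ _)); rewrite mulrDl; apply: lerD.
have bd (F : 'I_d -> R) c : (forall i, `|F i| <= c) -> `|\sum_i F i| <= d%:R * c.
by move=>Fc; apply: (le_trans (ler_norm_sum _ _ _)); exact: sum_le_const.
rewrite normrM ger0_norm ?invr_ge0// -mulrA; apply: ler_wpM2l; first by rewrite invr_ge0.
rewrite -!mulrA; apply: (bd)=> i; apply: (bd)=> k. rewrite normrM; apply: ler_pM=> //; first exact: (t_b2 T).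
by apply: (bd)=> j; exact: prod_le_sqint.
apply: (le_trans (jump_int_le pr)); apply: ler_wpM2l; first by rewrite !mulr_ge0. exact: gsum_le. Qed.
Let il : 0 <= lam^-1. Proof. by rewrite invr_ge0 ltW. Qed.

Lemma pathTheta_le r : p <= r <= q -> `|pathTheta f g z r| <= Bnd * (pathK f g r * rate f g r).
move=>pr; have /andP[K0 _] := pathK_itv pr; have r0 := rate0 f g pr.
rewrite /pathTheta -mulrDr normrM (ger0_norm K0) mulrCA; apply: ler_wpM2l=> //.
have sr : lam * sqint f g r <= rate f g r by rewrite lerDr; exact: kap0.
have sr' : sqint f g r <= lam^-1 * rate f g r by rewrite mulrC ler_pdivlMr// mulrC.
have kr : kap r <= rate f g r by rewrite lerDl; apply: mulr_ge0=> //; exact: ltW.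
have br : 1 + \sum_j `|b j r| <= lam^-1 * rate f g r.
rewrite mulrC ler_pdivlMr// mulrC; exact: le_trans (kap_b pr) kr.
rewrite /Bnd (mulrDl _ (lam^-1 * _)); apply: (le_trans (ler_normD _ _)); apply: lerD; last first.
apply: (le_trans (pathgen_le pr)); rewrite [X in _ <= X * _]mulrC -[leRHS]mulrA; apply: ler_wpM2l=> //.
by apply: addr_ge0; rewrite !mulr_ge0 ?invr_ge0.
apply: (le_trans (ler_normB _ _)); rewrite (mulrDl (C * (1 + lam^-1)) C); apply: lerD; last first.
rewrite normrM ger0_norm// mulrC; apply: ler_wpM2r=> //; exact: (t_b0 T).
apply: (@le_trans _ _ (C * (1 + \sum_j `|b j r|))).
rewrite mulrDr mulr1; apply: (le_trans (ler_normD _ _)); apply: lerD; first exact: (t_bt T).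
rewrite mulr_sumr; apply: (le_trans (ler_norm_sum _ _ _)); apply: ler_sum=> j _.
by rewrite normrM mulrC ler_wpM2r//; exact: (t_b1 T).
rewrite -mulrA; apply: ler_wpM2l=> //; apply: (le_trans br); apply: ler_wpM2r=> //. by rewrite lerDr. Qed.
Let mzh h : unif_cont p q h -> measi p q (fun r=> h r (z r)).
exact: test_measurable. Qed.

Lemma pathTheta_measurable : measi p q (pathTheta f g z).
have mK := pathK_measurable. have mb j := itg_meas (bi j); have mr := itg_meas rate_itg.
apply: measD; apply: measM=> //. apply: measB; last by apply: measM=> //; exact: mzh (t_u0 T).
apply: measD; first exact: mzh (t_ut T). by apply: meas_sum=> j; apply: measM=> //; exact: mzh (t_u1 T j).
apply: measD; last exact: jump_int_measurable. apply: measM=> //; apply: meas_sum=> i; apply: meas_sum=> k.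
apply: measM; first exact: mzh (t_u2 T i k).
by apply: meas_sum=> j; apply: measurable_funTS; apply: measM; exact: ad_f ad _ _. Qed.
Let Kr_itg : itgi p q (fun r=> pathK f g r * rate f g r).
exact: (@itg_expint R p q (rate f g) pq rate_itg (fun r pr=> rate0 f g pr)). Qed.

Lemma Bnd_ge0 : 0 <= Bnd.
by rewrite /Bnd !addr_ge0 ?mulr_ge0 ?addr_ge0 ?mulr_ge0 ?invr_ge0// ltW. Qed.

Lemma pathTheta_itg : itgi p q (pathTheta f g z).
apply: (le_itgi pathTheta_measurable (g := fun r=> Bnd * (pathK f g r * rate f g r))). exact: pathTheta_le.
by apply: itgZ=> //; exact: Kr_itg. Qed.

(** The integral of [pathK * rate] is [1 - pathK q], at most 1. As the bound depends on d, C and lam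
    only, bounded convergence in w becomes possible. *)
Lemma int_pathTheta_le : `|int p q (pathTheta f g z)| <= Bnd.
apply: (le_trans (int_norm pathTheta_itg)).
apply: (@le_trans _ _ (int p q (fun r=> Bnd * (pathK f g r * rate f g r)))).
by apply: int_le=> //; [exact: itg_norm pathTheta_itg|by apply: itgZ=> //; exact: Kr_itg|exact: pathTheta_le].
rewrite /int RintegralZl//. rewrite -[X in _ <= X]mulr1; apply: ler_wpM2l; first exact: Bnd_ge0.
have := @int_expint_full R p q (rate f g) pq rate_itg (fun r pr=> rate0 f g pr).
rewrite /int /expint=> ->; rewrite gerBl; exact: expR_ge0. Qed.

End Fixed.

Context (f_ : nat -> 'I_d -> 'I_d -> R -> R) (g_ : nat -> 'I_d -> R -> U -> R) (z_ : nat -> R -> 'rV[R]_d) (f : 'I_d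
  -> 'I_d -> R -> R) (g : 'I_d -> R -> U -> R) (z : R -> 'rV[R]_d) (ad_ : forall n, admissible (f_ n) (g_ n)) (ad :
  admissible f g) (mz_ : forall n, meas (z_ n : mR R -> borelRd R d)) (mz : meas (z : mR R -> borelRd R d)) (cz : {ae
  Leb, forall r, p <= r <= q -> z_ n r @[n --> \oo] --> z r}).
Let df n i j r := f_ n i j r - f i j r.
Let dg n i r u := g_ n i r u - g i r u.
Context (add : forall n, admissible (df n) (dg n)) (cfg : int p q (sqint (df n) (dg n)) @[n --> \oo] --> (0 : R)).

(** Arranged for [L1_small]: a small multiple of the squares of the limits plus a multiple of the
    squared differences. *)
Let prod_split (a a' s s' e : R) : 0 < e ->
  `|a * a' - s * s'| <= e * (s ^+ 2 + s' ^+ 2) + (1 + e^-1) * ((a - s) ^+ 2 + (a' - s') ^+ 2).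
move=>e0; set x := a - s; set y := a' - s'.
have -> : a * a' - s * s' = x * y + s * y + s' * x by rewrite /x /y; ring. have ei : 0 < e^-1 by rewrite invr_gt0.
have H (u v : R) : `|u * v| <= e * u ^+ 2 + e^-1 * v ^+ 2.
rewrite normrM -[u ^+ 2]real_normK ?num_real// -[v ^+ 2]real_normK ?num_real//. set u1 := `|u|; set v1 := `|v|.
have u10 : 0 <= u1 by exact: normr_ge0. have v10 : 0 <= v1 by exact: normr_ge0.
have E : e^-1 * (e * u1 - v1) ^+ 2 = e * u1 ^+ 2 - 2 * (u1 * v1) + e^-1 * v1 ^+ 2 by field; rewrite gt_eqF.
have := mulr_ge0 (ltW ei) (sqr_ge0 (e * u1 - v1)); rewrite E. have := mulr_ge0 u10 v10; lra.
have Hxy : `|x * y| <= x ^+ 2 + y ^+ 2.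
rewrite normrM -[x ^+ 2]real_normK ?num_real// -[y ^+ 2]real_normK ?num_real//.
have := sqr_ge0 (`|x| - `|y|); rewrite sqrrB; have : 0 <= `|x| * `|y| by apply: mulr_ge0. lra.
have := ler_normD (x * y + s * y) (s' * x); have := ler_normD (x * y) (s * y).
have := H s y; have := H s' x; move: Hxy; lra. Qed.
Let S := sqint f g.
Let D n := sqint (df n) (dg n).
Let Si : itgi p q S. Proof. exact: ad_i ad. Qed.
Let Di n : itgi p q (D n). Proof. exact: ad_i (add n). Qed.
Let le_sq (f' : 'I_d -> 'I_d -> R -> R) g' i j r : f' i j r ^+ 2 <= sqint f' g' r.
rewrite /sqint (bigD1 i)//= (bigD1 j)//= -!addrA lerDl !addr_ge0//.
- by apply: sumr_ge0=> *; exact: sqr_ge0.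
- by apply: sumr_ge0=> *; apply: sumr_ge0=> *; exact: sqr_ge0.
- by apply: sumr_ge0=> *; apply: Rintegral_ge0=> u _; exact: sqr_ge0. Qed.
Let L1_ff i j k : int p q (fun r=> `|f_ n i j r * f_ n k j r - f i j r * f k j r|) @[n --> \oo] --> (0 : R).
refine (@L1_small R p q (fun n r=> `|f_ n i j r * f_ n k j r - f i j r * f k j r|) S D (fun e=> 2 * (1 + (e / 2)^-1)) Si Di cfg _ (fun n r=> normr_ge0 _) _).
- by move=>n; apply: itg_norm; apply: itgB=> //; [exact: (ff_itg (ad_ n))|exact: (ff_itg ad)].
- move=>e e0 n r pr; have e2 : 0 < e / 2 by rewrite divr_gt0. apply: (le_trans (prod_split _ _ _ _ e2)).
have := le_sq f g i j r; have := le_sq f g k j r; rewrite -/(S r).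
have := le_sq (df n) (dg n) i j r; have := le_sq (df n) (dg n) k j r; rewrite -/(D n r) /df.
have ei : 0 < (e / 2)^-1 by rewrite invr_gt0.
move: (S r) (D n r) (f i j r ^+ 2) (f k j r ^+ 2)=> s1 d1 s2 s3 h1 h2 h3 h4.
apply: (@le_trans _ _ (e / 2 * (s1 + s1) + (1 + (e / 2)^-1) * (d1 + d1))); last by lra.
apply: lerD; apply: ler_wpM2l; [exact: ltW|exact: lerD| |exact: lerD]. by apply: addr_ge0=> //; exact: ltW. Qed.
Let L1_sq : int p q (fun r=> `|sqint (f_ n) (g_ n) r - S r|) @[n --> \oo] --> (0 : R).
refine (@L1_small R p q (fun n r=> `|sqint (f_ n) (g_ n) r - S r|) S D (fun e=> (1 + (e / 2)^-1) * 2) Si Di cfg _ (fun n r=> normr_ge0 _) _).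
- by move=>n; apply: itg_norm; apply: itgB=> //; exact: ad_i (ad_ n).
- move=>e e0 n r pr; have e2 : 0 < e / 2 by rewrite divr_gt0. have ei : 0 < (e / 2)^-1 by rewrite invr_gt0.
have H (a s : R) : `|a ^+ 2 - s ^+ 2| <= e * s ^+ 2 + (1 + (e / 2)^-1) * 2 * (a - s) ^+ 2.
have := prod_split a a s s e2; rewrite -!expr2; lra. move: ((1 + (e / 2)^-1) * 2) H=> c2 H.
rewrite /S /D /sqint opprD addrACA !mulrDr [X in _ <= X]addrACA. apply: (le_trans (ler_normD _ _)); apply: lerD.
rewrite -sumrB !mulr_sumr -big_split; apply: (le_trans (ler_norm_sum _ _ _)); apply: ler_sum=> i _ /=.
rewrite -sumrB !mulr_sumr -big_split; apply: (le_trans (ler_norm_sum _ _ _)); apply: ler_sum=> j _ /=. exact: H.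
rewrite -sumrB !mulr_sumr -big_split; apply: (le_trans (ler_norm_sum _ _ _)); apply: ler_sum=> i _ /=.
rewrite -RintegralB//; [|exact: ad_gi (ad_ n) i r|exact: ad_gi ad i r].
rewrite (_ : e * _ = \int[M]_u (e * g i r u ^+ 2)); last by rewrite RintegralZl//; exact: (ad_gi ad i r).
rewrite (_ : c2 * _ = \int[M]_u (c2 * dg n i r u ^+ 2)); last by rewrite RintegralZl//; exact: (ad_gi (add n) i r).
have i1 : itgT M (fun u=> e * g i r u ^+ 2) by apply: itgZ=> //; exact: ad_gi ad i r.
have i2 : itgT M (fun u=> c2 * dg n i r u ^+ 2) by apply: itgZ=> //; exact: ad_gi (add n) i r.
rewrite -RintegralD//; apply: le_norm_Rint=> //; last exact: itgD.
apply: measB; apply: measurable_itg'; [exact: ad_gi (ad_ n) i r|exact: ad_gi ad i r]. Qed.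
Let rate_ n := rate (f_ n) (g_ n).
Let L1_rate : int p q (fun r=> `|rate_ n r - rate f g r|) @[n --> \oo] --> (0 : R).
have E n : int p q (fun r=> `|rate_ n r - rate f g r|) = lam * int p q (fun r=> `|sqint (f_ n) (g_ n) r - S r|).
rewrite /int -RintegralZl//; last by apply: itg_norm; apply: itgB=> //; exact: ad_i (ad_ n).
apply: eq_Rintegral=> r _; rewrite /rate_ /rate opprD addrACA subrr add0r -mulrBr normrM. by rewrite gtr0_norm.
under eq_fun do rewrite E. by apply: (@cvg_to_eq _ _ (lam * 0)); [exact: (cvgM (cvg_cst lam) L1_sq)|rewrite mulr0].
Qed.
Let ri n : itgi p q (rate_ n). Proof. exact: rate_itg (ad_ n). Qed.
Let ri0 : itgi p q (rate f g). Proof. exact: rate_itg ad. Qed.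

Lemma pathK_cvg r : p <= r <= q -> pathK (f_ n) (g_ n) r @[n --> \oo] --> pathK f g r.
move=> /andP[pr rq]; have sub (a : R -> R) : itgi p q a -> itgi p r a by exact: itg_sub.
apply: (@continuous_cvg _ _ _ _ _ (fun n=> - int p r (rate_ n)) expR); first exact: continuous_expR.
apply: cvgN; apply/cvgrPdist_le=> e e0.
move/cvgrPdist_le : L1_rate=> /(_ e e0); apply: filterS=> n; rewrite sub0r normrN.
have id : itgi p q (fun r=> rate_ n r - rate f g r) by exact: itgB. rewrite (ger0_norm (int_ge0 _)) // => H.
rewrite distrC /int -RintegralB//; [|exact: sub|exact: sub].
apply: (le_trans (int_norm (sub _ id))); apply: le_trans H. rewrite [leRHS](int_split pr rq); last exact: itg_norm.
by rewrite lerDl; apply: int_ge0. Qed.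
(** Only g varies here, at the common argument [z_ n]; [jump_term_lip] is combined with a weighted
    inequality between mixed and pure squares. The variation of z is left to [L1_jump2]. *)
Let jump1 n r : p <= r <= q -> forall e, 0 < e ->
  `|jump_int (g_ n) (z_ n) r - jump_int g (z_ n) r| <= C * d%:R * (e * S r + (e^-1 + d%:R) * D n r).
move=>pr e e0. have i1 := jump_sect_itg (ad_ n) (mz_ n) pr; have i2 := jump_sect_itg ad (mz_ n) pr.
have ei : 0 < e^-1 by rewrite invr_gt0.
have sg i : itgT M (fun u=> e * g i r u ^+ 2 + (e^-1 + d%:R) * dg n i r u ^+ 2).
by apply: itgD=> //; apply: itgZ=> //; [exact: ad_gi ad i r|exact: ad_gi (add n) i r].
have ssg : itgT M (fun u=> C * d%:R * \sum_i (e * g i r u ^+ 2 + (e^-1 + d%:R) * dg n i r u ^+ 2)).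
by apply: itgZ=> //; apply: itg_sum=> // i _; exact: sg.
apply: (@le_trans _ _ (\int[M]_u (C * d%:R * \sum_i (e * g i r u ^+ 2 + (e^-1 + d%:R) * dg n i r u ^+ 2)))).
rewrite /jump_int -RintegralB//; apply: le_norm_Rint=> //.
by apply: measB; [exact: (measurable_itg' i1)|exact: (measurable_itg' i2)].
move=>u _; apply: (le_trans (jump_term_lip T _ _ _ pr)).
rewrite (_ : \row_i g_ n i r u - \row_i g i r u = \row_i dg n i r u); last by apply/rowP=> i; rewrite !mxE.
set y := \row_i g i r u; set v := \row_i dg n i r u.
have Y : n1 y ^+ 2 <= d%:R * \sum_i g i r u ^+ 2 by apply: (le_trans (n1_sqr _)); under eq_bigr do rewrite mxE.
have V : n1 v ^+ 2 <= d%:R * \sum_i dg n i r u ^+ 2 by apply: (le_trans (n1_sqr _)); under eq_bigr do rewrite mxE.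
rewrite -mulrA -[leRHS]mulrA; apply: ler_wpM2l=> //; rewrite big_split /= -!mulr_sumr.
move: (n1 y) (n1 v) (n1_ge0 y) (n1_ge0 v) Y V=> a v' a0 v0 Y V.
have E : e^-1 * (e * a - v') ^+ 2 = e * a ^+ 2 - 2 * (a * v') + e^-1 * v' ^+ 2 by field; rewrite gt_eqF.
have := mulr_ge0 (ltW ei) (sqr_ge0 (e * a - v')); rewrite E=> H. have := mulr_ge0 a0 v0=> H1.
have := ler_wpM2l (ltW e0) Y; have := ler_wpM2l (ltW ei) V. have := ler_wpM2l (ler0n R d) V.
move: (\sum_i g i r u ^+ 2) (\sum_i dg n i r u ^+ 2) (e^-1) H=> A B e' H; move: (d%:R : R)=> d'.
rewrite -[(a + _) * v']/((a + d' * v') * v'). have -> : (a + d' * v') * v' = a * v' + d' * v' ^+ 2 by ring.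
have -> : d' * (e * A + (e' + d') * B) = e * (d' * A) + e' * (d' * B) + d' * (d' * B) by ring. lra.
rewrite RintegralZl//; last by apply: itg_sum=> // i _; exact: sg.
rewrite Rint_sum//; apply: ler_wpM2l; first exact: mulr_ge0.
rewrite (eq_bigr (fun i=> e * \int[M]_u (g i r u ^+ 2) + (e^-1 + d%:R) * \int[M]_u (dg n i r u ^+ 2))); last first.
move=>i _; have j1 := ad_gi ad i r; have j2 := ad_gi (add n) i r.
by rewrite RintegralD//; [rewrite !RintegralZl|exact: itgZ|exact: itgZ].
rewrite big_split /= -!mulr_sumr; apply: lerD; apply: ler_wpM2l.
- exact: ltW.
- by rewrite lerDr; apply: sumr_ge0=> i _; apply: sumr_ge0=> j _; exact: sqr_ge0.
- by apply: addr_ge0=> //; exact: ltW.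
- by rewrite lerDr; apply: sumr_ge0=> i _; apply: sumr_ge0=> j _; exact: sqr_ge0. Qed.
Let ji n := jump_int_itg (ad_ n) (mz_ n).
Let ji' n := jump_int_itg ad (mz_ n).
Let ji0 := jump_int_itg ad mz.

Let d1 n : itgi p q (fun r=> jump_int (g_ n) (z_ n) r - jump_int g (z_ n) r).
by apply: itgB. Qed.
Let d2 n : itgi p q (fun r=> jump_int g (z_ n) r - jump_int g z r).
by apply: itgB. Qed.
Let L1_jump1 : int p q (fun r=> `|jump_int (g_ n) (z_ n) r - jump_int g (z_ n) r|) @[n --> \oo] --> (0 : R).
pose E e := e / (C * d%:R + 1). have c1 : 0 < C * d%:R + 1 by apply: ltr_wpDl=> //; exact: mulr_ge0.
refine (@L1_small R p q (fun n r=> `|jump_int (g_ n) (z_ n) r - jump_int g (z_ n) r|) S D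
(fun e=> C * d%:R * ((E e)^-1 + d%:R)) Si Di cfg _ (fun n r=> normr_ge0 _) _).
- by move=>n; exact: itg_norm (d1 n).
- move=>e e0 n r pr; have e2 : 0 < E e by rewrite divr_gt0.
apply: (le_trans (jump1 n pr e2)); rewrite mulrDr -!mulrA lerD2r !mulrA; apply: ler_wpM2r; first exact: sqint_ge0.
rewrite /E ler_pdivrMr// [leRHS]mulrC; apply: ler_wpM2r; [exact: ltW|by rewrite lerDl]. Qed.
Let test_cvg h r : p <= r <= q -> unif_cont p q h -> z_ n r @[n --> \oo] --> z r ->
  h r (z_ n r) @[n --> \oo] --> h r (z r).
by move=>pr uh cc; refine (@continuous_cvg _ _ _ _ _ (fun n=> z_ n r) (h r) _ (@unif_cont_x _ _ _ _ _ _ pr uh (z r)) cc). Qed.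
(** Two dominated convergences: in the mark at fixed r, with the squares of g as majorant, and then
    in r. *)
Let L1_jump2 : int p q (fun r=> `|jump_int g (z_ n) r - jump_int g z r|) @[n --> \oo] --> (0 : R).
apply: (@cvg_to_eq _ _ (int p q (fun=> 0))); last by rewrite /int Rintegral_cst// mul0r.
apply: (@int_dct_ae R p q _ _ (fun r=> 2 * (C * d%:R * d%:R * S r))).
- move=>n; apply: (@meas_comp _ _ _ _ _ _ (@normr R R))=> //.
by apply: measB; [exact: (measurable_itg' (ji' n))|exact: (measurable_itg' ji0)].
- exact: measurable_cst.
- apply: ae_imp cz=> r H pr; have {}H := H pr. apply: (@cvg_to_eq _ _ `|0|); last by rewrite normr0.
apply: cvg_norm; apply: (@cvg_to_eq _ _ (jump_int g z r - jump_int g z r)); last by rewrite subrr.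
apply: cvgB; last exact: cvg_cst.
refine (@Rdct _ _ R M setT (fun n u=> jump_term phi phi1 r (z_ n r) (\row_i g i r u)) _ (fun u=> C * d%:R * d%:R * \sum_i g i r u ^+ 2) measurableT _ _ _ _ _).2.
+ by move=>n; exact: measurable_itg' (jump_sect_itg ad (mz_ n) pr).
+ exact: measurable_itg' (jump_sect_itg ad mz pr).
+ apply: aeW=> u _; rewrite /jump_term; apply: cvgB; last first.
apply: cvg_bigsum=> i; apply: cvgM; last exact: cvg_cst. exact: test_cvg pr (t_u1 T i) H.
apply: cvgB; last exact: test_cvg pr (t_u0 T) H.
apply: (@continuous_cvg _ _ _ _ _ (fun n=> z_ n r + \row_i g i r u) (phi r)); first exact: (unif_cont_x pr (t_u0 T)).
by apply: cvgD=> //; exact: cvg_cst.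
+ by apply: itgZ=> //; apply: itg_sum=> // i _; exact: ad_gi ad i r.
+ by move=>n u _; exact: jump_sect_le pr.
- by apply: itgZ=> //; apply: itgZ.
- move=>n r pr; rewrite normr_id; apply: (le_trans (ler_normB _ _)); rewrite mulr_natl mulr2n.
have H : C * d%:R * d%:R * \sum_i \int[M]_u (g i r u ^+ 2) <= C * d%:R * d%:R * S r.
apply: ler_wpM2l; first by rewrite !mulr_ge0.
by rewrite lerDr; apply: sumr_ge0=> i _; apply: sumr_ge0=> j _; exact: sqr_ge0.
by apply: lerD; apply: le_trans H; [exact: (jump_int_le ad (mz_ n) pr)|exact: (jump_int_le ad mz pr)]. Qed.
Let L1_jump : int p q (fun r=> `|jump_int (g_ n) (z_ n) r - jump_int g z r|) @[n --> \oo] --> (0 : R).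
apply: (@squeeze_cvgr _ _ _ _ (fun=> 0) (fun n=> int p q (fun r=> `|jump_int (g_ n) (z_ n) r - jump_int g (z_ n) r|)
+ int p q (fun r=> `|jump_int g (z_ n) r - jump_int g z r|))); last 2 first.
- exact: cvg_cst.
- by apply: (@cvg_to_eq _ _ (0 + 0)); [exact: (cvgD L1_jump1 L1_jump2)|rewrite addr0].
apply: nearW=> n; apply/andP; split; first by apply: int_ge0.
rewrite /int -RintegralD//; [|exact: itg_norm|exact: itg_norm]. apply: int_le=> //.
- by apply: itg_norm; apply: itgB.
- by apply: itgD=> //; exact: itg_norm.
- move=>r _; apply: le_trans (ler_normD _ _); rewrite addrA subrK //. Qed.
Let icvg (t_ : nat -> R -> R) (t : R -> R) := [/\ forall n, itgi p q (t_ n), itgi p q t &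
  int p q (t_ n) @[n --> \oo] --> int p q t].

Let icvgD t_ t s_ s : icvg t_ t -> icvg s_ s -> icvg (fun n r=> t_ n r + s_ n r) (fun r=> t r + s r).
move=> [h1 h2 h3] [k1 k2 k3]; split; [by move=>n; exact: itgD|exact: itgD|].
rewrite /int RintegralD//; under eq_fun do rewrite RintegralD//; exact: cvgD. Qed.
Let icvg0 : icvg (fun _ _=> 0) (fun _=> 0).
by split; [move=> _; exact: itg_cst|exact: itg_cst|exact: cvg_cst]. Qed.
Let icvg_sum (I : Type) (s : seq I) (t_ : I -> nat -> R -> R) (t : I -> R -> R) :
  (forall i, icvg (t_ i) (t i)) -> icvg (fun n r=> \sum_(i <- s) t_ i n r) (fun r=> \sum_(i <- s) t i r).
move=>H; elim: s=> [|i s IH].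
have := icvg0; congr icvg; first by apply/funext=> n; apply/funext=> r; rewrite big_nil.
by apply/funext=> r; rewrite big_nil.
have := icvgD (H i) IH; congr icvg; first by apply/funext=> n; apply/funext=> r; rewrite big_cons.
by apply/funext=> r; rewrite big_cons. Qed.
Let Kh_icvg h B (a_ : nat -> R -> R) a : unif_cont p q h -> (forall r y, p <= r <= q -> `|h r y| <= B) ->
  (forall n, itgi p q (a_ n)) -> itgi p q a -> int p q (fun r=> `|a_ n r - a r|) @[n --> \oo] --> (0 : R) ->
  icvg (fun n r=> pathK (f_ n) (g_ n) r * h r (z_ n r) * a_ n r) (fun r=> pathK f g r * h r (z r) * a r).
move=>uh hB ai_ ai ca. have mm_ n : measi p q (fun r=> pathK (f_ n) (g_ n) r * h r (z_ n r)).
by apply: measM; [exact: pathK_measurable (ad_ n)|exact: test_measurable (mz_ n) uh].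
have mm : measi p q (fun r=> pathK f g r * h r (z r)).
by apply: measM; [exact: pathK_measurable ad|exact: test_measurable mz uh].
have bm_ n r : p <= r <= q -> `|pathK (f_ n) (g_ n) r * h r (z_ n r)| <= B.
move=>pr; have /andP[K0 K1] := pathK_itv (f_ n) (g_ n) pr; rewrite normrM ger0_norm// -[B]mul1r.
by apply: ler_pM=> //; exact: hB. have bm r : p <= r <= q -> `|pathK f g r * h r (z r)| <= B.
move=>pr; have /andP[K0 K1] := pathK_itv f g pr; rewrite normrM ger0_norm// -[B]mul1r.
by apply: ler_pM=> //; exact: hB.
have imul (m' a' : R -> R) : measi p q m' -> (forall r, p <= r <= q -> `|m' r| <= B) ->
itgi p q a' -> itgi p q (fun r=> m' r * a' r).
move=>h1 h2 h3; apply: (itgM_bounded _ (C := B))=> // r /=; rewrite in_itv/=; exact: h2.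
split; [by move=>n; exact: (imul _ _ (mm_ n) (bm_ n))|exact: (imul _ _ mm bm)|].
refine (@L1_mul R p q a_ _ a _ B ai_ ai ca mm_ mm bm_ bm _).
apply: ae_imp cz=> r H pr; apply: cvgM; [exact: pathK_cvg|exact: test_cvg (H pr)]. Qed.
Let L1_self a : itgi p q a -> int p q (fun r=> `|a r - a r|) @[n --> \oo] --> (0 : R).
move=> _; rewrite (_ : int _ _ _ = 0); first exact: cvg_cst.
rewrite (_ : (fun r=> _) = (fun=> 0)); last by apply/funext=> r; rewrite subrr normr0.
by rewrite /int Rintegral_cst// mul0r. Qed.

(** The drift is a finite sum of products of [pathK], a bounded continuous function of z, and a
    factor converging in L1: 1, b, the rate, products of coefficients, or the jump integral.
    [L1_mul] applies to each. *)
Lemma int_pathTheta_cvg : int p q (pathTheta (f_ n) (g_ n) (z_ n)) @[n --> \oo] --> int p q (pathTheta f g z).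
have one : itgi p q (fun=> 1 : R) by exact: itg_cst.
have u1 : unif_cont p q (fun (_ : R) (_ : 'rV[R]_d)=> 1 : R). by move=>e e0; exists 1=> // *; rewrite subrr normr0.
have I1 := Kh_icvg (t_ut T) (t_bt T) (fun=> one) one (L1_self one).
have I2 j := Kh_icvg (t_u1 T j) (t_b1 T j) (fun=> bi j) (bi j) (L1_self (bi j)).
have nri n : itgi p q (fun r=> - rate_ n r) by exact: itgN.
have nri0 : itgi p q (fun r=> - rate f g r) by exact: itgN.
have nL1 : int p q (fun r=> `|- rate_ n r - - rate f g r|) @[n --> \oo] --> (0 : R).
apply: cvg_ext L1_rate=> n; apply: eq_Rintegral=> r _. by rewrite -opprD normrN.
have I3 := Kh_icvg (t_u0 T) (t_b0 T) nri nri0 nL1. have h2 i k : unif_cont p q (fun r y=> 2^-1 * phi2 i k r y).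
move=>e e0; have [del d0 H] := t_u2 T i k e0; exists del=> // s s' y y' ps ps' ss yy.
rewrite -mulrBr normrM ger0_norm ?invr_ge0//; apply: le_lt_trans (H s s' y y' ps ps' ss yy).
by rewrite ler_piMl// invf_le1// ler1n. have b2 i k r y : p <= r <= q -> `|2^-1 * phi2 i k r y| <= 2^-1 * C.
by move=>pr; rewrite normrM ger0_norm ?invr_ge0// ler_wpM2l ?invr_ge0//; exact: (t_b2 T).
have I4 i k j := Kh_icvg (h2 i k) (b2 i k) (fun n=> ff_itg (ad_ n) i j k) (ff_itg ad i j k) (L1_ff i j k).
have I5 := Kh_icvg u1 (B := 1) (fun r y _=> ltac:(by rewrite normr1)) ji ji0 L1_jump.
have I4' := icvg_sum (index_enum 'I_d) (fun i=> icvg_sum (index_enum 'I_d) (fun k=> icvg_sum (index_enum 'I_d) (fun j=> I4 i k j))).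
have [_ _] := icvgD (icvgD (icvgD I1 (icvg_sum (index_enum 'I_d) I2)) I3) (icvgD I4' I5).
have E f' g' z' r : pathTheta f' g' z' r = pathK f' g' r * phit r (z' r) * 1 +
\sum_j pathK f' g' r * phi1 j r (z' r) * b j r + pathK f' g' r * phi r (z' r) * (- rate f' g' r) +
(\sum_i \sum_k \sum_j pathK f' g' r * (2^-1 * phi2 i k r (z' r)) * (f' i j r * f' k j r) +
pathK f' g' r * 1 * jump_int g' z' r).
rewrite /pathTheta /pathgen mulrBr mulrDr !mulr1 mulrN [pathK f' g' r * (_ + jump_int _ _ _)]mulrDr.
rewrite [pathK f' g' r * (rate _ _ _ * _)]mulrCA [rate _ _ _ * _]mulrC. congr (_ + _ - _ + (_ + _)).
by rewrite mulr_sumr; apply: eq_bigr=> j _; rewrite [b j r * _]mulrC mulrA.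
rewrite !mulr_sumr; apply: eq_bigr=> i _; rewrite !mulr_sumr; apply: eq_bigr=> k _; rewrite !mulr_sumr.
by apply: eq_bigr=> j _; rewrite !mulrA. rewrite (funext (E f g z)).
apply: cvg_ext=> n; congr (int p q _); apply/funext=> r; exact: E. Qed.

End PathLimit.

(** * From convergence in probability to convergence along a subsequence *)

Section Vanish.
Context {R : realType} {dO : measure_display} {Om : measurableType dO} (P : probability Om R).

Definition cap1 (y : \bar R) : R := fine (mine 1%E y).

Lemma cap1_itv y : (0 <= y)%E -> 0 <= cap1 y <= 1.
rewrite /cap1; case: y=> [r| |]//=.
rewrite lee_fin=> r0; have [r1|] := leP 1%E r%:E; first by rewrite /= ?ler01 ?lexx.
by rewrite lte_fin=> /ltW r1 /=; rewrite r0. by move=> _; rewrite min_l ?leey//= ler01 lexx. Qed.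

Lemma cap1D x y : (0 <= x)%E -> (0 <= y)%E -> cap1 (x + y) <= cap1 x + cap1 y.
move=>x0 y0; have /andP[tx0 _] := cap1_itv x0; have /andP[ty0 _] := cap1_itv y0.
have /andP[_ t1] := cap1_itv (adde_ge0 x0 y0). have [x1|x1] := leP 1%E x.
rewrite {2}/cap1 (min_l x1)/=; apply: (le_trans t1); lra. have [y1|y1] := leP 1%E y.
rewrite [X in _ <= _ + X]/cap1 (min_l y1)/=; apply: (le_trans t1); lra.
rewrite {2 3}/cap1 (min_r (ltW x1)) (min_r (ltW y1)) -fineD ?ge0_fin_numE ?(lt_trans x1) ?(lt_trans y1) ?ltry//.
apply: fine_le; rewrite ?ge0_fin_numE ?adde_ge0//.
- by rewrite gt_min ltry.
- by rewrite le_min lee01 adde_ge0.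
- by rewrite lte_add_pinfty// ?(lt_trans x1) ?(lt_trans y1) ?ltry.
- by rewrite ge_min lexx orbT. Qed.

Lemma cap1_fin y : (0 <= y)%E -> cap1 y < 1 -> y = (cap1 y)%:E.
rewrite /cap1=> y0; have [y1|y1] := leP 1%E y; first by rewrite /= ltxx.
by move=> _; rewrite fineK// ge0_fin_numE// (lt_trans y1)// ltry. Qed.

Lemma cap1_EFin (x : R) : 0 <= x -> cap1 x%:E = minr 1 x.
by move=>x0; rewrite /cap1 -EFin_min. Qed.

Lemma measurable_cap1 {dT} {T : measurableType dT} (f : T -> \bar R) : meas f -> meas (fun w=> cap1 (f w)).
move=>mf; apply: (meas_comp (@fine_measurable R _ measurableT)).
by apply: measurable_mine=> //; exact: measurable_cst. Qed.

(** After capping at 1, convergence in probability is convergence to 0 of the mean of a bounded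
    quantity. In this form it is stable under sums, can be integrated over time, and yields a
    subsequence. *)
Definition vanish (Q : nat -> Om -> R) : Prop := [/\ forall n, meas (Q n),
  forall n w, 0 <= Q n w, exists B, forall n w, Q n w <= B & \int[P]_w Q n w @[n --> \oo] --> (0 : R)].

Lemma vanish_itg Q n : vanish Q -> itgT P (Q n).
move=> [mQ Q0 [B QB] _]; apply: (le_itg measurableT (mQ n) (g := fun=> B)). by move=>w _; rewrite ger0_norm.
exact: finite_measure_integrable_cst. Qed.

Lemma vanish_le (Q Q' : nat -> Om -> R) : (forall n, meas (Q n)) -> (forall n w, 0 <= Q n w <= Q' n w) ->
  vanish Q' -> vanish Q.
move=>mQ QQ' vQ'; have [mQ' Q'0 [B Q'B] cQ'] := vQ'. have Q0 n w : 0 <= Q n w by case/andP: (QQ' n w).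
split=> //; first by exists B=> n w; apply: le_trans (Q'B n w); case/andP: (QQ' n w).
apply: (squeeze_cvgr _ (cvg_cst 0) cQ'); apply: nearW=> n; apply/andP; split. by apply: Rintegral_ge0.
have iQ : itgT P (Q n). apply: (le_itg measurableT (mQ n) (g := Q' n)); last exact: vanish_itg.
by move=>w _; rewrite ger0_norm//; case/andP: (QQ' n w). apply: le_Rintegral=> //; first exact: vanish_itg.
by move=>w _; case/andP: (QQ' n w). Qed.

Lemma vanishD Q Q' : vanish Q -> vanish Q' -> vanish (fun n w=> Q n w + Q' n w).
move=>vQ vQ'; have [mQ Q0 [B QB] cQ] := vQ; have [mQ' Q'0 [B' Q'B] cQ'] := vQ'.
split; [by move=>n; exact: measD|by move=>n w; exact: addr_ge0| |]. by exists (B + B')=> n w; exact: lerD.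
apply: (cvg_ext (g := fun n=> \int[P]_w Q n w + \int[P]_w Q' n w)).
by move=>n; rewrite RintegralD//; exact: vanish_itg. by apply: (@cvg_to_eq _ _ (0 + 0)); [exact: cvgD|rewrite addr0].
Qed.

Lemma vanish0 : vanish (fun _ _=> 0).
split=> //; [by exists 0|].
by apply: (cvg_ext (g := fun=> 0)); [move=>n; rewrite Rintegral_cst// mul0r|exact: cvg_cst]. Qed.

Lemma vanish_sum {I : Type} (s : seq I) (Q : I -> nat -> Om -> R) : (forall i, vanish (Q i)) ->
  vanish (fun n w=> \sum_(i <- s) Q i n w).
move=>vQ; elim: s=> [|i s IH].
by have := vanish0; congr vanish; apply/funext=> n; apply/funext=> w; rewrite big_nil.
by have := vanishD (vQ i) IH; congr vanish; apply/funext=> n; apply/funext=> w; rewrite big_cons. Qed.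

(** The capped variable is at most e / 2 plus the indicator that Y exceeds e / 2. *)
Lemma vanish_in_prob (Y : nat -> Om -> \bar R) : (forall n, meas (Y n)) ->
  (forall n w, 0 <= Y n w)%E -> cvg_to0_in_prob P Y -> vanish (fun n w=> cap1 (Y n w)).
move=>mY Y0 cY; have m n := measurable_cap1 (mY n).
split=> //; [by move=>n w; case/andP: (cap1_itv (Y0 n w))|by exists 1=> n w; case/andP: (cap1_itv (Y0 n w))|].
apply/cvgrPdist_le=> e e0; have e2 : 0 < e / 2 by rewrite divr_gt0.
have /fine_cvgP[_ /cvgrPdist_le/(_ _ e2)] := cY _ e2.
apply: filterS=> n; rewrite !sub0r !normrN ger0_norm ?fine_ge0// => H.
have t0 w : 0 <= cap1 (Y n w) by case/andP: (cap1_itv (Y0 n w)).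
have mA : measurable [set w | ((e / 2)%:E < Y n w)%E].
by have := emeasurable_fun_o_infty measurableT (mY n) (e / 2)%:E; rewrite setTI; congr measurable; apply/seteqP; split=> w/=; rewrite in_itv/= andbT.
have iA : itgT P (\1_[set w | ((e / 2)%:E < Y n w)%E]).
apply: (le_itg measurableT _ (g := fun=> 1)); first exact: measurable_indic.
by move=>w _; rewrite indicE ger0_norm//; case: (_ \in _). exact: finite_measure_integrable_cst.
rewrite ger0_norm; last exact: Rintegral_ge0.
apply: (@le_trans _ _ (\int[P]_w (e / 2 + \1_[set w | ((e / 2)%:E < Y n w)%E] w))). apply: le_Rintegral=> //.
- apply: (le_itg measurableT (m n) (g := fun=> 1)); last exact: finite_measure_integrable_cst.
by move=>w _; rewrite ger0_norm//; case/andP: (cap1_itv (Y0 n w)).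
- by apply: itgD=> //; exact: finite_measure_integrable_cst.
move=>w _; rewrite indicE; have [/= h|/= h] := boolP ((e / 2)%:E < Y n w)%E.
rewrite mem_set//=; have /andP[_ H1] := cap1_itv (Y0 n w); apply: (le_trans H1); rewrite lerDr; exact: ltW.
rewrite memNset/=; last exact/negP.
rewrite addr0 -lee_fin; apply: le_trans (_ : (Y n w <= _)%E); last by rewrite leNgt.
rewrite /cap1 fineK ?ge_min ?lexx ?orbT// ge0_fin_numE ?le_min ?lee01 ?Y0//. by rewrite gt_min ltry.
rewrite RintegralD//; last exact: finite_measure_integrable_cst.
rewrite Rintegral_cst// [X in e / 2 * fine X](_ : _ = 1%E); last exact: probability_setT.
have -> : \int[P]_w \1_[set w | ((e / 2)%:E < Y n w)%E] w = fine (P [set w | ((e / 2)%:E < Y n w)%E]).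
by rewrite /Rintegral integral_indic// setIT. by rewrite /= mulr1; move: H; rewrite /=; lra. Qed.

Lemma summable_integral {dT} {T : measurableType dT} (mu : {measure set T -> \bar R}) (D : set T)
  (h : nat -> T -> R) : measurable D -> (forall k, measurable_fun D (h k)) -> (forall k x, 0 <= h k x) ->
  (\sum_(0 <= k <oo) \int[mu]_(x in D) (h k x)%:E < +oo)%E ->
  {ae mu, forall x, D x -> (\sum_(0 <= k <oo) (h k x)%:E < +oo)%E}.
move=>mD mh h0 H; have mE k : measurable_fun D (fun x=> (h k x)%:E) by exact/measEFin.
have h0E k x : D x -> (0 <= (h k x)%:E)%E by rewrite lee_fin.
have S0 x : (0 <= \sum_(0 <= k <oo) (h k x)%:E)%E by apply: nneseries_ge0=> *; rewrite lee_fin.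
have mS : measurable_fun D (fun x=> \sum_(0 <= k <oo) (h k x)%:E)%E.
by apply: ge0_emeasurable_sum=> // k x Dx _; exact: h0E.
have : mu.-integrable D (fun x=> \sum_(0 <= k <oo) (h k x)%:E)%E. apply/integrableP; split=> //.
by under eq_integral=> x _ do rewrite gee0_abs//; rewrite integral_nneseries.
by move=> /(integrable_ae mD); apply: ae_imp=> x K Dx; move: (K Dx); rewrite ge0_fin_numE. Qed.

Lemma summable_cvg0 (h : nat -> R) : (forall k, 0 <= h k) -> (\sum_(0 <= k <oo) (h k)%:E < +oo)%E ->
  h k @[k --> \oo] --> (0 : R).
by move=>h0 H; apply: cvg_series_cvg_0; exact: nnseries_is_cvg. Qed.

(** With means at most 2^-(k+1) the series has finite mean. Summability rather than convergence is
    recorded, because it passes to the nonnegative summands of Q and, through an integral over time,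
    to almost every time. *)
Lemma vanish_subseq Q : vanish Q ->
  exists nk : nat -> nat, {ae P, forall w, (\sum_(0 <= k <oo) (Q (nk k) w)%:E < +oo)%E}.
move=>vQ; have [mQ Q0 [B QB] cQ] := vQ. have H (k : nat) : exists n, \int[P]_w Q n w <= 1 / (2 ^ k.+1)%:R.
have e0 : 0 < 1 / (2 ^ k.+1)%:R :> R by rewrite divr_gt0// ltr0n expn_gt0.
move/cvgrPdist_le : cQ=> /(_ _ e0)[n _ /(_ n (leqnn n))]/=.
by rewrite sub0r normrN=> H; exists n; apply: le_trans H; exact: ler_norm. have [nk Hk] := choice H; exists nk.
have : {ae P, forall w, setT w -> (\sum_(0 <= k <oo) (Q (nk k) w)%:E < +oo)%E}. apply: summable_integral=> //.
apply: (@le_lt_trans _ _ 1%E); last exact: ltry. refine (le_trans _ (epsilon_trick0 xpredT (@ler01 R))).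
apply: lee_nneseries=> [k _ _|k _]; first by apply: integral_ge0=> w _; rewrite lee_fin.
have := Hk k; rewrite -lee_fin /Rintegral fineK//. by apply: integrable_fin_num=> //; exact: vanish_itg.
by apply: ae_imp=> w; apply. Qed.

End Vanish.

(** Right limits leave, after each jump larger than [n.+1%:R^-1], a gap without further such jumps;
    rationals chosen in these gaps are distinct. The union over n covers all jumps. *)
Lemma cadlag_jumps_countable {R : realType} {d} (t0 : R) (y : R -> 'rV[R]_d) :
  (forall s, t0 <= s -> y r @[r --> s^'+] --> y s) -> (forall s, t0 < s -> cvg (y r @[r --> s^'-])) ->
  exists2 D : set R, countable D & forall r, t0 < r -> ~ D r -> lim (y q @[q --> r^'-]) = y r.
move=>rc ll. pose D (n : nat) := [set r | t0 < r /\ n.+1%:R^-1 < `|lim (y q @[q --> r^'-]) - y r|].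
have cD n : countable (D n). have e0 : 0 < n.+1%:R^-1 / 4 :> R by rewrite divr_gt0// invr_gt0.
have H r : exists q : rat, D n r -> r < ratr q /\ forall s, r < s -> s <= ratr q -> ~ D n s.
have [Dr|nD] := pselect (D n r); last by exists 0.
have [tr _] := Dr; move/cvgrPdist_lt : (rc r (ltW tr))=> /(_ _ e0)[del /= del0 Hd].
have rd : r < r + del by rewrite ltrDl. have [q] := rat_in_itvoo rd; rewrite in_itv/= => /andP[rq qd].
exists q=> _; split=> // s rs sq [ts]; apply/negP; rewrite -leNgt.
have near u : r < u -> u <= s -> `|y r - y u| <= n.+1%:R^-1 / 4.
move=>ru us; apply/ltW/Hd=> //=; rewrite ltr0_norm ?subr_lt0// opprB ltrBlDl. exact: le_lt_trans (le_trans us sq) qd.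
have H1 : `|y r - lim (y q @[q --> s^'-])| <= n.+1%:R^-1 / 4.
have c1 : `|y r - y q| @[q --> s^'-] --> `|y r - lim (y q @[q --> s^'-])|.
by apply: cvg_norm; apply: cvgB; [exact: cvg_cst|exact: ll].
apply: (cvgr_to_le c1); have := nbhs_left_gt rs; apply: filterS2 (nbhs_left_lt s)=> u us ru.
by apply: near => //; exact: ltW. have H2 := near s rs (lexx s).
have := ler_normB (y r - y s) (y r - lim (y q @[q --> s^'-])).
rewrite (_ : y r - y s - _ = lim (y q @[q --> s^'-]) - y s); last first. by rewrite opprB addrC addrA subrK.
move: H1 H2 e0; move: `|_ - y s| `|_| `|_| (_^-1 : R)=> a a1 a2 a3; lra.
have [q Hq] := choice H; apply/countable_injP; exists (fun r=> pickle (q r))=> r s.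
rewrite !inE=> Dr Ds /(pcan_inj pickleK) qe. have [rq Hr] := Hq r Dr; have [sq Hs] := Hq s Ds.
have [rs|sr|//] := ltgtP r s. by exfalso; apply: (Hr s rs _ Ds); rewrite qe ltW.
by exfalso; apply: (Hs r sr _ Dr); rewrite -qe ltW. exists (\bigcup_n D n); first exact: bigcup_countable.
move=>r tr nD; apply/eqP; rewrite -subr_eq0 -normr_eq0; apply/eqP/le_anti; rewrite normr_ge0 andbT.
apply/ler_addgt0Pl=> e e0; rewrite addr0 leNgt; apply/negP=> H; apply: nD.
have [n Hn] := nat_large (@ler01 R) e0; exists n=> //; split=> //; apply: lt_trans H. by rewrite -div1r; exact: Hn.
Qed.

Lemma measurable_off_countable {R : realType} {dT} {T : measurableType dT} (D C : set R) (f g : R -> T) :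
  measurable D -> countable C -> measurable_fun D (g : mR R -> T) ->
  (forall r, D r -> ~ C r -> f r = g r) -> measurable_fun D (f : mR R -> T).
move=>mD cC mg fg _ B mB. have mC (E : set R) : E `<=` C -> measurable (E : set (mR R)).
move=>EC; apply: (@countable_measurable _ (mR R)); first by move=>t; exact: measurable_set1.
exact: (sub_countable (subset_card_le EC) cC).
rewrite (_ : D `&` f @^-1` B = ((D `&` g @^-1` B) `\` C) `|` ((D `&` f @^-1` B) `&` C)).
apply: measurableU; last by apply: mC; exact: subIsetr. by apply: measurableD; [exact: mg|exact: mC].
apply/seteqP; split=> r /=.
by move=> [Dr Br]; have [Cr|nC] := pselect (C r); [right|left; split=> //; split=> //; rewrite -(fg r)].
by move=> [[[Dr Br] nC]|[[]]] //; split=> //; rewrite (fg r). Qed.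

Lemma rc_joint {R : realType} {d} {dT} {T : measurableType dT} (Z : R -> T -> 'rV[R]_d) (a b : R) :
  a <= b -> (forall r, a <= r <= b -> meas (Z r : T -> borelRd R d)) ->
  (forall w r, a <= r < b -> Z s w @[s --> r^'+] --> Z r w) ->
  meas ((fun p=> Z (clamp a b p.1) p.2) : mR R * T -> borelRd R d).
move=>ab mZ cZ; apply: borelRd_measurable=> j.
apply: (progressive_measurable (Z := fun r w=> Z r w ord0 j))=> // [r abr|w r abr].
exact: (meas_comp (borelRd_coord j) (mZ r abr)).
exact: (@continuous_cvg _ _ _ _ _ (fun s=> Z s w) (fun v : 'rV[R]_d=> v ord0 j) _ (@continuous_coord R d j _) (cZ w r abr)).
Qed.

(** * Square integrable coefficients and integrals with a parameter *)

Section SqInt.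
Context {R : realType} {d : nat} {dU : measure_display} {U : measurableType dU} (M : {sigma_finite_measure set U -> \bar R}).

Lemma sqint_joint {dT} {T : measurableType dT} (f : 'I_d -> 'I_d -> T -> R) (g : 'I_d -> T -> U -> R) :
  (forall i j, meas (f i j)) -> (forall i, meas (fun p : T * U=> g i p.1 p.2)) ->
  meas (fun x=> \sum_i \sum_j f i j x ^+ 2 + \sum_i \int[M]_u (g i x u ^+ 2)).
move=>mf mg; apply: measD. by apply: meas_sum=> i; apply: meas_sum=> j; exact: measurable_funX.
apply: meas_sum=> i. by apply: (measurable_Rint_param M (f := fun p=> g i p.1 p.2 ^+ 2)); exact: measurable_funX. Qed.

Lemma sqrB_le (a b : R) : (a - b) ^+ 2 <= 2 * a ^+ 2 + 2 * b ^+ 2.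
have := sqr_ge0 (a + b); rewrite sqrrB sqrrD; lra. Qed.

Context (p q : R).

Lemma admissible_sqint_measurable (f : 'I_d -> 'I_d -> R -> R) (g : 'I_d -> R -> U -> R) :
  (forall i j, meas (f i j : mR R -> R)) -> (forall i, meas (fun x : mR R * U=> g i x.1 x.2)) ->
  meas (sqint M f g : mR R -> R).
exact: sqint_joint. Qed.

Lemma itg_sqrB (g g' : U -> R) : meas g -> meas g' ->
  itgT M (fun u=> g u ^+ 2) -> itgT M (fun u=> g' u ^+ 2) -> itgT M (fun u=> (g u - g' u) ^+ 2).
move=>mg mg' ig ig'; apply: (le_itg measurableT _ (g := fun u=> 2 * g u ^+ 2 + 2 * g' u ^+ 2)).
- by apply: measurable_funX; exact: measB.
- by move=>u _; rewrite ger0_norm ?sqr_ge0//; exact: sqrB_le.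
- by apply: itgD=> //; apply: itgZ. Qed.

Lemma sqintB_le (f f' : 'I_d -> 'I_d -> R -> R) (g g' : 'I_d -> R -> U -> R) r :
  (forall i, meas (g i r)) -> (forall i, meas (g' i r)) ->
  (forall i, itgT M (fun u=> g i r u ^+ 2)) -> (forall i, itgT M (fun u=> g' i r u ^+ 2)) ->
  sqint M (fun i j r=> f i j r - f' i j r) (fun i r u=> g i r u - g' i r u) r <=
  2 * sqint M f g r + 2 * sqint M f' g' r.
move=>mg mg' ig ig'; rewrite /sqint !mulrDr addrACA !mulr_sumr; apply: lerD.
rewrite -big_split; apply: ler_sum=> i _ /=; rewrite !mulr_sumr -big_split; apply: ler_sum=> j _ /=. exact: sqrB_le.
rewrite -big_split; apply: ler_sum=> i _ /=. rewrite -!RintegralZl// -RintegralD//; [|by apply: itgZ|by apply: itgZ].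
apply: le_Rintegral=> //; [exact: itg_sqrB|by apply: itgD=> //; apply: itgZ|]. by move=>u _; exact: sqrB_le. Qed.

Lemma admissibleB (f f' : 'I_d -> 'I_d -> R -> R) (g g' : 'I_d -> R -> U -> R) :
  admissible M p q f g -> admissible M p q f' g' ->
  admissible M p q (fun i j r=> f i j r - f' i j r) (fun i r u=> g i r u - g' i r u).
move=>a a'; have mg i r : meas (g i r) := meas_comp (ad_g a i) (measurable_pair1 r).
have mg' i r : meas (g' i r) := meas_comp (ad_g a' i) (measurable_pair1 r).
have mf i j : meas ((fun r=> f i j r - f' i j r) : mR R -> R).
by apply: measB; [exact: ad_f a i j|exact: ad_f a' i j].
have mG i : meas (fun x : mR R * U=> g i x.1 x.2 - g' i x.1 x.2). by apply: measB; [exact: ad_g a i|exact: ad_g a' i].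
split=> //. by move=>i r; apply: itg_sqrB; [exact: mg|exact: mg'|exact: ad_gi a i r|exact: ad_gi a' i r].
apply: (@le_itgi R p q _ (fun r=> 2 * sqint M f g r + 2 * sqint M f' g' r)).
- by apply: measurable_funTS; exact: admissible_sqint_measurable.
- move=>r _; rewrite ger0_norm; last exact: sqint_ge0.
by apply: sqintB_le=> i; [exact: mg|exact: mg'|exact: ad_gi a i r|exact: ad_gi a' i r].
- by apply: itgD=> //; apply: itgZ=> //; [exact: ad_i a|exact: ad_i a']. Qed.

(** A stochastic integral comes with elementary approximations in square norm, not with square
    integrability of its integrand; a finite distance to one admissible pair provides the latter. *)
Lemma admissible_of_diff (f f' : 'I_d -> 'I_d -> R -> R) (g g' : 'I_d -> R -> U -> R) :
  (forall i j, meas (f i j : mR R -> R)) -> (forall i, meas (fun x : mR R * U=> g i x.1 x.2)) ->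
  (forall i r, itgT M (fun u=> g i r u ^+ 2)) -> admissible M p q f' g' ->
  (\int[Leb]_(r in `[p, q]) (sqint M (fun i j r=> f' i j r - f i j r) (fun i r u=> g' i r u - g i r u) r)%:E < +oo)%E ->
  admissible M p q f g.
move=>mf mg gi a' fin. have mgr i r : meas (g i r) := meas_comp (mg i) (measurable_pair1 r).
have mgr' i r : meas (g' i r) := meas_comp (ad_g a' i) (measurable_pair1 r).
pose f2 i j r := f' i j r - f i j r; pose g2 i r u := g' i r u - g i r u. have a2 : admissible M p q f2 g2.
have mf2 i j : meas (f2 i j : mR R -> R). by apply: measB=> //; exact: ad_f a' i j.
have mg2 i : meas (fun x : mR R * U=> g2 i x.1 x.2). by apply: measB=> //; exact: ad_g a' i. split=> //.
by move=>i r; apply: itg_sqrB; [exact: mgr'|exact: mgr|exact: ad_gi a' i r|exact: gi]. apply/integrableP; split.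
by apply/measEFin; apply: measurable_funTS; exact: admissible_sqint_measurable.
under eq_integral do rewrite gee0_abs ?lee_fin ?sqint_ge0//. exact: fin.
have -> : f = (fun i j r=> f' i j r - f2 i j r).
by apply/funext=> i; apply/funext=> j; apply/funext=> r; rewrite /f2 subKr.
have -> : g = (fun i r u=> g' i r u - g2 i r u).
by apply/funext=> i; apply/funext=> j; apply/funext=> r; rewrite /g2 subKr. exact: admissibleB. Qed.

End SqInt.

Section SimpleIntegrands.
Context {R : realType} {dO : measure_display} {Om : measurableType dO} {d : nat} {dU : measure_display} {U : measurableType dU} (M : {sigma_finite_measure set U
  -> \bar R}).

Lemma val_bound (S : seq (@elementary R dO Om)) r w : `|elementary_val S r w| <= \sum_(e <- S) `|coef e w|.
apply: (le_trans (ler_norm_sum _ _ _)); apply: ler_sum=> e _.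
by rewrite normrM indicE; case: (_ \in _); rewrite ?normr0 ?mulr0 ?normr1 ?mulr1. Qed.

Lemma seq_sum_sqr_le {I : Type} (s : seq I) (a : I -> R) :
  (\sum_(i <- s) a i) ^+ 2 <= (size s)%:R * \sum_(i <- s) a i ^+ 2.
case: s=> [|i0 s0]; first by rewrite !big_nil expr2 !mulr0.
set s := i0 :: s0; rewrite !(big_nth i0) !big_mkord.
by have := sum_sqr_le (fun l : 'I_(size s)=> a (nth i0 s l)); rewrite card_ord. Qed.

Lemma mval_bound (S : seq (@marked R dO Om dU U)) r w u :
  marked_val S r w u ^+ 2 <= (size S)%:R * \sum_(e <- S) coef (base e) w ^+ 2 * \1_(mark e) u.
apply: (le_trans (seq_sum_sqr_le _ _)); apply: ler_wpM2l=> //; apply: ler_sum=> e _.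
rewrite !exprMn -mulrA; apply: ler_wpM2l; first exact: sqr_ge0.
rewrite !indicE; case: (u \in _); case: (r \in _); rewrite ?expr1n ?expr0n ?mulr1 ?mulr0 ?mul0r//. Qed.

Context (p q : R) (SW : 'I_d -> 'I_d -> seq (@elementary R dO Om)) (SN : 'I_d -> seq (@marked R dO Om dU U)) (ok :
  forall i l, (l < size (SN i))%N -> measurable (mark (nth dflt_m (SN i) l)) /\ (M (mark (nth dflt_m (SN i) l)) <
  +oo)%E).

Lemma itg_mark_sum (i : 'I_d) (a : @marked R dO Om dU U -> R) : itgT M (fun u=> \sum_(e <- SN i) a e * \1_(mark e) u).
under eq_fun do rewrite (big_nth dflt_m) big_mkord.
apply: itg_sum=> // l _; have [mm fm] := ok (ltn_ord l); apply: itgZ=> //.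
apply/integrableP; split; first by apply/measEFin; exact: measurable_indic.
by under eq_integral do rewrite gee0_abs ?lee_fin//; rewrite integral_indic// setIT. Qed.

Lemma admissible_simple w :
  admissible M p q (fun i j r=> elementary_val (SW i j) r w) (fun i r u=> marked_val (SN i) r w u).
have mf i j : meas ((fun r=> elementary_val (SW i j) r w) : mR R -> R).
by apply: meas_sum=> e; apply: measM=> //; exact: measurable_indic.
have mg i : meas (fun x : mR R * U=> marked_val (SN i) x.1 w x.2).
rewrite /marked_val; under eq_fun do rewrite (big_nth dflt_m) big_mkord.
apply: meas_sum=> l; have [mm fm] := ok (ltn_ord l); apply: measM. apply: measM=> //.
by apply: (@meas_comp _ _ _ _ _ _ (\1_(`]start (base (nth dflt_m (SN i) l)), stop (base (nth dflt_m (SN i) l))]) : mR R -> R))=> //; exact: measurable_indic.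
by apply: (@meas_comp _ _ _ _ _ _ (\1_(mark (nth dflt_m (SN i) l)) : U -> R))=> //; exact: measurable_indic.
have ib i := @itg_mark_sum i (fun e=> coef (base e) w ^+ 2).
have gi i r : itgT M (fun u=> marked_val (SN i) r w u ^+ 2).
apply: (le_itg measurableT _ (g := fun u=> (size (SN i))%:R * \sum_(e <- SN i) coef (base e) w ^+ 2 * \1_(mark e) u)).
- apply: measurable_funX; exact: (meas_comp (mg i) (measurable_pair1 r)).
- by move=>u _; rewrite ger0_norm ?sqr_ge0//; exact: mval_bound.
- exact: itgZ. split=> //. apply: (@le_itgi R p q _ (fun=> \sum_i \sum_j (\sum_(e <- SW i j) `|coef e w|) ^+ 2 +
\sum_i \int[M]_u ((size (SN i))%:R * \sum_(e <- SN i) coef (base e) w ^+ 2 * \1_(mark e) u))).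
- by apply: measurable_funTS; exact: admissible_sqint_measurable.
- move=>r _; rewrite ger0_norm ?sqint_ge0//; apply: lerD. apply: ler_sum=> i _; apply: ler_sum=> j _.
by rewrite -real_normK ?num_real// ler_sqr ?nnegrE ?sumr_ge0//; exact: val_bound.
apply: ler_sum=> i _; apply: le_Rintegral=> //; first exact: itgZ. by move=>u _; exact: mval_bound.
- exact: itg_cst. Qed.

End SimpleIntegrands.

Section ParamIntegrals.
Context {R : realType} {dT : measure_display} {T : measurableType dT} (a b : R) (f : R -> T -> R) (mf : meas (fun p : mR R * T=> f
  (clamp a b p.1) p.2)) (f0 : forall r w, 0 <= f r w).

Let V (x : T * mR R) : R := \1_(`[a, b]%classic) x.2 * f (clamp a b x.2) x.1.

Let mV : meas V.
apply: measM. have mi : meas (\1_(`[a, b]%classic) : mR R -> R) by []. exact: (meas_comp mi measurable_snd).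
apply: (meas_comp mf (g := fun x : T * mR R=> (x.2, x.1))). exact: measurable_fun_pair. Qed.
Let intV w : (\int[Leb]_(r in `[a, b]) (f r w)%:E = \int[Leb]_r (V (w, r))%:E)%E.
rewrite integral_mkcond; apply: eq_integral=> r _; rewrite /patch /V indicE/=.
by case: ifPn=> rab; rewrite ?mul0r// mul1r clamp_id//; move: rab; rewrite inE/= in_itv. Qed.
Let V0 x : (0 <= (V x)%:E)%E. Proof. by rewrite lee_fin mulr_ge0. Qed.

Lemma measurable_eint_param : meas (fun w=> \int[Leb]_(r in `[a, b]) (f r w)%:E)%E.
under eq_fun do rewrite intV.
by apply: (measurable_fun_fubini_tonelli_F (m2 := Leb) (EFin \o V))=> //; exact/measEFin. Qed.

Lemma Rint_swap (P : probability T R) : a <= b -> (forall r w, f r w <= 1) ->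
  \int[P]_w int a b (fun r=> f r w) = int a b (fun r=> \int[P]_w f r w).
move=>ab f1. have i1 w : itgi a b (fun r=> f r w). apply: (@le_itgi R a b _ (fun=> 1)); last exact: itg_cst.
have := measurable_funTS (D := `[a, b]%classic) (meas_comp mf (measurable_pair2 w)).
by apply: eq_measurable_fun=> r /=; rewrite inE/= in_itv/= => rab; rewrite clamp_id. by move=>r _; rewrite ger0_norm.
have i2 r : a <= r <= b -> itgT P (f r).
move=>rab; apply: (le_itg measurableT _ (g := fun=> 1)); last exact: finite_measure_integrable_cst.
by have := meas_comp mf (measurable_pair1 r); congr measurable_fun; apply/funext=> w /=; rewrite clamp_id.
by move=>w _; rewrite ger0_norm. rewrite /int /Rintegral; congr fine.
transitivity (\int[P]_w \int[Leb]_r (V (w, r))%:E)%E. apply: eq_integral=> w _; rewrite -intV /= fineK//.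
by apply: integrable_fin_num=> //; exact: i1.
rewrite (@fubini_tonelli _ _ _ _ _ P Leb (EFin \o V)) //; last exact/measEFin.
rewrite [RHS]integral_mkcond; apply: eq_integral=> r _; rewrite /patch /V/= indicE.
case: ifPn=> rab; last by rewrite (_ : (fun x=> _) = cst 0%E) ?integral0//; apply/funext=> w; rewrite mul0r.
have rab' : a <= r <= b by move: rab; rewrite inE/= in_itv.
rewrite (_ : (fun x=> _) = (EFin \o f r)); last by apply/funext=> w; rewrite mul1r clamp_id.
rewrite fineK//; apply: integrable_fin_num=> //; exact: i2. Qed.

End ParamIntegrals.

Lemma cap1_le {R : realType} (x y : \bar R) : (0 <= x)%E -> (x <= y)%E -> cap1 x <= cap1 y.
move=>x0 xy; have y0 := le_trans x0 xy. have fn (z : \bar R) : (0 <= z)%E -> mine 1%E z \is a fin_num.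
by move=>z0; rewrite ge0_fin_numE ?le_min ?lee01 ?z0// gt_min ltry. apply: fine_le; [exact: fn|exact: fn|].
by rewrite le_min !ge_min lexx xy orbT. Qed.

Lemma cap1_sum {R : realType} {I : Type} (s : seq I) (y : I -> \bar R) : (forall i, 0 <= y i)%E ->
  cap1 (\sum_(i <- s) y i)%E <= \sum_(i <- s) cap1 (y i).
move=>y0; elim: s=> [|i s IH]; first by rewrite !big_nil /cap1 min_r ?lee01//.
rewrite !big_cons; apply: (le_trans (cap1D (y0 i) _)); first exact: sume_ge0. by rewrite lerD2l. Qed.

Lemma within_right_cont {R : realType} (a r : R) (h : R -> R) : {within `[a, +oo[, continuous h} -> a <= r ->
  h s @[s --> r^'+] --> h r.
move=>ch ar; apply/cvgrPdist_lt=> e e0. have cr : h s @[s --> within `[a, +oo[ (nbhs r)] --> h r.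
by move/subspace_continuousP : ch; apply; rewrite /= in_itv/= ar.
have : \forall s \near within `[a, +oo[ (nbhs r), `|h r - h s| < e. by move/cvgrPdist_lt : cr; apply.
rewrite near_withinE=> /nbhs_ballP[del /= del0 H]; exists del=> //= s sd rs.
by apply: H=> //; rewrite /= in_itv/= andbT (le_trans ar (ltW rs)). Qed.

Lemma int_rcont {R : realType} (p q : R) (f : R -> R) : itgi p q f -> rcont p q ((fun s=> int p s f) : R -> R^o).
move=>fi; apply/rcontP=> r /andP[pr rq] e e0. have [del del0 H] := int_continuous fi e0.
exists (minr del (q - r)); first by rewrite lt_min del0 subr_gt0.
move=>s rs; rewrite -ltrBlDl lt_min=> /andP[sd sq]; apply: H.
- by rewrite pr ltW.
- by rewrite (le_trans pr (ltW rs))/=; move: sq; rewrite ltrD2r=> /ltW.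
- by rewrite distrC gtr0_norm ?subr_gt0. Qed.

Lemma rcont_path_measurable {R : realType} {d} (p q : R) (z : R -> 'rV[R]_d) : p <= q -> rcont p q z ->
  meas ((fun r=> z (clamp p q r)) : mR R -> borelRd R d).
move=>pq rz; have H := @rc_joint R d _ unit (fun r _=> z r) p q pq.
have {}H : meas ((fun x=> z (clamp p q x.1)) : mR R * unit -> borelRd R d).
by apply: H=> [r _|w r pr]; [exact: measurable_cst|exact: rz]. exact: (meas_comp H (measurable_pair2 tt)). Qed.

Lemma n1_measurable {R : realType} {d} {dT} {T : measurableType dT} (v : T -> 'rV[R]_d) :
  meas (v : T -> borelRd R d) -> meas (fun x=> n1 (v x)).
move=>mv; apply: meas_sum=> j; apply: (@meas_comp _ _ _ _ _ _ (@normr R R))=> //.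
exact: (meas_comp (borelRd_coord j) mv). Qed.

(** * The discounted formula for the solution *)

Section LevyFormula.
Context {R : realType} {dO : measure_display} {Om : measurableType dO} (P : probability Om R) (F : R -> set (set Om)) (uF :
  usual_filtration P F) {d} (W : R -> Om -> 'rV[R]_d) (BW : brownian_motion P F W) {dU} {U : measurableType dU} (M :
  {sigma_finite_measure set U -> \bar R}) (N : Om -> {measure set (U * mR R) -> \bar R}) (prm : poisson_random_measure
  P M N) (adN : adapted_random_measure P F N) (t0 T1 : R) (t00 : 0 <= t0) (tT : t0 <= T1) (b : 'rV[R]_d -> 'rV[R]_d)
  (sigma : 'rV[R]_d -> 'M[R]_d) (c : 'rV[R]_d -> U -> 'rV[R]_d) (mb : meas (b : borelRd R d -> borelRd R d)) (msigma :
  forall i j, meas ((fun x=> sigma x i j) : borelRd R d -> mR R)) (mc : meas ((fun p=> c p.1 p.2) : borelRd R d * U ->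
  borelRd R d)) (c2 : forall x i, itgT M (fun u=> c x u ord0 i ^+ 2)) (x0 : 'rV[R]_d) (X : R -> Om -> 'rV[R]_d) (XA :
  adapted_from F t0 (X : R -> Om -> borelRd R d)) (Xcad : cadlag_from t0 X) (bX : {ae P, forall w, forall i, itgi t0
  T1 (fun r=> b (X r w) ord0 i)}) (IW : 'I_d -> 'I_d -> R -> Om -> R) (IN : 'I_d -> R -> Om -> R) (IWA : forall i j,
  adapted_from F t0 (IW i j : R -> Om -> mR R)) (IWc : forall i j w, {within `[t0, +oo[, continuous (fun s=> IW i j s
  w)}) (INA : forall i, adapted_from F t0 (IN i : R -> Om -> mR R)) (INcad : forall i, cadlag_from t0 (IN i)) (SW :
  'I_d -> 'I_d -> nat -> seq (@elementary R dO Om)) (SN : 'I_d -> nat -> seq (@marked R dO Om dU U)) (okW : forall i j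
  n l, (l < size (SW i j n))%N -> elementary_ok F t0 (nth dflt_e (SW i j n) l)) (okN : forall i n l, (l < size (SN i
  n))%N -> marked_ok F M t0 (nth dflt_m (SN i n) l)) (cW : forall i j, cvg_to0_in_prob P (fun n w => \int[Leb]_(r in
  `[t0, T1]) ((sigma (X r w) i j - elementary_val (SW i j n) r w) ^+ 2)%:E)%E) (cN : forall i, cvg_to0_in_prob P (fun
  n w => \int[Leb]_(r in `[t0, T1]) \int[M]_u ((c (left_limit X r w) u ord0 i - marked_val (SN i n) r w u) ^+
  2)%:E)%E) (cIW : forall i j s, t0 <= s -> cvg_to0_in_prob P (fun n w => (`|IW i j s w - elementary_int (fun r w=> W
  r w ord0 j) (SW i j n) s w|)%:E)) (cIN : forall i s, t0 <= s -> cvg_to0_in_prob P (fun n w => (`|IN i s w -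
  marked_int M N (SN i n) s w|)%:E)) (eqX : {ae P, forall w, forall s i, t0 <= s -> X s w ord0 i = x0 ord0 i + int t0
  s (fun r=> b (X r w) ord0 i) + \sum_(j < d) IW i j s w + IN i s w}) (lam : R) (kap : sfun R d) (lam0 : 0 < lam)
  (mkap : meas (fun p : mR R * borelRd R d=> kap p.1 p.2)) (kap_b : forall r x, lam * (1 + \sum_j `|b x ord0 j|) <=
  kap r x) (kapi : {ae P, forall w, itgi t0 T1 (fun r=> kap r (X r w))}).

Let Xc r w := X (clamp t0 T1 r) w.
Let fv n w i j r := elementary_val (SW i j n) r w.
Let gv n w i r u := marked_val (SN i n) r w u.
Let fX w i j r := sigma (Xc r w) i j.
Let gX w i r u := c (Xc r w) u ord0 i.
Let bb j r w := b (Xc r w) ord0 j.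
(** Only the noise coefficients are approximated: b and kap are evaluated along X itself, while the
    square norm in the rate is that of the n-th approximation. *)
Let kk n r w := rate M lam (fun r=> kap r (Xc r w)) (fv n w) (gv n w) r.

Let Fmono s s' : 0 <= s -> s <= s' -> F s `<=` F s'. Proof. exact: uF.2.1. Qed.
Let sF s : t0 <= s -> sigma_algebra setT (F s).
by move=>ts; have [] := uF.1 s (le_trans t00 ts). Qed.
Let Fm s : t0 <= s -> F s `<=` measurable.
by move=>ts; have [] := uF.1 s (le_trans t00 ts). Qed.

Section Joint.
Context (s : R) (ts : t0 <= s) {dT : measure_display} {T' : measurableType dT} (e : T' -> Om) (me : forall A, F s A -> measurable (e
  @^-1` A)).

Let mew r {d2} {T2 : measurableType d2} (Y : Om -> T2) : t0 <= r -> r <= s -> meas_wrt (F r) Y -> meas (Y \o e).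
move=>tr rs mY _ B mB; rewrite setTI; apply: (me (A := Y @^-1` B)).
by apply: (Fmono (le_trans t00 tr) rs); exact: mY. Qed.

(** The map e will be the identity seen from two sides: from Om with the sigma-algebra F s, for
    adaptedness at time s, and from Om itself with s = T1, for joint measurability. *)
Lemma X_joint : meas ((fun p=> X (clamp t0 s p.1) (e p.2)) : mR R * T' -> borelRd R d).
apply: (rc_joint (Z := fun r x=> X r (e x)))=> // [r /andP[tr rs]|w r /andP[tr rs]].
exact: (mew tr rs (XA tr)). exact: (Xcad (e w)).1. Qed.

Lemma sigma_joint i j : meas (fun p : mR R * T'=> sigma (X (clamp t0 s p.1) (e p.2)) i j).
exact: (meas_comp (msigma i j) X_joint). Qed.

Lemma c_joint i : meas (fun p : (mR R * T') * U=> c (X (clamp t0 s p.1.1) (e p.1.2)) p.2 ord0 i).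
apply: (meas_comp (borelRd_coord i)); apply: (meas_comp mc (g := fun p : (mR R * T') * U =>
((X (clamp t0 s p.1.1) (e p.1.2) : borelRd R d), p.2))).
by apply: measurable_fun_pair=> //; exact: (meas_comp X_joint measurable_fst). Qed.

Lemma b_joint j : meas (fun p : mR R * T'=> b (X (clamp t0 s p.1) (e p.2)) ord0 j).
exact: (meas_comp (borelRd_coord j) (meas_comp mb X_joint)). Qed.
Let indic_coef (el : @elementary R dO Om) : elementary_ok F t0 el -> meas (fun p : mR R * T' =>
  coef el (e p.2) * \1_(`]start el, stop el]) (clamp t0 s p.1)).
move=> [te se [_ mcf]]; have [es|se'] := leP (start el) s.
apply: measM; first exact: (meas_comp (mew te es mcf) measurable_snd).
have mi : meas (\1_(`]start el, stop el]%classic) : mR R -> R) by [].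
exact: (meas_comp (meas_comp mi (clamp_measurable t0 s)) measurable_fst).
rewrite (_ : (fun _=> _) = cst 0)//; apply/funext=> p; rewrite indicE memNset ?mulr0//= in_itv/=.
by have /andP[_ h] := clamp_itv p.1 ts; rewrite ltNge (le_trans h (ltW se')). Qed.

Lemma val_joint n i j : meas (fun p : mR R * T'=> elementary_val (SW i j n) (clamp t0 s p.1) (e p.2)).
rewrite /elementary_val; under eq_fun do rewrite (big_nth dflt_e) big_mkord.
by apply: meas_sum=> l; apply: indic_coef; exact: okW. Qed.

Lemma mval_joint n i : meas (fun p : (mR R * T') * U=> marked_val (SN i n) (clamp t0 s p.1.1) (e p.1.2) p.2).
rewrite /marked_val; under eq_fun do rewrite (big_nth dflt_m) big_mkord.
apply: meas_sum=> l; have [ok mm fm] := okN (ltn_ord l).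
apply: measM; first exact: (meas_comp (indic_coef ok) measurable_fst).
have mi : meas (\1_(mark (nth dflt_m (SN i n) l)) : U -> R) by exact: measurable_indic.
exact: (meas_comp mi measurable_snd). Qed.

Lemma kap_joint : meas (fun p : mR R * T'=> kap (clamp t0 s p.1) (X (clamp t0 s p.1) (e p.2))).
apply: (meas_comp mkap (g := fun p : mR R * T' =>
((clamp t0 s p.1 : mR R), (X (clamp t0 s p.1) (e p.2) : borelRd R d)))).
apply: measurable_fun_pair; last exact: X_joint. exact: (meas_comp (clamp_measurable t0 s) measurable_fst). Qed.

Lemma sq_joint n : meas (fun p : mR R * T' => sqint M (fv n (e p.2)) (gv n (e p.2)) (clamp t0 s p.1)).
apply: (sqint_joint M (f := fun i j p=> fv n (e p.2) i j (clamp t0 s p.1))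
(g := fun i p u=> gv n (e p.2) i (clamp t0 s p.1) u))=> [i j|i]. exact: val_joint. exact: mval_joint. Qed.

End Joint.

Let clampc s r : t0 <= s <= T1 -> clamp t0 T1 (clamp t0 s r) = clamp t0 s r.
move=> /andP[ts sT]; rewrite clamp_id//; have /andP[-> h] := clamp_itv r ts. exact: le_trans sT. Qed.

Lemma Kp_adapted n s : t0 <= s <= T1 -> meas_wrt (F s) (Kp t0 (kk n) s).
move=>tsT; have /andP[ts sT] := tsT; apply/(meas_wrt_subalg (sF ts)).
apply: (meas_comp (@measurable_expR R)); apply: (@meas_comp _ _ _ _ _ _ (@GRing.opp R))=> //.
apply: measurable_integral_param; rewrite /kk /rate.
have me A : F s A -> measurable ((id : subalg (F s) -> Om) @^-1` A) by exact: sub_sigma_algebra.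
apply: measD; last by apply: measM=> //; exact: (sq_joint ts me).
have := kap_joint ts me; congr measurable_fun; apply/funext=> p. by rewrite /Xc clampc. Qed.

Lemma betap_adapted s : t0 <= s <= T1 -> meas_wrt (F s) (betap t0 bb s : Om -> borelRd R d).
move=>tsT; have /andP[ts sT] := tsT; apply/(meas_wrt_subalg (sF ts)); apply: borelRd_measurable=> j.
under eq_fun do rewrite mxE. apply: measurable_integral_param.
have me A : F s A -> measurable ((id : subalg (F s) -> Om) @^-1` A) by exact: sub_sigma_algebra.
by have := b_joint ts me j; congr measurable_fun; apply/funext=> p; rewrite /bb /Xc clampc. Qed.

Let idm A : F T1 A -> measurable ((id : Om -> Om) @^-1` A). Proof. exact: Fm. Qed.
Let mX r : t0 <= r -> meas (X r : Om -> borelRd R d).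
by move=>tr _ B mB; rewrite setTI; apply: (Fm tr); exact: XA. Qed.
Let L2 n w := (\int[Leb]_(r in `[t0, T1])
  (sqint M (fun i j r=> fv n w i j r - fX w i j r) (fun i r u=> gv n w i r u - gX w i r u) r)%:E)%E.
Let LW i j n w := (\int[Leb]_(r in `[t0, T1]) ((fv n w i j r - fX w i j r) ^+ 2)%:E)%E.
Let LN i n w := (\int[Leb]_(r in `[t0, T1]) (\int[M]_u ((gv n w i r u - gX w i r u) ^+ 2))%:E)%E.

Let Xc_clamp r w : Xc (clamp t0 T1 r) w = Xc r w.
by rewrite /Xc (clamp_id (clamp_itv r tT)). Qed.
Let mdf n i j : meas (fun p : mR R * Om => fv n p.2 i j (clamp t0 T1 p.1) - fX p.2 i j (clamp t0 T1 p.1)).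
apply: measB; first exact: (val_joint tT idm).
by have := sigma_joint tT idm i j; congr measurable_fun; apply/funext=> p; rewrite /fX Xc_clamp. Qed.
Let mdg n i : meas (fun p : (mR R * Om) * U =>
  gv n p.1.2 i (clamp t0 T1 p.1.1) p.2 - gX p.1.2 i (clamp t0 T1 p.1.1) p.2).
apply: measB; first exact: (mval_joint tT idm).
by have := c_joint tT idm i; congr measurable_fun; apply/funext=> p; rewrite /gX Xc_clamp. Qed.
Let mLN i n : meas (fun p : mR R * Om =>
  \int[M]_u ((gv n p.2 i (clamp t0 T1 p.1) u - gX p.2 i (clamp t0 T1 p.1) u) ^+ 2)).
apply: (measurable_Rint_param M (f := fun q : (mR R * Om) * U =>
(gv n q.1.2 i (clamp t0 T1 q.1.1) q.2 - gX q.1.2 i (clamp t0 T1 q.1.1) q.2) ^+ 2)).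
by apply: measurable_funX; exact: mdg. Qed.
Let simple_ok n i l : (l < size (SN i n))%N ->
  measurable (mark (nth dflt_m (SN i n) l)) /\ (M (mark (nth dflt_m (SN i n) l)) < +oo)%E.
by move=> /okN[]. Qed.
Let adv n w : admissible M t0 T1 (fv n w) (gv n w).
exact: (admissible_simple (M := M) t0 T1 (fun i j=> SW i j n) (SN := fun i=> SN i n) (fun i l=> @simple_ok n i l) w).
Qed.
Let mfX w i j : meas (fX w i j : mR R -> R).
have := meas_comp (sigma_joint tT idm i j) (measurable_pair2 w). by congr measurable_fun. Qed.
Let mgX w i : meas (fun x : mR R * U=> gX w i x.1 x.2).
have := meas_comp (c_joint tT idm i) (g := fun x : mR R * U=> ((x.1, w), x.2)).
apply; apply: measurable_fun_pair=> //; apply: measurable_fun_pair=> //. Qed.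
Let gXr w i r : meas (gX w i r).
exact: meas_comp (mgX w i) (measurable_pair1 r). Qed.
Let gvr n w i r : meas (gv n w i r).
exact: meas_comp (ad_g (adv n w) i) (measurable_pair1 r). Qed.
Let dgi n w i r : itgT M (fun u=> (gv n w i r u - gX w i r u) ^+ 2).
by apply: itg_sqrB; [exact: gvr|exact: gXr|exact: ad_gi (adv n w) i r|exact: c2]. Qed.
Let section_measurable (f : R -> Om -> R) w : meas (fun p : mR R * Om=> f (clamp t0 T1 p.1) p.2) ->
  measi t0 T1 (fun r=> f r w).
move=>mf; have := measurable_funTS (D := `[t0, T1]%classic) (meas_comp mf (measurable_pair2 w)).
by apply: eq_measurable_fun=> r /=; rewrite inE/= in_itv/= => rab; rewrite clamp_id. Qed.
Let L2E n w : L2 n w = (\sum_i \sum_j LW i j n w + \sum_i LN i n w)%E.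
have m1r i j : measi t0 T1 (fun r=> (fv n w i j r - fX w i j r) ^+ 2). apply: measurable_funX.
exact: (section_measurable (f := fun r w=> fv n w i j r - fX w i j r)).
have m1 i j : measi t0 T1 (fun r=> ((fv n w i j r - fX w i j r) ^+ 2)%:E). by apply/measEFin; exact: m1r.
have m2 i : measi t0 T1 (fun r=> (\int[M]_u ((gv n w i r u - gX w i r u) ^+ 2))%:E). apply/measEFin.
exact: (section_measurable (f := fun r w=> \int[M]_u ((gv n w i r u - gX w i r u) ^+ 2))).
have p2 i r : (0 <= (\int[M]_u ((gv n w i r u - gX w i r u) ^+ 2))%:E)%E.
by rewrite lee_fin; apply: Rintegral_ge0=> u _; exact: sqr_ge0.
have p1 i j r : (0 <= ((fv n w i j r - fX w i j r) ^+ 2)%:E)%E by rewrite lee_fin sqr_ge0.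
rewrite /L2 /sqint; under eq_integral do rewrite EFinD -!sumEFin. rewrite ge0_integralD//; last 4 first.
- by move=>r _; apply: sume_ge0=> i _; rewrite -sumEFin; apply: sume_ge0.
- apply: emeasurable_sum=> i; apply/measEFin; by apply: meas_sum=> j; exact: m1r.
- by move=>r _; apply: sume_ge0.
- by apply: emeasurable_sum. congr (_ + _)%E; last by rewrite ge0_integral_sum.
rewrite ge0_integral_sum//; last 2 first.
- move=>i; apply/measEFin; by apply: meas_sum=> j; exact: m1r.
- by move=>i r _; rewrite -sumEFin; apply: sume_ge0. apply: eq_bigr=> i _; under eq_integral do rewrite -sumEFin.
by rewrite ge0_integral_sum// => j; exact: m1. Qed.
Let LW0 i j n w : (0 <= LW i j n w)%E.
by apply: integral_ge0=> r _; rewrite lee_fin sqr_ge0. Qed.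
Let LN0 i n w : (0 <= LN i n w)%E.
by apply: integral_ge0=> r _; rewrite lee_fin; apply: Rintegral_ge0=> u _; exact: sqr_ge0. Qed.
Let L20 n w : (0 <= L2 n w)%E.
by apply: integral_ge0=> r _; rewrite lee_fin; exact: sqint_ge0. Qed.
Let vanish_LW i j : vanish P (fun n w=> cap1 (LW i j n w)).
apply: vanish_in_prob=> //.
move=>n; apply: (measurable_eint_param (f := fun r w=> (fv n w i j r - fX w i j r) ^+ 2)).
by apply: measurable_funX; exact: mdf. by move=> *; exact: sqr_ge0.
have := cW i j; congr cvg_to0_in_prob; apply/funext=> n; apply/funext=> w.
apply: eq_integral=> r; rewrite inE/= in_itv/= => pr. by rewrite /fX /Xc clamp_id// -[X in X ^+ 2]opprB sqrrN. Qed.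
(** The given approximation concerns c at left limits of X. A path has countably many jumps, so
    replacing the left limit by X changes the integrand on a Lebesgue null set only. *)
Let vanish_LN i : vanish P (fun n w=> cap1 (LN i n w)).
apply: vanish_in_prob=> //.
move=>n; apply: (measurable_eint_param (f := fun r w=> \int[M]_u ((gv n w i r u - gX w i r u) ^+ 2)))=> //.
by move=> *; apply: Rintegral_ge0=> u _; exact: sqr_ge0.
have := cN i; congr cvg_to0_in_prob; apply/funext=> n; apply/funext=> w.
have [D cD HD] := cadlag_jumps_countable (y := X ^~ w) (Xcad w).1 (Xcad w).2.
(* The point t0 is removed as well, since nothing is known of the left limit there. *)
have mD : measurable (`[t0, T1]%classic : set (mR R)) by []. pose D' := D `|` [set t0]. have cD' : countable D'.
rewrite (_ : D' = \bigcup_n (if n is 0 then D else [set t0])); first by apply: bigcup_countable=> // -[|m] _ //; exact: countable1.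
by apply/seteqP; split=> r /=; [move=> [Dr|->]; [exists 0%N|exists 1%N]|move=> [[|m] _]; [left|right]].
have E r : `[t0, T1]%classic r -> ~ D' r ->
(\int[M]_u ((c (left_limit X r w) u ord0 i - marked_val (SN i n) r w u) ^+ 2)%:E)%E =
(\int[M]_u ((gv n w i r u - gX w i r u) ^+ 2))%:E. rewrite /= in_itv/= => pr nD; have /andP[tr rT] := pr.
have tr' : t0 < r. by rewrite lt_neqAle tr andbT; apply/eqP=> e; apply: nD; right; rewrite /= e.
rewrite /left_limit HD//; last by move=>Dr; apply: nD; left.
rewrite /Rintegral fineK; last by apply: integrable_fin_num=> //; exact: dgi.
by apply: eq_integral=> u _; rewrite /gX /Xc clamp_id// -[X in X ^+ 2]opprB sqrrN.
have m2 : measi t0 T1 (fun r=> (\int[M]_u ((gv n w i r u - gX w i r u) ^+ 2))%:E). apply/measEFin.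
exact: (section_measurable (f := fun r w=> \int[M]_u ((gv n w i r u - gX w i r u) ^+ 2))).
apply/esym/ge0_ae_eq_integral=> //.
- exact: measurable_off_countable cD' m2 E.
- by move=>r _; rewrite lee_fin; apply: Rintegral_ge0=> u _; exact: sqr_ge0.
- by move=>r _; apply: integral_ge0=> u _; rewrite lee_fin sqr_ge0. exists D'; split.
- by apply: (@countable_measurable _ (mR R))=> // t; exact: measurable_set1.
- exact: countable_lebesgue_measure0.
- by move=>r /= nE; apply: contrapT=> nD; apply: nE=> pr; exact/esym/E. Qed.
Let mL2 n : meas (L2 n).
rewrite (_ : L2 n = fun w=> \sum_i \sum_j LW i j n w + \sum_i LN i n w)%E; last by apply/funext=> w; exact: L2E.
apply: emeasurable_funD; apply: emeasurable_sum=> i.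
apply: emeasurable_sum=> j; apply: (measurable_eint_param (f := fun r w=> (fv n w i j r - fX w i j r) ^+ 2)).
by apply: measurable_funX; exact: mdf. by move=> *; exact: sqr_ge0.
apply: (measurable_eint_param (f := fun r w=> \int[M]_u ((gv n w i r u - gX w i r u) ^+ 2)))=> //.
by move=> *; apply: Rintegral_ge0=> u _; exact: sqr_ge0. Qed.
Let vanish_L2 : vanish P (fun n w=> cap1 (L2 n w)).
apply: (vanish_le (Q' := fun n w=> \sum_i \sum_j cap1 (LW i j n w) + \sum_i cap1 (LN i n w))).
- by move=>n; apply: measurable_cap1.
- move=>n w; have /andP[-> _] /= := cap1_itv (L20 n w); rewrite L2E.
apply: (le_trans (cap1D _ _)); [by apply: sume_ge0=> i _; exact: sume_ge0|exact: sume_ge0|].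
apply: lerD; last exact: cap1_sum. apply: (le_trans (cap1_sum _ _)); first by move=>i; exact: sume_ge0.
by apply: ler_sum=> i _; exact: cap1_sum.
- apply: vanishD; apply: vanish_sum=> i; last exact: vanish_LN. by apply: vanish_sum=> j; exact: vanish_LW. Qed.
Let Y r w : 'rV[R]_d := \row_i (x0 ord0 i + \sum_j IW i j r w + IN i r w).
Let Yn n r w := Yp W M N x0 (fun i j=> SW i j n) (fun i=> SN i n) r w.
Let G : set Om := [set w | forall n, marks_finite N t0 T1 (fun i=> SN i n) w].

Let G_ae : {ae P, forall w, G w}.
apply: ae_foralln=> n. apply: (marks_finite_ae uF prm adN t00 tT (SN := fun i=> SN i n))=> i l; exact: okN.
Qed.
Let mG : measurable G.
rewrite -[G]setCK; apply: measurableC; apply: (usual_complete uF). exact: G_ae. Qed.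
(** The paths of Yn are known to be right-continuous on G only; the indicator of G makes the capped
    distance jointly measurable in (r, w). *)
Let gn n r w : R := \1_G w * cap1 (n1 (Yn n r w - Y r w))%:E.

Let mYn n r : t0 <= r <= T1 -> meas (Yn n r : Om -> borelRd R d).
move=>tr _ B mB; rewrite setTI; have /andP[tr0 _] := tr; apply: (Fm tr0).
exact: (Yp_adapted uF BW adN t00 x0 (fun i j l=> @okW i j n l) (fun i l=> @okN i n l) tr mB). Qed.
Let mY r : t0 <= r <= T1 -> meas (Y r : Om -> borelRd R d).
move=> /andP[tr _]; have sub (f : Om -> R) : meas_wrt (F r) (f : Om -> mR R) -> meas f.
by move=>mf _ B mB; rewrite setTI; apply: (Fm tr); exact: mf.
apply: borelRd_measurable=> i; under eq_fun do rewrite mxE. apply: measD; last by apply: sub; exact: INA.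
by apply: measD=> //; apply: meas_sum=> j; apply: sub; exact: IWA. Qed.
Let Y_rcont w : rcont t0 T1 (Y ^~ w).
apply: rcont_coord=> i r /andP[tr _].
rewrite (_ : (fun s=> Y s w ord0 i) = (fun s=> x0 ord0 i + \sum_j IW i j s w + IN i s w)); last first.
by apply/funext=> s; rewrite mxE. rewrite mxE; apply: cvgD; last exact: (INcad i w).1.
by apply: cvgD; [exact: cvg_cst|apply: cvg_bigsum=> j; exact: (within_right_cont (@IWc i j w))]. Qed.
Let Yn_rcont n w : G w -> rcont t0 T1 (Yn n ^~ w).
move=>Gw; exact: (@Yp_rcont _ _ _ _ _ _ _ BW _ _ _ _ _ _ t00 _ _ _ (fun i j l=> @okW i j n l) (fun i l=> @okN i n l) _ (Gw n)).
Qed.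
Let gn01 n r w : 0 <= gn n r w <= 1.
have /andP[h0 h1] : 0 <= cap1 (n1 (Yn n r w - Y r w))%:E <= 1 by apply: cap1_itv; rewrite lee_fin; exact: n1_ge0.
by rewrite /gn indicE; case: (w \in G); rewrite ?mul1r ?mul0r ?h0 ?h1// lexx ler01. Qed.
Let mdiff {dT} {T' : measurableType dT} (f h : T' -> 'rV[R]_d) : meas (f : T' -> borelRd R d) ->
  meas (h : T' -> borelRd R d) -> meas ((fun x=> f x - h x) : T' -> borelRd R d).
move=>mf mh; apply: borelRd_measurable=> i; under eq_fun do rewrite !mxE.
by apply: measB; [exact: (meas_comp (borelRd_coord i) mf)|exact: (meas_comp (borelRd_coord i) mh)]. Qed.
Let mgn n r : t0 <= r <= T1 -> meas (gn n r).
move=>tr; apply: measM; first exact: measurable_indic.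
apply: measurable_cap1; apply/measEFin; apply: n1_measurable; apply: mdiff; [exact: mYn|exact: mY]. Qed.
Let gn_joint n : meas (fun p : mR R * Om=> gn n (clamp t0 T1 p.1) p.2).
pose Z r w := \1_G w *: Yn n r w.
have mZ : meas ((fun p=> Z (clamp t0 T1 p.1) p.2) : mR R * Om -> borelRd R d). apply: rc_joint=> // [r tr|w r tr].
apply: borelRd_measurable=> i; under eq_fun do rewrite mxE.
by apply: measM; [exact: measurable_indic|exact: (meas_comp (borelRd_coord i) (mYn n tr))].
rewrite /Z; have [Gw|nG] := pselect (G w).
by rewrite indicE mem_set// scale1r; under eq_fun do rewrite scale1r; exact: Yn_rcont.
by rewrite indicE memNset// scale0r; under eq_fun do rewrite scale0r; exact: cvg_cst.
have mYj : meas ((fun p=> Y (clamp t0 T1 p.1) p.2) : mR R * Om -> borelRd R d).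
by apply: rc_joint=> [//|r tr|w r tr]; [exact: mY|exact: Y_rcont].
rewrite (_ : (fun p=> _) = fun p=> \1_G p.2 * cap1 (n1 (Z (clamp t0 T1 p.1) p.2 - Y (clamp t0 T1 p.1) p.2))%:E).
apply: measM. have mi : meas (\1_G : Om -> R) by exact: measurable_indic. exact: (meas_comp mi measurable_snd).
by apply: measurable_cap1; apply/measEFin; apply: n1_measurable; exact: mdiff.
apply/funext=> p; rewrite /gn /Z indicE; case: (p.2 \in G); last by rewrite !mul0r. by rewrite scale1r. Qed.
Let vanish_g r : t0 <= r <= T1 -> vanish P (fun n w=> gn n r w).
move=>tr; have /andP[tr0 _] := tr.
pose a i j n w := (`|IW i j r w - elementary_int (fun r w=> W r w ord0 j) (SW i j n) r w|)%:E : \bar R.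
pose a' i n w := (`|IN i r w - marked_int M N (SN i n) r w|)%:E : \bar R.
apply: (vanish_le (Q' := fun n w=> \sum_i (\sum_j cap1 (a i j n w) + cap1 (a' i n w)))).
- by move=>n; exact: mgn.
- move=>n w; have /andP[-> _] /= := gn01 n r w. apply: (@le_trans _ _ (cap1 (n1 (Yn n r w - Y r w))%:E)).
rewrite /gn indicE; case: (w \in G); rewrite ?mul1r ?mul0r//.
by have /andP[] : 0 <= cap1 (n1 (Yn n r w - Y r w))%:E <= 1 by apply: cap1_itv; rewrite lee_fin; exact: n1_ge0.
apply: (@le_trans _ _ (cap1 (\sum_i (\sum_j a i j n w + a' i n w))%E)).
apply: cap1_le; first by rewrite lee_fin; exact: n1_ge0.
rewrite (eq_bigr (fun i=> (\sum_j `|IW i j r w - elementary_int (fun r w=> W r w ord0 j) (SW i j n) r w|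
+ `|IN i r w - marked_int M N (SN i n) r w|)%:E)); last by move=>i _; rewrite EFinD -sumEFin.
rewrite sumEFin lee_fin; apply: ler_sum=> i _; rewrite !mxE.
set e1 := \sum_j elementary_int _ _ _ _; set e2 := marked_int _ _ _ _ _.
have -> : x0 ord0 i + e1 + e2 - (x0 ord0 i + \sum_j IW i j r w + IN i r w) =
- ((\sum_j IW i j r w - e1) + (IN i r w - e2)) by ring.
rewrite normrN; apply: (le_trans (ler_normD _ _)); rewrite lerD2r /e1 -sumrB; exact: ler_norm_sum.
apply: (le_trans (cap1_sum _ _)). by move=>i; apply: adde_ge0; [apply: sume_ge0=> j _|]; rewrite lee_fin.
apply: ler_sum=> i _; apply: (le_trans (cap1D _ _)).
- by apply: sume_ge0=> j _; rewrite lee_fin.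
- by rewrite lee_fin.
- by rewrite lerD2r; apply: cap1_sum=> j; rewrite lee_fin.
- have mN (f : Om -> R) : meas f -> meas (fun w=> (`|f w|)%:E).
by move=>mf; apply/measEFin; exact: (@meas_comp _ _ _ _ _ _ (@normr R R)).
have sub (f : Om -> R) : meas_wrt (F r) (f : Om -> mR R) -> meas f.
by move=>mf _ B mB; rewrite setTI; apply: (Fm tr0); exact: mf.
(* Measurability of a single elementary integral is read off from that of the whole process, with
   start 0 and all other sequences empty. *)
have Ym (S : 'I_d -> 'I_d -> seq (@elementary R dO Om)) (S' : 'I_d -> seq (@marked R dO Om dU U)) i :
(forall i j l, (l < size (S i j))%N -> elementary_ok F t0 (nth dflt_e (S i j) l)) ->
(forall i l, (l < size (S' i))%N -> marked_ok F M t0 (nth dflt_m (S' i) l)) ->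
meas (fun w=> \sum_j elementary_int (fun r w=> W r w ord0 j) (S i j) r w + marked_int M N (S' i) r w).
move=>oS oS'; have mY0 : meas (Yp W M N 0 S S' r : Om -> borelRd R d).
by move=> _ B mB; rewrite setTI; apply: (Fm tr0); exact: (Yp_adapted uF BW adN t00 0 oS oS' tr mB).
have := meas_comp (borelRd_coord i) mY0; congr measurable_fun; apply/funext=> w /=. by rewrite !mxE add0r.
have mE i j n : meas (fun w=> elementary_int (fun r w=> W r w ord0 j) (SW i j n) r w).
have := Ym (fun _ j'=> if j' == j then SW i j n else [::]) (fun=> [::]) i _ _.
set H := (X in X -> _ -> _); have h : H by move=> _ j' l; case: eqP=> // _; exact: okW.
move=> /(_ h)=> K; have {K} := K ltac:(by []); congr measurable_fun; apply/funext=> w.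
rewrite {1}/marked_int big_nil addr0 (bigD1 j)//= eqxx big1 ?addr0// => j' /negbTE ->.
by rewrite /elementary_int big_nil. have mI i n : meas (fun w=> marked_int M N (SN i n) r w).
have := Ym (fun _ _=> [::]) (fun i=> SN i n) i ltac:(by []) (fun i l=> @okN i n l).
congr measurable_fun; apply/funext=> w. by rewrite big1 ?add0r// => j _; rewrite /elementary_int big_nil.
apply: vanish_sum=> i; apply: vanishD; first apply: vanish_sum=> j.
apply: vanish_in_prob; [|by move=>n w; rewrite lee_fin|exact: cIW].
by move=>n; apply: mN; apply: measB=> //; apply: sub; exact: IWA.
apply: vanish_in_prob; [|by move=>n w; rewrite lee_fin|exact: cIN].
by move=>n; apply: mN; apply: measB=> //; apply: sub; exact: INA. Qed.
Let Dn n w := int t0 T1 (fun r=> gn n r w).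

Let gn_itg n w : itgi t0 T1 (fun r=> gn n r w).
apply: (@le_itgi R t0 T1 _ (fun=> 1)); last exact: itg_cst. exact: (section_measurable (f := gn n)).
by move=>r _; have /andP[h0 h1] := gn01 n r w; rewrite ger0_norm. Qed.
(** At each time the approximations converge in probability only. Fubini carries this to the
    integral over time, from which convergence at almost every time follows along a subsequence. *)
Let vanish_D : vanish P Dn.
have g0 n r w : 0 <= gn n r w by case/andP: (gn01 n r w).
have g1 n r w : gn n r w <= 1 by case/andP: (gn01 n r w).
have gi n r : t0 <= r <= T1 -> itgT P (gn n r) by move=>tr; exact: (vanish_itg n (vanish_g tr)). split.
- by move=>n; apply: measurable_integral_param; exact: gn_joint.
- by move=>n w; exact: int_ge0.
- exists (T1 - t0)=> n w; rewrite -[T1 - t0]mul1r -int_cst//; apply: int_le=> //; exact: itg_cst.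
- apply: (cvg_ext (g := fun n=> int t0 T1 (fun r=> \int[P]_w gn n r w))).
by move=>n; apply: Rint_swap=> //; exact: gn_joint.
apply: (@cvg_to_eq _ _ (int t0 T1 (fun=> 0))); last by rewrite int_cst// mul0r.
apply: (@int_dct R t0 T1 _ (fun=> 0) (fun=> 1)).
+ move=>n; have m := measurable_Rint_param P (gn_joint n). have {}m := measurable_funTS (D := `[t0, T1]%classic) m.
apply: eq_measurable_fun m=> r /=; rewrite inE/= in_itv/= => rab. by apply: eq_Rintegral=> w _; rewrite clamp_id.
+ by move=>r tr; have [_ _ _] := vanish_g tr.
+ exact: itg_cst.
+ move=>n r tr; rewrite ger0_norm; last by apply: Rintegral_ge0. apply: (@le_trans _ _ (\int[P]_w 1)).
by apply: le_Rintegral=> //; [exact: gi|exact: finite_measure_integrable_cst].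
by rewrite Rintegral_cst// mul1r [X in fine X](_ : _ = 1%E); last exact: probability_setT. Qed.
(** The terminal time has its own summand, since convergence at almost every r says nothing about
    T1. *)
Let Q n w := cap1 (L2 n w) + Dn n w + gn n T1 w.

Let vanish_Q : vanish P Q.
by apply: vanishD; [apply: vanishD|apply: vanish_g; rewrite tT lexx]. Qed.
Let zn n r w := zp W M N t0 x0 (fun i j=> SW i j n) (fun i=> SN i n) bb r w.

Record good_limit (nk : nat -> nat) w : Prop := GoodLimit {
  gl_ad : admissible M t0 T1 (fX w) (gX w);
  gl_sq : int t0 T1 (sqint M (fun i j r=> fv (nk k) w i j r - fX w i j r)
    (fun i r u=> gv (nk k) w i r u - gX w i r u)) @[k --> \oo] --> (0 : R);
  gl_z : {ae Leb, forall r, t0 <= r <= T1 -> zn (nk k) r w @[k --> \oo] --> X r w};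
  gl_zT : zn (nk k) T1 w @[k --> \oo] --> X T1 w }.

(** Each summand of Q is summable along the subsequence and so tends to 0. For the time integral the
    series is moved under the integral sign, which gives convergence at almost every r. *)
Lemma good_limitP nk w : G w -> (forall s i, t0 <= s -> X s w ord0 i = x0 ord0 i
  + int t0 s (fun r=> b (X r w) ord0 i) + \sum_(j < d) IW i j s w + IN i s w) ->
  (\sum_(0 <= k <oo) (Q (nk k) w)%:E < +oo)%E -> good_limit nk w.
move=>Gw eX HQ. have g0 n r : 0 <= gn n r w by case/andP: (gn01 n r w).
have D0 n : 0 <= Dn n w by exact: int_ge0. have l0 n : 0 <= cap1 (L2 n w) by case/andP: (cap1_itv (L20 n w)).
have sub (q : nat -> R) : (forall k, 0 <= q k) -> (forall k, q k <= Q (nk k) w) -> (\sum_(0 <= k <oo) (q k)%:E < +oo)%E.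
move=>q0 qQ; apply: le_lt_trans HQ; apply: lee_nneseries=> k; rewrite ?lee_fin// => _; exact: qQ.
have hQ n : [/\ cap1 (L2 n w) <= Q n w, Dn n w <= Q n w & gn n T1 w <= Q n w].
rewrite /Q; move: (l0 n) (D0 n) (g0 n T1); move: (cap1 _) (Dn n w) (gn n T1 w)=> a1 a2 a3 h1 h2 h3. by split; lra.
have c1 : cap1 (L2 (nk k) w) @[k --> \oo] --> (0 : R). apply: summable_cvg0; first by move=>k; exact: l0.
by apply: sub=> k; [exact: l0|have [] := hQ (nk k)]. have c3 : gn (nk k) T1 w @[k --> \oo] --> (0 : R).
apply: summable_cvg0; first by move=>k; exact: g0. by apply: sub=> k; [exact: g0|have [] := hQ (nk k)].
have c2' : {ae Leb, forall r, t0 <= r <= T1 -> gn (nk k) r w @[k --> \oo] --> (0 : R)}.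
have : {ae Leb, forall r, `[t0, T1]%classic r -> (\sum_(0 <= k <oo) (gn (nk k) r w)%:E < +oo)%E}.
apply: summable_integral=> //. by move=>k; exact: (section_measurable (f := gn (nk k))).
have : (\sum_(0 <= k <oo) (Dn (nk k) w)%:E < +oo)%E. by apply: sub=> k; [exact: D0|have [] := hQ (nk k)].
congr (_ < _)%E; apply: eq_eseriesr=> k _; rewrite /Dn /int /Rintegral fineK//.
by apply: integrable_fin_num=> //; exact: gn_itg.
apply: ae_imp=> r H tr; apply: summable_cvg0; first by move=>k; exact: g0. by apply: H; rewrite /= in_itv.
(* By the equation X is [betap + Y], with the same drift as the approximations; their distance to X
   is therefore that of Yn to Y. *)
have zc r : t0 <= r <= T1 -> gn (nk k) r w @[k --> \oo] --> (0 : R) -> zn (nk k) r w @[k --> \oo] --> X r w.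
move=>tr cg; have /andP[tr0 trT] := tr. have XE : X r w = betap t0 bb r w + Y r w. apply/rowP=> i; rewrite !mxE eX//.
rewrite (_ : int t0 r (bb i ^~ w) = int t0 r (fun r=> b (X r w) ord0 i)); first by ring.
apply: int_eq=> r' /andP[tr' rr']; rewrite /bb /Xc clamp_id//. by rewrite tr' (le_trans rr' trT).
have E k : zn (nk k) r w - X r w = Yn (nk k) r w - Y r w.
by rewrite XE /zn /zp -/(Yn (nk k) r w) opprD addrACA subrr add0r.
apply/cvgrPdist_lt=> e e0; have e1 : 0 < minr 1 e by rewrite lt_min ltr01.
move/cvgrPdist_lt : cg=> /(_ _ e1); apply: filterS=> k; rewrite sub0r normrN ger0_norm//.
rewrite /gn indicE mem_set// mul1r cap1_EFin; last exact: n1_ge0.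
rewrite distrC E=> H; apply: (le_lt_trans (norm_le_n1 _)).
have [//|ex] := ltP (n1 (Yn (nk k) r w - Y r w)) e; exfalso.
have : minr 1 e <= minr 1 (n1 (Yn (nk k) r w - Y r w)) by rewrite le_min !ge_min lexx ex orbT. by rewrite leNgt H.
have lt1 : \forall k \near \oo, cap1 (L2 (nk k) w) < 1.
by move/cvgrPdist_lt : c1=> /(_ _ (@ltr01 R)); apply: filterS=> k; rewrite sub0r normrN ger0_norm.
(* For large k the cap at 1 is inactive, so the distance to the elementary coefficients is
   finite. *)
have adX : admissible M t0 T1 (fX w) (gX w). have [k0 _ Hk] := lt1; have {Hk} Hk := Hk k0 (leqnn k0).
apply: (admissible_of_diff (mfX w) (mgX w) _ (adv (nk k0) w)); first by move=>i r; exact: c2.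
by have := cap1_fin (L20 (nk k0) w) Hk; rewrite /L2=> ->; exact: ltry. split=> //.
- have E k : int t0 T1 (sqint M (fun i j r=> fv (nk k) w i j r - fX w i j r)
(fun i r u=> gv (nk k) w i r u - gX w i r u)) = fine (L2 (nk k) w) by [].
apply: (cvg_ext E); apply: cvg_trans c1; apply: near_eq_cvg.
by apply: filterS lt1=> k H; rewrite [in RHS](cap1_fin (L20 (nk k) w) H).
- by apply: ae_imp c2'=> r H tr; apply: zc=> //; exact: H.
- by apply: zc=> //; rewrite tT lexx. Qed.
Let good_ae : exists nk, {ae P, forall w, [/\ G w, good_limit nk w,
  forall i, itgi t0 T1 (fun r=> b (X r w) ord0 i) & itgi t0 T1 (fun r=> kap r (X r w))]}.
have [nk Hnk] := vanish_subseq vanish_Q; exists nk.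
apply: filterS2 (filterI G_ae Hnk) (filterI eqX (filterI bX kapi))=> w [Gw HQ] [eX [bi ki]].
by split=> //; exact: good_limitP. Qed.

Lemma levy_admissible : {ae P, forall w, admissible M t0 T1 (fX w) (gX w)}.
by have [nk H] := good_ae; apply: ae_imp H=> w [_ []]. Qed.
Let bbi w : (forall i, itgi t0 T1 (fun r=> b (X r w) ord0 i)) -> forall i, itgi t0 T1 (bb i ^~ w).
move=>bi i; apply: (@le_itgi R t0 T1 _ (fun r=> `|b (X r w) ord0 i|)); last exact: itg_norm.
apply: eq_measurable_fun (itg_meas (bi i))=> r; rewrite inE/= in_itv/= => tr. by rewrite /bb /Xc clamp_id.
by move=>r tr; rewrite /bb /Xc clamp_id. Qed.
Let kpi w : itgi t0 T1 (fun r=> kap r (X r w)) -> itgi t0 T1 (fun r=> kap r (Xc r w)).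
move=>ki; apply: (@le_itgi R t0 T1 _ (fun r=> `|kap r (X r w)|)); last exact: itg_norm.
apply: eq_measurable_fun (itg_meas ki)=> r; rewrite inE/= in_itv/= => tr. by rewrite /Xc clamp_id.
by move=>r tr; rewrite /Xc clamp_id. Qed.
Let kk0 n r w : 0 <= kk n r w.
apply: addr_ge0; last by apply: mulr_ge0; [exact: ltW|exact: sqint_ge0].
apply: le_trans (kap_b _ _); apply: mulr_ge0; first exact: ltW. by apply: addr_ge0=> //; exact: sumr_ge0. Qed.

(** Limit of [elementary_formula] along the subsequence of [good_ae]. Both sides are bounded
    independently of the approximation, by [Bnd] and by C. The constant c of that formula is
    [lam^-1], by [kap_b]. *)
Lemma levy_formula phi phit phi1 phi2 C : test t0 T1 phi phit phi1 phi2 C ->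
  let Theta w := pathTheta M t0 phi phit phi1 phi2 lam (fun j r=> bb j r w) (fun r=> kap r (Xc r w))
  (fX w) (gX w) (Xc ^~ w) in [/\ itgT P (fun w=> int t0 T1 (Theta w)),
  itgT P (fun w=> pathK M t0 lam (fun r=> kap r (Xc r w)) (fX w) (gX w) T1 * phi T1 (X T1 w)),
  \int[P]_w (pathK M t0 lam (fun r=> kap r (Xc r w)) (fX w) (gX w) T1 * phi T1 (X T1 w)) - phi t0 x0
  = \int[P]_w int t0 T1 (Theta w) &
  {ae P, forall w, itgi t0 T1 (Theta w) /\ `|int t0 T1 (Theta w)| <= Bnd (d := d) C lam}].
move=>T Theta; have [nk Hg] := good_ae. have tTT : t0 <= T1 <= T1 by rewrite tT lexx.
have mXc w : meas ((Xc ^~ w) : mR R -> borelRd R d). exact: (meas_comp (X_joint tT idm) (measurable_pair2 w)).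
pose Th n w := int t0 T1 ((Thetap W M N t0 phi phit phi1 phi2 x0 (fun i j=> SW i j n) (fun i=> SN i n) (kk n) bb) ^~ w).
pose Hn n s w := Hp W M N t0 phi x0 (fun i j=> SW i j n) (fun i=> SN i n) (kk n) bb s w.
have kb r x : lam * (1 + \sum_j `|b x ord0 j|) <= kap r x by exact: kap_b.
have EF n : mean_formula P W M N t0 phi phit phi1 phi2 x0 (fun i j=> SW i j n) (fun i=> SN i n) (kk n) bb t0 T1.
apply: (elementary_formula uF BW prm adN t00 tT T (c := lam^-1) _ x0 (fun i j l=> @okW i j n l)
(fun i l=> @okN i n l) (kk := kk n) (bb := bb) (kk0 n) (fun s ts=> Kp_adapted n ts)
(fun s ts=> betap_adapted ts) _ (lexx t0) tT (lexx T1)). by rewrite invr_ge0 ltW.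
apply: ae_imp Hg=> w [Gw gl bi ki]; split; [|exact: bbi|].
by apply: itgD=> //; [exact: kpi|apply: itgZ=> //; exact: ad_i (adv n w)].
move=>r tr; rewrite mulrC ler_pdivlMr// mulrC.
apply: (le_trans (kb r (Xc r w))); rewrite /kk /rate lerDl; apply: mulr_ge0; [exact: ltW|exact: sqint_ge0].
have zm k w : G w -> (forall i, itgi t0 T1 (fun r=> b (X r w) ord0 i)) ->
meas ((fun r=> zn (nk k) (clamp t0 T1 r) w) : mR R -> borelRd R d).
move=>Gw bi; apply: (rcont_path_measurable (z := fun r=> zn (nk k) r w))=> // r tr. apply: cvgD; last exact: Yn_rcont.
have : rcont t0 T1 (betap t0 bb ^~ w); last by apply. apply: rcont_coord=> i; have := int_rcont (bbi bi i).
by congr rcont; apply/funext=> s; rewrite mxE. pose zk k w r := zn (nk k) (clamp t0 T1 r) w.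
have ThE k w : Th (nk k) w = int t0 T1 (pathTheta M t0 phi phit phi1 phi2 lam (fun j r=> bb j r w)
(fun r=> kap r (Xc r w)) (fv (nk k) w) (gv (nk k) w) (zk k w)).
apply: int_eq=> r tr; rewrite /pathTheta /pathgen /jump_int /zk clamp_id//.
have kbX w r : t0 <= r <= T1 -> lam * (1 + \sum_j `|bb j r w|) <= kap r (Xc r w) by move=> _; exact: kb.
case: (bdct (usual_complete uF) (f_ := fun k=> Th (nk k)) (f := fun w=> int t0 T1 (Theta w)) (C := Bnd (d := d) C lam))=> [k||i1 _ _ c1].
by have [i1 _ _] := EF (nk k); exact: measurable_itg' i1. apply: ae_imp Hg=> w [Gw gl bi ki]; split.
move=>k; rewrite ThE; apply: (int_pathTheta_le tT T lam0 (bbi bi) (kpi ki) (kbX w) (adv (nk k) w)). exact: zm.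
apply: (cvg_ext (fun k=> ThE k w)).
apply: (int_pathTheta_cvg tT T lam0 (bbi bi) (kpi ki) (kbX w) (fun k=> adv (nk k) w) (gl_ad gl)
(fun k=> zm k w Gw bi) (mXc w) _ (fun k=> admissibleB (adv (nk k) w) (gl_ad gl)) (gl_sq gl)).
apply: ae_imp (gl_z gl)=> r H tr; rewrite /zk /Xc clamp_id//; exact: H.
pose KX w := pathK M t0 lam (fun r=> kap r (Xc r w)) (fX w) (gX w) T1. have cphi := unif_cont_x tTT (t_u0 T).
case: (bdct (usual_complete uF) (f_ := fun k=> Hn (nk k) T1) (f := fun w=> KX w * phi T1 (X T1 w)) (C := C))=> [k||i2 _ _ c2'].
apply: measM. by move=> _ B mB; rewrite setTI; apply: (Fm tT); exact: Kp_adapted.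
have mz : meas (zn (nk k) T1 : Om -> borelRd R d). apply: borelRd_measurable=> i; under eq_fun do rewrite mxE.
apply: measD; last exact: (meas_comp (borelRd_coord i) (mYn (nk k) tTT)).
have mbt : meas (betap t0 bb T1 : Om -> borelRd R d); last exact: (meas_comp (borelRd_coord i) mbt).
by move=> _ B mB; rewrite setTI; apply: (Fm tT); exact: betap_adapted.
exact: (meas_comp (borelRd_continuous cphi) mz). apply: ae_imp Hg=> w [Gw gl bi ki]; split.
move=>k; rewrite /Hn /Hp normrM -[C]mul1r.
have /andP[K0 K1] := @pathK_itv R d dU U M t0 T1 lam lam0 (fun j r=> bb j r w) (fun r=> kap r (Xc r w)) (kbX w) (fv (nk k) w) (gv (nk k) w) T1 tTT.
by apply: ler_pM=> //; [rewrite ger0_norm|exact: (t_b0 T)]. apply: cvgM.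
exact: (pathK_cvg lam0 (kpi ki) (fun k=> adv (nk k) w) (gl_ad gl) (fun k=> admissibleB (adv (nk k) w) (gl_ad gl)) (gl_sq gl) tTT).
exact: (@continuous_cvg _ _ _ _ _ (fun k=> zn (nk k) T1 w) (phi T1) _ (@cphi _) (gl_zT gl)).
have H0 n w : Hn n t0 w = phi t0 x0.
rewrite /Hn /Hp /Kp int_pp oppr0 expR0 mul1r; congr phi; apply/rowP=> i; rewrite !mxE int_pp add0r.
rewrite big1 ?addr0; last first. move=>j _; rewrite /elementary_int (big_nth dflt_e) big_mkord big1// => l _.
have [te se _] := okW (ltn_ord l). by rewrite !min_r ?subrr ?mulr0// (le_trans te).
rewrite /marked_int (big_nth dflt_m) big_mkord big1 ?addr0// => l _. have [[te se _] _ _] := okN (ltn_ord l).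
rewrite !min_r ?(le_trans te)// /compensated subrr mulr0 subr0 set_itv_ge ?bnd_simp ?ltxx//.
by rewrite setX0 measure0 mulr0. split; [exact: i1|exact: i2| |]; last first.
apply: ae_imp Hg=> w [Gw gl bi ki]; have gX' := gl_ad gl; split.
exact: (pathTheta_itg tT T lam0 (bbi bi) (kpi ki) (kbX w) gX' (mXc w)).
exact: (int_pathTheta_le tT T lam0 (bbi bi) (kpi ki) (kbX w) gX' (mXc w)).
have E0 n : \int[P]_w Hn n t0 w = phi t0 x0. under eq_Rintegral do rewrite H0.
by rewrite Rintegral_cst// [X in _ * fine X](_ : _ = 1%E) ?mulr1//; exact: probability_setT.
have c3 : \int[P]_w Th (nk k) w @[k --> \oo] --> \int[P]_w (KX w * phi T1 (X T1 w)) - phi t0 x0.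
apply: (cvg_ext (g := fun k=> \int[P]_w Hn (nk k) T1 w - phi t0 x0)).
by move=>k; have [_ _ <-] := EF (nk k); rewrite -/(Hn (nk k) t0) E0. by apply: cvgB=> //; exact: cvg_cst.
exact: (cvg_unique _ c3 c1). Qed.
End LevyFormula.

(** * Smooth cut-offs *)

Section ContinuousOps.
Context {R : realType} {T : topologicalType}.
Implicit Types f g : T -> R.

Lemma contM f g : continuous f -> continuous g -> continuous (fun x=> f x * g x).
by move=>cf cg x; exact: (cvgM (cf x) (cg x)). Qed.

Lemma contD f g : continuous f -> continuous g -> continuous (fun x=> f x + g x).
by move=>cf cg x; exact: (cvgD (cf x) (cg x)). Qed.

Lemma contN f : continuous f -> continuous (fun x=> - f x).
by move=>cf x; exact: (cvgN (cf x)). Qed.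

Lemma cont_cst (a : R) : continuous (fun _ : T=> a).
by move=>x; exact: cvg_cst. Qed.

Lemma cont_comp f (h : R -> R) : continuous h -> continuous f -> continuous (fun x=> h (f x)).
by move=>ch cf x; refine (@continuous_cvg _ _ _ _ _ f h _ (ch (f x)) (cf x)). Qed.

Lemma contX f n : continuous f -> continuous (fun x=> f x ^+ n).
by move=>cf; apply: (cont_comp (h := fun x=> x ^+ n))=> //; exact: exprn_continuous. Qed.

Lemma cont_sum (I : Type) (s : seq I) (f : I -> T -> R) : (forall i, continuous (f i)) ->
  continuous (fun x=> \sum_(i <- s) f i x).
move=>cf; elim: s=> [|i s IH]; first by under eq_fun do rewrite big_nil; exact: cont_cst.
by under eq_fun do rewrite big_cons; exact: contD. Qed.

End ContinuousOps.

Section OneVariable.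
Context {R : realType}.

Lemma is_derive_quot (f : R -> R) (t D : R) : (forall e, 0 < e -> exists2 del, 0 < del &
  forall h, h != 0 -> `|h| < del -> `|h^-1 * (f (t + h) - f t) - D| < e) -> is_derive t 1 f D.
move=>H; have c : (fun h : R=> h^-1 *: ((f \o shift t) (h *: (1 : R)) - f t)) @ 0^' --> D.
apply/cvgrPdist_lt=> e e0; have [del del0 Hd] := H e e0; exists del=> //= h /=.
rewrite sub0r normrN=> hd h0; have := Hd h h0 hd. by rewrite distrC -[h *: (1:R)]/(h * 1) mulr1 [h + t]addrC.
by split; [apply/cvg_ex; exists D|exact/cvg_lim]. Qed.

(** Powers of the positive part. From exponent 2 on they are differentiable, so the cube is of class
    C^2. *)
Definition ppow (n : nat) (t : R) : R := (maxr 0 t) ^+ n.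

Lemma is_derive_ppow n (t : R) : is_derive t 1 (ppow n.+2) (n.+2%:R * ppow n.+1 t).
have [t0|t0|t0] := ltgtP t 0.
- apply: (near_eq_is_derive (f := cst 0)).
by near=> s; rewrite /ppow max_l ?expr0n//; rewrite ltW//; near: s; exact: lt_nbhsl.
by apply: is_derive_eq; rewrite /ppow max_l ?expr0n ?mulr0// ltW.
- have H : is_derive t 1 (fun s : R=> s ^+ n.+2) (n.+2%:R * ppow n.+1 t). rewrite /ppow max_r ?ltW//.
have H1 := @is_deriveX R R id n.+2 t 1 1 (is_derive_id t 1).
rewrite (_ : (fun s : R=> s ^+ n.+2) = id ^+ n.+2); last by apply/funext=> s; rewrite exprfctE.
by apply: (is_derive_eq H1); rewrite /GRing.scale/= mulr1.
refine (near_eq_is_derive _ H); near=> s; rewrite /ppow max_r//. rewrite ltW//; near: s; exact: lt_nbhsr.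
rewrite t0; apply: is_derive_quot=> e e0; exists (minr 1 e); first by rewrite lt_min ltr01.
move=>h h0; rewrite lt_min=> /andP[h1 he]. rewrite add0r /ppow maxxx !expr0n mulr0 !subr0 /=; have [hm|hp] := leP h 0.
by rewrite expr0n mulr0 normr0. rewrite exprS mulrA mulVf// mul1r; apply: le_lt_trans he.
rewrite exprS normrM ler_piMr// normrX exprn_ile1// ltW//.
Unshelve. all: by end_near. Qed.

Lemma ppow_le0 n t : t <= 0 -> ppow n.+1 t = 0.
by move=>t0; rewrite /ppow max_l// expr0n. Qed.

Lemma ppow_cont n : continuous (ppow n).
apply: contX; rewrite (_ : maxr 0 = fun t : R=> 2^-1 * (t + `|t|)). apply: contM; first exact: cont_cst.
by apply: contD=> t; [exact: cvg_id|exact: norm_continuous].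
by apply/funext=> t; have [t0|t0] := leP 0 t; [rewrite ger0_norm//|rewrite ltr0_norm//]; lra. Qed.

(* A C^2 bump: 1 on (-oo, 1], 0 on [2, oo). *)
Definition bump (r : R) := ppow 3 (1 - ppow 3 (r - 1)).

Definition bump1 (r : R) := - (9 * (ppow 2 (1 - ppow 3 (r - 1)) * ppow 2 (r - 1))).

(** Coefficients of the chain rule: 9 = 3 * 3 in [bump1], hence 54 = 9 * 2 * 3 and 18 = 9 * 2. *)
Definition bump2 (r : R) := 54 * (ppow 1 (1 - ppow 3 (r - 1)) * ppow 2 (r - 1) ^+ 2)
  - 18 * (ppow 2 (1 - ppow 3 (r - 1)) * ppow 1 (r - 1)).

Let is_derive_shift (r : R) : is_derive r 1 (fun s=> s - 1) 1.
by apply: is_derive_eq; rewrite subr0. Qed.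

Lemma is_derive_comp1 (f f' g : R -> R) (r D : R) : (forall t : R, is_derive t 1 f (f' t)) ->
  is_derive r 1 g D -> is_derive r 1 (fun s=> f (g s)) (f' (g r) * D).
by move=>df dg; exact: (@is_derive1_comp R f g r _ _ (df (g r)) dg). Qed.
Let is_derive_inner (r : R) : is_derive r 1 (fun s=> 1 - ppow 3 (s - 1)) (- (3 * ppow 2 (r - 1))).
have H := is_derive_comp1 (is_derive_ppow 1) (is_derive_shift r).
have H2 : is_derive r 1 (fun s=> 1 - ppow 3 (s - 1)) (0 - 3 * ppow 2 (r - 1) * 1) := is_deriveB (is_derive_cst (1 : R) r 1) H.
apply: (is_derive_eq H2). by rewrite sub0r mulr1. Qed.

Lemma is_derive_bump (r : R) : is_derive r 1 bump (bump1 r).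
apply: (is_derive_eq (is_derive_comp1 (is_derive_ppow 1) (is_derive_inner r))). by rewrite /bump1; ring. Qed.

Lemma is_derive_bump1 (r : R) : is_derive r 1 bump1 (bump2 r).
have H1 := is_derive_comp1 (is_derive_ppow 0) (is_derive_inner r).
have H2 := is_derive_comp1 (is_derive_ppow 0) (is_derive_shift r).
have H := is_deriveN (is_deriveZ 9 (is_deriveM H1 H2)). apply: (is_derive_eq H); rewrite /bump2 /GRing.scale/=; ring.
Qed.

Lemma bump_cont : [/\ continuous bump, continuous bump1 & continuous bump2].
have cB n : continuous (fun r : R=> ppow n (r - 1)).
by apply: (cont_comp (@ppow_cont n)); apply: contD=> [x|]; [exact: cvg_id|exact: cont_cst].
have cA n : continuous (fun r : R=> ppow n (1 - ppow 3 (r - 1))).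
by apply: (cont_comp (@ppow_cont n)); apply: contD; [exact: cont_cst|exact: contN]. split; first exact: cA.
by apply: contN; apply: contM; [exact: cont_cst|apply: contM; [exact: cA|exact: cB]].
apply: contD; last apply: contN; apply: contM; try exact: cont_cst.
by apply: contM; [exact: cA|apply: contX; exact: cB]. by apply: contM; [exact: cA|exact: cB]. Qed.

Lemma bump_in r : r <= 1 -> [/\ bump r = 1, bump1 r = 0 & bump2 r = 0].
move=>r1; have rm : r - 1 <= 0 by rewrite subr_le0.
rewrite /bump /bump1 /bump2 !(ppow_le0 _ rm) subr0 /ppow max_r ?ler01// !expr1n.
by split=> //; rewrite ?expr0n/= ?mulr0 ?subr0 ?oppr0. Qed.

Lemma bump_out r : 2 <= r -> [/\ bump r = 0, bump1 r = 0 & bump2 r = 0].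
move=>r2; have rm : 1 - ppow 3 (r - 1) <= 0. rewrite subr_le0 /ppow max_r; last by lra.
by rewrite exprn_ege1//; lra. by rewrite /bump /bump1 /bump2 !(ppow_le0 _ rm) !mul0r !mulr0 subr0 oppr0. Qed.

Lemma bump_itv r : 0 <= bump r <= 1.
have H t : 0 <= ppow 3 t by rewrite exprn_ge0// le_max lexx.
rewrite H /=; rewrite /bump {1}/ppow exprn_ile1 ?le_max ?lexx//. by rewrite ge_max ler01/= lerBlDr lerDl. Qed.

End OneVariable.

Section Cutoff.
Context {R : realType} {d : nat}.
Implicit Types x : 'rV[R]_d.

Lemma is_derive_of_line (f : 'rV[R]_d -> R) x e (D : R) :
  is_derive (0 : R) 1 (fun r=> f (x + r *: e)) D -> is_derive x e f D.
have E : (fun h : R=> h^-1 *: (((fun r=> f (x + r *: e)) \o shift (0 : R)) (h *: (1 : R)) - f (x + (0 : R) *: e)))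
= (fun h : R=> h^-1 *: ((f \o shift x) (h *: e) - f x)).
apply/funext=> h /=; rewrite scale0r !addr0; congr (_ *: (f _ - _)). by rewrite -[h *: (1:R)]/(h * 1) mulr1 addrC.
move=> [df fD]; split; first by rewrite /derivable -E. by rewrite -fD /derive -E. Qed.

Lemma is_derive_chain (g g' : R -> R) (s : 'rV[R]_d -> R) x e (D : R) : (forall r : R, is_derive r 1 g (g' r)) ->
  is_derive x e s D -> is_derive x e (fun y=> g (s y)) (g' (s x) * D).
move=>dg ds; apply: is_derive_of_line. have ds' : is_derive (0 : R) 1 (fun r=> s (x + r *: e)) D.
by apply: is_derive_line; rewrite scale0r addr0.
apply: (is_derive_eq (is_derive1_comp (f := g) (dg (s (x + (0 : R) *: e))) ds')). by rewrite scale0r addr0. Qed.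

Lemma is_derive_coord (i j : 'I_d) x : is_derive x (basis_vec j) (fun y=> y ord0 i) ((i == j)%:R : R).
apply: is_derive_of_line.
have -> : (fun r : R=> (x + r *: basis_vec j) ord0 i) = (fun r=> x ord0 i + r * (i == j)%:R).
by apply/funext=> r; rewrite !mxE eqxx /= eq_sym [(j == i)]eq_sym. apply: is_derive_eq; rewrite /GRing.scale/=; ring.
Qed.

Context (m : nat).
Let c : R := (m%:R ^+ 2)^-1.

(** The squared Euclidean norm of x / m, a polynomial and so smooth also at 0. *)
Definition csq x : R := c * \sum_i x ord0 i ^+ 2.

Definition chi x := bump (csq x).

Definition chi1 j x := bump1 (csq x) * (2 * c * x ord0 j).

Definition chi2 j k x := bump2 (csq x) * (2 * c * x ord0 j) * (2 * c * x ord0 k) + bump1 (csq x) * (2 * c * (j == k)%:R).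

Lemma is_derive_csq j x : is_derive x (basis_vec j) csq (2 * c * x ord0 j).
have H : is_derive x (basis_vec j) (\sum_(i < d) (fun y : 'rV[R]_d=> y ord0 i) ^+ 2) (\sum_(i < d) (2%:R * x ord0 i ^+ 1) *: ((i == j)%:R : R)).
by apply: is_derive_sum=> i; exact: is_deriveX (is_derive_coord i j x).
have -> : csq = c \*: (\sum_(i < d) (fun y : 'rV[R]_d=> y ord0 i) ^+ 2). by apply/funext=> y; rewrite /csq fct_sumE.
apply: (is_derive_eq (is_deriveZ c H)). rewrite (bigD1 j)//= eqxx big1=> [|i /negbTE ->]; last by rewrite scaler0.
rewrite /GRing.scale/=; ring. Qed.

Lemma is_derive_chi j x : is_derive x (basis_vec j) chi (chi1 j x).
exact: is_derive_chain (@is_derive_bump R) (is_derive_csq j x). Qed.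

Lemma is_derive_chi1 j k x : is_derive x (basis_vec j) (chi1 k) (chi2 j k x).
have H1 := is_derive_chain (@is_derive_bump1 R) (is_derive_csq j x).
have H2 := is_deriveZ (2 * c) (is_derive_coord k j x).
apply: (is_derive_eq (is_deriveM H1 H2)); rewrite /chi2 /GRing.scale/= (eq_sym k j).
rewrite -[(2 * c) *: x ord0 k]/((2 * c) * x ord0 k); ring. Qed.

Lemma csq_cont : continuous csq.
apply: contM; first exact: cont_cst. by apply: cont_sum=> i; apply: contX; exact: continuous_coord. Qed.
Let b01 := @bump_cont R.

Lemma chi_cont : continuous chi.
by have [b0 _ _] := b01; apply: cont_comp=> //; exact: csq_cont. Qed.
Let c3 i : continuous (fun y : 'rV[R]_d=> 2 * c * y ord0 i).
by apply: contM; [exact: cont_cst|exact: continuous_coord]. Qed.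

Lemma chi1_cont j : continuous (chi1 j).
by have [_ b1 _] := b01; apply: contM=> //; apply: cont_comp=> //; exact: csq_cont. Qed.

Lemma chi2_cont j k : continuous (chi2 j k).
have [_ b1 b2] := b01; apply: contD.
by apply: contM=> //; apply: contM=> //; apply: cont_comp=> //; exact: csq_cont.
by apply: contM; [apply: cont_comp=> //; exact: csq_cont|exact: cont_cst]. Qed.

Lemma chi_itv x : 0 <= chi x <= 1. Proof. exact: bump_itv. Qed.

Lemma chi_in x : n1 x < m%:R -> [/\ chi x = 1, forall j, chi1 j x = 0 & forall j k, chi2 j k x = 0].
move=>xm; have m0 : 0 < m%:R :> R := le_lt_trans (n1_ge0 x) xm. have cx : csq x <= 1.
rewrite /csq /c mulrC ler_pdivrMr ?exprn_gt0// mul1r.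
apply: (@le_trans _ _ (n1 x ^+ 2)); last by rewrite ler_sqr ?nnegrE ?n1_ge0 ?ltW.
rewrite expr2 {1}/n1 mulr_suml; apply: ler_sum=> i _.
rewrite -real_normK ?num_real// expr2; apply: ler_wpM2l=> //; exact: le_coord_n1. have [h0 h1 h2] := bump_in cx.
by rewrite /chi /chi1 /chi2 h0 h1 h2; split=> // *; rewrite !mul0r ?addr0. Qed.

(** By Cauchy-Schwarz [n1 x ^+ 2] is at most d times the squared Euclidean norm, so the latter is at
    least [4 * d * m ^+ 2], beyond the threshold [2 * m ^+ 2] of the bump. *)
Lemma chi_out x : (0 < d)%N -> (0 < m)%N -> 2 * d%:R * m%:R <= n1 x -> [/\ chi x = 0, forall j, chi1 j x = 0 & forall j k, chi2 j k x = 0].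
move=>d0' m0 xm; have mp : 0 < m%:R :> R by rewrite ltr0n. have cx : 2 <= csq x.
have dp : 1 <= d%:R :> R by rewrite ler1n. rewrite /csq /c mulrC ler_pdivlMr ?exprn_gt0//.
have H := n1_sqr x; have H2 : (2 * d%:R * m%:R) ^+ 2 <= n1 x ^+ 2. by rewrite ler_sqr ?nnegrE ?n1_ge0// !mulr_ge0.
have {H H2} H := le_trans H2 H. have d0 : 0 < d%:R :> R by rewrite ltr0n.
rewrite -(ler_pM2l d0); apply: le_trans H; rewrite !exprMn.
rewrite (_ : d%:R * (2 * m%:R ^+ 2) = 2 * (d%:R * m%:R ^+ 2)); last by ring.
rewrite (_ : 2 ^+ 2 * d%:R ^+ 2 * m%:R ^+ 2 = 4 * d%:R * (d%:R * m%:R ^+ 2)); last by ring.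
apply: ler_wpM2r; first by rewrite mulr_ge0// exprn_ge0. by lra. have [h0 h1 h2] := bump_out cx.
by rewrite /chi /chi1 /chi2 h0 h1 h2; split=> // *; rewrite !mul0r ?addr0. Qed.

End Cutoff.

(** * Test functions with compact support *)

Section CompactSupport.
Context {R : realType} {d : nat} (p q : R).
Implicit Types h : sfun R d.

Definition strip_cont h := {within strip `[p, q], continuous (fun z : R * 'rV[R]_d=> h z.1 z.2)}.

Lemma strip_contP h : strip_cont h -> forall s x e, p <= s <= q -> 0 < e -> exists2 del, 0 < del &
  forall s' x', p <= s' <= q -> `|s - s'| < del -> `|x - x'| < del -> `|h s x - h s' x'| < e.
move=>ch s x e ps e0. have cr : h z.1 z.2 @[z --> within (strip `[p, q]) (nbhs (s, x))] --> h s x.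
by move/subspace_continuousP : ch=> /(_ (s, x)); apply; split=> //=; rewrite in_itv.
have : \forall z \near within (strip `[p, q]) (nbhs (s, x)), `|h s x - h z.1 z.2| < e.
by move/cvgrPdist_lt : cr; apply. rewrite near_withinE=> /nbhs_ballP[del /= del0 H]; exists del=> // s' x' ps' ss xx.
by apply: (H (s', x')); split=> //=; rewrite -?ball_normE//= in_itv. Qed.

Section Bounded.
Context (h : sfun R d) (K : R) (ch : strip_cont h) (h0 : forall s x, K <= n1 x -> h s x = 0).

Let Box := `[p, q]%classic `*` [set x : 'rV[R]_d | forall j, `[- (`|K| + 1), `|K| + 1]%classic (x ord0 j)].

Let cBox : compact Box.
by apply: compact_setX; [exact: segment_compact|refine (@rV_compact R d (fun=> `[- (`|K| + 1), `|K| + 1]%classic) _)=> j; exact: segment_compact]. Qed.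
Let out_box s x : p <= s <= q -> ~ Box (s, x) -> exists j, `|K| + 1 < `|x ord0 j|.
move=>ps nB; apply: contrapT=> nE; apply: nB; split=> /=; first by rewrite in_itv.
move=>j; rewrite in_itv/= -ler_norml leNgt; apply/negP=> H; apply: nE; by exists j. Qed.

(** Compactness of the box gives a common radius for its points. The box exceeds the support by 1 in
    each coordinate, so whatever lies within distance 1 of a point outside it is still off the
    support; hence the minimum with 1. *)
Lemma compact_support_unif_cont : unif_cont p q h.
move=>e e0; have e2 : 0 < e / 2 by rewrite divr_gt0.
pose Q (del : R) (z : R * 'rV[R]_d) := p <= z.1 <= q -> forall s' x', p <= s' <= q ->
`|z.1 - s'| < del -> `|z.2 - x'| < del -> `|h z.1 z.2 - h s' x'| < e.
have /compact_near_coveringP/(_ R (0 : R)^'+ Q _) H := cBox. have {H} H : \forall r \near (0 : R)^'+, Box `<=` Q r.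
apply: H=> -[s0 x0] [/=]; rewrite in_itv/= => ps0 _. have [del del0 Hd] := strip_contP ch x0 ps0 e2.
have d2 : 0 < del / 2 by rewrite divr_gt0. exists (ball (s0, x0) (del / 2), [set r | r < del / 2]).
by split=> /=; [exact: nbhsx_ballx|exact: nbhs_right_lt]. move=> [[s x] r] [/= [b1 b2] rd] ps s' x' ps' ss xx.
move: b1 b2; rewrite /= -!ball_normE /= => b1 b2.
have H1 : `|h s0 x0 - h s x| < e / 2 by apply: Hd=> //; [apply: lt_trans b1 _|apply: lt_trans b2 _]; lra.
have H2 : `|h s0 x0 - h s' x'| < e / 2. apply: Hd=> //.
by rewrite -(subrK s s0) -addrA; apply: (le_lt_trans (ler_normD _ _)); have := lt_trans ss rd; lra.
by rewrite -(subrK x x0) -addrA; apply: (le_lt_trans (ler_normD _ _)); have := lt_trans xx rd; lra.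
rewrite (_ : h s x - h s' x' = (h s0 x0 - h s' x') - (h s0 x0 - h s x)); last by ring.
apply: (le_lt_trans (ler_normB _ _)); lra.
have [r /= r0 Hr] := H; pose del := r / 2; have del0 : 0 < del by rewrite divr_gt0. have Hd : Box `<=` Q del.
by apply: Hr=> //=; rewrite sub0r normrN gtr0_norm// ltr_pdivrMr// ltr_pMr// ltr1n.
exists (minr del 1); first by rewrite lt_min del0 ltr01.
move=>s s' x x' ps ps'; rewrite !lt_min=> /andP[sd _] /andP[xd x1].
have [B|nB] := pselect (Box (s, x)); first exact: (Hd _ B). have [j Hj] := out_box ps nB.
rewrite !h0 ?subrr ?normr0//. have := le_coord_n1 x' j; have := le_coord_norm (x - x') j; rewrite !mxE=> H2.
have := ler_norm K; have := lerB_dist (x ord0 j) (x ord0 j - x' ord0 j); rewrite subKr.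
have := le_lt_trans H2 x1; lra. have := le_coord_n1 x j; have := ler_norm K; lra. Qed.

Lemma compact_support_bounded : exists C, forall s x, p <= s <= q -> `|h s x| <= C.
pose Q (C : R) (z : R * 'rV[R]_d) := p <= z.1 <= q -> `|h z.1 z.2| <= C.
have /compact_near_coveringP/(_ R (+oo : set_system R) Q _) H := cBox.
have {H} H : \forall r \near (+oo : set_system R), Box `<=` Q r. apply: H=> -[s0 x0] [/=]; rewrite in_itv/= => ps0 _.
have [del del0 Hd] := strip_contP ch x0 ps0 ltr01. exists (ball (s0, x0) del, [set r | `|h s0 x0| + 1 <= r]).
by split=> /=; [exact: nbhsx_ballx|exact: nbhs_pinfty_ge].
move=> [[s x] r] [/= [b1 b2] rd] ps; move: b1 b2; rewrite /= -!ball_normE /= => b1 b2.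
apply: le_trans rd; have := Hd s x ps b1 b2; rewrite distrC=> H1.
rewrite -[h s x](subrK (h s0 x0)); apply: (le_trans (ler_normD _ _)); lra.
have /filter_ex[C HC] := H; exists (maxr 0 C)=> s x ps.
have [B|nB] := pselect (Box (s, x)); first by rewrite le_max (HC _ B ps) orbT.
have [j Hj] := out_box ps nB; rewrite h0 ?normr0 ?le_max ?lexx//. have := le_coord_n1 x j; have := ler_norm K; lra.
Qed.

End Bounded.

Section CutoffTest.
Context (v vt : sfun R d) (v1 : 'I_d -> sfun R d) (v2 : 'I_d -> 'I_d -> sfun R d).

(** The local counterpart of [test]: continuity on the closed strip in place of bounds and uniform
    continuity. *)
Record smooth_strip : Prop := SmoothStrip {
  sm_c : strip_cont v; sm_ct : strip_cont vt;
  sm_c1 : forall j, strip_cont (v1 j); sm_c2 : forall j k, strip_cont (v2 j k);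
  sm_dt : forall (s : R) x, p < s < q -> is_derive s 1 (v ^~ x) (vt s x);
  sm_d1 : forall j s x, p <= s <= q -> is_derive x (basis_vec j) (v s) (v1 j s x);
  sm_d2 : forall j k s x, p <= s <= q -> is_derive x (basis_vec j) (v1 k s) (v2 j k s x) }.

Context (sm : smooth_strip) (d0 : (0 < d)%N).

Definition cut m s x := v s x * chi m x.

Definition cutt m s x := vt s x * chi m x.

Definition cut1 m j s x := v1 j s x * chi m x + v s x * chi1 m j x.

Definition cut2 m j k s x := v2 j k s x * chi m x + v1 k s x * chi1 m j x
  + (v1 j s x * chi1 m k x + v s x * chi2 m j k x).

Let scM h (f : 'rV[R]_d -> R) : strip_cont h -> continuous f -> strip_cont (fun s x=> h s x * f x).
move=>ch cf; apply: (@contM R (subspace (strip `[p, q])))=> //.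
apply: continuous_subspaceT=> z; apply: (@continuous_comp _ _ _ snd f); [exact: cvg_snd|exact: cf]. Qed.
Let scD h h' : strip_cont h -> strip_cont h' -> strip_cont (fun s x=> h s x + h' s x).
by move=>ch ch'; exact: (@contD R (subspace (strip `[p, q]))). Qed.

(** Every derivative of the product has in each term a factor chi or a derivative of chi, hence
    vanishes far out; the compact case gives bounds and moduli. *)
Lemma cut_test m : (0 < m)%N -> exists C, test p q (cut m) (cutt m) (cut1 m) (cut2 m) C.
move=>m0; pose K : R := 2 * d%:R * m%:R.
have [c c1 c2] : [/\ continuous (@chi R d m), forall j, continuous (@chi1 R d m j) & forall j k, continuous (@chi2 R d m j k)].
by split; [exact: chi_cont|exact: chi1_cont|exact: chi2_cont].
have o0 s x : K <= n1 x -> cut m s x = 0 by move=> /(chi_out d0 m0)[e _ _]; rewrite /cut e mulr0.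
have ot s x : K <= n1 x -> cutt m s x = 0 by move=> /(chi_out d0 m0)[e _ _]; rewrite /cutt e mulr0.
have o1 j s x : K <= n1 x -> cut1 m j s x = 0. by move=> /(chi_out d0 m0)[e e1 _]; rewrite /cut1 e e1 !mulr0 addr0.
have o2 j k s x : K <= n1 x -> cut2 m j k s x = 0.
by move=> /(chi_out d0 m0)[e e1 e2]; rewrite /cut2 e !e1 e2 !mulr0 !addr0.
have k0 : strip_cont (cut m) by apply: scM=> //; exact: sm_c sm.
have kt : strip_cont (cutt m) by apply: scM=> //; exact: sm_ct sm. have k1 j : strip_cont (cut1 m j).
by apply: scD; apply: scM=> //; [exact: sm_c1 sm j|exact: sm_c sm]. have k2 j k : strip_cont (cut2 m j k).
by apply: scD; apply: scD; apply: scM=> //; [exact: sm_c2 sm j k|exact: sm_c1 sm k|exact: sm_c1 sm j|exact: sm_c sm].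
have [C0 H0] := compact_support_bounded k0 o0; have [Ct Ht] := compact_support_bounded kt ot.
have /choice[C1 H1] : forall j, exists C, forall s x, p <= s <= q -> `|cut1 m j s x| <= C.
by move=>j; exact: compact_support_bounded (k1 j) (o1 j).
have /choice[C2 H2] : forall jk, exists C, forall s x, p <= s <= q -> `|cut2 m jk.1 jk.2 s x| <= C.
by move=>jk; exact: compact_support_bounded (k2 jk.1 jk.2) (o2 jk.1 jk.2).
exists (`|C0| + `|Ct| + \sum_j `|C1 j| + \sum_jk `|C2 jk|). have P1 : 0 <= \sum_j `|C1 j| by apply: sumr_ge0.
have P2 : 0 <= \sum_jk `|C2 jk| by apply: sumr_ge0. have [Q0 Qt] := (normr_ge0 C0, normr_ge0 Ct). split.
- move=>s x ps; apply: (le_trans (H0 s x ps)); have := ler_norm C0; lra.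
- move=>s x ps; apply: (le_trans (Ht s x ps)); have := ler_norm Ct; lra.
- move=>j s x ps; apply: (le_trans (H1 j s x ps)).
have : C1 j <= \sum_j `|C1 j| by rewrite (bigD1 j)//= (le_trans (ler_norm _))// lerDl sumr_ge0. lra.
- move=>j k s x ps; apply: (le_trans (H2 (j, k) s x ps)).
have : C2 (j, k) <= \sum_jk `|C2 jk| by rewrite (bigD1 (j, k))//= (le_trans (ler_norm _))// lerDl sumr_ge0. lra.
- exact: compact_support_unif_cont k0 o0.
- exact: compact_support_unif_cont kt ot.
- by move=>j; exact: compact_support_unif_cont (k1 j) (o1 j).
- by move=>j k; exact: compact_support_unif_cont (k2 j k) (o2 j k).
- move=>s x ps. have H : is_derive s 1 ((v ^~ x) * cst (chi m x)) (v s x *: 0 + chi m x *: vt s x).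
exact: is_deriveM (sm_dt sm x ps) (is_derive_cst _ _ _).
apply: (is_derive_eq H); rewrite scaler0 add0r /GRing.scale/= mulrC//.
- move=>j s x ps; apply: (is_derive_eq (is_deriveM (sm_d1 sm j x ps) (is_derive_chi m j x))).
by rewrite /cut1 /GRing.scale/= addrC [chi m x * _]mulrC.
- move=>j k s x ps. have A := is_deriveM (sm_d2 sm j k x ps) (is_derive_chi m j x).
have B := is_deriveM (sm_d1 sm j x ps) (is_derive_chi1 m j k x).
apply: (is_derive_eq (is_deriveD A B)); rewrite /cut2 /GRing.scale/=; ring. Qed.

Lemma cut_in m s x : n1 x < m%:R -> [/\ cut m s x = v s x, cutt m s x = vt s x,
  forall j, cut1 m j s x = v1 j s x & forall j k, cut2 m j k s x = v2 j k s x].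
move=>xm; have [e0 e1 e2] := chi_in xm; rewrite /cut /cutt /cut1 /cut2 e0.
by split=> *; rewrite ?mulr1// ?e1 ?e2 ?mulr0 ?mulr1 ?addr0. Qed.

Lemma cut_le m s x : `|cut m s x| <= `|v s x|.
have /andP[c0 c1] := @chi_itv R d m x. by rewrite /cut normrM (ger0_norm c0) ler_piMr. Qed.

End CutoffTest.

End CompactSupport.

(** As T1 < T, the closed strip lies in [0, T[, and at a time strictly inside it the derivative
    relative to [0, T[ is two-sided. *)
Lemma C12_smooth_strip {R : realType} {d} (T t0 T1 : R) (u : sfun R d) : 0 <= t0 -> T1 < T -> C12_on `[0, T[ u ->
  smooth_strip t0 T1 u (fun s x=> time_derivative `[0, T[ u s x) (fun j s x=> partial1 (u s) j x)
  (fun j k s x=> partial2 (u s) j k x).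
move=>t00 TT [c0 [dt [d1 [d2 [ct [c1 c2]]]]]]. have inJ s : t0 <= s <= T1 -> `[0, T[%classic s.
by move=> /andP[ts sT]; rewrite /= in_itv/= (le_trans t00 ts) (le_lt_trans sT TT).
have sub : strip (d := d) `[t0, T1] `<=` strip `[0, T[.
by move=> [s x] [/= ts _]; split=> //=; apply: inJ; move: ts; rewrite in_itv. split.
- exact: continuous_subspaceW sub c0.
- exact: continuous_subspaceW sub ct.
- by move=>j; exact: continuous_subspaceW sub (c1 j).
- by move=>j k; exact: continuous_subspaceW sub (c2 j k).
- move=>s x /andP[ts sT]; have Js : `[0, T[%classic s by apply: inJ; rewrite !ltW.
have := dt s x Js; rewrite /derivable_within=> cq; apply: is_derive_quot=> e e0.
have : \forall h \near within [set h | `[0, T[%classic (s + h)] (0 : R)^',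
`|time_derivative `[0, T[ u s x - diff_quotient (fun s=> u s x) s h| < e.
by move/cvgrPdist_lt : (cq : _ --> _); apply. rewrite near_withinE near_withinE=> /nbhs_ballP[del /= del0 H].
have s0 : 0 < s by exact: le_lt_trans ts. have sT' : 0 < T - s by rewrite subr_gt0 (lt_trans sT).
exists (minr del (minr s (T - s))); first by rewrite !lt_min del0 s0.
move=>h h0; rewrite !lt_min=> /and3P[hd hs hT]; rewrite distrC; apply: H=> //=. by rewrite /ball/= sub0r normrN.
rewrite in_itv/=; move: hs hT; rewrite !ltr_norml=> /andP[a1 _] /andP[_ a2]; apply/andP; split; lra.
- by move=>j s x ts; apply: derivableP; exact: d1 (inJ s ts).
- by move=>j k s x ts; apply: derivableP; exact: d2 (inJ s ts). Qed.

(** Near each time the path stays within distance 1 of its value to the right and of its left limit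
    to the left; compactness of the time interval makes these bounds uniform. *)
Lemma cadlag_bounded {R : realType} {d} (t0 T : R) (y : R -> 'rV[R]_d) :
  (forall s, t0 <= s -> y r @[r --> s^'+] --> y s) -> (forall s, t0 < s -> cvg (y r @[r --> s^'-])) ->
  exists K, forall r, t0 <= r <= T -> n1 (y r) <= K.
move=>rc ll; pose Q (C : R) r := t0 <= r <= T -> n1 (y r) <= C.
have /compact_near_coveringP/(_ R (+oo : set_system R) Q _) H := @segment_compact R t0 T.
have {H} H : \forall C \near (+oo : set_system R), `[t0, T]%classic `<=` Q C.
apply: H=> s0 /=; rewrite in_itv/= => /andP[ts0 sT0]. have [dr /= dr0 Hr] : \forall r \near s0^'+, `|y s0 - y r| < 1.
by move/cvgrPdist_lt : (rc s0 ts0); apply.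
have [L [dl dl0 Hl]] : exists L, exists2 dl, 0 < dl & forall r, t0 <= r -> r < s0 -> s0 - r < dl -> n1 (y r) <= L.
have [e|ne] := eqVneq t0 s0. by exists 0; exists 1=> // r tr rs; move: tr; rewrite leNgt e rs.
have lt0 : t0 < s0 by rewrite lt_neqAle ne.
have [dl /= dl0 Hl] : \forall r \near s0^'-, `|lim (y q @[q --> s0^'-]) - y r| < 1.
by move/cvgrPdist_lt : (ll s0 lt0 : _ --> _); apply.
exists (n1 (lim (y q @[q --> s0^'-])) + d%:R), dl=> // r tr rs sr.
rewrite -[y r](subrK (lim (y q @[q --> s0^'-]))) addrC; apply: (le_trans (n1D _ _)); rewrite lerD2l.
apply: (le_trans (n1_le_norm _)); rewrite -[leRHS]mulr1; apply: ler_wpM2l=> //.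
by rewrite distrC ltW//; apply: Hl=> //=; rewrite gtr0_norm ?subr_gt0.
exists (ball s0 (minr dr dl), [set C | n1 (y s0) + d%:R + `|L| <= C]).
by split=> /=; [apply: nbhsx_ballx; rewrite lt_min dr0|apply: nbhs_pinfty_ge; exact: num_real].
move=> [r C] [/= + HC] /andP[tr rT]; rewrite -ball_normE /= lt_min=> /andP[b1 b2].
apply: le_trans HC; have [rs|sr|->] := ltgtP r s0.
- have := Hl r tr rs; move: b2; rewrite gtr0_norm ?subr_gt0// => b2 /(_ b2).
have := n1_ge0 (y s0); have := ler_norm L; have := ler0n R d; lra.
- have := Hr r b1 sr=> H1. have : n1 (y r) <= n1 (y s0) + d%:R; last by have := normr_ge0 L; lra.
rewrite -[y r](subrK (y s0)) addrC; apply: (le_trans (n1D _ _)); rewrite lerD2l.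
apply: (le_trans (n1_le_norm _)); rewrite -[leRHS]mulr1; apply: ler_wpM2l=> //. by rewrite distrC ltW.
- by have := normr_ge0 L; have := ler0n R d; lra.
have [C HC] := filter_ex H; exists C=> r tr; apply: (HC r)=> //; by rewrite /= in_itv. Qed.

(** * The Levy measure as an image measure *)

Section LevyMeasure.
Context {R : realType} {d : nat} {dU : measure_display} {U : measurableType dU} (M : {sigma_finite_measure set U -> \bar R}) (c : U ->
  'rV[R]_d) (nu : {measure set (borelRd R d) -> \bar R}) (mc : meas (c : U -> borelRd R d)) (nu_repr : forall G : set
  (borelRd R d), measurable G -> G `<=` Rd0 -> nu G = (\int[M]_v (\1_G (c v))%:E)%E).

Lemma measurable_Rd0 : measurable (Rd0 : set (borelRd R d)).
rewrite (_ : Rd0 = ~` [set y | n1 y = 0]). apply: measurableC; rewrite -[X in measurable X]setTI.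
have mn : meas ((@n1 R d) : borelRd R d -> R) by apply: n1_measurable; exact: measurable_id.
by have := mn measurableT [set 0] (measurable_set1 0). apply/seteqP; split=> y /=; rewrite /Rd0/=.
move=> /eqP y0 n0; apply: y0; apply/rowP=> j; rewrite mxE; apply/eqP; rewrite -normr_le0 -n0; exact: le_coord_n1.
by move=>n0; apply/eqP=> y0; apply: n0; rewrite y0; apply: big1=> j _; rewrite mxE normr0. Qed.

(** nu is the image of M under c away from 0 only; where c vanishes the integrand is 0 because
    [f 0 = 0]. *)
Lemma nu_ge0_integral (f : borelRd R d -> \bar R) : meas f -> (forall y, 0 <= f y)%E -> f 0 = 0%E ->
  (\int[nu]_(y in Rd0) f y = \int[M]_u f (c u))%E.
move=>mf f0 fz. rewrite (eq_measure_integral (pushforward M (c : U -> borelRd R d))); last first.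
move=>G mG GR; rewrite nu_repr//; transitivity (M ((c @^-1` G) `&` setT)); last by rewrite setIT.
rewrite -integral_indic//; last by rewrite -[X in measurable X]setTI; exact: mc.
rewrite ge0_integral_pushforward//; [|exact: measurable_Rd0|exact: measurable_funTS].
rewrite [LHS]integral_mkcond; apply: eq_integral=> u _; rewrite /patch.
by case: ifPn=> //; rewrite notin_setE /= /Rd0/= => /negP; rewrite negbK=> /eqP ->; rewrite fz. Qed.

Lemma nu_integral (f : borelRd R d -> R) : meas f -> f 0 = 0 -> \int[nu]_(y in Rd0) f y = \int[M]_u f (c u).
move=>mf fz; have mE : meas (EFin \o f) by exact/measEFin.
rewrite /Rintegral; congr fine; rewrite integralE [RHS]integralE; congr (_ - _)%E.
rewrite nu_ge0_integral//; first by apply: eq_integral=> u _; rewrite !funeposE. exact: measurable_funepos.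
by rewrite funeposE /= fz maxxx. rewrite nu_ge0_integral//; first by apply: eq_integral=> u _; rewrite !funenegE.
exact: measurable_funeneg. by rewrite funenegE /= fz oppr0 maxxx. Qed.

(** The premise has the shape of the growth condition at a point: a real number plus the second
    moment is at most a real number, so the second moment is finite. *)
Lemma levy_sq_itg (r K : R) : (r%:E + \int[nu]_(y in Rd0) (sqnorm y)%:E <= K%:E)%E ->
  forall i, itgT M (fun u=> c u ord0 i ^+ 2).
move=>H i; have ms : meas (fun y : borelRd R d=> sqnorm y).
by apply: meas_sum=> j; apply: measM; exact: borelRd_coord.
have s0 (y : 'rV[R]_d) : 0 <= sqnorm y by apply: sumr_ge0=> j _; rewrite -expr2 sqr_ge0.
have fin : (\int[M]_u (sqnorm (c u))%:E < +oo)%E. rewrite -(nu_ge0_integral (f := fun y=> (sqnorm y)%:E)).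
- rewrite ltNge leye_eq; apply/negP=> /eqP e; move: H; rewrite e addey ?ltNyr//.
- exact/measEFin.
- by move=>y; rewrite lee_fin.
- by rewrite /sqnorm /dotp big1// => j _; rewrite mxE mul0r.
have mci : meas (fun u=> c u ord0 i) := meas_comp (borelRd_coord i) mc.
apply: (le_itg measurableT _ (g := fun u=> sqnorm (c u))).
- exact: measurable_funX.
- move=>u _; rewrite ger0_norm ?sqr_ge0// /sqnorm /dotp (bigD1 i)//= expr2 lerDl.
by apply: sumr_ge0=> j _; rewrite -expr2 sqr_ge0.
- apply/integrableP; split; first by apply/measEFin; exact: meas_comp ms mc.
by under eq_integral do rewrite gee0_abs ?lee_fin//. Qed.

End LevyMeasure.

Section StripTools.
Context {R : realType} {d : nat} (p q : R) (pq : p <= q).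

Lemma strip_cont_x (h : sfun R d) s : strip_cont p q h -> p <= s <= q -> continuous (h s).
move=>ch ps x; apply/(@cvgrPdist_lt _ _ _ (nbhs x))=> e e0. have [del del0 H] := strip_contP ch x ps e0.
near=> y; apply: H=> //; first by rewrite subrr normr0.
Unshelve. all: by end_near. Qed.

Lemma strip_cont_measurable (h : sfun R d) : strip_cont p q h ->
  meas (fun x : mR R * borelRd R d=> h (clamp p q x.1) x.2).
move=>ch; apply: progressive_measurable=> // [r pr|y r /andP[pr rq]].
by apply: borelRd_continuous; exact: strip_cont_x ch pr. apply/cvgrPdist_lt=> e e0.
have pr' : p <= r <= q by rewrite pr ltW. have [del del0 H] := strip_contP ch y pr' e0.
exists (minr del (q - r))=> /=; first by rewrite lt_min del0 subr_gt0.
move=>s /=; rewrite lt_min=> /andP[sd sq] rs; apply: H=> //; last by rewrite subrr normr0.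
rewrite (le_trans pr (ltW rs))/=; move: sq; rewrite ltr0_norm ?subr_lt0// opprB; lra. Qed.

Lemma strip_cont_seq (h : sfun R d) s x (s_ : nat -> R) (x_ : nat -> 'rV[R]_d) :
  strip_cont p q h -> p <= s <= q -> (forall n, p <= s_ n <= q) ->
  s_ n @[n --> \oo] --> s -> x_ n @[n --> \oo] --> x -> h (s_ n) (x_ n) @[n --> \oo] --> h s x.
move=>ch ps ps_ cs cx; apply/cvgrPdist_lt=> e e0; have [del del0 H] := strip_contP ch x ps e0.
move/cvgrPdist_lt : cs=> /(_ _ del0); move/cvgrPdist_lt : cx=> /(_ _ del0). by apply: filterS2=> n xn sn; exact: H.
Qed.

(** Multiplication by a cut-off equal to 1 on the ball reduces this to compact support. *)
Lemma strip_cont_locbd (h : sfun R d) (K : R) : (0 < d)%N -> strip_cont p q h ->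
  exists C, forall s x, p <= s <= q -> n1 x <= K -> `|h s x| <= C.
move=>d0 ch; have [m mK] : exists m : nat, (0 < m)%N /\ K < m%:R.
exists (Num.truncn `|K|).+1; split=> //; apply: le_lt_trans (ler_norm K) _; exact: truncnS_gt. have [m0 {}mK] := mK.
have sc : strip_cont p q (fun s x=> h s x * chi m x). apply: (@contM R (subspace (strip `[p, q])))=> //.
apply: continuous_subspaceT=> z; apply: (@continuous_comp _ _ _ snd (chi m)); [exact: cvg_snd|exact: chi_cont].
have o s x : 2 * d%:R * m%:R <= n1 x -> h s x * chi m x = 0. by move=> /(chi_out d0 m0)[e _ _]; rewrite e mulr0.
have [C HC] := compact_support_bounded sc o; exists C=> s x ps xK.
by have := HC s x ps; have [-> _ _] := chi_in (le_lt_trans xK mK); rewrite mulr1. Qed.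

End StripTools.

(** * The Feynman-Kac formula for one weak solution *)

Section FeynmanKacSetting.
Context {R : realType} {dO : measure_display} {Om : measurableType dO} (P : probability Om R) (F : R -> set (set Om)) (uF :
  usual_filtration P F) {d} (W : R -> Om -> 'rV[R]_d) (d0 : (0 < d)%N) (BW : brownian_motion P F W) {dU} {U :
  measurableType dU} (M : {sigma_finite_measure set U -> \bar R}) (N : Om -> {measure set (U * mR R) -> \bar R}) (prm
  : poisson_random_measure P M N) (adN : adapted_random_measure P F N) (t0 T : R) (t00 : 0 <= t0) (tT : t0 <= T) (b :
  'rV[R]_d -> 'rV[R]_d) (sigma : 'rV[R]_d -> 'M[R]_d) (c : 'rV[R]_d -> U -> 'rV[R]_d) (mb : meas (b : borelRd R d ->
  borelRd R d)) (msigma : forall i j, meas ((fun x=> sigma x i j) : borelRd R d -> mR R)) (mc : meas ((fun p=> c p.1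
  p.2) : borelRd R d * U -> borelRd R d)) (c2 : forall x i, itgT M (fun u=> c x u ord0 i ^+ 2)) (x0 : 'rV[R]_d) (X : R
  -> Om -> 'rV[R]_d) (sde : solves_sde b sigma M c P F W N t0 x0 X) (rho : sfun R d) (rho0 : forall s x, 0 <= s <= T
  -> 0 <= rho s x) (crho : strip_cont 0 T rho).

(** The trace of a plus the second moment of the Levy measure, written with sigma and c. *)
Definition quad y : R := \sum_i \sum_j sigma y i j ^+ 2 + \sum_i \int[M]_u (c y u ord0 i ^+ 2).

(** The total size of the coefficients, with a weight q that will be chosen from the growth of the
    derivatives of u. *)
Definition hh (q : 'rV[R]_d -> R) y : R := q y * (1 + \sum_j `|b y ord0 j| + quad y).

(** rho is controlled on [0, T] only, hence the projection of time. *)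
Definition rt lam q r y : R := rho (clamp 0 T r) y + lam * hh q y.

Definition DD lam q w r : R := expR (- int t0 r (fun r=> rt lam q r (X r w))).

Definition Lg (phi : sfun R d) (phi1 : 'I_d -> sfun R d) (phi2 : 'I_d -> 'I_d -> sfun R d) r y : R :=
  \sum_j b y ord0 j * phi1 j r y + (2^-1 * (\sum_i \sum_k phi2 i k r y * (\sum_j sigma y i j * sigma y k j))
  + \int[M]_u jump_term phi phi1 r y (c y u)).

Record tame_path (w : Om) : Prop := TamePath {
  gb : forall i, itgi t0 T (fun r=> b (X r w) ord0 i);
  gA : itgi t0 T (fun r=> quad (X r w)) }.

Let T0 : 0 <= T. Proof. exact: le_trans tT. Qed.
Let Xcad : cadlag_from t0 X. Proof. by have [_ []] := sde. Qed.

Lemma quad_ge0 y : 0 <= quad y.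
apply: addr_ge0; apply: sumr_ge0=> i _; first by apply: sumr_ge0=> j _; exact: sqr_ge0.
by apply: Rintegral_ge0=> u _; exact: sqr_ge0. Qed.

Lemma quad_measurable : meas (quad : borelRd R d -> R).
apply: (sqint_joint M (T := borelRd R d) (f := fun i j y=> sigma y i j) (g := fun i y u=> c y u ord0 i))=> // i.
exact: (meas_comp (borelRd_coord i) mc). Qed.

Lemma hh_measurable q : meas (q : borelRd R d -> R) -> meas (hh q : borelRd R d -> R).
move=>mq; apply: measM=> //; apply: measD; last exact: quad_measurable.
apply: measD=> //; apply: meas_sum=> j; apply: (@meas_comp _ _ _ _ _ _ (@normr R R))=> //.
exact: (meas_comp (borelRd_coord j) mb). Qed.

Lemma rt_measurable lam q : meas (q : borelRd R d -> R) -> meas (fun p : mR R * borelRd R d=> rt lam q p.1 p.2).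
move=>mq; apply: measD; first exact: (strip_cont_measurable T0 crho).
by apply: measM=> //; exact: (meas_comp (hh_measurable mq) measurable_snd). Qed.

Lemma path_bounded w : exists K, forall r, t0 <= r <= T -> n1 (X r w) <= K.
exact: (cadlag_bounded T (Xcad w).1 (Xcad w).2). Qed.

Lemma path_measurable (h : mR R * borelRd R d -> R) w : meas h -> measi t0 T (fun r=> h (r, X r w)).
move=>mh; have mX : meas ((fun r=> X (clamp t0 T r) w) : mR R -> borelRd R d).
by apply: (rcont_path_measurable (z := X ^~ w))=> // r /andP[tr _]; exact: (Xcad w).1.
have := measurable_funTS (D := `[t0, T]%classic) (meas_comp mh (g := fun r : mR R=> (r, X (clamp t0 T r) w : borelRd R d)) _).
move=>H; have {}H := H (measurable_fun_pair (@measurable_id _ _ _) mX).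
by apply: eq_measurable_fun H=> r /=; rewrite inE/= in_itv/= => tr; rewrite clamp_id. Qed.

(** Paths of X are bounded on [t0, T], so such a q is bounded along each of them and [hh q] is
    integrable along tame ones. *)
Definition locbd (q : 'rV[R]_d -> R) := forall K, exists B, forall y, n1 y <= K -> `|q y| <= B.

Lemma hh_itg q w : tame_path w -> meas (q : borelRd R d -> R) -> locbd q -> itgi t0 T (fun r=> hh q (X r w)).
move=>gw mq lq; have [K HK] := path_bounded w; have [B HB] := lq K.
apply: (@itgM_bounded _ _ _ _ _ (mitv t0 T) B (fun r=> q (X r w))).
- exact: (path_measurable w (meas_comp mq measurable_snd)).
- by move=>r /=; rewrite in_itv/= => tr; apply: HB; exact: HK.
- apply: itgD=> //; last exact: gA gw. apply: itgD=> //; first exact: itg_cst.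
by apply: itg_sum=> // j _; apply: itg_norm; exact: gb gw j. Qed.

Lemma strip_path_itg h w : strip_cont 0 T h -> itgi t0 T (fun r=> h (clamp 0 T r) (X r w)).
move=>ch; have [K HK] := path_bounded w; have [B HB] := strip_cont_locbd K d0 ch.
apply: (@le_itgi R t0 T _ (fun=> B)); last exact: itg_cst. exact: (path_measurable w (strip_cont_measurable T0 ch)).
by move=>r tr; apply: HB; [exact: clamp_itv|exact: HK]. Qed.

Lemma rt_itg lam q w : tame_path w -> meas (q : borelRd R d -> R) -> locbd q ->
  itgi t0 T (fun r=> rt lam q r (X r w)).
by move=>gw mq lq; apply: itgD=> //; [exact: strip_path_itg|apply: itgZ=> //; exact: hh_itg]. Qed.

Lemma hh_ge0 q y : 1 <= q y -> 1 + \sum_j `|b y ord0 j| + quad y <= hh q y.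
move=>q1; rewrite ler_peMl//; apply: addr_ge0; last exact: quad_ge0. by apply: addr_ge0=> //; apply: sumr_ge0.
Qed.

Lemma rt_ge0 lam q r y : 0 <= lam -> 1 <= q y -> 0 <= rt lam q r y.
move=>l0 q1; apply: addr_ge0; first by apply: rho0; exact: clamp_itv.
apply: mulr_ge0=> //; apply: le_trans (hh_ge0 q1).
by apply: addr_ge0; [apply: addr_ge0=> //; apply: sumr_ge0|exact: quad_ge0]. Qed.

(** The outcome of [levy_formula] for all weights and test functions at once; the later limits refer
    to it and no longer to the noise. *)
Definition levy_data T1 : Prop := forall lam q phi phit phi1 phi2 C, 0 < lam -> meas (q : borelRd R d -> R) -> locbd q ->
  (forall y, 1 <= q y) -> test t0 T1 phi phit phi1 phi2 C ->
  let Th w r := DD lam q w r * (phit r (X r w) + Lg phi phi1 phi2 r (X r w) - rt lam q r (X r w) * phi r (X r w)) in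
  [/\ itgT P (fun w=> int t0 T1 (Th w)), itgT P (fun w=> DD lam q w T1 * phi T1 (X T1 w)),
  \int[P]_w (DD lam q w T1 * phi T1 (X T1 w)) - phi t0 x0 = \int[P]_w int t0 T1 (Th w) &
  {ae P, forall w, itgi t0 T1 (Th w) /\ `|int t0 T1 (Th w)| <= Bnd (d := d) C lam}].

(** An approximating sequence is chosen for each entry of sigma and each coordinate of c.
    Integrability of [quad] along the path comes from [levy_admissible], that is, from the
    approximability of the integrands. *)
Lemma levy_dataP : {ae P, forall w, tame_path w} /\ forall T1, t0 <= T1 <= T -> levy_data T1.
have [XA [_ [bX [IW [IN [hW [hN eqX]]]]]]] := sde.
have /boolp.choice[SW HSW] : forall ij : 'I_d * 'I_d, exists S : nat -> seq elementary,
(forall n i, (i < size (S n))%N -> elementary_ok F t0 (nth dflt_e (S n) i)) /\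
(forall s, t0 <= s -> cvg_to0_in_prob P (fun n w =>
\int[Leb]_(r in `[t0, s]) ((sigma (X r w) ij.1 ij.2 - elementary_val (S n) r w) ^+ 2)%:E)%E) /\
(forall s, t0 <= s -> cvg_to0_in_prob P (fun n w =>
(`|IW ij.1 ij.2 s w - elementary_int (fun r w=> W r w ord0 ij.2) (S n) s w|)%:E)).
by move=> [i j]; have [_ [_ H]] := hW i j. have /boolp.choice[SN HSN] : forall i, exists S : nat -> seq marked,
(forall n l, (l < size (S n))%N -> marked_ok F M t0 (nth dflt_m (S n) l)) /\
(forall s, t0 <= s -> cvg_to0_in_prob P (fun n w => \int[Leb]_(r in `[t0, s]) \int[M]_u
((c (left_limit X r w) u ord0 i - marked_val (S n) r w u) ^+ 2)%:E)%E) /\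
(forall s, t0 <= s -> cvg_to0_in_prob P (fun n w => (`|IN i s w - marked_int M N (S n) s w|)%:E)).
by move=>i; have [_ [_ H]] := hN i.
have bi T1 : t0 <= T1 -> {ae P, forall w, forall i, itgi t0 T1 (fun r=> b (X r w) ord0 i)}.
by move=>tT1; apply: ae_imp bX=> w H i; exact: H.
have Ek := fun T1 (tT1 : t0 <= T1) kap=> @levy_admissible R dO Om P F uF d W BW dU U M N prm adN t0 T1 t00 tT1 b sigma c msigma mc c2
x0 X XA Xcad (bi T1 tT1) IW IN (fun i j=> (hW i j).1) (fun i j=> (hW i j).2.1) (fun i=> (hN i).1) (fun i=> (hN i).2.1)
(fun i j=> SW (i, j)) SN (fun i j=> (HSW (i, j)).1) (fun i=> (HSN i).1)
(fun i j=> (HSW (i, j)).2.1 T1 tT1) (fun i=> (HSN i).2.1 T1 tT1) (fun i j=> (HSW (i, j)).2.2) (fun i=> (HSN i).2.2)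
eqX kap. have gae : {ae P, forall w, tame_path w}. have := Ek T tT (fun _ _=> 0) (aeW _ (fun w=> itg_cst _ _ _)).
apply: filterS2 (bi T tT)=> w bw ad; have := ad_i ad=> ai; split=> //.
apply: (@le_itgi R t0 T _ (fun r=> quad (X (clamp t0 T r) w))).
- by apply: eq_measurable_fun (itg_meas ai)=> r; rewrite inE/= in_itv/= => tr; rewrite /sqint clamp_id.
- by move=>r tr; rewrite clamp_id// ger0_norm ?quad_ge0.
- exact: ai. split=> // T1 /andP[tT1 T1T]. move=>lam q phi phit phi1 phi2 C l0 mq lq q1 Te Th.
(* The rate of [levy_formula] adds [lam * quad] by itself, so it is subtracted here and the total is
   [rt]. Since 1 <= q, enough is left to dominate the drift. *)
pose kap r y := rt lam q r y - lam * quad y. have mkap : meas (fun p : mR R * borelRd R d=> kap p.1 p.2).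
apply: measB; first exact: rt_measurable. by apply: measM=> //; exact: (meas_comp quad_measurable measurable_snd).
have kap_b r y : lam * (1 + \sum_j `|b y ord0 j|) <= kap r y.
have H := hh_ge0 (q1 y); have r0 := rho0 y (clamp_itv r T0). have := ler_wpM2l (ltW l0) H; rewrite /kap /rt.
have -> : lam * (1 + \sum_j `|b y ord0 j| + quad y) = lam * (1 + \sum_j `|b y ord0 j|) + lam * quad y by rewrite mulrDr.
move: (lam * (1 + _)) (lam * quad y) (lam * hh q y) (rho _ _) r0=> a1 a2 a3 a4 a5; lra.
have kapi : {ae P, forall w, itgi t0 T1 (fun r=> kap r (X r w))}.
apply: ae_imp gae=> w gw; apply: (itg_sub (lexx t0) T1T).
by apply: itgB=> //; [exact: rt_itg|apply: itgZ=> //; exact: gA gw].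
have LF := levy_formula uF BW prm adN t00 tT1 mb msigma mc c2 XA Xcad (bi T1 tT1) (fun i j=> (hW i j).1) (fun i j=> (hW i j).2.1)
(fun i=> (hN i).1) (fun i=> (hN i).2.1) (SW := fun i j=> SW (i, j)) (SN := SN)
(fun i j=> (HSW (i, j)).1) (fun i=> (HSN i).1)
(fun i j=> (HSW (i, j)).2.1 T1 tT1) (fun i=> (HSN i).2.1 T1 tT1) (fun i j=> (HSW (i, j)).2.2) (fun i=> (HSN i).2.2)
eqX l0 mkap kap_b kapi Te. have rE w r : t0 <= r <= T1 -> rate M lam (fun r=> kap r (X (clamp t0 T1 r) w))
(fun i j r=> sigma (X (clamp t0 T1 r) w) i j) (fun i r u=> c (X (clamp t0 T1 r) w) u ord0 i) r = rt lam q r (X r w).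
by move=>tr; rewrite /rate /kap /sqint clamp_id// -/(quad (X r w)) subrK.
have KE w r : t0 <= r <= T1 -> pathK M t0 lam (fun r=> kap r (X (clamp t0 T1 r) w))
(fun i j r=> sigma (X (clamp t0 T1 r) w) i j) (fun i r u=> c (X (clamp t0 T1 r) w) u ord0 i) r = DD lam q w r.
move=> /andP[tr rT]; rewrite /pathK /DD; congr (expR (- _)); apply: int_eq=> s /andP[ts sr].
by apply: rE; rewrite ts (le_trans sr rT).
pose Th' w := pathTheta M t0 phi phit phi1 phi2 lam (fun j r=> b (X (clamp t0 T1 r) w) ord0 j)
(fun r=> kap r (X (clamp t0 T1 r) w)) (fun i j r=> sigma (X (clamp t0 T1 r) w) i j)
(fun i r u=> c (X (clamp t0 T1 r) w) u ord0 i) (fun r=> X (clamp t0 T1 r) w).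
have ThE w r : t0 <= r <= T1 -> Th' w r = Th w r.
move=>tr; rewrite /Th' /pathTheta KE// rE// /pathgen /jump_int clamp_id// -mulrDr; congr (_ * _).
rewrite /Lg (_ : \int[M]_u jump_term phi phi1 r (X r w) (\row_i c (X r w) u ord0 i) =
\int[M]_u jump_term phi phi1 r (X r w) (c (X r w) u)); last first.
by apply: eq_Rintegral=> u _; congr jump_term; apply/rowP=> i; rewrite mxE.
by rewrite addrA [in RHS]addrA addrAC [in LHS]addrAC [in RHS]addrAC; ring.
have iE w : int t0 T1 (Th' w) = int t0 T1 (Th w) by apply: int_eq=> r; exact: ThE.
have T1T1 : t0 <= T1 <= T1 by rewrite tT1 lexx. have [i1 i2 E ab] := LF; split.
- by move: i1; congr (itgT P _); apply/funext=> w; exact: iE.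
- by move: i2; congr (itgT P _); apply/funext=> w; rewrite KE.
- move: E; under eq_Rintegral do rewrite KE//; move=> ->. by apply: eq_Rintegral=> w _; exact: iE.
apply: ae_imp ab=> w [it ib]; rewrite -iE; split; last exact: ib.
apply: (@le_itgi R t0 T1 _ (fun r=> `|Th' w r|)); last exact: itg_norm.
by apply: eq_measurable_fun (itg_meas it)=> r; rewrite inE/= in_itv/= => tr; exact: ThE. by move=>r tr; rewrite ThE.
Qed.

(** * A weight that dominates all cut-offs *)

Section CutoffLimit.
Context (T1 B : R) (u ut : sfun R d) (u1 : 'I_d -> sfun R d) (u2 : 'I_d -> 'I_d -> sfun R d) (C : nat -> R) (B0 : 0 <=
  B) (uB : forall s y, t0 <= s <= T1 -> `|u s y| <= B) (HC : forall m, test t0 T1 (cut u m.+1) (cutt ut m.+1) (cut1 u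
  u1 m.+1) (cut2 u u1 u2 m.+1) (C m)).

(** Dominates the constants of the cut-offs with index up to k + 1. The last of these coincides with
    u on [n1 < k + 2], which contains the points whose norm has integer part k and everything within
    distance 1 of them. *)
Definition weight_seq k : R := 1 + \sum_(m < k.+2) `|C m|.

(** [gidx 0 1 1] is the integer part, in a form already known to be measurable. *)
Definition weight y := weight_seq (gidx 0 1 1 (n1 (y : 'rV[R]_d))).

Lemma weight_ge1 y : 1 <= weight y.
by rewrite lerDl sumr_ge0. Qed.

Lemma weight_measurable : meas (weight : borelRd R d -> R).
have mn := n1_measurable (T := borelRd R d) (v := id) (@measurable_id _ _ _).
exact: (meas_comp (gidx_measurable 0 1 1 weight_seq) mn). Qed.
Let gidx_n1 (y : 'rV[R]_d) : (gidx 0 1 1 (n1 y))%:R <= n1 y < (gidx 0 1 1 (n1 y)).+1%:R.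
have := gidxP (@ltr01 R) (N := 1%N) isT (n1_ge0 y). by rewrite /gp !add0r !subr0 !mul1r !divr1. Qed.

Lemma weight_locbd : locbd weight.
move=>K; exists (weight_seq (Num.truncn `|K|))=> y yK; rewrite ger0_norm; last exact: le_trans (weight_ge1 y).
have mono : {homo weight_seq : n m / (n <= m)%N >-> n <= m}.
by apply/nondecreasing_seqP=> n; rewrite lerD2l [leRHS]big_ord_recr/= lerDl.
apply: mono; have /andP[ky _] := gidx_n1 y. have /andP[_ Kt] := truncn_itv (normr_ge0 K).
have : (gidx 0 1 1 (n1 y))%:R < (Num.truncn `|K|).+1%:R :> R.
by apply: le_lt_trans Kt; apply: (le_trans ky); exact: le_trans yK (ler_norm K). by rewrite ltr_nat ltnS. Qed.

(* Near y only the first gidx.+2 cutoffs matter: the later ones coincide there with the last of these. *)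
Let cut_stable m y : exists2 m', C m' <= weight y & forall s y', n1 y' < (gidx 0 1 1 (n1 y)).+2%:R ->
  [/\ cut u m.+1 s y' = cut u m'.+1 s y', cutt ut m.+1 s y' = cutt ut m'.+1 s y',
  forall j, cut1 u u1 m.+1 j s y' = cut1 u u1 m'.+1 j s y' &
  forall j k, cut2 u u1 u2 m.+1 j k s y' = cut2 u u1 u2 m'.+1 j k s y'].
have Cw m' : (m' < (gidx 0 1 1 (n1 y)).+2)%N -> C m' <= weight y.
move=>mk; apply: (le_trans (ler_norm _)); rewrite /weight /weight_seq (bigD1 (Ordinal mk))//=.
have : 0 <= \sum_(i < (gidx 0 1 1 (n1 y)).+2 | i != Ordinal mk) `|C i| by exact: sumr_ge0.
by move: (\sum_(_ | _) _)=> z z0; lra.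
have [mk|km] := ltnP m (gidx 0 1 1 (n1 y)).+2; first by exists m; first exact: Cw.
exists (gidx 0 1 1 (n1 y)).+1; first exact: Cw. move=>s y' yk; have ym : n1 y' < m.+1%:R.
by apply: lt_le_trans yk _; rewrite ler_nat ltnW.
have [-> -> e1 e2] := cut_in u ut u1 u2 s ym; have [-> -> f1 f2] := cut_in u ut u1 u2 s yk.
by split=> // [j|j k]; rewrite ?e1 ?f1 ?e2 ?f2. Qed.
Let self (y : 'rV[R]_d) : n1 y < (gidx 0 1 1 (n1 y)).+2%:R :> R.
by have /andP[_ H] := gidx_n1 y; apply: lt_le_trans H _; rewrite ler_nat. Qed.

Lemma cut_weight m s y : t0 <= s <= T1 -> [/\ `|cutt ut m.+1 s y| <= weight y,
  forall j, `|cut1 u u1 m.+1 j s y| <= weight y & forall j k, `|cut2 u u1 u2 m.+1 j k s y| <= weight y].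
move=>ts; have [m' Cm' H] := cut_stable m y; have [_ -> e1 e2] := H s y (self y); have Tm := HC m'.
split=> [|j|j k]; rewrite ?e1 ?e2; apply: le_trans Cm'.
- exact: (t_bt Tm).
- exact: (t_b1 Tm).
- exact: (t_b2 Tm). Qed.
Let cutB m s y : t0 <= s <= T1 -> `|cut u m.+1 s y| <= B.
by move=>ts; apply: le_trans (cut_le _ _ _ _) _; exact: uB. Qed.
Let d1 : 1 <= d%:R :> R. Proof. by rewrite ler1n. Qed.

(** A jump with [n1 v <= 1] stays where only the first cut-offs matter, so the Taylor bound holds
    with a constant below the weight. For a longer jump the values are bounded by B and the gradient
    by the weight, and [1 < n1 v] allows passing to the square. *)
Lemma jump_weight m s y v : t0 <= s <= T1 ->
  `|jump_term (cut u m.+1) (cut1 u u1 m.+1) s y v| <= weight y * (2 * B + d%:R) * n1 v ^+ 2.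
move=>ts; have w1 := weight_ge1 y; have n0 := n1_ge0 v. have [v1|v1] := leP (n1 v) 1.
have [m' Cm' H] := cut_stable m y. have yv : n1 (y + v) < (gidx 0 1 1 (n1 y)).+2%:R.
apply: le_lt_trans (n1D _ _) _; have /andP[_ ] := gidx_n1 y.
by rewrite -[in X in _ -> X](addn1 (gidx _ _ _ _).+1) natrD=> H1; apply: ltr_leD.
have [f1 _ _ _] := H s (y + v) yv; have [f2 _ f3 _] := H s y (self y).
have -> : jump_term (cut u m.+1) (cut1 u u1 m.+1) s y v = jump_term (cut u m'.+1) (cut1 u u1 m'.+1) s y v.
by rewrite /jump_term f1 f2; congr (_ - _); apply: eq_bigr=> i _; rewrite f3.
apply: (le_trans (jump_term_le (HC m') y v ts)); apply: ler_wpM2r; first exact: sqr_ge0.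
apply: le_trans (ler_wpM2r (ler0n _ _) Cm') _; apply: ler_wpM2l; first exact: le_trans w1. by rewrite lerDr mulr_ge0.
have [_ b1 _] := cut_weight m y ts. have bs : `|\sum_i cut1 u u1 m.+1 i s y * v ord0 i| <= weight y * n1 v.
apply: (le_trans (ler_norm_sum _ _ _)); rewrite /n1 mulr_sumr; apply: ler_sum=> i _. by rewrite normrM ler_wpM2r.
have c1 := cutB m (y + v) ts; have c2' := cutB m y ts. apply: (@le_trans _ _ (2 * B + weight y * n1 v)).
rewrite /jump_term; move: (cut _ _ _ (y + v)) (cut _ _ _ y) (\sum_i _) c1 c2' bs=> a1 a2 a3 h1 h2 h3.
apply: le_trans (ler_normB _ _) _; apply: lerD=> //; apply: le_trans (ler_normB _ _) _.
have -> : 2 * B = B + B by ring. exact: lerD. have nn : n1 v <= n1 v ^+ 2 by rewrite expr2 ler_peMr// ltW.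
have n11 : 1 <= n1 v ^+ 2 by apply: le_trans nn; exact: ltW. rewrite mulrDr mulrDl; apply: lerD.
have B2 : 0 <= 2 * B by exact: mulr_ge0. have wB : 2 * B <= weight y * (2 * B) by rewrite ler_peMl.
by apply: (le_trans wB); rewrite ler_peMr// (le_trans B2). rewrite -mulrA; apply: ler_wpM2l; first exact: le_trans w1.
by apply: (le_trans nn); rewrite ler_peMl// sqr_ge0. Qed.
Let jump_meas m s y : t0 <= s <= T1 -> meas (fun v=> jump_term (cut u m.+1) (cut1 u u1 m.+1) s y (c y v)).
move=>ts; have mcy : meas (c y : U -> borelRd R d).
by apply: (meas_comp mc (g := fun v=> (y, v) : borelRd R d * U)); exact: measurable_pair1.
apply: (meas_comp (f := (fun v=> jump_term (cut u m.+1) (cut1 u u1 m.+1) s y v) : borelRd R d -> R))=> //.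
apply: borelRd_continuous=> v; rewrite /jump_term. apply: contD; last first.
by apply: contN; apply: cont_sum=> i; apply: contM; [exact: cont_cst|exact: continuous_coord].
apply: contD; last exact: cont_cst.
move=>z; apply: (@continuous_comp _ _ _ (fun v=> y + v) (cut u m.+1 s)); last exact: (unif_cont_x ts (t_u0 (HC m))).
by apply: continuousD; [exact: cst_continuous|exact: id]. Qed.
Let sq_int y : itgT M (fun v=> n1 (c y v) ^+ 2) /\ \int[M]_v (n1 (c y v) ^+ 2) <= d%:R * quad y.
have i1 : itgT M (fun v=> d%:R * \sum_i c y v ord0 i ^+ 2).
by apply: itgZ=> //; apply: itg_sum=> // i _; exact: c2. have mcy : meas (c y : U -> borelRd R d).
by apply: (meas_comp mc (g := fun v=> (y, v) : borelRd R d * U)); exact: measurable_pair1.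
have mn : meas (fun v=> n1 (c y v) ^+ 2) by apply: measurable_funX; exact: n1_measurable.
have le v : `|n1 (c y v) ^+ 2| <= d%:R * \sum_i c y v ord0 i ^+ 2. by rewrite ger0_norm ?sqr_ge0// n1_sqr.
split; first by apply: (le_itg _ mn _ i1)=> // v _; exact: le.
have H := @le_norm_Rint _ _ _ M setT _ _ measurableT mn (fun v _=> le v) i1.
apply: (le_trans (ler_norm _)); apply: (le_trans H).
rewrite RintegralZl//; last by apply: itg_sum=> // i _; exact: c2. apply: ler_wpM2l; first exact: ler0n.
rewrite (@Rint_sum _ _ _ M _ _ _ _ _ measurableT); last by move=>i _; exact: c2.
by rewrite lerDr; apply: sumr_ge0=> i _; apply: sumr_ge0=> j _; exact: sqr_ge0. Qed.
Let jdom y : itgT M (fun v=> weight y * (2 * B + d%:R) * n1 (c y v) ^+ 2).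
by apply: itgZ=> //; exact: (sq_int y).1. Qed.

(** The summands belong to time and drift, to the second-order term with its sum over three indices,
    and to the jump integral. *)
Definition gen_cst : R := 1 + d%:R * (d%:R * d%:R) + (2 * B + d%:R) * d%:R.

Lemma gen_cst_ge0 : 0 <= gen_cst.
by rewrite /gen_cst !addr_ge0 ?mulr_ge0 ?addr_ge0 ?mulr_ge0. Qed.
Let generator_arith (a1 a2 a3 a4 s' w q x : R) : 1 <= x -> `|a1| <= w -> `|a2| <= w * s' ->
  `|a3| <= x * (x * (w * (x * q))) -> `|a4| <= w * (2 * B + x) * (x * q) -> 0 <= s' -> 1 <= w -> 0 <= q ->
  `|a1 + (a2 + (2^-1 * a3 + a4))| <= (1 + x * (x * x) + (2 * B + x) * x) * (w * (1 + s' + q)).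
move=>x1 bt e1 e2 e3 s0 w1 q0; have w0 : 0 <= w by exact: le_trans w1.
apply: (@le_trans _ _ (`|a1| + (`|a2| + (2^-1 * `|a3| + `|a4|)))).
apply: le_trans (ler_normD _ _) _; rewrite lerD2l; apply: le_trans (ler_normD _ _) _; rewrite lerD2l.
by apply: le_trans (ler_normD _ _) _; rewrite lerD2r normrM ger0_norm.
have h3 : 2^-1 * `|a3| <= `|a3| by rewrite ler_piMl// invf_le1// ler1n.
apply: (@le_trans _ _ (w * (1 + s') + (x * (x * x) + (2 * B + x) * x) * (w * q))).
have -> : (x * (x * x) + (2 * B + x) * x) * (w * q) = x * (x * (w * (x * q))) + w * (2 * B + x) * (x * q) by ring.
have -> : w * (1 + s') = w + w * s' by ring. lra. have Y0 : 0 <= x * (x * x) + (2 * B + x) * x.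
by have x00 : 0 <= x by [lra]; rewrite addr_ge0 ?mulr_ge0 ?addr_ge0 ?mulr_ge0.
rewrite -[1 + _ + _]addrA; move: (x * (x * x) + (2 * B + x) * x) Y0=> Y Y0.
have -> : (1 + Y) * (w * (1 + s' + q)) = w * (1 + s') + Y * (w * q) + (w * q + Y * (w * (1 + s'))) by ring.
by rewrite lerDl addr_ge0 ?mulr_ge0 ?addr_ge0. Qed.

Lemma generator_weight m s y : t0 <= s <= T1 ->
  `|cutt ut m.+1 s y + Lg (cut u m.+1) (cut1 u u1 m.+1) (cut2 u u1 u2 m.+1) s y| <= gen_cst * hh weight y.
move=>ts; have [bt b1 b2] := cut_weight m y ts; have w1 := weight_ge1 y.
have w0 : 0 <= weight y by exact: le_trans w1. have q0 := quad_ge0 y.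
have e1 : `|\sum_j b y ord0 j * cut1 u u1 m.+1 j s y| <= weight y * \sum_j `|b y ord0 j|.
apply: (le_trans (ler_norm_sum _ _ _)); rewrite mulr_sumr; apply: ler_sum=> i _. by rewrite normrM mulrC ler_wpM2r.
have sq i j : sigma y i j ^+ 2 <= quad y. apply: (@le_trans _ _ (\sum_i \sum_j sigma y i j ^+ 2)); last first.
by rewrite lerDl; apply: sumr_ge0=> k _; apply: Rintegral_ge0=> v _; exact: sqr_ge0.
rewrite (bigD1 i)//= (bigD1 j)//= -addrA lerDl; apply: addr_ge0. by apply: sumr_ge0=> k _; exact: sqr_ge0.
by apply: sumr_ge0=> k _; apply: sumr_ge0=> l _; exact: sqr_ge0.
have e2 : `|\sum_i \sum_k cut2 u u1 u2 m.+1 i k s y * (\sum_j sigma y i j * sigma y k j)| <=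
d%:R * (d%:R * (weight y * (d%:R * quad y))).
have sumle (h : 'I_d -> R) (z : R) : (forall i, `|h i| <= z) -> `|\sum_i h i| <= d%:R * z.
move=>H; apply: (le_trans (ler_norm_sum _ _ _)); apply: (le_trans (ler_sum _ (fun i _=> H i))).
by rewrite sumr_const card_ord mulr_natl.
apply: (sumle _)=> i; apply: (sumle _)=> k; rewrite normrM; apply: ler_pM=> //; apply: (sumle _)=> j.
have := sq i j; have := sq k j; have := sqr_ge0 (sigma y i j - sigma y k j); have := sqr_ge0 (sigma y i j + sigma y k j).
move: (sigma y i j) (sigma y k j) (quad y)=> x z q; rewrite sqrrB sqrrD ler_norml=> *; apply/andP; split; lra.
have e3 : `|\int[M]_v jump_term (cut u m.+1) (cut1 u u1 m.+1) s y (c y v)| <= weight y * (2 * B + d%:R) * (d%:R * quad y).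
apply: (le_trans (@le_norm_Rint _ _ _ M setT _ _ measurableT (jump_meas m y ts) (fun v _=> jump_weight m y (c y v) ts) (jdom y))).
rewrite RintegralZl//; last exact: (sq_int y).1.
by apply: ler_wpM2l; [rewrite mulr_ge0// addr_ge0// mulr_ge0|exact: (sq_int y).2].
have s0 : 0 <= \sum_j `|b y ord0 j| by exact: sumr_ge0. exact: generator_arith. Qed.

(** At a fixed point the local terms are eventually constant in m, and [jump_weight] dominates the
    jump integrands uniformly in m. *)
Lemma generator_cut_cvg s y : t0 <= s <= T1 ->
  cutt ut m.+1 s y + Lg (cut u m.+1) (cut1 u u1 m.+1) (cut2 u u1 u2 m.+1) s y @[m --> \oo] -->
  ut s y + Lg u u1 u2 s y.
move=>ts; have big z : \forall m \near \oo, n1 (z : 'rV[R]_d) < m.+1%:R.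
exists (Num.truncn (n1 z))=> // m /= le; have /andP[_ H] := truncn_itv (n1_ge0 z).
by apply: lt_le_trans H _; rewrite ler_nat ltnS.
have jc v : jump_term (cut u m.+1) (cut1 u u1 m.+1) s y v @[m --> \oo] --> jump_term u u1 s y v.
apply: cvg_near_cst; near=> m; rewrite /jump_term.
have [e0 _ _ _] : [/\ cut u m.+1 s (y + v) = u s (y + v), cutt ut m.+1 s (y + v) = ut s (y + v),
forall j, cut1 u u1 m.+1 j s (y + v) = u1 j s (y + v) & forall j k, cut2 u u1 u2 m.+1 j k s (y + v) = u2 j k s (y + v)].
by apply: cut_in; near: m; exact: big. have [e1 _ e2 _] : [/\ cut u m.+1 s y = u s y, cutt ut m.+1 s y = ut s y,
forall j, cut1 u u1 m.+1 j s y = u1 j s y & forall j k, cut2 u u1 u2 m.+1 j k s y = u2 j k s y].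
by apply: cut_in; near: m; exact: big. by rewrite e0 e1; congr (_ - _); apply: eq_bigr=> i _; rewrite e2.
have ml : meas (fun v=> jump_term u u1 s y (c y v)).
by apply: (measurable_fun_cvg (fun m=> jump_meas m y ts))=> v _; exact: jc.
have [_ jl] := @Rdct _ _ _ M setT _ _ _ measurableT (fun m=> jump_meas m y ts) ml
(aeW _ (fun v _=> jc (c y v))) (jdom y) (fun m v _=> jump_weight m y (c y v) ts).
have st (h_ : nat -> R) h : (\forall m \near \oo, h_ m = h) -> h_ m @[m --> \oo] --> h by exact: cvg_near_cst.
have yb := big y. apply: cvgD; first by apply: st; apply: filterS yb=> m /(cut_in u ut u1 u2 s)[]. apply: cvgD.
apply: st; apply: filterS yb=> m /(cut_in u ut u1 u2 s)[_ _ e _]. by apply: eq_bigr=> j _; rewrite e.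
apply: cvgD=> //; apply: st; apply: filterS yb=> m /(cut_in u ut u1 u2 s)[_ _ _ e].
by congr (_ * _); apply: eq_bigr=> i _; apply: eq_bigr=> k _; rewrite e.
Unshelve. all: by end_near. Qed.

End CutoffLimit.

Lemma lim_sub (a a' : nat -> R) (l l' : R) : a n @[n --> \oo] --> l -> a' n @[n --> \oo] --> l' ->
  a n - a' n @[n --> \oo] --> l - l'.
exact: cvgB. Qed.

Lemma lim_subc (a : nat -> R) (l k : R) : a n @[n --> \oo] --> l -> a n - k @[n --> \oo] --> l - k.
by move=>h; apply: cvgB=> //; exact: cvg_cst. Qed.

Lemma lim_eq (a a' : nat -> R) (l l' : R) : (forall n, a n = a' n) -> a n @[n --> \oo] --> l ->
  a' n @[n --> \oo] --> l' -> l = l'.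
by move=>e c1 /(cvg_ext e) c2'; exact: (cvg_unique _ c1 c2'). Qed.

Section Limits.
Context (gae : {ae P, forall w, tame_path w}) (LD : forall T1, t0 <= T1 <= T -> levy_data T1).

(** The weight q is common to all cut-offs, so one discount serves the whole sequence and stays
    fixed in the limit. *)
Lemma cutoff_limit T1 B u ut u1 u2 : t0 <= T1 <= T ->
  smooth_strip t0 T1 u ut u1 u2 -> (forall s y, t0 <= s <= T1 -> `|u s y| <= B) ->
  exists q : 'rV[R]_d -> R, [/\ meas (q : borelRd R d -> R), locbd q, forall y, 1 <= q y & forall lam, 0 < lam ->
  let Th w r := DD lam q w r * (ut r (X r w) + Lg u u1 u2 r (X r w) - rt lam q r (X r w) * u r (X r w)) in
  [/\ itgT P (fun w=> int t0 T1 (Th w)), itgT P (fun w=> DD lam q w T1 * u T1 (X T1 w)) &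
  \int[P]_w (DD lam q w T1 * u T1 (X T1 w)) - u t0 x0 = \int[P]_w int t0 T1 (Th w)]].
move=>tT1 sm uB; have /andP[tT1' T1T] := tT1. have tt : t0 <= t0 <= T1 by rewrite lexx.
have TT : t0 <= T1 <= T1 by rewrite tT1' lexx. have B0 : 0 <= B := le_trans (normr_ge0 _) (uB t0 0 tt).
have /boolp.choice[C HC] := fun m=> cut_test sm d0 (ltn0Sn m).
have mq := weight_measurable C; have lq := weight_locbd C; have q1 := weight_ge1 C.
exists (weight C); split=> // lam l0 Th; set q := weight C in mq lq q1 Th *.
pose Tm m w r := DD lam q w r * (cutt ut m.+1 r (X r w) + Lg (cut u m.+1) (cut1 u u1 m.+1) (cut2 u u1 u2 m.+1) r (X r w)
- rt lam q r (X r w) * cut u m.+1 r (X r w)).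
have LDm m : [/\ itgT P (fun w=> int t0 T1 (Tm m w)), itgT P (fun w=> DD lam q w T1 * cut u m.+1 T1 (X T1 w)),
\int[P]_w (DD lam q w T1 * cut u m.+1 T1 (X T1 w)) - cut u m.+1 t0 x0 = \int[P]_w int t0 T1 (Tm m w) &
{ae P, forall w, itgi t0 T1 (Tm m w)}].
have [h1 h2 h3 h4] := @LD _ tT1 lam q _ _ _ _ _ l0 mq lq q1 (HC m); split=> //. by apply: ae_imp h4=> w [].
(* The first summand arises because [hh] is at most [rt / lam], the second bounds the killing
   term. *)
pose K' := gen_cst B / lam + B. have itm : {ae P, forall w, forall m, itgi t0 T1 (Tm m w)}.
by apply: ae_foralln=> m; have [] := LDm m. have ucv r y : cut u m.+1 r y @[m --> \oo] --> u r y.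
apply: cvg_near_cst; exists (Num.truncn (n1 y))=> // m /= le; have /andP[_ H] := truncn_itv (n1_ge0 y).
have ym : n1 y < m.+1%:R by apply: lt_le_trans H _; rewrite ler_nat ltnS.
by have [-> _ _ _] := cut_in u ut u1 u2 r ym. have ki w : tame_path w -> itgi t0 T1 (fun r=> rt lam q r (X r w)).
by move=>gw; apply: (itg_sub (lexx _) T1T); exact: rt_itg.
have k0 w r : t0 <= r <= T1 -> 0 <= rt lam q r (X r w) by move=> _; exact: rt_ge0 (ltW l0) _.
have DD1 w r : tame_path w -> t0 <= r <= T1 -> 0 <= DD lam q w r <= 1. by move=>gw; exact: (expint_itv (k0 w)).
have Tle w m r : tame_path w -> t0 <= r <= T1 -> `|Tm m w r| <= K' * (DD lam q w r * rt lam q r (X r w)).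
move=>gw tr; have /andP[D0 _] := DD1 w r gw tr; rewrite /Tm normrM (ger0_norm D0) [leRHS]mulrCA.
apply: ler_wpM2l=> //; have g1 := generator_weight B0 uB HC m (X r w) tr.
have u1' : `|cut u m.+1 r (X r w)| <= B by apply: le_trans (cut_le _ _ _ _) _; exact: uB. have r0 := k0 w r tr.
have hr : hh q (X r w) <= rt lam q r (X r w) / lam.
rewrite ler_pdivlMr// mulrC /rt lerDr; apply: rho0; exact: clamp_itv.
apply: (le_trans (ler_normB _ _)); rewrite normrM (ger0_norm r0). have c0 := gen_cst_ge0 B0.
have := ler_wpM2l c0 hr; have := ler_wpM2l r0 u1'; rewrite /K' -/q in g1 *.
move: (hh q _) (rt lam q _ _) (gen_cst B) g1=> h k c' g1 e1 e2; rewrite mulrDl.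
have -> : c' / lam * k = c' * (k / lam) by rewrite mulrAC mulrA.
by apply: lerD; [exact: le_trans g1 e2|rewrite [B * k]mulrC].
have dom w : tame_path w -> itgi t0 T1 (fun r=> K' * (DD lam q w r * rt lam q r (X r w))).
by move=>gw; apply: itgZ=> //; exact: (itg_expint tT1' (ki w gw) (k0 w)).
have Kint w : tame_path w -> int t0 T1 (fun r=> K' * (DD lam q w r * rt lam q r (X r w))) <= K'.
move=>gw; have i := itg_expint tT1' (ki w gw) (k0 w); rewrite /int RintegralZl//.
have := int_expint_full tT1' (ki w gw) (k0 w); rewrite /int /expint=> ->.
have K0 : 0 <= K' by rewrite addr_ge0// divr_ge0 ?gen_cst_ge0// ltW. by rewrite ler_piMr// gerBl expR_ge0.
have cP := usual_complete uF.
case: (bdct cP (f_ := fun m w=> int t0 T1 (Tm m w)) (f := fun w=> int t0 T1 (Th w)) (C := K'))=> [m||i1 _ _ E1].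
- by have [h _ _ _] := LDm m; exact: (measurable_itg' h). apply: filterS2 gae itm=> w gw iw; split=> [m|].
apply: (le_trans (int_norm (iw m))); apply: le_trans (Kint w gw).
by apply: int_le; [exact: itg_norm|exact: dom|move=>r tr; exact: Tle].
apply: (int_dct _ _ (dom w gw))=> [m|r tr|m r tr]; first exact: itg_meas. apply: cvgM; first exact: cvg_cst.
have gc := generator_cut_cvg B0 uB HC (y := X r w) tr. by apply: (cvgB gc); apply: cvgM; [exact: cvg_cst|exact: ucv].
exact: Tle.
case: (bdct cP (f_ := fun m w=> DD lam q w T1 * cut u m.+1 T1 (X T1 w)) (f := fun w=> DD lam q w T1 * u T1 (X T1 w)) (C := B))=> [m||i2 _ _ E2].
- by have [_ h _ _] := LDm m; exact: (measurable_itg' h).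
apply: ae_imp gae=> w gw; split=> [m|]; last by apply: cvgM; [exact: cvg_cst|exact: ucv].
have /andP[D0 D1] := DD1 w T1 gw TT; rewrite normrM (ger0_norm D0).
have uc := le_trans (cut_le u m.+1 T1 (X T1 w)) (uB T1 (X T1 w) TT). by rewrite -[leRHS]mul1r; exact: ler_pM.
split=> //. have E3 := lim_sub E2 (ucv t0 x0).
have E4 : \int[P]_w (DD lam q w T1 * cut u m.+1 T1 (X T1 w)) - cut u m.+1 t0 x0 @[m --> \oo] --> \int[P]_w int t0 T1 (Th w).
by apply: cvg_ext E1=> m; have [] := LDm m. exact: (cvg_unique _ E3 E4). Qed.

(** * The limits in lam and in the terminal time *)

Lemma int_cvg p q s (s_ : nat -> R) f : itgi p q f -> (forall n, p <= s_ n <= q) -> p <= s <= q ->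
  s_ n @[n --> \oo] --> s -> int p (s_ n) f @[n --> \oo] --> int p s f.
move=>fi ps_ ps cs; apply/cvgrPdist_lt=> e e0; have [del del0 H] := int_continuous fi e0.
by move/cvgrPdist_lt : cs=> /(_ _ del0); apply: filterS=> n; exact: H. Qed.

Lemma lim_harmonic (a a' : R) : a + n.+1%:R^-1 * a' @[n --> \oo] --> a.
rewrite -[X in _ --> X]addr0 -[X in a + X](mul0r a'); apply: cvgD; first exact: cvg_cst.
by apply: cvgM; [exact: cvg_harmonic|exact: cvg_cst]. Qed.

Definition disc w r : R := expR (- int t0 r (fun r=> rho (clamp 0 T r) (X r w))).

Lemma disc_cvg w s (s_ : nat -> R) : (forall n, t0 <= s_ n <= T) -> t0 <= s <= T -> s_ n @[n --> \oo] --> s ->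
  disc w (s_ n) @[n --> \oo] --> disc w s.
move=>ps_ ps cs; apply: (continuous_cvg _ (@continuous_expR R _)); apply: cvgN.
exact: int_cvg (strip_path_itg w crho) ps_ ps cs. Qed.

Lemma disc_itv w r : t0 <= r <= T -> 0 <= disc w r <= 1.
by move=>tr; apply: (expint_itv (q := T)) tr=> s _; apply: rho0; exact: clamp_itv. Qed.

Lemma DD_itv lam q w r : 0 < lam -> (forall y, 1 <= q y) -> 0 <= DD lam q w r <= 1.
by move=>l0 q1; rewrite expR_ge0 expRN_ge0_le1//; apply: int_ge0=> s _; exact: rt_ge0 (ltW l0) _. Qed.

Lemma DD_cvg lam q w s (s_ : nat -> R) : tame_path w -> meas (q : borelRd R d -> R) -> locbd q ->
  (forall n, t0 <= s_ n <= T) -> t0 <= s <= T -> s_ n @[n --> \oo] --> s ->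
  DD lam q w (s_ n) @[n --> \oo] --> DD lam q w s.
move=>gw mq lq ps_ ps cs; apply: (continuous_cvg _ (@continuous_expR R _)); apply: cvgN.
exact: int_cvg (rt_itg _ gw mq lq) ps_ ps cs. Qed.

Lemma DD_disc_cvg q w r : tame_path w -> meas (q : borelRd R d -> R) -> locbd q -> t0 <= r <= T ->
  DD n.+1%:R^-1 q w r @[n --> \oo] --> disc w r.
move=>gw mq lq /andP[tr rT]; apply: (continuous_cvg _ (@continuous_expR R _)); apply: cvgN.
have i1 := itg_sub (lexx t0) rT (strip_path_itg w crho). have i2 := itg_sub (lexx t0) rT (hh_itg gw mq lq).
apply: (@cvg_ext _ _ (fun n=> int t0 r (fun s=> rho (clamp 0 T s) (X s w)) + n.+1%:R^-1 * int t0 r (fun s=> hh q (X s w)))).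
move=>n; rewrite /int RintegralD//; last exact: itgZ. by rewrite RintegralZl. exact: lim_harmonic. Qed.

Lemma strip_cont_path h w t1 : strip_cont t0 t1 h -> t0 <= t1 <= T -> measi t0 t1 (fun r=> h r (X r w)).
move=>ch /andP[t01 t1T]; have := path_measurable w (strip_cont_measurable t01 ch).
move=> /(measurable_funS (mitv t0 T)) H; have {}H := H `[t0, t1]%classic (subset_itvl _).
have {}H : measi t0 t1 (fun r=> h (clamp t0 t1 r) (X r w)) by apply: H; rewrite bnd_simp.
by apply: eq_measurable_fun H=> r; rewrite inE/= in_itv/= => tr; rewrite clamp_id. Qed.

(** By the equation the drift reduces to g minus [lam * hh * u]. The rate contains [lam * hh], so
    after discounting this term contributes at most B, whatever lam is; along a path it tends to
    0. *)
Lemma rate_limit T1 B Cg u ut u1 u2 g : t0 <= T1 <= T ->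
  smooth_strip t0 T1 u ut u1 u2 -> (forall s y, t0 <= s <= T1 -> `|u s y| <= B) ->
  strip_cont 0 T g -> (forall s y, 0 <= s <= T -> `|g s y| <= Cg) ->
  (forall s y, t0 <= s <= T1 -> ut s y + Lg u u1 u2 s y - rho s y * u s y = g s y) ->
  [/\ itgT P (fun w=> int t0 T1 (fun r=> disc w r * g r (X r w))), itgT P (fun w=> disc w T1 * u T1 (X T1 w)) &
  \int[P]_w (disc w T1 * u T1 (X T1 w)) - u t0 x0 = \int[P]_w int t0 T1 (fun r=> disc w r * g r (X r w))].
move=>tT1 sm uB cg gC pde; have /andP[tT1' T1T] := tT1. have [q [mq lq q1 H]] := cutoff_limit tT1 sm uB.
have TT : t0 <= T1 <= T1 by rewrite tT1' lexx.
have Ttr r : t0 <= r <= T1 -> t0 <= r <= T by move=> /andP[-> h]; exact: le_trans T1T.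
have T0r r : t0 <= r <= T1 -> 0 <= r <= T by move=> /Ttr /andP[h ->]; rewrite (le_trans t00 h).
have B0 : 0 <= B := le_trans (normr_ge0 _) (uB T1 0 TT). pose lam n : R := n.+1%:R^-1.
have l0 n : 0 < lam n by rewrite invr_gt0 ltr0n. have l1 n : lam n <= 1 by rewrite invf_le1 ?ltr0n// ler1n.
have h0 y : 0 <= hh q y. apply: le_trans (hh_ge0 (q1 y)); apply: addr_ge0; last exact: quad_ge0.
by apply: addr_ge0=> //; exact: sumr_ge0.
pose Tn n w r := DD (lam n) q w r * (g r (X r w) - lam n * hh q (X r w) * u r (X r w)).
have Hn n : [/\ itgT P (fun w=> int t0 T1 (Tn n w)), itgT P (fun w=> DD (lam n) q w T1 * u T1 (X T1 w)) &
\int[P]_w (DD (lam n) q w T1 * u T1 (X T1 w)) - u t0 x0 = \int[P]_w int t0 T1 (Tn n w)].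
have E w : int t0 T1 (Tn n w) = int t0 T1 (fun r=> DD (lam n) q w r * (ut r (X r w) + Lg u u1 u2 r (X r w) - rt (lam n) q r (X r w) * u r (X r w))).
apply: int_eq=> r tr; congr (_ * _); rewrite -(pde r (X r w) tr) /rt clamp_id; last exact: T0r.
by move: (rho _ _) (Lg _ _ _ _ _)=> z z'; ring. have [i1 i2 i3] := H (lam n) (l0 n); split; last 1 first.
by rewrite i3; apply: eq_Rintegral=> w _; rewrite E. by move: i1; congr (itgT P _); apply/funext=> w; rewrite E.
exact: i2. have D1 n w r : 0 <= DD (lam n) q w r <= 1 by exact: DD_itv.
have ki n w : tame_path w -> itgi t0 T1 (fun r=> rt (lam n) q r (X r w)).
by move=>gw; apply: (itg_sub (lexx _) T1T); exact: rt_itg.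
have k0 n w r : t0 <= r <= T1 -> 0 <= rt (lam n) q r (X r w) by move=> _; exact: rt_ge0 (ltW (l0 n)) _.
have gi w : itgi t0 T1 (fun r=> g r (X r w)). apply: (@le_itgi R t0 T1 _ (fun=> Cg)); last exact: itg_cst.
have := itg_meas (itg_sub (lexx t0) T1T (strip_path_itg w cg)).
by apply: eq_measurable_fun=> r; rewrite inE/= in_itv/= => tr; rewrite clamp_id//; exact: T0r.
by move=>r tr; apply: gC; exact: T0r. have mT n w : tame_path w -> measi t0 T1 (Tn n w).
move=>gw; apply: measM; first exact: (expint_measurable tT1' (ki n w gw)). apply: measB; first exact: itg_meas.
apply: measM; last exact: strip_cont_path (sm_c sm) tT1.
by apply: measM=> //; exact: itg_meas (itg_sub (lexx t0) T1T (hh_itg gw mq lq)).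
have Tle n w r : t0 <= r <= T1 -> `|Tn n w r| <= DD (lam n) q w r * (Cg + lam n * hh q (X r w) * B).
move=>tr; have /andP[D0 _] := D1 n w r; rewrite normrM (ger0_norm D0); apply: ler_wpM2l=> //.
apply: le_trans (ler_normB _ _) _; apply: lerD; first by apply: gC; exact: T0r.
have lh0 : 0 <= lam n * hh q (X r w) := mulr_ge0 (ltW (l0 n)) (h0 _).
by rewrite normrM (ger0_norm lh0); apply: ler_wpM2l=> //; exact: uB.
have Cg0 : 0 <= Cg := le_trans (normr_ge0 _) (gC T1 0 (T0r _ TT)). have cP := usual_complete uF.
(* The bound adds to the contribution of g the number B times the integral of [DD * rt], which is at
   most 1. *)
case: (bdct cP (f_ := fun n w=> int t0 T1 (Tn n w)) (f := fun w=> int t0 T1 (fun r=> disc w r * g r (X r w))) (C := Cg * (T1 - t0) + B))=> [n||i1 _ _ E1].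
- by have [h _ _] := Hn n; exact: (measurable_itg' h).
apply: ae_imp gae=> w gw; have hi := itg_sub (lexx t0) T1T (hh_itg gw mq lq).
have di : itgi t0 T1 (fun r=> Cg + hh q (X r w) * B). apply: itgD=> //; first exact: itg_cst.
rewrite (_ : (fun r=> hh q (X r w) * B) = (fun r=> B * hh q (X r w))); first exact: itgZ.
by apply/funext=> r; rewrite mulrC. have Tle' n r : t0 <= r <= T1 -> `|Tn n w r| <= Cg + hh q (X r w) * B.
move=>tr; have /andP[D0 D1'] := D1 n w r; apply: (le_trans (Tle n w r tr)).
have Y0 := addr_ge0 Cg0 (mulr_ge0 (mulr_ge0 (ltW (l0 n)) (h0 (X r w))) B0).
apply: (@le_trans _ _ (Cg + lam n * hh q (X r w) * B)); first by rewrite ler_piMl.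
by rewrite lerD2l; apply: ler_wpM2r=> //; rewrite ler_piMl. split=> [n|].
have ti : itgi t0 T1 (Tn n w) by apply: (le_itgi (mT n w gw) (Tle' n) di).
have ei := itg_expint tT1' (ki n w gw) (k0 n w).
have bi : itgi t0 T1 (fun r=> Cg + B * (DD (lam n) q w r * rt (lam n) q r (X r w))).
by apply: itgD=> //; [exact: itg_cst|exact: itgZ].
apply: (le_trans (int_norm ti)); apply: (@le_trans _ _ (int t0 T1 (fun r=> Cg + B * (DD (lam n) q w r * rt (lam n) q r (X r w))))).
apply: int_le=> //; first exact: itg_norm.
move=>r tr; have /andP[D0 D1'] := D1 n w r; apply: (le_trans (Tle n w r tr)); rewrite mulrDr.
apply: lerD; first by rewrite ler_piMl.
rewrite [leLHS]mulrA [leLHS]mulrC; apply: ler_wpM2l=> //; apply: ler_wpM2l=> //.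
by rewrite /rt lerDr; apply: rho0; exact: clamp_itv. rewrite /int RintegralD//; [|exact: itg_cst|exact: itgZ].
have := int_cst Cg tT1'; rewrite /int=> ->; rewrite lerD2l RintegralZl//.
have := int_expint_full tT1' (ki n w gw) (k0 n w); rewrite /int /expint=> ->. by rewrite ler_piMr// gerBl expR_ge0.
apply: (int_dct _ _ di)=> [n|r tr|n r tr]; [exact: mT| |exact: Tle'].
apply: cvgM; first by apply: DD_disc_cvg=> //; exact: Ttr.
have := @lim_harmonic (g r (X r w)) (- (hh q (X r w) * u r (X r w))).
by apply: cvg_ext=> n; rewrite /lam; move: (hh _ _) (u _ _) (n.+1%:R^-1)=> h' u' k; ring.
case: (bdct cP (f_ := fun n w=> DD (lam n) q w T1 * u T1 (X T1 w)) (f := fun w=> disc w T1 * u T1 (X T1 w)) (C := B))=> [n||i2 _ _ E2].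
- by have [_ h _] := Hn n; exact: (measurable_itg' h).
apply: ae_imp gae=> w gw; split=> [n|]; last by apply: cvgM; [exact: DD_disc_cvg|exact: cvg_cst].
have /andP[D0 D1'] := D1 n w T1; rewrite normrM (ger0_norm D0) -[leRHS]mul1r. by apply: ler_pM=> //; exact: uB.
split; [exact: i1|exact: i2|]; have E3 := lim_subc (k := u t0 x0) E2; by refine (lim_eq _ E3 E1)=> n; have [_ _ ->] := Hn n.
Qed.

Definition Tseq n : R := T - (T - t0) / n.+1%:R.

Lemma Tseq_itv n : t0 < T -> t0 <= Tseq n < T.
move=>tT'; have h : 0 < T - t0 by rewrite subr_gt0. have n0 : 0 < n.+1%:R :> R by rewrite ltr0n.
rewrite /Tseq gtrBl divr_gt0// andbT lerBrDr -lerBrDl ler_pdivrMr//. by rewrite ler_peMr ?ler1n// ltW. Qed.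

Lemma Tseq_cvg : Tseq n @[n --> \oo] --> T.
have := @lim_harmonic T (- (T - t0)); apply: cvg_ext=> n. by rewrite /Tseq mulrN mulrC. Qed.

Lemma path_left_limit w : t0 < T -> X (Tseq n) w @[n --> \oo] --> left_limit X T w.
move=>tT'; have cX : X r w @[r --> T^'-] --> left_limit X T w by exact: (Xcad w).2.
apply: (@cvg_comp _ _ _ Tseq (fun r=> X r w) _ _ _ _ cX)=> A [e /= e0 HA].
move/cvgrPdist_lt : Tseq_cvg=> /(_ e e0); apply: filterS=> n Hn. by apply: HA=> //; have /andP[] := Tseq_itv n tT'.
Qed.
Let Tseq_le n : t0 < T -> t0 <= Tseq n <= T.
by move=> /(Tseq_itv n)/andP[-> /ltW]. Qed.

Lemma disc_g_itg g w : strip_cont 0 T g -> itgi t0 T (fun r=> disc w r * g (clamp 0 T r) (X r w)).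
move=>cg; apply: (@itgM_bounded _ _ _ _ _ (mitv t0 T) 1 (disc w)).
- exact: (expint_measurable tT (strip_path_itg w crho)).
- by move=>r /=; rewrite in_itv/= => tr; have /andP[h1 h2] := disc_itv w tr; rewrite ger0_norm.
- exact: strip_path_itg. Qed.

(** Equation and derivatives are available before T only, so the formula is used at times increasing
    strictly to T, and the path contributes its left limit there. *)
Lemma time_limit B Cg u ut u1 u2 g : t0 < T -> (forall T1, t0 <= T1 -> T1 < T -> smooth_strip t0 T1 u ut u1 u2) ->
  strip_cont 0 T u -> (forall s y, 0 <= s <= T -> `|u s y| <= B) ->
  strip_cont 0 T g -> (forall s y, 0 <= s <= T -> `|g s y| <= Cg) ->
  (forall s y, 0 <= s < T -> ut s y + Lg u u1 u2 s y - rho s y * u s y = g s y) ->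
  [/\ itgT P (fun w=> int t0 T (fun r=> disc w r * g (clamp 0 T r) (X r w))),
  itgT P (fun w=> disc w T * u T (left_limit X T w)) &
  \int[P]_w (disc w T * u T (left_limit X T w)) - u t0 x0 = \int[P]_w int t0 T (fun r=> disc w r * g (clamp 0 T r) (X r w))].
move=>tT' sm cu uB cg gC pde; have cP := usual_complete uF. have TT : t0 <= T <= T by rewrite tT lexx.
have T0r r : t0 <= r <= T -> 0 <= r <= T by move=> /andP[h ->]; rewrite (le_trans t00 h).
have Hn n : [/\ itgT P (fun w=> int t0 (Tseq n) (fun r=> disc w r * g (clamp 0 T r) (X r w))),
itgT P (fun w=> disc w (Tseq n) * u (Tseq n) (X (Tseq n) w)) &
\int[P]_w (disc w (Tseq n) * u (Tseq n) (X (Tseq n) w)) - u t0 x0 =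
\int[P]_w int t0 (Tseq n) (fun r=> disc w r * g (clamp 0 T r) (X r w))]. have /andP[h1 h2] := Tseq_itv n tT'.
have uB' s y : t0 <= s <= Tseq n -> `|u s y| <= B.
by move=> /andP[ts sT]; apply: uB; rewrite (le_trans t00 ts)/= (le_trans sT (ltW h2)).
have pde' s y : t0 <= s <= Tseq n -> ut s y + Lg u u1 u2 s y - rho s y * u s y = g s y.
by move=> /andP[ts sT]; apply: pde; rewrite (le_trans t00 ts)/= (le_lt_trans sT h2).
have [i1 i2 i3] := rate_limit (Tseq_le n tT') (sm _ h1 h2) uB' cg gC pde'.
have E w : int t0 (Tseq n) (fun r=> disc w r * g (clamp 0 T r) (X r w)) = int t0 (Tseq n) (fun r=> disc w r * g r (X r w)).
by apply: int_eq=> r /andP[tr rT]; rewrite clamp_id// (le_trans t00 tr)/= (le_trans rT (ltW h2)).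
split; [|exact: i2|]. by move: i1; congr (itgT P _); apply/funext=> w; rewrite E.
by rewrite i3; apply: eq_Rintegral=> w _; rewrite E. have gi w := disc_g_itg w cg.
have gb w n : `|int t0 (Tseq n) (fun r=> disc w r * g (clamp 0 T r) (X r w))| <= Cg * (T - t0).
have /andP[h1 /ltW h2] := Tseq_itv n tT'; have i := itg_sub (lexx t0) h2 (gi w).
have Cg0 : 0 <= Cg := le_trans (normr_ge0 _) (gC T 0 (T0r _ TT)).
apply: (le_trans (int_norm i)); apply: (@le_trans _ _ (int t0 (Tseq n) (fun=> Cg))).
apply: int_le; [exact: itg_norm|exact: itg_cst|move=>r /andP[tr rT]].
have /andP[D0 D1] : 0 <= disc w r <= 1 by apply: disc_itv; rewrite tr (le_trans rT h2).
rewrite normrM (ger0_norm D0) -[leRHS]mul1r; apply: ler_pM=> //; apply: gC; exact: clamp_itv.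
by rewrite int_cst//; apply: ler_wpM2l=> //; rewrite lerD2r.
case: (bdct cP (f_ := fun n w=> int t0 (Tseq n) (fun r=> disc w r * g (clamp 0 T r) (X r w))) (f := fun w=> int t0 T (fun r=> disc w r * g (clamp 0 T r) (X r w))) (C := Cg * (T - t0)))=> [n||i1 _ _ E1].
- by have [h _ _] := Hn n; exact: (measurable_itg' h). apply: ae_imp gae=> w gw; split; first exact: gb.
by apply: (int_cvg (gi w) (fun n=> Tseq_le n tT') TT); exact: Tseq_cvg.
case: (bdct cP (f_ := fun n w=> disc w (Tseq n) * u (Tseq n) (X (Tseq n) w)) (f := fun w=> disc w T * u T (left_limit X T w)) (C := B))=> [n||i2 _ _ E2].
- by have [_ h _] := Hn n; exact: (measurable_itg' h). apply: ae_imp gae=> w gw; split=> [n|].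
have /andP[D0 D1] := disc_itv w (Tseq_le n tT'); rewrite normrM (ger0_norm D0) -[leRHS]mul1r.
by apply: ler_pM=> //; apply: uB; exact: T0r _ (Tseq_le n tT').
apply: cvgM; first refine (@disc_cvg w T Tseq (fun n=> Tseq_le n tT') TT Tseq_cvg).
apply: (strip_cont_seq cu (T0r _ TT) (fun n=> T0r _ (Tseq_le n tT'))); first exact: Tseq_cvg. exact: path_left_limit.
split; [exact: i1|exact: i2|]; have E3 := lim_subc (k := u t0 x0) E2; by refine (lim_eq _ E3 E1)=> n; have [_ _ ->] := Hn n.
Qed.

(* Tests frozen in time transfer the value at the left limit X(T-) to X(T). *)
Lemma frozen_left_limit lam psi phit phi1 phi2 C : 0 < lam -> test t0 T (fun=> psi) phit phi1 phi2 C ->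
  itgT P (fun w=> DD lam (fun=> 1) w T * psi (X T w)) /\
  (t0 < T -> itgT P (fun w=> DD lam (fun=> 1) w T * psi (left_limit X T w)) /\
  \int[P]_w (DD lam (fun=> 1) w T * psi (X T w)) = \int[P]_w (DD lam (fun=> 1) w T * psi (left_limit X T w))) /\
  (t0 = T -> \int[P]_w (DD lam (fun=> 1) w T * psi (X T w)) = psi x0).
move=>l0 Te; have cP := usual_complete uF; have TT : t0 <= T <= T by rewrite tT lexx.
have mq : meas ((fun=> 1) : borelRd R d -> R) by exact: measurable_cst.
have lq : locbd (fun=> 1) by move=>K; exists 1=> y _; rewrite normr1.
have q1 : forall y : 'rV[R]_d, 1 <= (fun=> 1) y :> R by [].
have [i1 i2 E ae1] := @LD T TT lam _ _ _ _ _ _ l0 mq lq q1 Te.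
pose Th w r := DD lam (fun=> 1) w r * (phit r (X r w) + Lg (fun=> psi) phi1 phi2 r (X r w)
- rt lam (fun=> 1) r (X r w) * psi (X r w)). rewrite -/(Th _) in i1 E ae1. split; first exact: i2.
split=> [tT'|tTe]; last first. have I0 : \int[P]_w int t0 T (Th w) = 0.
rewrite (_ : (fun w=> int t0 T (Th w)) = fun=> 0); first by rewrite Rintegral_cst//= mul0r.
by apply/funext=> w; rewrite -tTe int_pp. by apply/eqP; rewrite -subr_eq0 E I0.
have Hn n : [/\ itgT P (fun w=> int t0 (Tseq n) (Th w)), itgT P (fun w=> DD lam (fun=> 1) w (Tseq n) * psi (X (Tseq n) w)),
\int[P]_w (DD lam (fun=> 1) w (Tseq n) * psi (X (Tseq n) w)) - psi x0 = \int[P]_w int t0 (Tseq n) (Th w) &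
{ae P, forall w, `|int t0 (Tseq n) (Th w)| <= Bnd (d := d) C lam}].
have [h1 h2 h3 h4] := @LD _ (Tseq_le n tT') lam _ _ _ _ _ _ l0 mq lq q1 (test_sub (lexx t0) (ltW (elimTF andP (Tseq_itv n tT')).2) Te); split=> //.
by apply: ae_imp h4=> w []. have C0 := test_C_ge0 Te tT.
case: (bdct cP (f_ := fun n w=> int t0 (Tseq n) (Th w)) (f := fun w=> int t0 T (Th w)) (C := Bnd (d := d) C lam))=> [n||_ _ _ E1].
- by have [h _ _ _] := Hn n; exact: (measurable_itg' h).
have aeb : {ae P, forall w, forall n, `|int t0 (Tseq n) (Th w)| <= Bnd (d := d) C lam}.
by apply: ae_foralln=> n; have [] := Hn n. apply: filterS2 ae1 aeb=> w [ti _] bw; split=> //.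
by apply: (int_cvg ti (fun n=> Tseq_le n tT') TT); exact: Tseq_cvg.
case: (bdct cP (f_ := fun n w=> DD lam (fun=> 1) w (Tseq n) * psi (X (Tseq n) w)) (f := fun w=> DD lam (fun=> 1) w T * psi (left_limit X T w)) (C := C))=> [n||i3 _ _ E2].
- by have [_ h _ _] := Hn n; exact: (measurable_itg' h). apply: ae_imp gae=> w gw; split=> [n|].
have /andP[D0 D1] := DD_itv w (Tseq n) l0 q1; rewrite normrM (ger0_norm D0) -[leRHS]mul1r.
by apply: ler_pM=> //; exact: (t_b0 Te _ TT).
apply: cvgM; first exact: (DD_cvg gw mq lq (fun n=> Tseq_le n tT') TT Tseq_cvg).
have /= cpsi := unif_cont_x TT (t_u0 Te). by apply: continuous_cvg; [exact: cpsi|exact: path_left_limit].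
split; first exact: i3. have E3 := lim_subc (k := psi x0) E2. apply: (addIr (- psi x0)); rewrite E; apply/esym.
by refine (lim_eq _ E3 E1)=> n; have [_ _ ->] := Hn n. Qed.

Lemma frozen_strip (u ut : sfun R d) u1 u2 (s : R) : smooth_strip s s u ut u1 u2 ->
  smooth_strip t0 T (fun=> u s) (fun _ _=> 0) (fun j _=> u1 j s) (fun j k _=> u2 j k s).
move=>sm; have ss : s <= s <= s by rewrite lexx.
have fc (h : sfun R d) : strip_cont s s h -> strip_cont t0 T (fun=> h s). move=>ch; apply: continuous_subspaceT=> z.
apply: (@continuous_comp _ _ _ snd (h s)); first exact: cvg_snd. exact: (strip_cont_x ch ss).
split=> [| |j|j k|r x _|j r x _|j k r x _].
- exact: fc (sm_c sm).
- by apply: continuous_subspaceT; exact: cst_continuous.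
- exact: (fc _ (@sm_c1 _ _ _ _ _ _ _ _ sm j)).
- exact: (fc _ (@sm_c2 _ _ _ _ _ _ _ _ sm j k)).
- exact: is_derive_cst.
- exact: sm_d1 sm _ _ _ ss.
- exact: sm_d2 sm _ _ _ _ ss. Qed.

(** [u T] is merely continuous and cannot be a test function. It is approximated by cut-offs of
    [u (s_ n)] with [s_ n < T], which are of class C^2 and kept constant in time, while the
    parameter lam of [frozen_left_limit] tends to 0 along with n. *)
Lemma terminal_value B u ut u1 u2 : 0 < T -> (forall s, 0 <= s < T -> smooth_strip s s u ut u1 u2) ->
  strip_cont 0 T u -> (forall s y, 0 <= s <= T -> `|u s y| <= B) -> itgT P (fun w=> disc w T * u T (X T w)) /\
  (t0 < T -> \int[P]_w (disc w T * u T (X T w)) = \int[P]_w (disc w T * u T (left_limit X T w))) /\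
  (t0 = T -> \int[P]_w (disc w T * u T (X T w)) = u T x0).
move=>Tpos sm cu uB; have cP := usual_complete uF; have TT : t0 <= T <= T by rewrite tT lexx.
have T0T : 0 <= T <= T by rewrite lexx T0. pose s_ n : R := T - T / n.+1%:R. have s_itv n : 0 <= s_ n < T.
have n0 : 0 < n.+1%:R :> R by rewrite ltr0n.
by rewrite /s_ gtrBl divr_gt0// andbT subr_ge0 ler_pdivrMr// ler_peMr// ler1n.
have s_le n : 0 <= s_ n <= T by have /andP[-> /ltW] := s_itv n. have s_cvg : s_ n @[n --> \oo] --> T.
by have := @lim_harmonic T (- T); apply: cvg_ext=> n; rewrite /s_ mulrN mulrC.
(* The last argument of [cut] is a dummy time. *)
pose psi n := cut (fun=> u (s_ n)) n.+1 0. have psi_cvg y : psi n y @[n --> \oo] --> u T y.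
have uc : u (s_ n) y @[n --> \oo] --> u T y. by apply: (strip_cont_seq cu T0T s_le s_cvg); exact: cvg_cst.
apply: cvg_trans uc; apply: near_eq_cvg; exists (Num.truncn (n1 y))=> // m /= le.
have /andP[_ H] := truncn_itv (n1_ge0 y). have ym : n1 y < m.+1%:R by apply: lt_le_trans H _; rewrite ler_nat ltnS.
by rewrite /psi /cut; have [-> _ _] := chi_in ym; rewrite mulr1.
have psi_le n y : `|psi n y| <= B by apply: le_trans (cut_le _ _ _ _) _; exact: uB.
have /boolp.choice[C HC] := fun n=> cut_test (frozen_strip (sm _ (s_itv n))) d0 (ltn0Sn n).
pose lam n : R := n.+1%:R^-1. have l0 n : 0 < lam n by rewrite invr_gt0 ltr0n.
have Fn n := frozen_left_limit (psi := psi n) (l0 n) (HC n).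
have mq : meas ((fun=> 1) : borelRd R d -> R) by exact: measurable_cst.
have lq : locbd (fun=> 1) by move=>K; exists 1=> y _; rewrite normr1.
have lim (Y : Om -> 'rV[R]_d) : (forall n, itgT P (fun w=> DD (lam n) (fun=> 1) w T * psi n (Y w))) ->
itgT P (fun w=> disc w T * u T (Y w)) /\
\int[P]_w (DD (lam n) (fun=> 1) w T * psi n (Y w)) @[n --> \oo] --> \int[P]_w (disc w T * u T (Y w)).
move=>iY; suff [] : [/\ itgT P (fun w=> disc w T * u T (Y w)), meas (fun w=> disc w T * u T (Y w)),
{ae P, forall w, `|disc w T * u T (Y w)| <= B} &
\int[P]_w (DD (lam n) (fun=> 1) w T * psi n (Y w)) @[n --> \oo] --> \int[P]_w (disc w T * u T (Y w))] by [].
apply: (bdct cP)=> [n|]; first exact: (measurable_itg' (iY n)). apply: ae_imp gae=> w gw; split=> [n|].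
have /andP[D0 D1] := DD_itv w T (l0 n) (fun _ : 'rV[R]_d=> lexx 1).
by rewrite normrM (ger0_norm D0) -[leRHS]mul1r; apply: ler_pM. by apply: cvgM; [exact: DD_disc_cvg|exact: psi_cvg].
have [iX EX] := lim (X T) (fun n=> (Fn n).1). split; first exact: iX. split=> [tT'|tTe].
have [_ EL] := lim (left_limit X T) (fun n=> ((Fn n).2.1 tT').1).
by apply: (lim_eq _ EX EL)=> n; exact: ((Fn n).2.1 tT').2.
by apply: (lim_eq _ EX (psi_cvg x0))=> n; exact: (Fn n).2.2. Qed.

End Limits.

(** [time_limit] gives the formula with the left limit at T, and [terminal_value] exchanges it for
    [X T]. *)
Lemma feynman_kac_disc B Cg u ut u1 u2 g : 0 < T -> (forall s T1, 0 <= s -> T1 < T -> smooth_strip s T1 u ut u1 u2) ->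
  strip_cont 0 T u -> (forall s y, 0 <= s <= T -> `|u s y| <= B) ->
  strip_cont 0 T g -> (forall s y, 0 <= s <= T -> `|g s y| <= Cg) ->
  (forall s y, 0 <= s < T -> ut s y + Lg u u1 u2 s y - rho s y * u s y = g s y) ->
  let Z w := disc w T * u T (X T w) - int t0 T (fun r=> disc w r * g (clamp 0 T r) (X r w)) in
  itgT P Z /\ \int[P]_w Z w = u t0 x0.
move=>Tpos sm cu uB cg gC pde Z; have [gae LD] := levy_dataP.
have sms s : 0 <= s < T -> smooth_strip s s u ut u1 u2 by move=> /andP[h1 h2]; exact: sm.
have [iX [EL E0]] := terminal_value gae LD Tpos sms cu uB.
have [iG E] : itgT P (fun w=> int t0 T (fun r=> disc w r * g (clamp 0 T r) (X r w))) /\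
\int[P]_w (disc w T * u T (X T w)) - u t0 x0 = \int[P]_w int t0 T (fun r=> disc w r * g (clamp 0 T r) (X r w)).
(* At t0 = T there is no earlier time to come from: the time integrals vanish and the terminal mean
   is [u T x0]. *)
move: tT; rewrite le_eqVlt=> /orP[/eqP tTe|tT'].
have z w : int t0 T (fun r=> disc w r * g (clamp 0 T r) (X r w)) = 0 by rewrite tTe int_pp.
rewrite (_ : (fun w=> int t0 T _) = fun=> 0); last by apply/funext. split; first exact: integrable0.
by rewrite Rintegral_cst// mul0r (E0 tTe) tTe subrr.
have [i1 i2 i3] := time_limit gae LD tT' (fun T1 h1 h2=> sm t0 T1 t00 h2) cu uB cg gC pde. by split=> //; rewrite EL.
split; first exact: itgB. by rewrite /Z RintegralB// -E opprB addrC subrK. Qed.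

End FeynmanKacSetting.

Theorem theorem7p5 (R : realType) (d : nat) (hd : (2 <= d)%N)
  (a : 'rV[R]_d -> 'M[R]_d) (b : 'rV[R]_d -> 'rV[R]_d)
  (nu : 'rV[R]_d -> {measure set (borelRd R d) -> \bar R})
  (sigma : 'rV[R]_d -> 'M[R]_d)
  (dU : measure_display) (U : measurableType dU)
  (M : {sigma_finite_measure set U -> \bar R})
  (c : 'rV[R]_d -> U -> 'rV[R]_d)
  (b_meas : measurable_fun setT (b : borelRd R d -> borelRd R d))
  (a_meas : forall i j, measurable_fun setT
     ((fun x => a x i j) : borelRd R d -> measurableTypeR R))
  (a_sym : forall x, (a x)^T = a x)
  (a_nneg : forall x (v : 'rV[R]_d), 0 <= dotp (v *m a x) v)
  (nu_levy : forall x,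
     (\int[nu x]_(y in Rd0) (Num.min (enorm y) (sqnorm y))%:E < +oo)%E)
  (sigma_meas : forall i j, measurable_fun setT
     ((fun x => sigma x i j) : borelRd R d -> measurableTypeR R))
  (sigma_sq : forall x, sigma x *m (sigma x)^T = a x)
  (c_meas : measurable_fun setT
     ((fun p => c p.1 p.2) : borelRd R d * U -> borelRd R d))
  (nu_repr : forall x (G : set (borelRd R d)), measurable G -> G `<=` Rd0 ->
     nu x G = (\int[M]_v (\1_G (c x v))%:E)%E)
  (K : R) (K_gt0 : 0 < K) (zeta : R -> R)
  (zeta_ge1 : forall r, 0 <= r -> 1 <= zeta r)
  (zeta_nd : forall r s, 0 <= r -> r <= s -> zeta r <= zeta s)
  (zeta_C1 : C1_on `[0, +oo[ zeta)
  (zeta_int : (\int[lebesgue_measure]_(r in `[0%R, +oo[)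
                 ((r * zeta r + 1)^-1)%:E = +oo)%E)
  (growth : forall x,
     ((2 * dotp x (b x) + \tr (a x))%:E
        + \int[nu x]_(y in Rd0) (sqnorm y)%:E
      <= (K * (sqnorm x * zeta (sqnorm x) + 1))%:E)%E)
  (wellposed : forall t x, 0 <= t -> unique_weak_solution b sigma M c t x)
  (T : R) (T_gt0 : 0 < T)
  (rho g : R -> 'rV[R]_d -> R) (f : 'rV[R]_d -> R)
  (rho_ge0 : forall t x, 0 <= t <= T -> 0 <= rho t x)
  (rho_cont : continuous_on_strip `[0, T] rho)
  (g_cont : continuous_on_strip `[0, T] g)
  (g_bnd : bounded_on_strip `[0, T] g)
  (f_cont : continuous f)
  (f_bnd : exists C : R, forall x, `|f x| <= C)
  (u : R -> 'rV[R]_d -> R)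
  (u_C12 : C12_on `[0, T[ u)
  (u_cont : continuous_on_strip `[0, T] u)
  (u_bnd : bounded_on_strip `[0, T] u)
  (u_dom : forall t x, 0 <= t < T -> levy_integrable nu (u t) x)
  (u_pde : forall t x, 0 <= t < T ->
     time_derivative `[0, T[ u t x + levy_operator a b nu (u t) x
       - rho t x * u t x = g t x)
  (u_final : forall x, u T x = f x) :
  forall (t : R) (x : 'rV[R]_d), 0 <= t <= T ->
  forall (dO : measure_display) (Omega : measurableType dO)
    (P : probability Omega R) (X : R -> Omega -> 'rV[R]_d),
    weak_solution b sigma M c t x P X ->
    ('E_P [ fun w => feynman_kac_functional rho g f t T (fun s => X s w) ]
     = (u t x)%:E)%E.
Proof. move=>t x t0T dO Om P X [F [W [N [uF BW prm adN sde]]]]. have d0 : (0 < d)%N by exact: ltnW.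
have /andP[t00 tT] := t0T. have mcx y : meas (c y : U -> borelRd R d).
by apply: (meas_comp c_meas (g := fun v=> (y, v) : borelRd R d * U)); exact: measurable_pair1.
have c2 y i : itgT M (fun v=> c y v ord0 i ^+ 2) := levy_sq_itg (mcx y) (nu_repr y) (growth y) i.
have [B uB] := u_bnd; have [Cg gC] := g_bnd.
have uB' s y : 0 <= s <= T -> `|u s y| <= B by move=>sT; apply: uB; rewrite /= in_itv.
have gC' s y : 0 <= s <= T -> `|g s y| <= Cg by move=>sT; apply: gC; rewrite /= in_itv.
(* The equation is restated with sigma and c in place of a and nu: the entries of a are those of
   sigma times its transpose, and the integral against nu is carried over to M. *)
have pde s y : 0 <= s < T -> time_derivative `[0, T[ u s y + Lg M b sigma c u (fun j s=> partial1 (u s) j)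
(fun j k s=> partial2 (u s) j k) s y - rho s y * u s y = g s y. move=>sT; rewrite -(u_pde s y sT); congr (_ + _ - _).
have sT' : 0 <= s <= T by have /andP[-> /ltW] := sT. have aE i k : a y i k = \sum_j sigma y i j * sigma y k j.
by rewrite -sigma_sq mxE; apply: eq_bigr=> j _; rewrite mxE.
have mj : meas (jump_increment (u s) y : borelRd R d -> R).
apply: borelRd_continuous; rewrite /jump_increment=> v; apply: contD; last first.
by apply: contN; apply: cont_sum=> i; apply: contM; [exact: continuous_coord|exact: cont_cst].
apply: contD; last exact: cont_cst.
move=>z; apply: (@continuous_comp _ _ _ (fun v=> y + v) (u s)); last exact: (strip_cont_x u_cont sT').
(* The increment vanishes at 0, as [nu_integral] demands: zeros of c do not count in nu. *)
by apply: continuousD; [exact: cst_continuous|exact: id]. have j0 : jump_increment (u s) y 0 = 0.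
by rewrite /jump_increment addr0 subrr sub0r /dotp big1 ?oppr0// => i _; rewrite mxE mul0r.
have e1 : \sum_i \sum_k partial2 (u s) i k y * (\sum_j sigma y i j * sigma y k j) =
\sum_i \sum_k a y i k * partial2 (u s) i k y. by apply: eq_bigr=> i _; apply: eq_bigr=> k _; rewrite aE mulrC.
have e2 : \int[M]_v jump_term u (fun j s=> partial1 (u s) j) s y (c y v) = \int[M]_v jump_increment (u s) y (c y v).
apply: eq_Rintegral=> v _; rewrite /jump_term /jump_increment /dotp; congr (_ - _).
by apply: eq_bigr=> i _; rewrite mxE mulrC.
by rewrite /levy_operator /Lg (nu_integral (mcx y) (nu_repr y) mj j0) e1 e2 addrA; congr (_ + _); exact: addrC.
have [iZ EZ] := feynman_kac_disc uF d0 BW prm adN t00 tT b_meas sigma_meas c_meas c2 sde rho_ge0 rho_cont T_gt0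
(fun s T1 s0 T1T=> C12_smooth_strip s0 T1T u_C12) u_cont uB' g_cont gC' pde. set Z := (fun w=> _) in iZ EZ.
(* On [t, T] the projections of time in [disc] and in g act as the identity. *)
have ZE w : feynman_kac_functional rho g f t T (fun s=> X s w) = Z w.
have dE s : t <= s <= T -> discount rho (fun s=> X s w) t s = disc t T X rho w s.
move=> /andP[ts sT]; rewrite /discount /disc; congr (expR (- _)); apply: int_eq=> r /andP[tr rs].
by rewrite clamp_id// (le_trans t00 tr) (le_trans rs sT).
rewrite /feynman_kac_functional /Z dE ?tT ?lexx// -u_final; congr (_ - _); apply: int_eq=> r tr.
by rewrite dE// clamp_id//; have /andP[tr' ->] := tr; rewrite (le_trans t00 tr').
rewrite unlock; under eq_integral do rewrite ZE. by rewrite -EZ /Rintegral fineK//; exact: integrable_fin_num. Qed.
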